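(* Let $d\geq1$ be an integer, $t>0$ and $f\in L^2(\mathbb{R}^d)$. Then $$\|R^t_jf\|_{L^2}^2\leq\|R_jf\|_{L^2}^2,\qquad j=1,\ldots,d .$$
   Context: For $t>0$ and $j\in\{1,\dots,d\}$ the truncated Riesz transform is $$R_j^tf(x)=\frac{\Gamma\left(\frac{d+1}{2}\right)}{\pi^{\frac{d+1}{2}}}\int_{|x-y|>t}\frac{x_j-y_j}{|x-y|^{d+1}}f(y)\,\mathrm{d}y .$$ The $j$th Riesz transform is $R_jf(x)=\lim_{t\to0^+}R_j^tf(x)$ for Schwartz functions $f$ on $\mathbb{R}^d$, extended by density to a bounded operator on $L^2(\mathbb{R}^d)$. Norms are those of $L^2(\mathbb{R}^d)$. *)

(* Defs.v *)
From HB Require Import structures.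
From mathcomp Require Import all_boot all_order all_algebra.
From mathcomp Require Import complex.
From mathcomp Require Import all_classical all_reals all_analysis.

Set Implicit Arguments.
Unset Strict Implicit.
Unset Printing Implicit Defensive.
Import Order.TTheory GRing.Theory Num.Theory.
Import numFieldNormedType.Exports.

Local Open Scope classical_set_scope.
Local Open Scope ring_scope.
Local Open Scope complex_scope.

(* The sigma-algebra on 'rV[R]_n is the one generated by the coordinate maps,
   as the library does for n.-tuple T; it is the Borel sigma-algebra of R^n. *)
Section measurable_rV.
Context {R : realType} {n : nat}.

Let coors : 'I_n -> 'rV[R]_n -> measurableTypeR R := fun i x => x 0 i.

Let rV_set0 : g_sigma_preimage coors set0.
Proof. exact: sigma_algebra0. Qed.

Let rV_setC A : g_sigma_preimage coors A -> g_sigma_preimage coors (~` A).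
Proof. exact: sigma_algebraC. Qed.

Let rV_bigcup (F : _^nat) : (forall i, g_sigma_preimage coors (F i)) ->
  g_sigma_preimage coors (\bigcup_i (F i)).
Proof. exact: sigma_algebra_bigcup. Qed.

HB.instance Definition _ := @isMeasurable.Build default_measure_display
  'rV[R]_n (g_sigma_preimage coors) rV_set0 rV_setC rV_bigcup.

Lemma measurable_coord (i : 'I_n) :
  measurable_fun [set: 'rV[R]_n] (fun x => x 0 i : measurableTypeR R).
Proof.
move=> _ Y mY; rewrite setTI; apply: sub_sigma_algebra.
by rewrite (bigD1 i)//=; left; exists Y => //; rewrite setTI.
Qed.

Lemma measurable_fun_rV d (T : measurableType d) (f : T -> 'rV[R]_n) :
  (forall i, measurable_fun [set: T] (fun x => f x 0 i : measurableTypeR R)) ->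
  measurable_fun [set: T] f.
Proof.
move=> mf; apply: (@measurability _ _ _ _ _ _
  (\big[setU/set0]_(i < n) preimage_set_system setT (coors i) measurable)) => //.
move=> _ [B + <-]; elim/big_ind : _ => //.
  by move=> A C hA hC [/hA|/hC].
by move=> i _ [A mA <-]; rewrite setTI; exact: mf.
Qed.

End measurable_rV.

Section lebesgue_rV.
Context {R : realType}.

Definition consrV n (p : measurableTypeR R * 'rV[R]_n) : 'rV[R]_n.+1 :=
  \row_i oapp (p.2 ord0) p.1 (unlift ord0 i).

Lemma consrV0 n p : @consrV n p 0 ord0 = p.1.
Proof. by rewrite mxE unlift_none. Qed.

Lemma consrVS n p i : @consrV n p 0 (lift ord0 i) = p.2 0 i.
Proof. by rewrite mxE liftK. Qed.

Lemma measurable_consrV n : measurable_fun setT (@consrV n).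
Proof.
apply: measurable_fun_rV => i; case: (unliftP ord0 i) => [k|] ->.
  under eq_fun do rewrite consrVS.
  by apply: (measurableT_comp (measurable_coord k)); exact: measurable_snd.
by under eq_fun do rewrite consrV0; exact: measurable_fst.
Qed.

Definition lebesgue_rVS n (m : {sigma_finite_measure set 'rV[R]_n -> \bar R}) :
  set 'rV[R]_n.+1 -> \bar R :=
  pushforward (lebesgue_measure \x m)%E (@consrV n).

Section lebesgue_rVS_measure.
Variables (n : nat) (m : {sigma_finite_measure set 'rV[R]_n -> \bar R}).

Let mpre A : measurable A -> measurable (@consrV n @^-1` A).
Proof. by move=> mA; rewrite -[X in measurable X]setTI; exact: measurable_consrV. Qed.

Let lebesgue_rVS0 : lebesgue_rVS m set0 = 0%E.
Proof. by rewrite /lebesgue_rVS /pushforward preimage_set0 measure0. Qed.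

Let lebesgue_rVS_ge0 A : (0 <= lebesgue_rVS m A)%E.
Proof. by rewrite /lebesgue_rVS /pushforward measure_ge0. Qed.

Let lebesgue_rVS_sigma_additive : semi_sigma_additive (lebesgue_rVS m).
Proof.
move=> F mF tF mUF; rewrite /lebesgue_rVS /pushforward preimage_bigcup.
apply: measure_semi_sigma_additive.
- by move=> k; exact: mpre.
- apply/trivIsetP => /= i j _ _ ij; rewrite -preimage_setI.
  by move/trivIsetP : tF => /(_ _ _ _ _ ij) ->//; rewrite preimage_set0.
- by rewrite -preimage_bigcup; exact: mpre.
Qed.

HB.instance Definition _ := isMeasure.Build _ _ _ (lebesgue_rVS m)
  lebesgue_rVS0 lebesgue_rVS_ge0 lebesgue_rVS_sigma_additive.

Let lebesgue_rVS_sigma_finite : sigma_finite setT (lebesgue_rVS m).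
Proof.
pose unc (v : 'rV[R]_n.+1) : measurableTypeR R * 'rV[R]_n :=
  (v 0 ord0, \row_i v 0 (lift ord0 i)).
have consK : cancel (@consrV n) unc.
  move=> [a v]; rewrite /unc consrV0; congr pair.
  by apply/rowP => i; rewrite mxE consrVS.
have munc : measurable_fun setT unc.
  apply/measurable_fun_pair; first exact: measurable_coord.
  apply: measurable_fun_rV => i.
  by under eq_fun do rewrite mxE; exact: measurable_coord.
have /sigma_finiteP[F [TF ndF Foo]] := sigma_finiteT (@lebesgue_measure R).
have /sigma_finiteP[G [TG ndG Goo]] := sigma_finiteT m.
exists (fun k => unc @^-1` (F k `*` G k)).
  rewrite -preimage_bigcup; apply/esym/seteqP; split => // v _ /=.
  have [k _ Fk] : (\bigcup_i F i) (unc v).1 by rewrite -TF.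
  have [l _ Gl] : (\bigcup_i G i) (unc v).2 by rewrite -TG.
  exists (maxn k l) => //; split.
    by move: (unc v).1 Fk; exact/subsetPset/ndF/leq_maxl.
  by move: (unc v).2 Gl; exact/subsetPset/ndG/leq_maxr.
move=> k; have [mF Fk] := Foo k; have [mG Gk] := Goo k; split.
  by rewrite -[X in measurable X]setTI; apply: munc => //; exact: measurableX.
rewrite /lebesgue_rVS /pushforward -comp_preimage (_ : unc \o _ = id).
  rewrite preimage_id product_measure1E//.
  by rewrite lte_mul_pinfty// ge0_fin_numE.
by apply/funext => x; exact: consK.
Qed.

HB.instance Definition _ := Measure_isSigmaFinite.Build _ _ _
  (lebesgue_rVS m) lebesgue_rVS_sigma_finite.

End lebesgue_rVS_measure.

Fixpoint lebesgue_rV n : {sigma_finite_measure set 'rV[R]_n -> \bar R} :=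
  if n is m.+1 then lebesgue_rVS (lebesgue_rV m) else \d_(0 : 'rV[R]_0).


Lemma lebesgue_rV_box n (A : 'I_n -> set (measurableTypeR R)) :
  (forall i, measurable (A i)) ->
  lebesgue_rV n [set x | forall i, A i (x 0 i)] =
    (\prod_(i < n) lebesgue_measure (A i))%E.
Proof.
elim: n A => [|n IH] A mA.
  by rewrite big_ord0 /= diracE mem_set// => -[].
have mbox : measurable [set x : 'rV[R]_n | forall i, A (lift ord0 i) (x 0 i)].
  rewrite [X in measurable X](_ : _ =
      \big[setI/setT]_(i < n) [set x : 'rV[R]_n | A (lift ord0 i) (x 0 i)]).
    apply: bigsetI_measurable => i _.
    by rewrite -[X in measurable X]setTI; exact: measurable_coord.
  apply/seteqP; split => x /=.
    by move=> h; elim/big_ind : _ => //= i _; exact: h.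
  by move=> h i; move: h; rewrite (bigD1 i)//= => -[].
rewrite big_ord_recl -IH// -product_measure1E// /= /lebesgue_rVS /pushforward.
congr (_ _); apply/seteqP; split => -[a v] /=.
  move=> h; split=> [|i]; first by have := h ord0; rewrite consrV0.
  by have := h (lift ord0 i); rewrite consrVS.
by move=> [h0 hS] i; case: (unliftP ord0 i) => [k|] ->;
  rewrite ?consrVS ?consrV0.
Qed.

End lebesgue_rV.

Definition Gamma {R : realType} (z : R) : R :=
  \int[lebesgue_measure]_(x in `]0, +oo[) (x `^ (z - 1) * expR (- x)).

Section riesz.
Context {R : realType} {d : nat}.
Local Notation E := 'rV[R]_d.
Local Notation mu := (lebesgue_rV d).
Implicit Types (f g : E -> R[i]) (j : 'I_d) (t : R).

(* The library norm `|x| on 'rV[R]_d is the sup norm. *)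
Definition enorm (x : E) : R := Num.sqrt (\sum_i x 0 i ^+ 2).

Definition L2norm f : \bar R :=
  'N[mu]_2%:E[(fun x => (ComplexField.Normc.normc (f x))%:E)]%E.

Definition L2 f : Prop :=
  [/\ measurable_fun setT (fun x => complex.Re (f x)),
      measurable_fun setT (fun x => complex.Im (f x)) &
      (L2norm f < +oo)%E].

Definition cintegral (D : set E) f : R[i] :=
  (\int[mu]_(x in D) complex.Re (f x)) +i* (\int[mu]_(x in D) complex.Im (f x)).

Definition riesz_trunc j t f : E -> R[i] := fun x =>
  (Gamma (d.+1%:R / 2) / pi `^ (d.+1%:R / 2))%:C *
  cintegral [set y | t < enorm (x - y)]
    (fun y => ((x - y) 0 j / enorm (x - y) ^+ d.+1)%:C * f y).

Definition iter_partial (s : seq 'I_d) (u : E -> R) : E -> R :=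
  foldr (fun i v x => 'D_('e_i) v x) u s.

(* If all iterated partial derivatives are differentiable, u is C^infinity;
   every derivative d^b u is some iter_partial s u. *)
Definition schwartzR (u : E -> R) : Prop :=
  (forall s x, differentiable (iter_partial s u) x) /\
  (forall (a : 'I_d -> nat) (s : seq 'I_d), exists M : R, forall x : E,
     `|(\prod_i x 0 i ^+ a i) * iter_partial s u x| <= M).

Definition schwartz f : Prop :=
  schwartzR (fun x => complex.Re (f x)) /\ schwartzR (fun x => complex.Im (f x)).

(* T is a bounded linear operator on L^2 which on Schwartz functions is the
   pointwise limit of the truncations; functions in L^2 are identified when
   they agree almost everywhere. *)
Definition is_riesz j (T : (E -> R[i]) -> E -> R[i]) : Prop :=
  [/\ forall f, L2 f -> L2 (T f),
      forall (a : R[i]) f g, L2 f -> L2 g ->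
        {ae mu, forall x, T (fun y => a * f y + g y) x = a * T f x + T g x},
      exists M : R, forall f, L2 f -> (L2norm (T f) <= M%:E * L2norm f)%E &
      forall f, schwartz f -> {ae mu, forall x,
        complex.Re (riesz_trunc j t f x) @[t --> 0^'+] --> complex.Re (T f x) /\
        complex.Im (riesz_trunc j t f x) @[t --> 0^'+] --> complex.Im (T f x)}].

(* By density of Schwartz functions, is_riesz j determines T f up to a null
   set for every f in L^2. *)
Definition riesz j : (E -> R[i]) -> E -> R[i] :=
  xget (fun _ _ => 0) [set T | is_riesz j T].

End riesz.

(* Main.v *)
(* Write [gs a] for the Gaussian of width a normalised to mass one and
   [kp j a] = - d_j [gs a]. Since the integral of [kp j a] over a > 0 is a
   constant multiple [kk] of z_j / |z|^(d+1), the operators [kc j c] = (that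
   kernel) * [gs c] are superpositions of Gaussian kernels; they commute with
   [gs b], which shifts c to (b^2 + c^2)^(1/2), and they are bounded on L^2
   because the sum over j of their autocorrelations is a Gaussian. Their
   strong limit T as c -> 0 is the Riesz transform.

   The inequality follows from averaging over the truncation. With [wt t a] =
   max (gs a - gs a at radius t, 0) and [vt t] its integral over a, integrating
   d_j by parts gives, for the truncated kernel [kt j t],
     kc j c = kt j t * gs c + vt t * kp j c.
   Let [py y] be the Poisson-type mixture of Gaussians of mass one and [psi y]
   the mixture with weight 1 - exp (- y^2 / a^2); integration in polar
   coordinates of the (a, b) plane gives
     kc j c = psi y * kp j c + py y * kc j c.
   Eliminating [kp j c], the function phi = psi y - vt t + py y * vt t satisfies
     psi y * kt j t * gs c = phi * kc j c.
   Moreover phi >= 0 and its integral equals that of psi y, so Young's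
   inequality bounds the L^2 norm of (psi y / |psi y|_1) * kt j t * gs c * f by
   that of T f. Letting c and y tend to 0, where psi y / |psi y|_1 is an
   approximate identity, Fatou's lemma gives |kt j t * f| <= |T f|. Finally T is
   the Riesz transform: on Schwartz functions the truncations converge
   uniformly to T, and Schwartz functions are dense in L^2. *)

Require Import Defs.
From HB Require Import structures.
From mathcomp Require Import all_boot all_order all_algebra.
From mathcomp Require Import complex ring lra.
From mathcomp Require Import all_classical all_reals all_analysis.
From mathcomp Require Import measurable_realfun.

Set Implicit Arguments.
Unset Strict Implicit.
Unset Printing Implicit Defensive.
Import Order.TTheory GRing.Theory Num.Theory.
Import numFieldNormedType.Exports.

Local Open Scope classical_set_scope.
Local Open Scope ring_scope.

(** In Fourier terms [py y] is exp (- y |xi|) and [psi y] a constant times (1 - exp (- y |xi|)) /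
    |xi|. The identity for [phi] then says that the multiplier of [kt j t] relative to that of T,
    times the transform of [psi y], is the transform of [phi]; the latter is at most its value at 0
    because [phi] >= 0, and y -> 0 bounds the relative multiplier by 1. Gaussians replace the
    Fourier transform throughout, being closed under convolution and scaling. Positivity of [phi]:
    let I be the integral of [gs a] over a > 0 and I(t) its value at radius t. Formally [vt t] = max
    (I - I(t), 0) and [psi y] = I - [py y] * I, so inside the ball of radius t [phi] = I(t) - [py y]
    * min (I, I(t)), which is nonnegative because [py y] is a probability density; outside the ball
    [vt t] vanishes. For d = 1 the integral I diverges, so it never appears: the value at radius t
    is subtracted before integrating over a, and positivity is proved with a cut-off a <= A that is
    removed at the end. *)

Section affine_line.
Context {R : realType}.
Local Notation leb := (@lebesgue_measure R).

(** * Affine changes of variables and Tonelli on R and R^d *)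

Lemma measurable_affine (s b : R) :
  measurable_fun [set: measurableTypeR R] (fun x : R => s * x + b : measurableTypeR R).
Proof. by apply: measurable_funD => //; exact: measurable_funM. Qed.

(** Uniqueness of Lebesgue measure: [s] times its pushforward under the affine map gives the
    intervals ]u, v] their length. *)
Lemma ge0_integral_affine_pos (s b : R) (f : R -> \bar R) : 0 < s ->
  measurable_fun setT f -> (forall x, 0 <= f x)%E ->
  (\int[leb]_x f (s * x + b)%R = (s^-1)%:E * \int[leb]_x f x)%E.
Proof.
move=> s0 mf f0.
pose phi : measurableTypeR R -> measurableTypeR R := fun x => s * x + b.
have mphi : measurable_fun setT phi by exact: measurable_affine.
pose pm : {measure set (measurableTypeR R) -> \bar R} :=
  measure_function_pushforward__canonical__measure_function_Measure leb mphi.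
pose m := mscale (NngNum (ltW s0)) pm.
have E A : measurable A -> leb A = m A.
  move=> mA; apply: lebesgue_measure_unique => // _ [[u v]] _ <-.
  transitivity (s%:E * leb (phi @^-1` `]u, v]))%E; last by [].
  rewrite (_ : phi @^-1` _ = `](u - b) / s, (v - b) / s]%classic); last first.
    apply/seteqP; split => x /=; rewrite !in_itv/= /phi.
      by rewrite ltr_pdivrMr// ler_pdivlMr// ltrBlDr lerBrDr ![x * s]mulrC.
    by rewrite ltr_pdivrMr// ler_pdivlMr// ltrBlDr lerBrDr ![x * s]mulrC.
  rewrite !lebesgue_measure_itv/= !lte_fin ltr_pM2r ?invr_gt0// ltrD2r.
  case: ifPn => uv; last by rewrite mule0.
  rewrite -!EFinD -EFinM; congr (_%:E).
  by field; rewrite gt_eqF.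
transitivity (\int[pm]_x f x)%E.
  by rewrite ge0_integral_pushforward.
have -> : (\int[leb]_x f x = \int[m]_x f x)%E.
  by apply: eq_measure_integral => A mA _; exact: E.
rewrite ge0_integral_mscale//= muleA -EFinM mulVf ?gt_eqF//.
by rewrite mul1e.
Qed.

Lemma ge0_integralN (f : R -> \bar R) :
  measurable_fun setT f -> (forall x, 0 <= f x)%E ->
  (\int[leb]_x f (- x)%R = \int[leb]_x f x)%E.
Proof.
move=> mf f0.
pose phi : measurableTypeR R -> measurableTypeR R := fun x => - x.
have mphi : measurable_fun setT phi by exact: oppr_measurable.
pose pm : {measure set (measurableTypeR R) -> \bar R} :=
  measure_function_pushforward__canonical__measure_function_Measure leb mphi.
transitivity (\int[pm]_x f x)%E.
  by rewrite ge0_integral_pushforward.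
by apply: eq_measure_integral => A mA _; exact: lebesgue_measureN.
Qed.

Lemma ge0_integral_affine (s b : R) (f : R -> \bar R) : s != 0 ->
  measurable_fun setT f -> (forall x, 0 <= f x)%E ->
  (\int[leb]_x f (s * x + b)%R = (`|s|^-1)%:E * \int[leb]_x f x)%E.
Proof.
move=> s0 mf f0; have [sp|sn|] := ltgtP 0 s; last by move=> h; rewrite -h eqxx in s0.
  by rewrite ge0_integral_affine_pos// gtr0_norm.
rewrite ltr0_norm//.
rewrite -(@ge0_integral_affine_pos (- s) b) ?oppr_gt0//.
rewrite -ge0_integralN//.
- by under [RHS]eq_integral do rewrite mulNr -mulrN.
- exact: measurableT_comp (measurable_affine s b).
Qed.

End affine_line.

Section euclidean_measure.
Context {R : realType}.
Local Notation leb := (@lebesgue_measure R).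

Lemma ge0_integral_rVS n (f : 'rV[R]_n.+1 -> \bar R) :
  measurable_fun setT f -> (forall x, 0 <= f x)%E ->
  (\int[lebesgue_rV n.+1]_x f x =
   \int[leb]_a \int[lebesgue_rV n]_v f (consrV (a, v)))%E.
Proof.
move=> mf f0; rewrite /= /lebesgue_rVS ge0_integral_pushforward//=; last first.
  exact: measurable_consrV.
rewrite preimage_setT fubini_tonelli1//.
by apply: measurableT_comp => //; exact: measurable_consrV.
Qed.

Lemma measurable_rV_affine n (s : R) (b : 'rV[R]_n) :
  measurable_fun setT (fun x : 'rV[R]_n => s *: x + b).
Proof.
apply: measurable_fun_rV => i.
under eq_fun do rewrite !mxE.
exact: measurableT_comp (measurable_affine s _) (measurable_coord i).
Qed.

(** Induction on the dimension: through [consrV] the map acts separately on the first coordinate and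
    on the remaining row, and each coordinate contributes a factor 1 / |s|. *)
Lemma ge0_integral_rV_affine n (s : R) (b : 'rV[R]_n) (f : 'rV[R]_n -> \bar R) :
  s != 0 -> measurable_fun setT f -> (forall x, 0 <= f x)%E ->
  (\int[lebesgue_rV n]_x f (s *: x + b)%R =
   (`|s| ^- n)%:E * \int[lebesgue_rV n]_x f x)%E.
Proof.
move=> s0; elim: n b f => [|n IH] b f mf f0.
  rewrite /= expr0 invr1 mul1e !integral_dirac//.
    by rewrite !diracT !mul1e; congr f; apply/rowP => -[].
  by apply: measurableT_comp => //; exact: measurable_rV_affine.
rewrite !ge0_integral_rVS//; last first.
  by apply: measurableT_comp => //; exact: measurable_rV_affine.
pose b' := \row_i b 0 (lift ord0 i).
have E a v : s *: consrV (a, v) + b = consrV (s * a + b 0 ord0, s *: v + b').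
  apply/rowP => i; case: (unliftP ord0 i) => [k|] ->.
    by rewrite !mxE liftK/= !mxE.
  by rewrite !mxE unlift_none.
have mc : measurable_fun setT (f \o @consrV R n).
  by apply: measurableT_comp => //; exact: measurable_consrV.
under eq_integral => a _.
  under eq_integral do rewrite E.
  rewrite (IH b' (fun v => f (consrV (s * a + b 0 ord0, v))))//; last first.
    by apply: (measurableT_comp mc); exact: measurable_pair1.
  over.
pose g (a : measurableTypeR R) := (\int[lebesgue_rV n]_v f (consrV (a, v)))%E.
have mg : measurable_fun setT g.
  by apply: (measurable_fun_fubini_tonelli_F (f \o @consrV R n)) => // x; exact: f0.
have g0 a : (0 <= g a)%E by exact: integral_ge0.
transitivity (\int[leb]_a ((`|s| ^- n)%:E * g (s * a + b 0 ord0)%R))%E.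
  exact: eq_integral.
have mga := measurableT_comp mg (measurable_affine s (b 0 ord0)).
rewrite (@ge0_integralZl_EFin _ _ _ leb setT measurableT (fun a => g (s * a + b 0 ord0)) (fun x _ => g0 _) mga); last first.
  by rewrite invr_ge0 exprn_ge0.
rewrite (ge0_integral_affine (b 0%R ord0) s0 mg g0) muleA -EFinM; congr (_%:E * _)%E.
by rewrite exprSr invfM.
Qed.

Lemma ge0_integral_prod n (h : 'I_n -> R -> \bar R) :
  (forall i, measurable_fun setT (h i)) -> (forall i x, 0 <= h i x)%E ->
  (\int[lebesgue_rV n]_x (\prod_(i < n) h i (x 0%R i)) =
   \prod_(i < n) \int[leb]_x h i x)%E.
Proof.
elim: n h => [|n IH] h mh h0.
  rewrite big_ord0 /= integral_dirac//=.
    by rewrite diracT mul1e big_ord0.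
  rewrite (_ : (fun _ => _) = cst 1%E)//.
  by apply/funext => x; rewrite big_ord0.
have mp m (k : 'I_m -> R -> \bar R) : (forall i, measurable_fun setT (k i)) ->
    measurable_fun setT (fun x : 'rV[R]_m => \prod_(i < m) k i (x 0%R i))%E.
  move=> mk; elim: (index_enum _) => [|i r IHr].
    rewrite (_ : (fun _ => _) = cst 1%E)//.
    by apply/funext => x; rewrite big_nil.
  under eq_fun do rewrite big_cons.
  apply: emeasurable_funM => //.
  exact: measurableT_comp (mk i) (measurable_coord i).
rewrite ge0_integral_rVS; last 2 first.
- exact: mp.
- by move=> x; exact: prode_ge0.
under eq_integral => a _.
  under eq_integral => v _.
    rewrite big_ord_recl consrV0/=.
    under eq_bigr do rewrite consrVS.
    over.
  rewrite ge0_integralZl//=; last 2 first.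
  - exact: (mp _ (fun i => h (lift ord0 i))).
  - by move=> x _; exact: prode_ge0.
  rewrite (IH (fun i => h (lift ord0 i)))//.
  over.
rewrite ge0_integralZr//= ?big_ord_recl//.
- exact: mh.
- by apply: prode_ge0 => i _; exact: integral_ge0.
Qed.

End euclidean_measure.

(** * Real-valued integrals: scaling, dominated convergence, Fubini *)

Section real_integrals.
Context d (T : measurableType d) (R : realType) (m : {measure set T -> \bar R}).
Implicit Types f g : T -> R.

Lemma integrable_ltyP f : measurable_fun setT f ->
  (m.-integrable setT (EFin \o f) <-> (\int[m]_x (`|f x|)%:E < +oo)%E).
Proof.
move=> mf; split=> [/integrableP[_]//|h].
by apply/integrableP; split=> //; exact/measurable_EFinP.
Qed.

Lemma integrable_le f g : measurable_fun setT f ->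
  m.-integrable setT (EFin \o g) -> (forall x, `|f x| <= g x) ->
  m.-integrable setT (EFin \o f).
Proof.
move=> mf ig fg; apply: (le_integrable measurableT _ _ ig).
  exact/measurable_EFinP.
move=> x _ /=; rewrite lee_fin (le_trans (fg x))//.
exact: ler_norm.
Qed.

Lemma EFin_Rintegral f : m.-integrable setT (EFin \o f) ->
  ((\int[m]_x f x)%R%:E = \int[m]_x (f x)%:E)%E.
Proof. by move=> intf; rewrite fineK// integrable_fin_num. Qed.

(** Measurability suffices: [fine] sends infinite and undefined integrals to 0, and scaling by a
    nonzero constant keeps them infinite. This lets constants be moved before integrability is
    known. *)
Lemma Rintegral_measurableZl f (c : R) : measurable_fun setT f ->
  (\int[m]_x (c * f x) = c * \int[m]_x f x)%R.
Proof.
move=> mf.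
have pos (k : R) : 0 <= k -> (\int[m]_x (k * f x) = k * \int[m]_x f x)%R.
  move=> k0; rewrite /Rintegral [in LHS]integralE [in RHS]integralE.
  have -> : ((fun x => (k * f x)%:E)^\+ = fun x => k%:E * (EFin \o f)^\+ x)%E.
    by rewrite -ge0_funeposM.
  have -> : ((fun x => (k * f x)%:E)^\- = fun x => k%:E * (EFin \o f)^\- x)%E.
    by rewrite -ge0_funenegM.
  have mf' : measurable_fun setT (EFin \o f) by exact/measurable_EFinP.
  rewrite !ge0_integralZl_EFin//; try exact: measurable_funepos; try exact: measurable_funeneg.
  set a := (\int[m]_x _)%E; set b := (\int[m]_x _)%E.
  have a0 : (0 <= a)%E by exact: integral_ge0.
  have b0 : (0 <= b)%E by exact: integral_ge0.
  have [->|kn0] := eqVneq k 0; first by rewrite !mul0e subee// mul0r.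
  have kp : 0 < k by rewrite lt_def kn0.
  case: a a0 => [a||]// a0; case: b b0 => [b||]// b0;
    by rewrite ?gt0_muley ?lte_fin//= ?mulr0// mulrBr.
have [c0|c0] := leP 0 c; first exact: pos.
have -> : (\int[m]_x (c * f x))%R = (\int[m]_x (- (- c * f x)))%R.
  by apply: eq_Rintegral => x _; rewrite mulNr opprK.
suff opp g : measurable_fun setT g -> (\int[m]_x (- g x) = - \int[m]_x g x)%R.
  rewrite opp; last exact: measurable_funM.
  by rewrite pos ?mulNr ?opprK// oppr_ge0 ltW.
move=> mg; rewrite /Rintegral [in LHS]integralE [in RHS]integralE.
have -> : ((fun x => (- g x)%:E)^\+ = (EFin \o g)^\-)%E.
  by rewrite -funeposN.
have -> : ((fun x => (- g x)%:E)^\- = (EFin \o g)^\+)%E.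
  by rewrite -funenegN.
set a := (\int[m]_x _)%E; set b := (\int[m]_x _)%E.
have a0 : (0 <= a)%E by exact: integral_ge0.
have b0 : (0 <= b)%E by exact: integral_ge0.
by case: a a0 => [a||]// a0; case: b b0 => [b||]// b0; rewrite /= ?opprB// oppr0.
Qed.

Lemma le_normr_Rintegral_fin f (M : R) : measurable_fun setT f ->
  (\int[m]_x (`|f x|)%:E <= M%:E)%E -> `|(\int[m]_x f x)%R| <= M.
Proof.
move=> mf fM; have intf : m.-integrable setT (EFin \o f).
  by apply/integrable_ltyP => //; apply: le_lt_trans fM (ltry _).
rewrite -lee_fin (le_trans _ fM)//.
rewrite EFin_normr_Rintegral//.
exact: le_abse_integral (measurable_int _ intf).
Qed.

Lemma cvg_Rintegral (f_ : nat -> T -> R) f g :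
  (forall n, measurable_fun setT (f_ n)) -> measurable_fun setT f ->
  {ae m, forall x, f_ n x @[n --> \oo] --> f x} ->
  m.-integrable setT (EFin \o g) ->
  {ae m, forall x, forall n, `|f_ n x| <= g x} ->
  ((\int[m]_x f_ n x)%R @[n --> \oo] --> (\int[m]_x f x)%R).
Proof.
move=> mf_ mf f_f ig fg.
have [//||||intf _ cv] := @dominated_convergence _ _ _ m setT measurableT
    (fun n => EFin \o f_ n) (EFin \o f) (EFin \o g) _ _ _ ig _.
- by move=> n; exact/measurable_EFinP.
- exact/measurable_EFinP.
- apply: filterS f_f => x h _ /=; apply: cvg_comp h _.
  exact: cvg_id.
- by apply: filterS fg => x h n _ /=; rewrite lee_fin.
apply: fine_cvg; rewrite fineK//; exact: integrable_fin_num.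
Qed.

End real_integrals.

Section real_fubini.
Context d1 d2 (T1 : measurableType d1) (T2 : measurableType d2) (R : realType).
Variables (m1 : {sigma_finite_measure set T1 -> \bar R}).
Variables (m2 : {sigma_finite_measure set T2 -> \bar R}).
Implicit Types h : T1 * T2 -> R.

Lemma measurable_Rintegral_fst h : measurable_fun setT h ->
  measurable_fun setT (fun x => (\int[m2]_y h (x, y))%R).
Proof.
move=> mh; rewrite /Rintegral; apply: measurableT_comp => //.
have mh' : measurable_fun setT (EFin \o h) by exact/measurable_EFinP.
rewrite (_ : (fun _ => _) = (fun x => \int[m2]_y (EFin \o h)^\+%E (x, y) -
    \int[m2]_y (EFin \o h)^\-%E (x, y))%E); last first.
  apply/funext => x; rewrite integralE; congr (_ - _)%E.
    by apply: eq_integral => y _; rewrite !funeposE.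
  by apply: eq_integral => y _; rewrite !funenegE.
apply: emeasurable_funB.
  apply: (measurable_fun_fubini_tonelli_F (EFin \o h)^\+%E) => //.
  exact: measurable_funepos.
apply: (measurable_fun_fubini_tonelli_F (EFin \o h)^\-%E) => //.
exact: measurable_funeneg.
Qed.

Lemma integrable_prod_lty h : measurable_fun setT h ->
  (\int[m1]_x \int[m2]_y (`|h (x, y)|)%:E < +oo)%E ->
  (m1 \x m2)%E.-integrable setT (EFin \o h).
Proof.
move=> mh hlt; apply/integrable12ltyP => //; exact/measurable_EFinP.
Qed.

Lemma EFin_Rintegral_ae h : measurable_fun setT h ->
  (\int[m1]_x \int[m2]_y (`|h (x, y)|)%:E < +oo)%E ->
  {ae m1, forall x, ((\int[m2]_y h (x, y))%R%:E = \int[m2]_y (h (x, y))%:E)%E}.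
Proof.
move=> mh hlt; have := ae_integrable1 (integrable_prod_lty mh hlt).
apply: filterS => x hx; exact: EFin_Rintegral.
Qed.

Lemma integrable_Rintegral_fst h : measurable_fun setT h ->
  (\int[m1]_x \int[m2]_y (`|h (x, y)|)%:E < +oo)%E ->
  m1.-integrable setT (fun x => (\int[m2]_y h (x, y))%R%:E).
Proof.
move=> mh hlt; have ih := integrable_prod_lty mh hlt.
apply/integrableP; split.
  by apply/measurable_EFinP; exact: measurable_Rintegral_fst.
apply: le_lt_trans hlt; apply: ae_ge0_le_integral => //.
- apply/measurable_EFinP; apply: measurableT_comp => //.
  exact: measurable_Rintegral_fst.
- by move=> x _; exact: integral_ge0.
- apply: (measurable_fun_fubini_tonelli_F (fun z => (`|h z|)%:E)) => //.
  by apply/measurable_EFinP; exact: measurableT_comp.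
have := ae_integrable1 ih; apply: filterS => x hx _.
rewrite EFin_Rintegral//; apply: le_abse_integral => //.
exact: measurable_int hx.
Qed.

End real_fubini.

Section real_fubini2.
Context d1 d2 (T1 : measurableType d1) (T2 : measurableType d2) (R : realType).
Variables (m1 : {sigma_finite_measure set T1 -> \bar R}).
Variables (m2 : {sigma_finite_measure set T2 -> \bar R}).
Implicit Types h : T1 * T2 -> R.

Lemma Rintegral_fubini h : measurable_fun setT h ->
  (\int[m1]_x \int[m2]_y (`|h (x, y)|)%:E < +oo)%E ->
  (\int[m1]_x \int[m2]_y h (x, y))%R = (\int[m2]_y \int[m1]_x h (x, y))%R.
Proof.
move=> mh hlt; have ih := integrable_prod_lty mh hlt.
have mh2 : measurable_fun setT (fun z => h (z.2, z.1)).
  apply: measurableT_comp => //; apply/measurable_fun_pair => //.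
have hlt2 : (\int[m2]_x \int[m1]_y (`|h (y, x)|)%:E < +oo)%E.
  rewrite -(fubini_tonelli (fun z => (`|h z|)%:E))//.
  by apply/measurable_EFinP; exact: measurableT_comp.
apply/EFin_inj; rewrite !EFin_Rintegral; last 2 first.
- exact: (integrable_Rintegral_fst mh2 hlt2).
- exact: (integrable_Rintegral_fst mh hlt).
(* The real and the extended inner integrals agree only where the section is integrable, that is,
   almost everywhere. *)
rewrite (@ae_eq_integral _ _ _ m1 setT (fun x => \int[m2]_y (h (x, y))%:E)%E); last 4 first.
- exact: measurableT.
- by apply/measurable_EFinP; exact: measurable_Rintegral_fst.
- exact: measurable_fubini_F ih.
- have := EFin_Rintegral_ae mh hlt; apply: filterS => x + _; exact.
rewrite (@ae_eq_integral _ _ _ m2 setT (fun y => \int[m1]_x (h (x, y))%:E)%E); last 4 first.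
- exact: measurableT.
- by apply/measurable_EFinP; exact: (measurable_Rintegral_fst m1 mh2).
- exact: measurable_fubini_G ih.
- have := EFin_Rintegral_ae mh2 hlt2; apply: filterS => x + _; exact.
exact: (Fubini ih).
Qed.

End real_fubini2.

(** * Square-integrable functions: Cauchy-Schwarz, Fatou, completeness *)

Section square_norm.
Context d (T : measurableType d) (R : realType) (m : {measure set T -> \bar R}).
Implicit Types f g : T -> R.

(** The squared L^2 norm, left squared and extended-real so that monotonicity, Tonelli and Fatou
    apply directly; the price is the factor 2 of [sqnD_le] in place of the triangle inequality. *)
Definition sqn f : \bar R := (\int[m]_x (f x ^+ 2)%:E)%E.

Definition L2r f := measurable_fun setT f /\ (sqn f < +oo)%E.

Lemma sqn_ge0 f : (0 <= sqn f)%E.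
Proof. by apply: integral_ge0 => x _; rewrite lee_fin sqr_ge0. Qed.

Lemma L2r_fin_num f : L2r f -> sqn f \is a fin_num.
Proof. by move=> [_ ?]; rewrite ge0_fin_numE// sqn_ge0. Qed.

Lemma measurable_sqr f : measurable_fun setT f ->
  measurable_fun setT (fun x => (f x ^+ 2)%:E).
Proof. by move=> mf; apply/measurable_EFinP; exact: measurable_funX. Qed.

Lemma sqn_le f g : measurable_fun setT f -> measurable_fun setT g ->
  {ae m, forall x, `|f x| <= `|g x|} -> (sqn f <= sqn g)%E.
Proof.
move=> mf mg fg; apply: ae_ge0_le_integral => //.
- by move=> x _; rewrite lee_fin sqr_ge0.
- exact: measurable_sqr.
- by move=> x _; rewrite lee_fin sqr_ge0.
- exact: measurable_sqr.
- apply: filterS fg => x fgx _; rewrite lee_fin -[leLHS]real_normK ?num_real//.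
  by rewrite -[leRHS]real_normK ?num_real// lerXn2r// nnegrE.
Qed.

Lemma sqn_ae_eq f g : measurable_fun setT f -> measurable_fun setT g ->
  {ae m, forall x, f x = g x} -> sqn f = sqn g.
Proof.
move=> mf mg fg; apply/eqP; rewrite eq_le !sqn_le//;
  by apply: filterS fg => x ->.
Qed.

Lemma sqnZ f (c : R) : measurable_fun setT f ->
  sqn (fun x => c * f x) = ((c ^+ 2)%:E * sqn f)%E.
Proof.
move=> mf; rewrite /sqn -ge0_integralZl_EFin ?sqr_ge0//.
- by apply: eq_integral => x _; rewrite -EFinM exprMn.
- by move=> x _; rewrite lee_fin sqr_ge0.
- exact: measurable_sqr.
Qed.

Lemma sqnD_le f g : measurable_fun setT f -> measurable_fun setT g ->
  (sqn (fun x => f x + g x)%R <= 2%:E * (sqn f + sqn g))%E.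
Proof.
move=> mf mg; rewrite /sqn -ge0_integralD//; last 4 first.
- by move=> x _; rewrite lee_fin sqr_ge0.
- exact: measurable_sqr.
- by move=> x _; rewrite lee_fin sqr_ge0.
- exact: measurable_sqr.
rewrite -ge0_integralZl_EFin//; last 2 first.
- by move=> x _; rewrite -EFinD lee_fin addr_ge0// sqr_ge0.
- by apply: emeasurable_funD; exact: measurable_sqr.
apply: ge0_le_integral => //.
- by move=> x _; rewrite lee_fin sqr_ge0.
- exact/measurable_sqr/measurable_funD.
- by apply: measurable_funeM; apply: emeasurable_funD; exact: measurable_sqr.
- move=> x _; rewrite -EFinD -EFinM lee_fin -subr_ge0.
  have -> : 2 * (f x ^+ 2 + g x ^+ 2) - (f x + g x) ^+ 2 = (f x - g x) ^+ 2.
    by ring.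
  exact: sqr_ge0.
Qed.

Lemma sqnB_le f g : measurable_fun setT f -> measurable_fun setT g ->
  (sqn (fun x => f x - g x)%R <= 2%:E * (sqn f + sqn g))%E.
Proof.
move=> mf mg; have := sqnD_le mf (measurable_funN mg).
by congr (_ <= 2%:E * (_ + _))%E; rewrite /sqn; apply: eq_integral => x _;
  rewrite sqrrN.
Qed.

Lemma sqnN f : sqn (fun x => - f x) = sqn f.
Proof. by rewrite /sqn; apply: eq_integral => x _; rewrite sqrrN. Qed.

Lemma sqn_subC f g : sqn (fun x => f x - g x) = sqn (fun x => g x - f x).
Proof. by rewrite -sqnN; congr sqn; apply/funext => x; rewrite opprB. Qed.

Lemma sqn_norm f : sqn (fun x => `|f x|) = sqn f.
Proof. by rewrite /sqn; apply: eq_integral => x _; rewrite real_normK ?num_real. Qed.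

Lemma L2rD f g : L2r f -> L2r g -> L2r (fun x => f x + g x).
Proof.
move=> [mf f2] [mg g2]; split; first exact: measurable_funD.
apply: le_lt_trans (sqnD_le mf mg) _.
by rewrite lte_mul_pinfty// lte_add_pinfty.
Qed.

Lemma L2rN f : L2r f -> L2r (fun x => - f x).
Proof. by move=> [mf f2]; split; [exact: measurable_funN|rewrite sqnN]. Qed.

Lemma L2rB f g : L2r f -> L2r g -> L2r (fun x => f x - g x).
Proof. by move=> hf hg; apply: L2rD => //; exact: L2rN. Qed.

Lemma L2rZ f c : L2r f -> L2r (fun x => c * f x).
Proof.
move=> [mf f2]; split; first exact: measurable_funM.
by rewrite sqnZ// lte_mul_pinfty// lee_fin sqr_ge0.
Qed.

Lemma L2r_le f g : measurable_fun setT f -> L2r g ->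
  {ae m, forall x, `|f x| <= `|g x|} -> L2r f.
Proof.
by move=> mf [mg g2] fg; split => //; apply: le_lt_trans g2; exact: sqn_le.
Qed.

Lemma L2r0 : L2r (fun=> 0).
Proof.
split => //; rewrite /sqn; under eq_integral do rewrite expr0n/=.
by rewrite integral0.
Qed.

Lemma LnormX2 (f : T -> \bar R) :
  ('N[m]_2%:E[f] ^+ 2 = \int[m]_x (`|f x| ^+ 2))%E.
Proof.
have pE (x : \bar R) : (0 <= x -> x `^ 2 = x ^+ 2)%E.
  case: x => [x| |] // x0; last by rewrite poweRyr.
  by rewrite poweR_EFin powR_mulrn// -EFin_expe.
rewrite -pE ?Lnorm_ge0// poweR_Lnorm//.
by apply: eq_integral => x _; rewrite pE.
Qed.

Lemma cauchy_schwarz f g : measurable_fun setT f -> measurable_fun setT g ->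
  ((\int[m]_x (`|f x * g x|)%:E) ^+ 2 <= sqn f * sqn g)%E.
Proof.
move=> mf mg.
have h2 : 2^-1 + 2^-1 = 1 :> R by field.
have h := @hoelder _ T R m f g 2 2 mf mg (ltr0Sn _ 1) (ltr0Sn _ 1) h2.
have -> : sqn f = ('N[m]_2%:E[EFin \o f] ^+ 2)%E.
  rewrite LnormX2; apply: eq_integral => x _.
  by rewrite abse_EFin -EFin_expe real_normK ?num_real.
have -> : sqn g = ('N[m]_2%:E[EFin \o g] ^+ 2)%E.
  rewrite LnormX2; apply: eq_integral => x _.
  by rewrite abse_EFin -EFin_expe real_normK ?num_real.
move: h; rewrite Lnorm1.
under eq_integral do rewrite abse_EFin.
set a := (\int[m]_x _)%E; set b := 'N[m]__[_]%E; set c := 'N[m]__[_]%E => ab.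
have a0 : (0 <= a)%E by exact: integral_ge0.
by rewrite !expe2 muleACA lee_pmul.
Qed.

Lemma integrableM_L2r f g : L2r f -> L2r g ->
  m.-integrable setT (EFin \o (fun x => f x * g x)).
Proof.
move=> [mf f2] [mg g2]; apply/integrable_ltyP; first exact: measurable_funM.
have := cauchy_schwarz mf mg.
set a := (\int[m]_x _)%E => h.
have a0 : (0 <= a)%E by exact: integral_ge0.
have : (a ^+ 2 < +oo)%E.
  by apply: le_lt_trans h _; rewrite lte_mul_pinfty ?sqn_ge0// ge0_fin_numE// sqn_ge0.
by case: a a0 {h} => [r| |] // _; rewrite ?ltry// expe2 mulyy.
Qed.

Lemma normr_Rintegral_sqr_le f g : measurable_fun setT f -> measurable_fun setT g ->
  ((`|(\int[m]_x (f x * g x))%R| ^+ 2)%:E <= sqn f * sqn g)%E.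
Proof.
move=> mf mg; apply: le_trans (cauchy_schwarz mf mg).
set a := (\int[m]_x (`|_|)%:E)%E.
have a0 : (0 <= a)%E by exact: integral_ge0.
case aE : a a0 => [r| |]// a0; last by rewrite expe2 mulyy leey.
have := @le_normr_Rintegral_fin _ _ _ m (fun x => f x * g x) r.
rewrite -/a aE => /(_ (measurable_funM mf mg) (lexx _)) h.
by rewrite -EFin_expe lee_fin lerXn2r// nnegrE// (le_trans _ h).
Qed.

Definition cvgL2 (f_ : nat -> T -> R) f := forall e : R, 0 < e ->
  \forall n \near \oo, (sqn (fun x => f_ n x - f x)%R <= e%:E)%E.

Lemma cvg_Rintegral_L2 (f_ : nat -> T -> R) f g :
  (forall n, L2r (f_ n)) -> L2r f -> L2r g -> cvgL2 f_ f ->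
  (\int[m]_x (f_ n x * g x))%R @[n --> \oo] --> (\int[m]_x (f x * g x))%R.
Proof.
move=> hf_ hf hg f_f; apply/cvgrPdist_lt => e e0.
have B0 : 0 <= fine (sqn g) by rewrite fine_ge0// sqn_ge0.
(* The threshold makes the product in Cauchy-Schwarz smaller than e^2; the summand 1 avoids a
   division by zero when [g] vanishes. *)
have e20 : 0 < e ^+ 2 / (fine (sqn g) + 1) by rewrite divr_gt0 ?exprn_gt0// ltr_wpDl.
have := f_f _ e20; apply: filterS => n /= h.
rewrite distrC -RintegralB//; try exact: integrableM_L2r.
have := normr_Rintegral_sqr_le (L2rB (hf_ n) hf).1 hg.1.
under eq_Rintegral do rewrite mulrBl.
have hl : (sqn (fun x => f_ n x - f x)%R * sqn g < (e ^+ 2)%:E)%E.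
  rewrite -(fineK (L2r_fin_num hg)).
  apply: le_lt_trans (lee_wpmul2r _ h) _; rewrite ?lee_fin// -EFinM lte_fin.
  by rewrite -mulrA mulrC -lter_pdivlMr ?exprn_gt0// divff ?gt_eqF ?exprn_gt0// mulrC
    ltr_pdivrMr ?mul1r ?ltrDl// ltr_wpDl.
move=> /le_lt_trans/(_ hl); rewrite lte_fin.
by rewrite ltr_pXn2r ?nnegrE ?(ltW e0).
Qed.

Lemma sqn_fatou (f_ : nat -> T -> R) f (M : \bar R) :
  (forall n, measurable_fun setT (f_ n)) -> measurable_fun setT f ->
  {ae m, forall x, f_ n x @[n --> \oo] --> f x} ->
  (\forall n \near \oo, (sqn (f_ n) <= M)%E) -> (sqn f <= M)%E.
Proof.
move=> mf_ mf f_f fM.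
have mE n := measurable_sqr (mf_ n).
have -> : sqn f = (\int[m]_x limn_einf (fun n => (f_ n x ^+ 2)%:E))%E.
  apply: ge0_ae_eq_integral => //.
  - exact: measurable_sqr.
  - under eq_fun do rewrite -[limn_einf _]oppeK -limn_esupN.
    apply: measurableT_comp => //; apply: measurable_fun_limn_esup => n.
    by apply: measurableT_comp => //; exact: mE.
  - by move=> x _; rewrite lee_fin sqr_ge0.
  - move=> x _; rewrite limn_einf_lim; apply: lime_ge.
      exact: is_cvg_einfs.
    apply: nearW => n; apply: le_ereal_inf_tmp => _ [k _ <-].
    by rewrite lee_fin sqr_ge0.
  - apply: filterS f_f => x h _.
    have h2 : (f_ n x ^+ 2)%:E @[n --> \oo] --> (f x ^+ 2)%:E.
      apply: cvg_EFin; first exact: nearW.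
      by rewrite !expr2; exact: cvgM.
    rewrite is_cvg_limn_einfE; first by apply/esym/cvg_lim.
    by apply/cvg_ex; eexists; exact: h2.
apply: le_trans (fatou m measurableT mE _) _.
  by move=> n x _; rewrite lee_fin sqr_ge0.
rewrite limn_einf_lim; apply: lime_le; first exact: is_cvg_einfs.
(* The bound holds from some rank N on, so the infimum over k >= n is tested at k = max n N. *)
case: fM => N _ fM; near=> n.
apply: ge_ereal_inf; exists (sqn (f_ (maxn n N))).
  by exists (maxn n N) => //=; rewrite leq_maxl.
by apply: fM; rewrite /= leq_maxr.
Unshelve. all: end_near. Qed.

End square_norm.

Section L2_completeness.
Context d (T : measurableType d) (R : realType) (m : {measure set T -> \bar R}).

(** The weights 4^k against the bounds 8^-k make the sum of 4^k |g_(k+1) - g_k|^2 integrable. Where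
    that sum is finite the increments are at most a constant times 2^-k, so their series
    converges. *)
Lemma cvg_fast_subseq (g : nat -> T -> R) : (forall n, measurable_fun setT (g n)) ->
  (forall k, (sqn m (fun x => g k.+1 x - g k x)%R <= (8^-1 ^+ k)%:E)%E) ->
  {ae m, forall x, cvgn (fun n => g n x)}.
Proof.
move=> mg hg.
pose D k x := g k.+1 x - g k x.
have mD k : measurable_fun setT (D k) by exact: measurable_funB.
pose S x := (\sum_(k <oo) (4 ^+ k * D k x ^+ 2)%:E)%E.
have mS k : measurable_fun setT (fun x => (4 ^+ k * D k x ^+ 2)%:E).
  by apply/measurable_EFinP; apply: measurable_funM => //; exact: measurable_funX.
have S0 k x : (0 <= (4 ^+ k * D k x ^+ 2)%:E)%E.
  by rewrite lee_fin; apply: mulr_ge0; [exact: exprn_ge0|exact: sqr_ge0].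
have intS : (\int[m]_x S x < +oo)%E.
  rewrite /S integral_nneseries//.
  apply: (@le_lt_trans _ _ (\sum_(k <oo) (2%:R / (2 ^ (k + 1))%:R)%:E)%E); last first.
    by have /cvg_lim -> // := @cvg_geometric_eseries_half R 2 0; exact: ltry.
  apply: lee_nneseries; first by move=> k *; apply: integral_ge0 => x _; exact: S0.
  move=> k *.
  under eq_integral do rewrite EFinM.
  rewrite ge0_integralZl_EFin ?exprn_ge0//; last 2 first.
  - by move=> x _; rewrite lee_fin sqr_ge0.
  - exact: measurable_sqr.
  have h4 : (0 <= (4 ^+ k : R)%:E)%E by rewrite lee_fin exprn_ge0.
  apply: le_trans (lee_wpmul2l h4 (hg k)) _.
  rewrite -EFinM lee_fin -exprMn (_ : 4 * 8^-1 = 2^-1); last by field.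
  rewrite addn1 natrX exprS invfM mulrA divff ?pnatr_eq0// mul1r exprVn.
  by [].
have intSi : m.-integrable setT S.
  apply/integrableP; split; first exact: ge0_emeasurable_sum.
  under eq_integral do rewrite gee0_abs ?nneseries_ge0//.
  exact: intS.
have := integrable_ae measurableT intSi; apply: filterS => x /(_ I) Sx.
have -> : (fun n => g n x) = (fun n => g 0%N x + series (fun k => D k x) n).
  by apply/funext => n; rewrite /series/= /D telescope_sumr// addrC subrK.
apply: is_cvgD; first exact: is_cvg_cst.
apply: normed_cvg.
pose c := Num.sqrt (fine (S x)).
apply: (@series_le_cvg _ _ (geometric c 2^-1)).
- by move=> n /=.
- by move=> n; rewrite /geometric/= mulr_ge0 ?sqrtr_ge0// exprn_ge0.
- move=> n; rewrite /geometric/= -(@ler_pXn2r _ 2)// ?nnegrE ?mulr_ge0 ?sqrtr_ge0 ?exprn_ge0//.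
  have Sx0 : (0 <= S x)%E by apply: nneseries_ge0 => k _ _; exact: S0.
  rewrite exprMn sqr_sqrtr ?fine_ge0// -exprM mulnC exprM (_ : 2^-1 ^+ 2 = 4^-1) ?exprVn; last by field.
  rewrite ler_pdivlMr ?exprn_gt0// mulrC real_normK ?num_real//.
  rewrite -lee_fin fineK//.
  have := @nneseries_lim_ge R (fun k => (4 ^+ k * D k x ^+ 2)%:E) xpredT 0 n.+1.
  move=> /(_ (fun k _ _ => S0 k x)); apply: le_trans.
  rewrite big_nat_recr//= leeDr// sume_ge0// => i _; exact: S0.
by apply: is_cvg_geometric_series; rewrite ger0_norm// invf_lt1// ltr1n.
Qed.

Lemma L2_complete (f_ : nat -> T -> R) : (forall n, L2r m (f_ n)) ->
  (forall e : R, 0 < e -> exists N, forall p q, (N <= p)%N -> (N <= q)%N ->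
    (sqn m (fun x => f_ p x - f_ q x)%R <= e%:E)%E) ->
  exists2 f, L2r m f & cvgL2 m f_ f.
Proof.
move=> hf cau.
have e0 k : 0 < 8^-1 ^+ k :> R by rewrite exprn_gt0.
pose N k := sval (cid (cau _ (e0 k))).
have NP k p q : (N k <= p)%N -> (N k <= q)%N ->
  (sqn m (fun x => f_ p x - f_ q x)%R <= (8^-1 ^+ k)%:E)%E.
  exact: svalP (cid (cau _ (e0 k))) p q.
(* Summing the successors makes the ranks strictly increasing and keeps [n k] above [N k]. *)
pose n k := (\sum_(i < k.+1) (N i).+1)%N.
have Nn k : (N k <= n k)%N by rewrite /n big_ord_recr/= (leq_trans (leqnSn _))// leq_addl.
have nS k : (n k < n k.+1)%N by rewrite /n [X in (_ < X)%N]big_ord_recr/= addnS ltnS leq_addr.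
have kn k : (k <= n k)%N by elim: k => // k IH; exact: leq_ltn_trans IH (nS k).
pose g k := f_ (n k).
have mg k : measurable_fun setT (g k) by case: (hf (n k)).
have cg := @cvg_fast_subseq g mg (fun k => NP k _ _ (leq_trans (Nn k) (ltnW (nS k))) (Nn k)).
(* The upper limit is measurable everywhere and equals the limit wherever the subsequence converges;
   [fine] gives a real value on the exceptional null set. *)
pose f x := fine (limn_esup (fun k => (g k x)%:E)).
have mf : measurable_fun setT f.
  apply: measurableT_comp => //; apply: measurable_fun_limn_esup => k.
  exact/measurable_EFinP.
have gf : {ae m, forall x, g k x @[k --> \oo] --> f x}.
  apply: filterS cg => x /cvg_ex[l hl].
  suff -> : f x = l by [].
  have hl' : (g k x)%:E @[k --> \oo] --> l%:E by apply: cvg_EFin => //; exact: nearW.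
  rewrite /f is_cvg_limn_esupE; last by apply/cvg_ex; exists l%:E.
  by have /cvg_lim -> := hl'.
have key e : 0 < e -> \forall p \near \oo, (sqn m (fun x => f_ p x - f x)%R <= e%:E)%E.
  move=> ep; have [M MP] := cau _ ep; exists M => // p /= Mp.
  apply: (@sqn_fatou _ _ _ _ (fun k x => f_ p x - g k x)).
  - by move=> k; apply: measurable_funB => //; case: (hf p).
  - by apply: measurable_funB => //; case: (hf p).
  - apply: filterS gf => x gx; apply: cvgB => //; exact: cvg_cst.
  - exists M => // k /= Mk; apply: MP => //; exact: leq_trans (kn k).
exists f => //; split => //.
have [M _ MP] := key 1 ltr01.
have := MP M (leqnn M); rewrite sqn_subC => h.
have := sqnD_le m (measurable_funB mf (hf M).1) (hf M).1.
rewrite (_ : (fun x => _) = f); last by apply/funext => x; rewrite subrK.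
move=> /le_lt_trans; apply; rewrite lte_mul_pinfty// lte_add_pinfty//; last by case: (hf M).
by rewrite (le_lt_trans h)// ltry.
Qed.

End L2_completeness.

(** * Convolution, dominated convergence in L^2 and Young's inequality *)

Section convolution.
Context {R : realType} {d : nat}.
Local Notation E := 'rV[R]_d.
Local Notation mu := (@lebesgue_rV R d).
Implicit Types f g h : E -> R.

Lemma measurable_rV_sub : measurable_fun setT (fun z : E * E => z.1 - z.2).
Proof.
apply: measurable_fun_rV => i.
under eq_fun do rewrite !mxE.
apply: measurable_funB.
  exact: measurableT_comp (measurable_coord i) measurable_fst.
exact: measurableT_comp (measurable_coord i) measurable_snd.
Qed.

Lemma measurable_rV_subl (x : E) : measurable_fun setT (fun y : E => x - y).
Proof.
apply: measurable_fun_rV => i; under eq_fun do rewrite !mxE.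
by apply: measurable_funB => //; exact: measurable_coord.
Qed.

Lemma measurable_rV_subr (x : E) : measurable_fun setT (fun y : E => y - x).
Proof.
apply: measurable_fun_rV => i; under eq_fun do rewrite !mxE.
by apply: measurable_funB => //; exact: measurable_coord.
Qed.

Lemma ge0_integral_rV_subl (x : E) (f : E -> \bar R) : measurable_fun setT f ->
  (forall y, 0 <= f y)%E -> (\int[mu]_y f (x - y)%R = \int[mu]_y f y)%E.
Proof.
move=> mf f0; have := @ge0_integral_rV_affine R d (-1) x f _ mf f0.
rewrite oppr_eq0 oner_eq0 normrN normr1 expr1n invr1 mul1e => /(_ isT) <-.
by apply: eq_integral => y _; rewrite scaleN1r addrC.
Qed.

Lemma ge0_integral_rV_subr (x : E) (f : E -> \bar R) : measurable_fun setT f ->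
  (forall y, 0 <= f y)%E -> (\int[mu]_y f (y - x)%R = \int[mu]_y f y)%E.
Proof.
move=> mf f0; have := @ge0_integral_rV_affine R d 1 (- x) f _ mf f0.
rewrite oner_eq0 normr1 expr1n invr1 mul1e => /(_ isT) <-.
by apply: eq_integral => y _; rewrite scale1r.
Qed.

Lemma Rintegral_rV_affine (s : R) (b : E) f : s != 0 -> measurable_fun setT f ->
  (\int[mu]_x f (s *: x + b))%R = `|s| ^- d * (\int[mu]_x f x)%R.
Proof.
move=> s0 mf; rewrite /Rintegral [in LHS]integralE [in RHS]integralE.
have mf' : measurable_fun setT (EFin \o f) by exact/measurable_EFinP.
have -> : ((fun x => (f (s *: x + b))%:E)^\+ =
    fun x => (EFin \o f)^\+ (s *: x + b)%R)%E.
  by apply/funext => x; rewrite !funeposE.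
have -> : ((fun x => (f (s *: x + b))%:E)^\- =
    fun x => (EFin \o f)^\- (s *: x + b)%R)%E.
  by apply/funext => x; rewrite !funenegE.
rewrite !ge0_integral_rV_affine//; try exact: measurable_funepos; try exact: measurable_funeneg.
set c := `|s| ^- d; have c0 : 0 < c by rewrite invr_gt0 exprn_gt0// normr_gt0.
set a := (\int[_]_x _)%E; set a' := (\int[_]_x _)%E.
have p0 : (0 <= a)%E by exact: integral_ge0.
have p'0 : (0 <= a')%E by exact: integral_ge0.
by case: a p0 => [p| |]// _; case: a' p'0 => [p'| |]// _;
  rewrite ?gt0_muley ?lte_fin//= ?mulr0// mulrBr.
Qed.

Lemma Rintegral_rV_subl (x : E) f : measurable_fun setT f ->
  (\int[mu]_y f (x - y))%R = (\int[mu]_y f y)%R.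
Proof.
move=> mf; have := @Rintegral_rV_affine (-1) x f _ mf.
rewrite oppr_eq0 oner_eq0 normrN normr1 expr1n invr1 mul1r => /(_ isT) <-.
by apply: eq_Rintegral => y _; rewrite scaleN1r addrC.
Qed.

Lemma Rintegral_rV_subr (x : E) f : measurable_fun setT f ->
  (\int[mu]_y f (y - x))%R = (\int[mu]_y f y)%R.
Proof.
move=> mf; have := @Rintegral_rV_affine 1 (- x) f _ mf.
rewrite oner_eq0 normr1 expr1n invr1 mul1r => /(_ isT) <-.
by apply: eq_Rintegral => y _; rewrite scale1r.
Qed.

Lemma sqn_subl (x : E) f : measurable_fun setT f ->
  sqn mu (fun y => f (x - y)) = sqn mu f.
Proof.
move=> mf; rewrite /sqn (ge0_integral_rV_subl x (f := fun y => (f y ^+ 2)%:E))//.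
- exact: measurable_sqr.
- by move=> y; rewrite lee_fin sqr_ge0.
Qed.

Lemma measurable_subl (x : E) f : measurable_fun setT f ->
  measurable_fun setT (fun y : E => f (x - y)).
Proof. by move=> mf; exact: measurableT_comp mf (measurable_rV_subl x). Qed.

Lemma L2r_subl (x : E) f : L2r mu f -> L2r mu (fun y => f (x - y)).
Proof.
by move=> [mf f2]; split; [exact: measurable_subl|rewrite sqn_subl].
Qed.

Definition cv f g : E -> R := fun x => (\int[mu]_y (f (x - y) * g y))%R.

Lemma measurable_cv_kernel f g : measurable_fun setT f -> measurable_fun setT g ->
  measurable_fun setT (fun z : E * E => f (z.1 - z.2) * g z.2).
Proof.
move=> mf mg; apply: measurable_funM.
  exact: measurableT_comp mf measurable_rV_sub.
exact: measurableT_comp mg measurable_snd.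
Qed.

Lemma measurable_cv f g : measurable_fun setT f -> measurable_fun setT g ->
  measurable_fun setT (cv f g).
Proof.
move=> mf mg.
exact: (measurable_Rintegral_fst mu (measurable_cv_kernel mf mg)).
Qed.

Lemma cvC f g : measurable_fun setT f -> measurable_fun setT g -> cv f g = cv g f.
Proof.
move=> mf mg; apply/funext => x; rewrite /cv.
rewrite -(@Rintegral_rV_subl x).
  by apply: eq_Rintegral => y _; rewrite subKr mulrC.
by apply: measurable_funM => //; exact: measurable_subl.
Qed.

(** The uniform bound on |g| * |h| is what Fubini needs against an integrable [f]. It covers two
    situations: [g] and [h] both in L^2 ([cv_holder]), and [g] integrable with [h] bounded
    ([cvA_bdd]). *)
Lemma cvA f g h (M : R) : measurable_fun setT g -> measurable_fun setT h ->
  mu.-integrable setT (EFin \o f) ->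
  (forall x, (\int[mu]_y (`|g (x - y) * h y|)%:E <= M%:E)%E) ->
  cv (cv f g) h = cv f (cv g h).
Proof.
move=> mg mh intf ghM; apply/funext => x.
have mf : measurable_fun setT f by apply/measurable_EFinP; exact: measurable_int intf.
pose H (z : E * E) := f (x - z.1) * (g (z.1 - z.2) * h z.2).
have mH : measurable_fun setT H.
  apply: measurable_funM; last exact: measurable_cv_kernel.
  exact: measurableT_comp (measurable_subl x mf) measurable_fst.
have M0 : 0 <= M.
  by rewrite -lee_fin; apply: le_trans (ghM 0); apply: integral_ge0.
have Hlt : (\int[mu]_y \int[mu]_z (`|H (y, z)|)%:E < +oo)%E.
  apply: (@le_lt_trans _ _ (\int[mu]_y (M * `|f (x - y)|)%:E)%E).
    apply: ge0_le_integral => //.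
    - by move=> y _; exact: integral_ge0.
    - apply: (measurable_fun_fubini_tonelli_F (fun z => (`|H z|)%:E)) => //.
      by apply/measurable_EFinP; exact: measurableT_comp.
    - apply/measurable_EFinP; apply: measurable_funM => //.
      by apply: measurableT_comp => //; exact: measurable_subl.
    - move=> y _; rewrite /H/=.
      under eq_integral do rewrite normrM EFinM.
      rewrite ge0_integralZl_EFin//; last first.
        apply/measurable_EFinP; apply: measurableT_comp => //.
        by apply: measurable_funM => //; exact: measurable_subl.
      by rewrite mulrC EFinM; apply: lee_wpmul2l.
  under eq_integral do rewrite EFinM.
  rewrite ge0_integralZl_EFin//; last first.
    by apply/measurable_EFinP; apply: measurableT_comp => //; exact: measurable_subl.
  rewrite (ge0_integral_rV_subl x (f := fun y => (`|f y|)%:E))//; last first.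
    by apply/measurable_EFinP; exact: measurableT_comp.
  by rewrite lte_mul_pinfty//; case/integrableP : intf.
rewrite [RHS](_ : _ = (\int[mu]_y \int[mu]_z H (y, z))%R); last first.
  apply: eq_Rintegral => y _; rewrite /H/= Rintegral_measurableZl//.
  by apply: measurable_funM => //; exact: measurable_subl.
rewrite (Rintegral_fubini mH Hlt); apply: eq_Rintegral => z _.
rewrite /H/= mulrC -Rintegral_measurableZl; last first.
  by apply: measurable_funM => //; exact: measurable_subl.
rewrite -[LHS](@Rintegral_rV_subr z); last first.
  by do 2! apply: measurable_funM => //; exact: measurable_subl.
by apply: eq_Rintegral => y _; rewrite opprB addrA subrK mulrC mulrA.
Qed.

End convolution.

Section L2_dominated.
Context d (T : measurableType d) (R : realType) (m : {measure set T -> \bar R}).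
Implicit Types f g : T -> R.

Lemma integrable_sqr g : L2r m g -> m.-integrable setT (EFin \o (fun x => g x ^+ 2)).
Proof.
move=> [mg g2]; apply/integrable_ltyP; first exact: measurable_funX.
suff -> : (\int[m]_x (`|g x ^+ 2|)%:E)%E = sqn m g by [].
by apply: eq_integral => x _; rewrite ger0_norm// sqr_ge0.
Qed.

Lemma cvgL2_dominated (f_ : nat -> T -> R) f g :
  (forall n, measurable_fun setT (f_ n)) -> measurable_fun setT f ->
  {ae m, forall x, f_ n x @[n --> \oo] --> f x} -> L2r m g ->
  {ae m, forall x, forall n, `|f_ n x| <= g x} -> cvgL2 m f_ f.
Proof.
move=> mf_ mf f_f hg fg e e0.
have ig : m.-integrable setT (EFin \o (fun x => 4 * g x ^+ 2)).
  exact: integrableZl (integrable_sqr hg).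
have mD n : measurable_fun setT (fun x => (f_ n x - f x) ^+ 2).
  by apply: measurable_funX; exact: measurable_funB.
have lf : {ae m, forall x, `|f x| <= g x}.
  apply: filterS2 fg f_f => x gx fx.
  have cn : `|f_ n x| @[n --> \oo] --> `|f x| by exact: cvg_norm.
  have /cvg_lim <- // := cn; apply: limr_le; last exact: nearW.
  by apply/cvg_ex; exists `|f x|.
have bD : {ae m, forall x, forall n, `|(f_ n x - f x) ^+ 2| <= 4 * g x ^+ 2}.
  apply: filterS2 fg lf => x gx lfx n.
  have -> : 4 * g x ^+ 2 = (g x + g x) ^+ 2 by ring.
  rewrite normrX lerXn2r// ?nnegrE ?addr_ge0// ?(le_trans _ lfx)//.
  by rewrite (le_trans (ler_normB _ _))// lerD.
have cD : {ae m, forall x, (f_ n x - f x) ^+ 2 @[n --> \oo] --> (0 : R)}.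
  apply: filterS f_f => x fx.
  have h : f_ n x - f x @[n --> \oo] --> f x - f x by apply: cvgB => //; exact: cvg_cst.
  rewrite subrr in h; rewrite -(mulr0 0).
  by under eq_cvg do rewrite expr2; exact: cvgM.
have hfn n : L2r m (f_ n).
  apply: L2r_le hg _ => //; apply: filterS fg => x gx.
  by rewrite (le_trans (gx n))// ler_norm.
have hf : L2r m f.
  by apply: L2r_le hg _ => //; apply: filterS lf => x gx; rewrite (le_trans gx)// ler_norm.
have := cvg_Rintegral mD (measurable_cst _) cD ig bD.
rewrite [X in _ --> X](_ : _ = 0); last by rewrite /Rintegral integral0.
move=> /cvgr0Pnorm_le/(_ e e0); apply: filterS => n /=.
have hD := L2rB (hfn n) hf.
rewrite -(fineK (L2r_fin_num hD)) lee_fin.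
by apply: le_trans; exact: ler_norm.
Qed.

End L2_dominated.

Section young.
Context {R : realType} {d : nat}.
Local Notation E := 'rV[R]_d.
Local Notation mu := (@lebesgue_rV R d).
Implicit Types f g h : E -> R.

Lemma sqr_Rintegral_le d' (T : measurableType d') (m : {measure set T -> \bar R})
    (f : T -> R) : measurable_fun setT f ->
  ((((\int[m]_x f x)%R) ^+ 2)%:E <= (\int[m]_x (`|f x|)%:E) ^+ 2)%E.
Proof.
move=> mf; have := @le_normr_Rintegral_fin _ _ _ m f.
set a := (\int[m]_x _)%E; have a0 : (0 <= a)%E by exact: integral_ge0.
case: a a0 => [r| |] // r0 h; last by rewrite expe2 mulyy leey.
move: h => /(_ r mf (lexx _)) h.
by rewrite -EFin_expe lee_fin -[leLHS]real_normK ?num_real// lerXn2r// nnegrE (le_trans _ h).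
Qed.

(** Cauchy-Schwarz for the splitting |f g| = |f|^(1/2) (|f|^(1/2) |g|) bounds the square at x by M
    times the integral of |f(x - y)| g(y)^2; Tonelli in x produces the second factor M. *)
Lemma sqn_cv_le f g (M : R) : mu.-integrable setT (EFin \o f) ->
  (\int[mu]_x (`|f x|)%:E <= M%:E)%E -> L2r mu g ->
  (sqn mu (cv f g) <= (M ^+ 2)%:E * sqn mu g)%E.
Proof.
move=> intf fM hg; have mg := hg.1.
have mf : measurable_fun setT f by apply/measurable_EFinP; exact: measurable_int intf.
have M0 : 0 <= M by rewrite -lee_fin (le_trans _ fM)// integral_ge0.
have mnf : measurable_fun setT (fun x => (`|f x|)%:E).
  by apply/measurable_EFinP; exact: measurableT_comp.
have mK : measurable_fun setT (fun z : E * E => (`|f (z.1 - z.2)| * g z.2 ^+ 2)%:E).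
  apply/measurable_EFinP; apply: measurable_funM.
    by apply: measurableT_comp => //; exact: measurableT_comp mf measurable_rV_sub.
  by apply: measurable_funX; exact: measurableT_comp mg measurable_snd.
have K0 z : (0 <= (`|f (z.1 - z.2)| * g z.2 ^+ 2)%:E)%E.
  by rewrite lee_fin mulr_ge0// sqr_ge0.
have pt x : ((cv f g x ^+ 2)%:E <= M%:E * \int[mu]_y (`|f (x - y)| * g y ^+ 2)%:E)%E.
  have mfx := measurable_subl x mf.
  have ms : measurable_fun setT (fun y : E => Num.sqrt `|f (x - y)|).
    apply: measurableT_comp; last exact: measurableT_comp mfx.
    by apply: continuous_measurable_fun; exact: sqrt_continuous.
  have ms2 : measurable_fun setT (fun y : E => Num.sqrt `|f (x - y)| * g y).
    exact: measurable_funM.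
  apply: le_trans (sqr_Rintegral_le mu (measurable_funM mfx mg)) _.
  have -> : (\int[mu]_y (`|f (x - y) * g y|)%:E = \int[mu]_y
      (`|Num.sqrt `|f (x - y)| * (Num.sqrt `|f (x - y)| * g y)|)%:E)%E.
    apply: eq_integral => y _; rewrite mulrA -expr2 sqr_sqrtr//.
    by rewrite !normrM normr_id.
  apply: le_trans (cauchy_schwarz mu ms ms2) _.
  have -> : sqn mu (fun y : E => Num.sqrt `|f (x - y)|) = (\int[mu]_y (`|f y|)%:E)%E.
    rewrite -(ge0_integral_rV_subl x mnf)//.
    by apply: eq_integral => y _; rewrite sqr_sqrtr.
  have -> : sqn mu (fun y : E => Num.sqrt `|f (x - y)| * g y) =
      (\int[mu]_y (`|f (x - y)| * g y ^+ 2)%:E)%E.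
    by apply: eq_integral => y _; rewrite exprMn sqr_sqrtr.
  apply: lee_wpmul2r => //; apply: integral_ge0 => y _; exact: K0 (x, y).
rewrite /sqn; apply: le_trans (ge0_le_integral _ _ _ _ _ (fun x _ => pt x)) _ => //.
- by move=> x _; rewrite lee_fin sqr_ge0.
- by apply: measurable_sqr; exact: measurable_cv.
- apply: measurable_funeM; exact: (measurable_fun_fubini_tonelli_F (fun z : E * E => (`|f (z.1 - z.2)| * g z.2 ^+ 2)%:E)).
rewrite ge0_integralZl_EFin//; last 2 first.
- by move=> x _; apply: integral_ge0 => y _; exact: K0 (x, y).
- exact: (measurable_fun_fubini_tonelli_F (fun z : E * E => (`|f (z.1 - z.2)| * g z.2 ^+ 2)%:E)).
rewrite (fubini_tonelli (fun z : E * E => (`|f (z.1 - z.2)| * g z.2 ^+ 2)%:E))//=.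
rewrite expr2 EFinM -muleA; apply: lee_wpmul2l; first by rewrite lee_fin.
rewrite -ge0_integralZl_EFin//; last 2 first.
- by move=> x _; rewrite lee_fin sqr_ge0.
- exact: measurable_sqr.
apply: ge0_le_integral => //.
- by move=> y _; apply: integral_ge0 => x _; exact: K0 (x, y).
- exact: (measurable_fun_fubini_tonelli_G (fun z : E * E => (`|f (z.1 - z.2)| * g z.2 ^+ 2)%:E)).
- by apply: measurable_funeM; exact: measurable_sqr.
move=> y _; under eq_integral do rewrite mulrC EFinM.
rewrite ge0_integralZl_EFin ?sqr_ge0//; last first.
  by apply: measurableT_comp mnf _ => //; exact: measurable_rV_subr.
rewrite (ge0_integral_rV_subr y (f := fun x => (`|f x|)%:E))// muleC.
by apply: lee_wpmul2r => //; rewrite lee_fin sqr_ge0.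
Qed.

Lemma L2r_cv f g : mu.-integrable setT (EFin \o f) -> L2r mu g -> L2r mu (cv f g).
Proof.
move=> intf hg; split.
  apply: measurable_cv hg.1; apply/measurable_EFinP; exact: measurable_int intf.
have fi : (\int[mu]_x (`|f x|)%:E)%E \is a fin_num.
  by rewrite ge0_fin_numE ?integral_ge0//; case/integrableP : intf.
apply: le_lt_trans (sqn_cv_le intf _ hg) _; first by rewrite -(fineK fi).
by rewrite lte_mul_pinfty ?lee_fin ?sqr_ge0//; case: hg.
Qed.
End young.

(** * Open boxes and an induction principle for L^2 *)

Section boxes.
Context {R : realType} {d : nat}.
Local Notation E := 'rV[R]_d.
Local Notation mu := (@lebesgue_rV R d).

Definition obox (l u : 'I_d -> R) : set E := [set x | forall i, l i < x 0 i < u i].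

Lemma oboxE l u : obox l u =
  [set x | forall i, `]l i, u i[%classic (x 0 i : measurableTypeR R)].
Proof. by apply/seteqP; split => x h i; have := h i; rewrite /= in_itv. Qed.

Lemma measurable_coord_forall (A : 'I_d -> set (measurableTypeR R)) :
  (forall i, measurable (A i)) -> measurable [set x : E | forall i, A i (x 0 i)].
Proof.
move=> mA; rewrite [X in measurable X](_ : _ =
    \big[setI/setT]_(i < d) [set x : E | A i (x 0 i)]).
  apply: bigsetI_measurable => i _.
  by rewrite -[X in measurable X]setTI; exact: measurable_coord.
apply/seteqP; split => x /=.
  by move=> h; elim/big_ind : _ => //= i _; exact: h.
by move=> h i; move: h; rewrite (bigD1 i)//= => -[].
Qed.

Lemma measurable_obox l u : measurable (obox l u).
Proof.
rewrite oboxE; apply: (@measurable_coord_forall (fun i => `]l i, u i[%classic)) => i.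
exact: measurable_itv.
Qed.

Lemma obox_lty l u : (mu (obox l u) < +oo)%E.
Proof.
rewrite oboxE (@lebesgue_rV_box _ _ (fun i => `]l i, u i[%classic)); last first.
  by move=> i; exact: measurable_itv.
suff : (\prod_(i < d) lebesgue_measure `]l i, u i[%classic)%E \is a fin_num.
  by rewrite ge0_fin_numE// prode_ge0.
apply: prode_fin_num => i _; rewrite lebesgue_measure_itv/=.
by case: ifP.
Qed.

Lemma oboxI l u l' u' : obox l u `&` obox l' u' =
  obox (fun i => Num.max (l i) (l' i)) (fun i => Num.min (u i) (u' i)).
Proof.
apply/seteqP; split => x /=.
  move=> [h1 h2] i; have /andP[a b] := h1 i; have /andP[a' b'] := h2 i.
  by rewrite gt_max lt_min a a' b b'.
by move=> h; split=> i; have := h i; rewrite gt_max lt_min => /andP[/andP[a b] /andP[c e]]; apply/andP.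
Qed.

Definition cube (n : nat) : set E := obox (fun=> - n%:R) (fun=> n%:R).

Lemma cube_bigcup : \bigcup_n cube n = setT.
Proof.
apply/seteqP; split => // x _.
pose M := \sum_i `|x 0 i|.
exists (Num.bound M) => //= i; rewrite -ltr_norml.
apply: le_lt_trans (archi_boundP _); last by apply: sumr_ge0 => *.
by rewrite /M (bigD1 i)//= lerDl sumr_ge0.
Qed.

Lemma cube_nd (m n : nat) : (m <= n)%N -> cube m `<=` cube n.
Proof.
move=> mn x h i; have := h i; rewrite -!ltr_norml => /lt_le_trans; apply.
by rewrite ler_nat.
Qed.

Lemma measurable_obox_generated (A : set E) : measurable A ->
  <<s [set B | exists l u, B = obox l u] >> A.
Proof.
set G := [set B | _].
suff : \big[setU/set0]_(i < d) preimage_set_system setT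
     (fun x : E => x 0 i : measurableTypeR R) measurable `<=` <<s G >>.
  by move=> h; apply: smallest_sub => //; exact: smallest_sigma_algebra.
elim/big_ind : _ => //.
  by move=> A1 A2 h1 h2 B [/h1|/h2].
move=> i _ B [C mC <-]; rewrite setTI.
have : [set C | <<s G >> ((fun x : E => x 0 i) @^-1` C)] C; last by [].
move: C mC; rewrite -/(_ `<=` _).
have -> : (@measurable _ (measurableTypeR R)) = (RGenOpens.G (R := R)).-sigma.-measurable.
  exact: RGenOpens.measurableE.
apply: smallest_sub.
  split => /=.
  - by rewrite preimage_set0; exact: sigma_algebra0.
  - by move=> C h; rewrite setTD preimage_setC; exact: sigma_algebraC.
  - by move=> F h; rewrite preimage_bigcup; exact: sigma_algebra_bigcup.
move=> _ [a [b ->]] /=.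
(* The preimage of an interval under one coordinate is an unbounded slab, exhausted by boxes whose
   other sides are ]-n, n[. *)
rewrite (_ : _ @^-1` _ = \bigcup_n obox (fun k => if k == i then a else - n%:R)
   (fun k => if k == i then b else n%:R)).
  by apply: sigma_algebra_bigcup => n; apply: sub_sigma_algebra; eexists; eexists; reflexivity.
apply/seteqP; split => x /=.
  rewrite in_itv/= => xi; have : (\bigcup_n cube n) x by rewrite cube_bigcup.
  by move=> [n _ h]; exists n => // k; case: eqP => [->//|_]; exact: h.
by move=> [n _ /(_ i)]; rewrite eqxx in_itv.
Qed.

End boxes.

Section density.
Context {R : realType} {d : nat}.
Local Notation E := 'rV[R]_d.
Local Notation mu := (@lebesgue_rV R d).
Implicit Types f g h : E -> R.
Variable P : (E -> R) -> Prop.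
Hypothesis P0 : P (fun=> 0).
Hypothesis PZD : forall a f g, L2r mu f -> L2r mu g -> P f -> P g ->
  P (fun x => a * f x + g x).
Hypothesis Plim : forall (f_ : nat -> E -> R) f, (forall n, L2r mu (f_ n)) ->
  (forall n, P (f_ n)) -> L2r mu f -> cvgL2 mu f_ f -> P f.
Hypothesis Pbox : forall l u, P (\1_(obox l u)).

Lemma L2r_indic (A : set E) : measurable A -> (mu A < +oo)%E -> L2r mu (\1_A : E -> R).
Proof.
move=> mA Alt; split; first exact: measurable_indic.
rewrite (_ : sqn _ _ = mu A)// /sqn -[A in RHS]setIT -integral_indic//.
by apply: eq_integral => x _; rewrite indicE -natrX; case: (_ \in _).
Qed.

Let cubeI_lty (A : set E) n : measurable A -> (mu (A `&` cube n) < +oo)%E.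
Proof.
move=> mA; apply: le_lt_trans (obox_lty (fun=> - n%:R) (fun=> n%:R)).
apply: le_measure; rewrite ?inE//; [|exact: measurable_obox].
by apply: measurableI => //; exact: measurable_obox.
Qed.

Let L2r_cubeI (A : set E) n : measurable A -> L2r mu (\1_(A `&` cube n) : E -> R).
Proof.
move=> mA; apply: L2r_indic; last exact: cubeI_lty.
by apply: measurableI => //; exact: measurable_obox.
Qed.

(** Boxes are stable under intersection and generate the measurable sets, so the lambda-system lemma
    applies. Intersecting with a cube keeps every indicator in L^2, where the closure properties of
    [P] are available. *)
Let P_cubeI (A : set E) n : measurable A -> P (\1_(A `&` cube n)).
Proof.
move=> mA.
pose G := [set B : set E | exists l u, B = obox l u].
pose H := [set B : set E | measurable B /\ P (\1_(B `&` cube n))].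
suff [] : H A by [].
apply: (@lambda_system_subset _ G _ setT H) => //; last exact: measurable_obox_generated.
- by move=> _ _ [l [u ->]] [l' [u' ->]]; rewrite oboxI; eexists; eexists; reflexivity.
- split => //.
  + by split => //; rewrite setTI; exact: Pbox.
  + move=> B C CB [mB PB] [mC PC]; split; first exact: measurableD.
    rewrite (_ : \1_ _ = fun x => -1 * \1_(C `&` cube n) x + \1_(B `&` cube n) x).
      by apply: PZD => //; exact: L2r_cubeI.
    apply/funext => x; rewrite !indicE in_setI in_setD !in_setI.
    case: (boolP (x \in C)) => xC; case: (boolP (x \in B)) => xB; case: (x \in _);
      rewrite /= ?mulN1r ?mulr0 ?oppr0 ?addr0 ?add0r ?addNr//.
    by have /mem_set := CB _ (set_mem xC); rewrite (negbTE xB).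
  + move=> F ndF HF; have mF i : measurable (F i) by case: (HF i).
    split; first exact: bigcup_measurable.
    have mUF : measurable (\bigcup_i F i) by exact: bigcup_measurable.
    apply: (Plim (f_ := fun k => \1_(F k `&` cube n))).
    * by move=> k; exact: L2r_cubeI.
    * by move=> k; case: (HF k).
    * exact: L2r_cubeI.
    * apply: (cvgL2_dominated (g := \1_(cube n) : E -> R)).
      - by move=> k; case: (L2r_cubeI n (mF k)).
      - by case: (L2r_cubeI n mUF).
      - apply: aeW => x; apply: (cvg_near_cst _).
        have [[k _ Fk]|nF] := pselect ((\bigcup_i F i) x).
          near=> j; rewrite !indicE !in_setI; congr (_ && _)%:R.
          have kj : (k <= j)%N by near: j; exact: nbhs_infty_ge.
          rewrite !mem_set//; first by exists k.
          by move: Fk; exact: (subsetPset _ _ (ndF _ _ kj)).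
        near=> j; rewrite !indicE !in_setI; congr (_ && _)%:R.
        by rewrite !memNset// => Fj; apply: nF; exists j.
      - by apply: L2r_indic; [exact: measurable_obox|exact: obox_lty].
      - apply: aeW => x k; rewrite !indicE in_setI.
        by case: (_ \in F k); case: (_ \in cube n); rewrite /= ?normr0 ?normr1.
- by move=> _ [l [u ->]]; split; [exact: measurable_obox|rewrite oboxI; exact: Pbox].
Unshelve. all: end_near. Qed.

Let P_indic (A : set E) : measurable A -> (mu A < +oo)%E -> P (\1_A).
Proof.
move=> mA Alt; have hA := L2r_indic mA Alt.
apply: (Plim (f_ := fun n => \1_(A `&` cube n))) => //.
- by move=> n; exact: L2r_cubeI.
- by move=> n; exact: P_cubeI.
apply: (cvgL2_dominated (g := \1_A : E -> R)) => //.
- by move=> n; case: (L2r_cubeI n mA).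
- apply: aeW => x; apply: (cvg_near_cst _).
  have [k _ Fk] : (\bigcup_n cube n) x by rewrite cube_bigcup.
  near=> j; rewrite !indicE in_setI [x \in cube j]mem_set ?andbT//.
  apply: cube_nd Fk; near: j; exact: nbhs_infty_ge.
- apply: aeW => x k; rewrite !indicE in_setI.
  by case: (_ \in A); case: (_ \in cube k); rewrite /= ?normr0 ?normr1.
Unshelve. all: end_near. Qed.

Import HBNNSimple.

Let P_nnsfun (f : {nnsfun E >-> R}) : L2r mu f -> P f.
Proof.
move=> hf.
have -> : (f : E -> R) = fun x => \sum_(y \in range f) (y * \1_(f @^-1` [set y]) x).
  by apply/funext => x; rewrite -fimfunE.
have mfy y : measurable (f @^-1` [set y]) by exact: measurable_funPTI.
(* Chebyshev's inequality: y^2 times the measure of the level set at y is at most the squared norm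
   of [f]. *)
have hy y : y != 0 -> (mu (f @^-1` [set y]) < +oo)%E.
  move=> y0; have y20 : 0 < y ^+ 2 by rewrite exprn_even_gt0.
  rewrite -(@lte_pmul2l _ (y ^+ 2)%:E)// mulry gtr0_sg// mul1e.
  apply: le_lt_trans hf.2; rewrite -[X in mu X]setIT -integral_indic//.
  rewrite -ge0_integralZl_EFin ?(ltW y20)//; last first.
    by apply/measurable_EFinP; exact: measurable_indic.
  apply: ge0_le_integral => //.
  - by move=> x _; rewrite mule_ge0 ?lee_fin ?sqr_ge0.
  - apply: measurable_funeM; apply/measurable_EFinP; exact: measurable_indic.
  - by apply: measurable_sqr; case: hf.
  - move=> x _; rewrite -EFinM lee_fin indicE.
    have [|_] := boolP (x \in _); last by rewrite mulr0 sqr_ge0.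
    by rewrite inE /= => ->; rewrite mulr1.
have -> : (fun x => \sum_(y \in range f) (y * \1_(f @^-1` [set y]) x)) =
    (fun x => \sum_(y <- finmap.enum_fset (fset_set (range f))) (y * \1_(f @^-1` [set y]) x)).
  by apply/funext => x; rewrite fsbig_finite//=; exact: fimfunP.
suff [] : L2r mu (fun x => \sum_(y <- finmap.enum_fset (fset_set (range f))) (y * \1_(f @^-1` [set y]) x)) /\
  P (fun x => \sum_(y <- finmap.enum_fset (fset_set (range f))) (y * \1_(f @^-1` [set y]) x)) by [].
elim: (finmap.enum_fset _) => [|y s [IH1 IH2]].
  by under eq_fun do rewrite big_nil; split => //; exact: L2r0.
under eq_fun do rewrite big_cons.
have [->|y0] := eqVneq y 0.
  by under eq_fun do rewrite mul0r add0r; split.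
have hi := L2r_indic (mfy y) (hy y y0).
split; first by apply: L2rD => //; exact: L2rZ.
apply: PZD => //; exact: P_indic (mfy y) (hy y y0).
Qed.

Let P_ge0 f : L2r mu f -> (forall x, 0 <= f x) -> P f.
Proof.
move=> hf f0; have [mf _] := hf.
have mf' : measurable_fun setT (EFin \o f) by exact/measurable_EFinP.
pose g := nnsfun_approx measurableT mf'.
have cg x : g n x @[n --> \oo] --> f x.
  have : (g n x)%:E @[n --> \oo] --> (f x)%:E.
    by apply: (@cvg_nnsfun_approx _ _ _ _ measurableT _ mf') => // y _; rewrite lee_fin.
  by move=> /fine_cvg.
have gf x n : g n x <= f x.
  have /cvg_lim <- // := cg x.
  apply: (@nondecreasing_cvgn_le _ (fun n => g n x)); last by apply/cvg_ex; exists (f x); exact: cg.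
  move=> i j ij; exact/lefP/nd_nnsfun_approx.
have hg n : L2r mu (g n).
  apply: L2r_le hf _ => //; apply: aeW => x.
  by rewrite !ger0_norm.
apply: (Plim (f_ := g)) => //; first by move=> n; exact: P_nnsfun.
apply: (cvgL2_dominated (g := f)) => //.
- by apply: aeW => x; exact: cg.
- by apply: aeW => x n; rewrite ger0_norm.
Qed.

(** A property stable under linear combinations and L^2 limits has to be checked on open boxes only.
    It serves twice: for the approximate identity [approx_id] and for the density of Schwartz
    functions. *)
Theorem L2_induction f : L2r mu f -> P f.
Proof.
move=> hf.
have hp : L2r mu (fun x => Num.max (f x) 0).
  apply: (L2r_le _ hf); first by apply: measurable_maxr => //; exact: hf.1.
  by apply: aeW => x; case: (leP 0 (f x)) => h; rewrite ?normr0.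
have hn : L2r mu (fun x => Num.max (- f x) 0).
  apply: (L2r_le _ hf).
    by apply: measurable_maxr => //; apply: measurable_funN; exact: hf.1.
  by apply: aeW => x; case: (leP 0 (- f x)) => h; rewrite ?normr0// normrN.
rewrite (_ : f = fun x => -1 * Num.max (- f x) 0 + Num.max (f x) 0).
  by apply: PZD => //; apply: P_ge0 => // x; rewrite le_max lexx orbT.
apply/funext => x; rewrite mulN1r.
by case: (leP 0 (f x)) => h; case: (leP 0 (- f x)) => h'; lra.
Qed.

End density.

Lemma integrable_realZl d (T : measurableType d) (R : realType)
    (m : {measure set T -> \bar R}) (f : T -> R) (c : R) :
  m.-integrable setT (EFin \o f) ->
  m.-integrable setT (EFin \o (fun x => c * f x)).
Proof. by move=> intf; exact: (integrableZl measurableT c intf). Qed.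

Lemma integrable_realD d (T : measurableType d) (R : realType)
    (m : {measure set T -> \bar R}) (f g : T -> R) :
  m.-integrable setT (EFin \o f) -> m.-integrable setT (EFin \o g) ->
  m.-integrable setT (EFin \o (fun x => f x + g x)).
Proof. by move=> intf intg; exact: (integrableD measurableT intf intg). Qed.

Lemma integrable_realB d (T : measurableType d) (R : realType)
    (m : {measure set T -> \bar R}) (f g : T -> R) :
  m.-integrable setT (EFin \o f) -> m.-integrable setT (EFin \o g) ->
  m.-integrable setT (EFin \o (fun x => f x - g x)).
Proof. by move=> intf intg; exact: (integrableB measurableT intf intg). Qed.

(** * Gaussians, their derivatives and their moments *)

Section gaussians.
Context {R : realType} {d : nat}.
Local Notation E := 'rV[R]_d.
Local Notation mu := (@lebesgue_rV R d).
Implicit Types (x y z : E) (a b : R).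

Definition nsq x : R := \sum_i x 0 i ^+ 2.

Lemma nsq_ge0 x : 0 <= nsq x.
Proof. by apply: sumr_ge0 => i _; exact: sqr_ge0. Qed.

Lemma nsqZ a x : nsq (a *: x) = a ^+ 2 * nsq x.
Proof. by rewrite /nsq mulr_sumr; apply: eq_bigr => i _; rewrite mxE exprMn. Qed.

Lemma nsqN x : nsq (- x) = nsq x.
Proof. by rewrite -scaleN1r nsqZ sqrrN expr1n mul1r. Qed.

Lemma coord_sqr_le x i : x 0 i ^+ 2 <= nsq x.
Proof. by rewrite /nsq (bigD1 i)//= lerDl sumr_ge0// => k _; exact: sqr_ge0. Qed.

Lemma measurable_nsq : measurable_fun setT nsq.
Proof.
rewrite /nsq; elim: (index_enum _) => [|i r IHr].
  rewrite (_ : (fun _ => _) = cst 0); first exact: measurable_cst.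
  by apply/funext => x; rewrite big_nil.
under eq_fun do rewrite big_cons.
by apply: measurable_funD => //; apply: measurable_funX; exact: measurable_coord.
Qed.

(** With exponent - |x|^2 / a^2 the squared widths add under convolution ([cv_gs]), and each
    coordinate has variance a^2 / 2. *)
Definition gs a x : R := (a * Num.sqrt pi) ^- d * expR (- (nsq x / a ^+ 2)).

Lemma measurable_gs a : measurable_fun setT (gs a).
Proof.
apply: measurable_funM => //; apply: measurableT_comp => //.
by apply: measurable_funN; apply: measurable_funM => //; exact: measurable_nsq.
Qed.

Lemma sqrtpi_gt0 : 0 < Num.sqrt pi :> R.
Proof. by rewrite sqrtr_gt0 pi_gt0. Qed.

Lemma gs_norm_gt0 a : 0 < a -> 0 < (a * Num.sqrt pi) ^- d.
Proof. by move=> a0; rewrite invr_gt0 exprn_gt0// mulr_gt0// sqrtpi_gt0. Qed.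

Lemma gs_gt0 a x : 0 < a -> 0 < gs a x.
Proof. by move=> a0; rewrite mulr_gt0 ?gs_norm_gt0// expR_gt0. Qed.

Lemma gs_ge0 a x : 0 < a -> 0 <= gs a x.
Proof. by move=> a0; rewrite ltW// gs_gt0. Qed.

Lemma gs_le a x : 0 < a -> gs a x <= (a * Num.sqrt pi) ^- d.
Proof.
move=> a0; rewrite ler_piMr ?(ltW (gs_norm_gt0 a0))// -expR0 ler_expR oppr_le0.
by rewrite divr_ge0 ?nsq_ge0// exprn_ge0// ltW.
Qed.

Lemma gsN a x : gs a (- x) = gs a x.
Proof. by rewrite /gs nsqN. Qed.

Lemma gs_scale a x : 0 < a -> gs a x = a ^- d * gs 1 (a^-1 *: x).
Proof.
move=> a0; rewrite /gs nsqZ mul1r expr1n divr1 [in LHS]exprMn invfM -mulrA.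
by rewrite exprVn [a ^- 2 * _]mulrC.
Qed.

Lemma integral_gs a : 0 < a -> (\int[mu]_x (gs a x)%:E = 1)%E.
Proof.
have h1 : (\int[mu]_x (gs 1 x)%:E = 1)%E.
  rewrite /gs; under eq_integral do rewrite EFinM.
  rewrite ge0_integralZl_EFin ?invr_ge0 ?exprn_ge0 ?mulr_ge0 ?sqrtr_ge0//; last first.
    apply/measurable_EFinP; apply: measurableT_comp => //.
    by apply: measurable_funN; apply: measurable_funM => //; exact: measurable_nsq.
  have -> : (\int[mu]_x (expR (- (nsq x / 1 ^+ 2)))%:E)%E =
      (\int[mu]_x \prod_(i < d) (gauss_fun (x 0%R i))%:E)%E.
    apply: eq_integral => x _; rewrite prodEFin expr1n divr1 /nsq -sumrN.
    by rewrite expR_sum.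
  rewrite (@ge0_integral_prod _ _ (fun _ t => (gauss_fun t)%:E)); last 2 first.
  - by move=> _; apply/measurable_EFinP; exact: measurable_gauss_fun.
  - by move=> _ t; rewrite lee_fin gauss_fun_ge0.
  under eq_bigr do rewrite integralT_gauss.
  rewrite prodEFin -EFinM mul1r prodr_const card_ord mulVf//.
  by rewrite expf_neq0// gt_eqF// sqrtpi_gt0.
move=> a0; rewrite -h1.
under eq_integral do rewrite (gs_scale _ a0) EFinM.
rewrite ge0_integralZl_EFin ?invr_ge0 ?exprn_ge0 ?(ltW a0)//; last 2 first.
- by move=> x _; rewrite lee_fin gs_ge0.
- apply/measurable_EFinP; apply: measurableT_comp (measurable_gs 1) _.
  have := measurable_rV_affine a^-1 (0 : E).
  by under [X in measurable_fun _ X -> _]eq_fun do rewrite addr0.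
under [in LHS]eq_integral do rewrite -[_ *: _]addr0.
rewrite (@ge0_integral_rV_affine R d a^-1 0 (fun x => (gs 1 x)%:E)); last 3 first.
- by rewrite invr_eq0 gt_eqF.
- by apply/measurable_EFinP; exact: measurable_gs.
- by move=> x; rewrite lee_fin gs_ge0.
rewrite h1 mule1 gtr0_norm ?invr_gt0// -EFinM exprVn invrK mulVf//.
by rewrite expf_neq0// gt_eqF.
Qed.

Lemma integrable_gs a : 0 < a -> mu.-integrable setT (EFin \o gs a).
Proof.
move=> a0; apply/integrable_ltyP; first exact: measurable_gs.
under eq_integral do rewrite ger0_norm ?gs_ge0//.
by rewrite integral_gs// ltry.
Qed.

Lemma Rintegral_gs a : 0 < a -> (\int[mu]_x gs a x)%R = 1.
Proof. by move=> a0; rewrite /Rintegral integral_gs. Qed.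

(** Completing the square in z: the second factor on the right is a normalised Gaussian in z centred
    at (b^2 / c^2) x, so integrating in z leaves [gs c x], and moments in z are moments about that
    centre. *)
Lemma gsM a b x z : 0 < a -> 0 < b -> let c := Num.sqrt (a ^+ 2 + b ^+ 2) in
  gs a (x - z) * gs b z = gs c x * gs (a * b / c) (z - (b ^+ 2 / c ^+ 2) *: x).
Proof.
move=> a0 b0 c.
have c20 : 0 < a ^+ 2 + b ^+ 2 by rewrite addr_gt0// exprn_gt0.
have c0 : 0 < c by rewrite sqrtr_gt0.
have cE : c ^+ 2 = a ^+ 2 + b ^+ 2 by rewrite sqr_sqrtr// ltW.
have p0 := sqrtpi_gt0.
rewrite /gs [LHS]mulrACA [RHS]mulrACA -!expRD -!invfM -!exprMn; congr (_ ^-1 * expR _).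
  by congr (_ ^+ _); field; rewrite gt_eqF.
rewrite -!opprD; congr (- _).
rewrite /nsq !mulr_suml -!big_split/=; apply: eq_bigr => i _; rewrite !mxE.
rewrite exprMn exprMn exprVn cE.
by field; rewrite ?gt_eqF// ?cE.
Qed.

Lemma gs_sqrt_gt0 a b : 0 < a -> 0 < Num.sqrt (a ^+ 2 + b ^+ 2).
Proof. by move=> a0; rewrite sqrtr_gt0 ltr_wpDr ?sqr_ge0// exprn_gt0. Qed.

Lemma cv_gs a b : 0 < a -> 0 < b -> cv (gs a) (gs b) = gs (Num.sqrt (a ^+ 2 + b ^+ 2)).
Proof.
move=> a0 b0; apply/funext => x; rewrite /cv.
have c0 := gs_sqrt_gt0 b a0.
under eq_Rintegral do rewrite gsM//.
rewrite Rintegral_measurableZl; last first.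
  by apply: measurableT_comp (measurable_gs _) _; exact: measurable_rV_subr.
rewrite (Rintegral_rV_subr _ (measurable_gs _)) Rintegral_gs ?mulr1//.
by rewrite divr_gt0// mulr_gt0.
Qed.

Lemma Rintegral_odd (f : E -> R) : measurable_fun setT f ->
  (forall x, f (- x) = - f x) -> (\int[mu]_x f x)%R = 0.
Proof.
move=> mf fN.
have := Rintegral_rV_subl 0 mf.
under eq_Rintegral do rewrite sub0r fN -mulN1r.
rewrite Rintegral_measurableZl// mulN1r => /eqP.
by rewrite eq_sym -subr_eq0 opprK -mulr2n mulrn_eq0/= => /eqP.
Qed.

(** Doubling the width leaves over a factor exp (- 3 |x|^2 / (4 a^2)), which absorbs |x_j| / a. Thus
    polynomial factors are always dominated by a wider Gaussian. *)
Lemma coord_gs_le a x j : 0 < a -> `|x 0 j| * gs a x <= 2 ^+ d * a * gs (2 * a) x.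
Proof.
move=> a0; have p0 := sqrtpi_gt0.
have -> : gs a x = 2 ^+ d * gs (2 * a) x * expR (- (3 / 4 * (nsq x / a ^+ 2))).
  rewrite /gs !mulrA -[in RHS]mulrA -expRD; congr (_ * expR _); last by field; rewrite gt_eqF.
  by rewrite -[2 * a * _]mulrA [in RHS]exprMn invfM mulrA mulfV ?mul1r// expf_neq0// pnatr_eq0.
have G0 : 0 < 2 ^+ d * gs (2 * a) x by rewrite mulr_gt0 ?exprn_gt0// gs_gt0// mulr_gt0.
have -> : 2 ^+ d * a * gs (2 * a) x = 2 ^+ d * gs (2 * a) x * a by ring.
rewrite mulrCA ler_pM2l//.
rewrite expRN ler_pdivrMr ?expR_gt0//.
apply: (@le_trans _ _ (a * (1 + 3 / 4 * (nsq x / a ^+ 2)))); last first.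
  by rewrite ler_pM2l// expR_ge1Dx.
pose t := `|x 0 j| / a.
have t2 : t ^+ 2 <= nsq x / a ^+ 2.
  by rewrite exprMn real_normK ?num_real// exprVn ler_pM2r ?coord_sqr_le// invr_gt0 exprn_gt0.
rewrite -ler_pdivrMl// mulrC -/t.
have : 0 <= (t - 1) ^+ 2 by exact: sqr_ge0.
have : 0 <= (3 * t - 2) ^+ 2 by exact: sqr_ge0.
nra.
Qed.

Lemma nsq_gs_le x : nsq x * gs 1 x <= 2 ^+ d * 2 * gs 2 x.
Proof.
have p0 := sqrtpi_gt0.
have -> : gs 1 x = 2 ^+ d * gs 2 x * expR (- (3 / 4 * nsq x)).
  rewrite /gs !mulrA -[in RHS]mulrA -expRD; congr (_ * expR _); last by field.
  by rewrite mul1r [in RHS]exprMn invfM mulrA mulfV ?mul1r// expf_neq0// pnatr_eq0.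
have G0 : 0 < 2 ^+ d * gs 2 x by rewrite mulr_gt0 ?exprn_gt0// gs_gt0.
have -> : 2 ^+ d * 2 * gs 2 x = 2 ^+ d * gs 2 x * 2 by ring.
rewrite mulrCA ler_pM2l//.
rewrite expRN ler_pdivrMr ?expR_gt0//.
apply: (@le_trans _ _ (2 * (1 + 3 / 4 * nsq x))).
  by have := nsq_ge0 x; lra.
by rewrite ler_pM2l// expR_ge1Dx.
Qed.

Lemma Rintegral_nsq_gs1 : (\int[mu]_x (nsq x * gs 1 x))%R = d%:R / 2.
Proof.
set S := Rintegral _ _ _.
have iS : mu.-integrable setT (EFin \o (fun x => nsq x * gs 1 x)).
  apply: (@integrable_le _ _ _ mu _ (fun x => 2 ^+ d * 2 * gs 2 x)).
  - by apply: measurable_funM; [exact: measurable_nsq|exact: measurable_gs].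
  - have i2 := integrable_gs (ltr0Sn R 1); exact: integrable_realZl i2.
  - move=> x; rewrite ger0_norm ?nsq_gs_le// mulr_ge0 ?nsq_ge0// gs_ge0//.
(* convexity of the exponential: both sides agree at [a = 1], so their derivatives do *)
have key a : 0 < a -> 1 - (a ^- 2 - 1) * S <= a ^+ d.
  move=> a0.
  have i1 := integrable_gs (ltr01 : 0 < 1 :> R).
  have ia := integrable_gs a0.
  have -> : 1 - (a ^- 2 - 1) * S = (\int[mu]_x (gs 1 x - (a ^- 2 - 1) * (nsq x * gs 1 x)))%R.
    rewrite RintegralB//; last exact: integrable_realZl.
    by rewrite Rintegral_gs// RintegralZl.
  have -> : a ^+ d = (\int[mu]_x (a ^+ d * gs a x))%R.
    by rewrite RintegralZl// Rintegral_gs// mulr1.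
  apply: le_Rintegral => //.
  - by apply: integrable_realB => //; exact: integrable_realZl.
  - exact: integrable_realZl.
  - move=> x _.
    have -> : a ^+ d * gs a x = gs 1 x * expR (- ((a ^- 2 - 1) * nsq x)).
      rewrite /gs -[in RHS]mulrA -expRD mulrA; congr (_ * expR _).
        by rewrite mul1r exprMn invfM mulrA mulfV ?mul1r// expf_neq0// gt_eqF.
      by rewrite expr1n divr1; ring.
    have -> : gs 1 x - (a ^- 2 - 1) * (nsq x * gs 1 x) =
      gs 1 x * (1 + - ((a ^- 2 - 1) * nsq x)) by ring.
    by rewrite ler_wpM2l ?gs_ge0// expR_ge1Dx.
pose u (n : nat) : R := n.+1%:R^-1.
have u0 n : 0 < u n by rewrite invr_gt0.
have ucvg : u n @[n --> \oo] --> (0 : R) by exact: cvg_harmonic.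
(* [key] is divided by t - 1: p(t) = (t^d - 1) / (t - 1) and q(t) = S (1 - t^-2) / (t - 1). The sign
   of p - q is that of t - 1, so its value d - 2 S at 1 vanishes, by the limits from the two
   sides. *)
pose p (t : R) := \sum_(i < d) t ^+ i.
pose q (t : R) := S * (t + 1) / t ^+ 2.
have pq t : 0 < t -> 0 <= (t - 1) * (p t - q t).
  move=> t0; have := key _ t0; rewrite mulrBr -subrX1 -subr_ge0.
  congr (0 <= _); rewrite /q; field; exact: lt0r_neq0.
have cp n : continuous (fun t : R => \sum_(i < n) t ^+ i).
  elim: n => [|n IH] t; first by under eq_fun do rewrite big_ord0; exact: cvg_cst.
  under eq_fun do rewrite big_ord_recr.
  by apply: cvgD; [exact: IH|exact: exprn_continuous].
have cq : {for (1 : R), continuous q}.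
  apply: cvgM.
    by apply: cvgM; [exact: cvg_cst|apply: cvgD; [exact: cvg_id|exact: cvg_cst]].
  by apply: cvgV; [rewrite expr1n oner_eq0|exact: exprn_continuous].
have pq1 : p 1 - q 1 = d%:R - S * 2.
  rewrite /p /q expr1n divr1; congr (_ - _).
  under eq_bigr do rewrite expr1n.
  by rewrite sumr_const card_ord.
have lim (v : nat -> R) : v n @[n --> \oo] --> (1 : R) ->
    p (v n) - q (v n) @[n --> \oo] --> d%:R - S * 2.
  move=> v1; rewrite -pq1; apply: cvgB.
    exact: (cvg_comp _ _ v1 (cp d 1)).
  exact: (cvg_comp _ _ v1 cq).
apply/eqP; rewrite eq_le; apply/andP; split.
  suff : 0 <= d%:R - S * 2 by lra.
  have h : 1 + u n @[n --> \oo] --> (1 : R).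
    by rewrite -[X in _ --> X]addr0; apply: cvgD => //; exact: cvg_cst.
  have /cvg_lim <- // := lim _ h; apply: limr_ge; first exact: cvgP (lim _ h).
  apply: nearW => n.
  have := pq (1 + u n) _; rewrite addr_gt0// addrC addKr => /(_ isT).
  by rewrite pmulr_rge0.
suff : d%:R - S * 2 <= 0 by lra.
have h : 1 - u n / 2 @[n --> \oo] --> (1 : R).
  rewrite -[X in _ --> X]subr0 -(mul0r 2^-1); apply: cvgB; first exact: cvg_cst.
  by apply: cvgM => //; exact: cvg_cst.
have /cvg_lim <- // := lim _ h; apply: limr_le; first exact: cvgP (lim _ h).
apply: nearW => n.
have un1 : u n <= 1 by rewrite invf_le1// ler1n.
have v0 : 0 < 1 - u n / 2 by have := u0 n; lra.
have := pq _ v0; rewrite addrAC subrr add0r mulNr.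
by rewrite oppr_ge0 pmulr_rle0// divr_gt0.
Qed.

End gaussians.

Section real_sums.
Context d (T : measurableType d) (R : realType) (m : {measure set T -> \bar R}).

Lemma integrable_real_sum (I : Type) (s : seq I) (f : I -> T -> R) :
  (forall i, m.-integrable setT (EFin \o f i)) ->
  m.-integrable setT (EFin \o (fun x => \sum_(i <- s) f i x)).
Proof.
move=> intf; elim: s => [|i s IH].
  rewrite (_ : _ \o _ = cst 0%E); first exact: integrable0.
  by apply/funext => x /=; rewrite big_nil.
rewrite (_ : _ \o _ = EFin \o (fun x => f i x + \sum_(i <- s) f i x)).
  exact: integrable_realD.
by apply/funext => x /=; rewrite big_cons.
Qed.

Lemma Rintegral_sum (I : Type) (s : seq I) (f : I -> T -> R) :
  (forall i, m.-integrable setT (EFin \o f i)) ->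
  (\int[m]_x (\sum_(i <- s) f i x) = \sum_(i <- s) \int[m]_x f i x)%R.
Proof.
move=> intf; elim: s => [|i s IH].
  rewrite big_nil /Rintegral (eq_integral (cst 0%E)) ?integral0// => x _.
  by rewrite big_nil.
rewrite big_cons -IH -RintegralD//; last exact: integrable_real_sum.
by apply: eq_Rintegral => x _; rewrite big_cons.
Qed.

End real_sums.

Section gaussian_gradient.
Context {R : realType} {d : nat}.
Local Notation E := 'rV[R]_d.
Local Notation mu := (@lebesgue_rV R d).
Implicit Types (x y z : E) (a b : R) (j : 'I_d).

Definition kp j a x : R := 2 * x 0 j / a ^+ 2 * gs a x.

Lemma measurable_kp j a : measurable_fun setT (kp j a).
Proof.
apply: measurable_funM; last exact: measurable_gs.
by apply: measurable_funM => //; apply: measurable_funM => //; exact: measurable_coord.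
Qed.

Lemma kpN j a x : kp j a (- x) = - kp j a x.
Proof. by rewrite /kp gsN mxE mulrN !mulNr. Qed.

Lemma kp_le j a x : 0 < a -> `|kp j a x| <= 2 ^+ d.+1 / a * gs (2 * a) x.
Proof.
move=> a0; rewrite /kp normrM [X in _ * X]ger0_norm ?gs_ge0//.
rewrite normrM normrM (ger0_norm (ler0n _ 2)) [`|(a ^+ 2)^-1|]ger0_norm ?invr_ge0 ?exprn_ge0 ?(ltW a0)//.
have -> : 2 * `|x 0 j| / a ^+ 2 * gs a x = 2 / a ^+ 2 * (`|x 0 j| * gs a x) by ring.
have -> : 2 ^+ d.+1 / a * gs (2 * a) x = 2 / a ^+ 2 * (2 ^+ d * a * gs (2 * a) x).
  by rewrite exprS; field; rewrite gt_eqF.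
by rewrite ler_wpM2l ?coord_gs_le// divr_ge0// exprn_ge0// ltW.
Qed.

Lemma integrable_kp j a : 0 < a -> mu.-integrable setT (EFin \o kp j a).
Proof.
move=> a0; apply: (integrable_le (measurable_kp j a) _ (fun x => kp_le j x a0)).
by apply: integrable_realZl; apply: integrable_gs; rewrite mulr_gt0.
Qed.

Lemma sqn_gs a : 0 < a -> (sqn mu (gs a) <= ((a * Num.sqrt pi) ^- d)%:E)%E.
Proof.
move=> a0; rewrite -[leRHS]mule1 -(@integral_gs R d _ a0) -ge0_integralZl_EFin; last 4 first.
- exact: measurableT.
- by move=> x _; rewrite lee_fin gs_ge0.
- by apply/measurable_EFinP; exact: measurable_gs.
- by rewrite ltW// gs_norm_gt0.
apply: ge0_le_integral => //.
- by move=> x _; rewrite lee_fin sqr_ge0.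
- by apply: measurable_sqr; exact: measurable_gs.
- by apply: measurable_funeM; apply/measurable_EFinP; exact: measurable_gs.
- by move=> x _; rewrite -EFinM lee_fin expr2 ler_wpM2r ?gs_ge0// gs_le.
Qed.

Lemma L2r_gs a : 0 < a -> L2r mu (gs a).
Proof.
move=> a0; split; first exact: measurable_gs.
exact: le_lt_trans (sqn_gs a0) (ltry _).
Qed.

Lemma sqn_kp j a : 0 < a ->
  (sqn mu (kp j a) <= ((2 ^+ d.+1 / a) ^+ 2 * (a * Num.sqrt pi) ^- d)%:E)%E.
Proof.
move=> a0; have a20 : 0 < 2 * a by rewrite mulr_gt0.
have mg := measurable_gs (2 * a) : measurable_fun [set: E] _.
apply: (@le_trans _ _ (sqn mu (fun x => 2 ^+ d.+1 / a * gs (2 * a) x))).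
  apply: sqn_le; [exact: measurable_kp|exact: measurable_funM|].
  by apply: aeW => x; rewrite (le_trans (kp_le j x a0))// ler_norm.
rewrite sqnZ// [leRHS]EFinM; apply: lee_wpmul2l; first by rewrite lee_fin sqr_ge0.
apply: le_trans (sqn_gs a20) _; rewrite lee_fin.
have p0 := @sqrtpi_gt0 R.
rewrite lef_pV2 ?posrE ?exprn_gt0 ?mulr_gt0//.
rewrite lerXn2r ?nnegrE ?mulr_ge0 ?(ltW a0) ?(ltW p0)// -mulrA ler_peMl ?ler1n//.
by rewrite mulr_ge0 ?(ltW a0) ?(ltW p0).
Qed.

Lemma L2r_kp j a : 0 < a -> L2r mu (kp j a).
Proof.
move=> a0; split; first exact: measurable_kp.
exact: le_lt_trans (sqn_kp j a0) (ltry _).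
Qed.

Lemma Rintegral_coord_gs j a : (\int[mu]_x (x 0 j * gs a x))%R = 0.
Proof.
apply: Rintegral_odd.
  by apply: measurable_funM; [exact: measurable_coord|exact: measurable_gs].
by move=> x; rewrite gsN mxE mulNr.
Qed.

Lemma integrable_coord_gs j a : 0 < a ->
  mu.-integrable setT (EFin \o (fun x => x 0 j * gs a x)).
Proof.
move=> a0; apply: (@integrable_le _ _ _ mu _ (fun x => 2 ^+ d * a * gs (2 * a) x)).
- by apply: measurable_funM; [exact: measurable_coord|exact: measurable_gs].
- by apply: integrable_realZl; apply: integrable_gs; rewrite mulr_gt0.
- by move=> x; rewrite normrM [X in _ * X]ger0_norm ?gs_ge0// coord_gs_le.
Qed.

Lemma integrable_nsq_gs a : 0 < a ->
  mu.-integrable setT (EFin \o (fun x => nsq x * gs a x)).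
Proof.
move=> a0.
suff h : mu.-integrable setT (EFin \o (fun x => \sum_(i < d) x 0 i * (x 0 i * gs a x))).
  apply: eq_integrable h => // x _ /=; congr EFin.
  by rewrite /nsq mulr_suml; apply: eq_bigr => i _; rewrite mulrA.
have -> : EFin \o (fun x => \sum_(i < d) x 0 i * (x 0 i * gs a x)) =
   (fun x => \sum_(i < d) (x 0%R i * (x 0%R i * gs a x))%:E)%E.
  by apply/funext => x /=; rewrite sumEFin.
apply: integrable_sum => // i _.
apply: (@integrable_le _ _ _ mu _ (fun x => 2 ^+ d * a * (2 ^+ d * (2 * a) * gs (2 * (2 * a)) x))).
- apply: measurable_funM; first exact: measurable_coord.
  by apply: measurable_funM; [exact: measurable_coord|exact: measurable_gs].
- by do 2! apply: integrable_realZl; apply: integrable_gs; rewrite !mulr_gt0.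
- move=> x; rewrite 2!normrM [`|gs a x|]ger0_norm ?gs_ge0//.
  apply: le_trans (ler_wpM2l (normr_ge0 _) (coord_gs_le x i a0)) _.
  rewrite mulrCA ler_wpM2l ?mulr_ge0 ?exprn_ge0 ?(ltW a0)// coord_gs_le//.
  by rewrite mulr_gt0.
Qed.

Lemma Rintegral_nsq_gs a : 0 < a -> (\int[mu]_x (nsq x * gs a x))%R = a ^+ 2 * (d%:R / 2).
Proof.
move=> a0; rewrite -Rintegral_nsq_gs1.
have mS : measurable_fun setT (fun x => nsq x * gs 1 x).
  by apply: measurable_funM; [exact: measurable_nsq|exact: measurable_gs].
have ai : a^-1 != 0 by rewrite invr_eq0 gt_eqF.
have := Rintegral_rV_affine 0 ai mS.
set I1 := Rintegral _ _ _; set I2 := Rintegral _ _ _ => h.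
have -> : I2 = `|a^-1| ^+ d * I1 by rewrite h mulrA mulfV ?mul1r// expf_neq0// normr_eq0.
rewrite mulrA -Rintegral_measurableZl; last first.
  exact: measurableT_comp mS (measurable_rV_affine _ _).
apply: eq_Rintegral => x _; rewrite addr0 (gs_scale _ a0) nsqZ gtr0_norm ?invr_gt0//.
by rewrite exprVn; field; rewrite expf_neq0 gt_eqF.
Qed.

(** By [gsM] the variable z has mean s x with s = b^2 / c^2, and the centred first moment vanishes
    by oddness; so z_j is replaced by s x_j. *)
Lemma cv_gs_kp j a b : 0 < a -> 0 < b ->
  cv (gs a) (kp j b) = kp j (Num.sqrt (a ^+ 2 + b ^+ 2)).
Proof.
move=> a0 b0; apply/funext => x; rewrite /cv.
set c := Num.sqrt _; have c0 : 0 < c := gs_sqrt_gt0 b a0.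
have cE : c ^+ 2 = a ^+ 2 + b ^+ 2 by rewrite sqr_sqrtr// addr_ge0// sqr_ge0.
set h := a * b / c; have h0 : 0 < h by rewrite divr_gt0// mulr_gt0.
set s := b ^+ 2 / c ^+ 2.
rewrite (@eq_Rintegral _ _ _ mu setT (fun z => 2 / b ^+ 2 * gs c x * ((z - s *: x) 0 j * gs h (z - s *: x) +
   s * x 0 j * gs h (z - s *: x)))); last first.
  move=> z _; have /= e := gsM x z a0 b0.
  rewrite /kp mulrCA e -/c -/h -/s !mxE; ring.
pose F (u : E) := u 0 j * gs h u + s * x 0 j * gs h u.
have mF : measurable_fun setT F.
  apply: measurable_funD.
    by apply: measurable_funM; [exact: measurable_coord|exact: measurable_gs].
  by apply: measurable_funM => //; exact: measurable_gs.
rewrite Rintegral_measurableZl; last first.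
  by apply: measurableT_comp mF _; exact: measurable_rV_subr.
rewrite (Rintegral_rV_subr _ mF) /F RintegralD//; last 2 first.
- exact: integrable_coord_gs.
- by apply: integrable_realZl; exact: integrable_gs.
rewrite Rintegral_coord_gs add0r Rintegral_measurableZl; last exact: measurable_gs.
by rewrite Rintegral_gs// /kp /s mulr1; field; rewrite !gt_eqF.
Qed.

(** The right side is the Laplacian of [gs c], as expected from the sum over j of d_j d_j applied to
    [gs a] * [gs b]. *)
Lemma sum_cv_kp a b x : 0 < a -> 0 < b -> let c := Num.sqrt (a ^+ 2 + b ^+ 2) in
  \sum_(j < d) cv (kp j a) (kp j b) x =
    (4 * nsq x / c ^+ 4 - 2 * d%:R / c ^+ 2) * gs c x.
Proof.
move=> a0 b0 c; have c0 : 0 < c := gs_sqrt_gt0 b a0.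
have cE : c ^+ 2 = a ^+ 2 + b ^+ 2 by rewrite sqr_sqrtr// addr_ge0// sqr_ge0.
set h := a * b / c; have h0 : 0 < h by rewrite divr_gt0// mulr_gt0.
set s := b ^+ 2 / c ^+ 2.
rewrite /cv -Rintegral_sum; last first.
  move=> j; apply: integrableM_L2r; last exact: L2r_kp.
  by apply: L2r_subl; exact: L2r_kp.
(* With z = s x + u the scalar product (x - z) . z equals s (1 - s) |x|^2 + (1 - 2 s) x . u - |u|^2;
   the middle term is odd in u. *)
pose F (u : E) := s * (1 - s) * nsq x * gs h u +
  (1 - 2 * s) * (\sum_(j < d) x 0 j * (u 0 j * gs h u)) - nsq u * gs h u.
have ml : measurable_fun setT (fun u : E => \sum_(j < d) x 0 j * (u 0 j * gs h u)).
  apply/measurable_EFinP.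
  apply: (measurable_int mu); apply: integrable_real_sum => j.
  by apply: integrable_realZl; exact: integrable_coord_gs.
have mg := measurable_gs h : measurable_fun [set: E] _.
have mF : measurable_fun setT F.
  apply: measurable_funB; last by apply: measurable_funM => //; exact: measurable_nsq.
  by apply: measurable_funD; exact: measurable_funM.
rewrite (@eq_Rintegral _ _ _ mu setT (fun z => 4 / (a ^+ 2 * b ^+ 2) * gs c x * F (z - s *: x))); last first.
  move=> z _; have /= e := gsM x z a0 b0; rewrite -/c -/h -/s in e.
  rewrite /kp (eq_bigr (fun j : 'I_d => 4 / (a ^+ 2 * b ^+ 2) * ((x - z) 0 j * z 0 j) *
    (gs a (x - z) * gs b z))); last by move=> j _; field; rewrite !gt_eqF.
  rewrite -mulr_suml -mulr_sumr e /F.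
  have -> : \sum_(j < d) (x - z) 0 j * z 0 j = s * (1 - s) * nsq x +
      (1 - 2 * s) * \sum_(j < d) x 0 j * (z - s *: x) 0 j - nsq (z - s *: x).
    rewrite /nsq !mulr_sumr -sumrN -!big_split/=; apply: eq_bigr => j _.
    by rewrite !mxE; ring.
  have -> : \sum_(j < d) x 0 j * ((z - s *: x) 0 j * gs h (z - s *: x)) =
      (\sum_(j < d) x 0 j * (z - s *: x) 0 j) * gs h (z - s *: x).
    by rewrite mulr_suml; apply: eq_bigr => j _; rewrite mulrA.
  ring.
rewrite Rintegral_measurableZl; last first.
  by apply: measurableT_comp mF _; exact: measurable_rV_subr.
have i1 := integrable_gs h0 : mu.-integrable _ _.
have i2 : mu.-integrable setT (EFin \o (fun u : E => \sum_(j < d) x 0 j * (u 0 j * gs h u))).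
  by apply: integrable_real_sum => j; apply: integrable_realZl; exact: integrable_coord_gs.
rewrite (Rintegral_rV_subr _ mF) /F RintegralB//; last 2 first.
- by apply: integrable_realD; exact: integrable_realZl.
- exact: integrable_nsq_gs.
rewrite RintegralD//; try exact: integrable_realZl.
rewrite (Rintegral_measurableZl mu _ mg) (Rintegral_measurableZl mu _ ml) Rintegral_gs// Rintegral_nsq_gs//.
rewrite (Rintegral_odd ml); last first.
  move=> u; rewrite -sumrN; apply: eq_bigr => j _.
  by rewrite gsN mxE mulNr mulrN.
rewrite mulr0 addr0 mulr1 /s /h.
have -> : (a * b / c) ^+ 2 = a ^+ 2 * b ^+ 2 / c ^+ 2 by field; rewrite gt_eqF.
rewrite (_ : c ^+ 4 = (c ^+ 2) ^+ 2); last by rewrite -exprM.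
rewrite cE.
by field; rewrite -cE ?expf_neq0 ?(gt_eqF c0) ?(gt_eqF a0) ?(gt_eqF b0).
Qed.

End gaussian_gradient.

(** * Half-line integrals, polar coordinates and weights *)

Section half_line.
Context {R : realType}.
Local Notation leb := (@lebesgue_measure R).
Implicit Types a b r w y : R.

(** The half-line enters as a factor, so that scaling and Fubini can be used on the whole line
    without restricting domains. *)
Definition ps a : R := \1_(`]0, +oo[%classic : set R) a.

Lemma psE a : ps a = (0 < a)%R%:R.
Proof. by rewrite /ps indicE mem_setE in_itv/= andbT. Qed.

Lemma ps_ge0 a : 0 <= ps a.
Proof. by rewrite psE. Qed.

Lemma ps_gt0 a : 0 < a -> ps a = 1.
Proof. by rewrite psE => ->. Qed.

Lemma ps_le0 a : a <= 0 -> ps a = 0.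
Proof. by rewrite psE leNgt => /negbTE ->. Qed.

Lemma measurable_ps : measurable_fun setT ps.
Proof. exact: measurable_indic. Qed.

Lemma ps_scale s a : 0 < s -> ps (s * a) = ps a.
Proof. by move=> s0; rewrite !psE pmulr_rgt0. Qed.

Lemma ge0_integral_scale s (f : R -> \bar R) : 0 < s -> measurable_fun setT f ->
  (forall x, 0 <= f x)%E -> (\int[leb]_x f (s * x)%R = (s^-1)%:E * \int[leb]_x f x)%E.
Proof.
move=> s0 mf f0; rewrite -(@ge0_integral_affine_pos _ s 0)//.
by apply: eq_integral => x _; rewrite addr0.
Qed.

Lemma integral_ps (f : R -> R) : measurable_fun setT f -> (forall x, 0 <= f x) ->
  (\int[leb]_x (ps x * f x)%:E = \int[leb]_(x in `]0%R, +oo[) (f x)%:E)%E.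
Proof.
move=> mf f0; rewrite [RHS]integral_mkcond; apply: eq_integral => x _.
rewrite patchE mem_setE in_itv/= andbT psE.
by case: ifP; rewrite ?mul1r ?mul0r.
Qed.

Definition hgauss : R := Num.sqrt pi / 2.

Lemma hgauss_gt0 : 0 < hgauss.
Proof. by rewrite divr_gt0// sqrtr_gt0 pi_gt0. Qed.

Lemma integral_ps_gauss : (\int[leb]_w (ps w * expR (- w ^+ 2))%:E = hgauss%:E)%E.
Proof.
rewrite integral_ps; last 2 first.
- exact: measurable_gauss_fun.
- by move=> x; exact: expR_ge0.
rewrite integral_itv_obnd_cbnd; last first.
  by apply/measurable_EFinP; apply: measurable_funTS; exact: measurable_gauss_fun.
exact: integral0y_gauss.
Qed.

Lemma integral_ps_gauss_scale s : 0 < s ->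
  (\int[leb]_w (ps w * (s * expR (- (s * w) ^+ 2)))%:E = hgauss%:E)%E.
Proof.
move=> s0; rewrite -integral_ps_gauss.
have mg : measurable_fun setT (fun w => (ps w * expR (- w ^+ 2))%:E).
  apply/measurable_EFinP; apply: measurable_funM; [exact: measurable_ps|].
  exact: measurable_gauss_fun.
have g0 w : (0 <= (ps w * expR (- w ^+ 2))%:E)%E.
  by rewrite lee_fin mulr_ge0 ?ps_ge0 ?expR_ge0.
have := ge0_integral_scale s0 mg g0 => h.
rewrite -[RHS]mul1e -(@divff _ s) ?gt_eqF// EFinM -muleA -h.
rewrite -ge0_integralZl_EFin ?(ltW s0)//; last first.
  have ms : measurable_fun setT (fun w : R => s * w) by exact: measurable_funM.
  exact: measurableT_comp mg ms.
by apply: eq_integral => w _; rewrite ps_scale// -EFinM mulrCA.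
Qed.

(** Pointwise limit of the continuous functions x / (x^2 + 1 / (n + 1)), which also tend to the
    convention 0^-1 = 0 at the origin. *)
Lemma measurable_inv : measurable_fun [set: R] (fun x : R => x^-1).
Proof.
apply: (@measurable_fun_cvg _ _ R setT (fun n (x : R) => x / (x ^+ 2 + n.+1%:R^-1))).
  move=> n; apply: measurable_funM => //; apply: continuous_measurable_fun => x.
  apply: cvgV; first by rewrite gt_eqF// ltr_wpDl ?sqr_ge0.
  by apply: cvgD; [exact: exprn_continuous|exact: cvg_cst].
move=> x _; have [->|x0] := eqVneq x 0.
  by rewrite invr0; under eq_cvg do rewrite mul0r; exact: cvg_cst.
have -> : x^-1 = x / (x ^+ 2 + 0) by rewrite addr0 expr2 invfM mulrA divff ?mul1r.
apply: cvgM; first exact: cvg_cst.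
apply: cvgV; first by rewrite addr0 expf_neq0.
by apply: cvgD; [exact: cvg_cst|exact: cvg_harmonic].
Qed.

Lemma measurable_expVX (s : R) n : measurable_fun setT (fun b : R => expR (- (s / b ^+ n))).
Proof.
apply: measurableT_comp => //; apply: measurable_funN; apply: measurable_funM => //.
by apply: (measurableT_comp measurable_inv); exact: measurable_funX.
Qed.

(** Up to the factor [hgauss], the density in b whose mixture of the [gs b] is the Poisson kernel at
    height y. *)
Definition cauchy_weight y b : R := ps b * (y / b ^+ 2 * expR (- (y ^+ 2 / b ^+ 2))).

Lemma cauchy_weight_ge0 y b : 0 <= y -> 0 <= cauchy_weight y b.
Proof. by move=> y0; rewrite !mulr_ge0 ?ps_ge0 ?expR_ge0 ?invr_ge0 ?sqr_ge0. Qed.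

Lemma measurable_cauchy_weight y : measurable_fun setT (cauchy_weight y).
Proof.
apply: measurable_funM; first exact: measurable_ps.
apply: measurable_funM; last exact: measurable_expVX.
apply: measurable_funM => //.
by apply: (measurableT_comp measurable_inv); exact: measurable_funX.
Qed.

(** With r the radius and w = a / b as angular variable, the weight becomes (y / r) exp (- y^2 (1 +
    w^2) / r^2). For fixed r its integral over w is a half Gaussian integral, which leaves exp (-
    y^2 / r^2). *)
Lemma polar (F : R -> \bar R) y : 0 < y -> measurable_fun setT F ->
  (forall r, 0 <= F r)%E ->
  (\int[leb]_b \int[leb]_a ((ps a * cauchy_weight y b)%:E * F (Num.sqrt (a ^+ 2 + b ^+ 2))) =
   hgauss%:E * \int[leb]_r ((ps r * expR (- (y ^+ 2 / r ^+ 2)))%:E * F r))%E.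
Proof.
move=> y0 mF F0.
have m1 : measurable_fun setT (fun z : R * R => z.1) by exact: measurable_fst.
have m2 : measurable_fun setT (fun z : R * R => z.2) by exact: measurable_snd.
have msqrt : measurable_fun setT (@Num.sqrt R).
  by apply: continuous_measurable_fun; exact: sqrt_continuous.
have mW := measurable_cauchy_weight y.
have mps := measurable_ps.
(* [H1] is the integrand in (b, w) after a = b w, with Jacobian b; [H2] is the one in (w, r) after b
   = r / sqrt (1 + w^2). *)
pose H1 (z : R * R) := ((ps z.2 * (z.1 * cauchy_weight y z.1))%:E *
  F (z.1 * Num.sqrt (1 + z.2 ^+ 2))%R)%E.
pose H2 (z : R * R) := ((ps z.1 * (ps z.2 * (y / z.2 * expR (- (y ^+ 2 * (1 + z.1 ^+ 2) / z.2 ^+ 2)))))%:E *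
  F z.2)%E.
have mH1 : measurable_fun setT H1.
  apply: emeasurable_funM.
    apply/measurable_EFinP; apply: measurable_funM; first exact: measurableT_comp mps m2.
    by apply: measurable_funM => //; exact: measurableT_comp mW m1.
  apply: (measurableT_comp mF); apply: measurable_funM => //.
  by apply: (measurableT_comp msqrt); apply: measurable_funD => //; exact: measurable_funX.
have mH2 : measurable_fun setT H2.
  apply: emeasurable_funM; last exact: measurableT_comp mF m2.
  apply/measurable_EFinP; apply: measurable_funM; first exact: measurableT_comp mps m1.
  apply: measurable_funM; first exact: measurableT_comp mps m2.
  apply: measurable_funM.
    by apply: measurable_funM => //; exact: measurableT_comp measurable_inv m2.
  apply: measurableT_comp => //; apply: measurable_funN; apply: measurable_funM.
    by apply: measurable_funM => //; apply: measurable_funD => //; exact: measurable_funX.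
  by apply: (measurableT_comp measurable_inv); exact: measurable_funX.
have W0 b : 0 <= cauchy_weight y b by rewrite cauchy_weight_ge0// ltW.
have H10 z : (0 <= H1 z)%E.
  rewrite /H1 mule_ge0// lee_fin mulr_ge0 ?ps_ge0//.
  have [b0|b0] := leP 0 z.1; first by rewrite mulr_ge0.
  by rewrite /cauchy_weight ps_le0 ?(ltW b0)// mul0r mulr0.
have H20 z : (0 <= H2 z)%E.
  rewrite /H2 mule_ge0// lee_fin mulr_ge0 ?ps_ge0//.
  have [b0|b0] := leP 0 z.2; last by rewrite ps_le0 ?(ltW b0)// mul0r.
  by rewrite !mulr_ge0 ?ps_ge0 ?expR_ge0 ?invr_ge0 ?(ltW y0).
transitivity (\int[leb]_b \int[leb]_w H1 (b, w))%E.
  apply: eq_integral => b _; rewrite /H1/=.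
  have [b0|b0] := leP b 0.
    rewrite /cauchy_weight (ps_le0 b0).
    by under eq_integral do rewrite mul0r mulr0 mul0e; under [RHS]eq_integral do rewrite mul0r !mulr0 mul0e.
  pose f a := ((ps a * cauchy_weight y b)%:E * F (Num.sqrt (a ^+ 2 + b ^+ 2)))%E.
  have mf : measurable_fun setT f.
    apply: emeasurable_funM; first by apply/measurable_EFinP; exact: measurable_funM.
    apply: (measurableT_comp mF); apply: (measurableT_comp msqrt).
    by apply: measurable_funD => //; exact: measurable_funX.
  have f0 a : (0 <= f a)%E by rewrite mule_ge0// lee_fin mulr_ge0// ps_ge0.
  have h := ge0_integral_scale b0 mf f0.
  transitivity ((b / b)%:E * \int[leb]_a f a)%E; first by rewrite divff ?gt_eqF// mul1e.
  rewrite EFinM -muleA -h.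
  rewrite -ge0_integralZl_EFin ?(ltW b0)//; last first.
    have ms : measurable_fun setT (fun w : R => b * w) by exact: measurable_funM.
    exact: measurableT_comp mf ms.
  apply: eq_integral => w _; rewrite /f ps_scale// muleA -EFinM.
  congr ((_)%:E * F _)%E; first by ring.
  have -> : (b * w) ^+ 2 + b ^+ 2 = b ^+ 2 * (1 + w ^+ 2) by ring.
  by rewrite sqrtrM ?sqr_ge0// sqrtr_sqr (ger0_norm (ltW b0)).
rewrite fubini_tonelli//.
transitivity (\int[leb]_w \int[leb]_r H2 (w, r))%E.
  apply: eq_integral => w _.
  pose s := Num.sqrt (1 + w ^+ 2).
  have s2 : s ^+ 2 = 1 + w ^+ 2 by rewrite sqr_sqrtr// addr_ge0// sqr_ge0.
  have s0 : 0 < s by rewrite sqrtr_gt0 ltr_pwDl// sqr_ge0.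
  have mH2w : measurable_fun setT (fun r => H2 (w, r)) by exact: measurable_fun_pair2.
  transitivity ((s / s)%:E * \int[leb]_r H2 (w, r))%E; last by rewrite mulfV ?gt_eqF// mul1e.
  rewrite EFinM -muleA -ge0_integral_scale//.
  rewrite -ge0_integralZl_EFin ?(ltW s0)//; last first.
    have ms : measurable_fun setT (fun r : R => s * r) by exact: measurable_funM.
    exact: measurableT_comp mH2w ms.
  apply: eq_integral => b _; rewrite /H1 /H2/= muleA -EFinM -/s mulrC [b * s]mulrC.
  have [b0|b0] := leP b 0.
    rewrite /cauchy_weight (ps_le0 b0) (ps_le0 (a := s * b)) ?pmulr_rle0//.
    by rewrite !(mul0r, mulr0) !mul0e.
  congr ((_)%:E * _)%E.
  rewrite /cauchy_weight ps_scale// -s2 exprMn.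
  have -> : y ^+ 2 * s ^+ 2 / (s ^+ 2 * b ^+ 2) = y ^+ 2 / b ^+ 2.
    by field; rewrite !gt_eqF.
  by field; rewrite !gt_eqF.
rewrite fubini_tonelli// -ge0_integralZl_EFin ?(ltW hgauss_gt0)//; last 2 first.
- by move=> r _; rewrite mule_ge0// lee_fin mulr_ge0 ?ps_ge0 ?expR_ge0.
- apply: emeasurable_funM => //; apply/measurable_EFinP; apply: measurable_funM => //.
  exact: measurable_expVX.
apply: eq_integral => r _; rewrite /H2/=.
have [r0|r0] := leP r 0.
  rewrite ps_le0// mul0r mul0e mule0.
  by under eq_integral do rewrite mul0r mulr0 mul0e; rewrite integral0.
have yr0 : 0 < y / r by rewrite divr_gt0.
rewrite muleA -EFinM.
pose c := ((expR (- (y ^+ 2 / r ^+ 2)))%:E * F r)%E.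
transitivity (\int[leb]_w (c * (ps w * (y / r * expR (- (y / r * w) ^+ 2)))%:E))%E.
  apply: eq_integral => w _; rewrite /c muleAC -EFinM; congr (_%:E * _)%E.
  rewrite (ps_gt0 r0) mul1r.
  have -> : - (y ^+ 2 * (1 + w ^+ 2) / r ^+ 2) = - (y ^+ 2 / r ^+ 2) + - (y / r * w) ^+ 2.
    by field; rewrite gt_eqF.
  by rewrite expRD; ring.
rewrite ge0_integralZl//; last 3 first.
- apply/measurable_EFinP; apply: measurable_funM => //; apply: measurable_funM => //.
  apply: measurableT_comp => //; apply: measurable_funN; apply: measurable_funX.
  exact: measurable_funM.
- move=> w _; rewrite lee_fin mulr_ge0 ?ps_ge0//; apply: mulr_ge0; [exact: ltW yr0|exact: expR_ge0].
- by rewrite /c mule_ge0// lee_fin expR_ge0.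
rewrite (integral_ps_gauss_scale yr0) /c (ps_gt0 r0) mul1r muleAC -EFinM.
by rewrite [X in X%:E]mulrC.
Qed.

End half_line.

Section ftc_tools.
Context {R : realType}.
Local Notation leb := (@lebesgue_measure R).

Lemma integral_ftc (F f : R -> R) (a b : R) : a <= b ->
  (forall x, a <= x <= b -> is_derive x 1 F (f x)) ->
  (forall x, a <= x <= b -> {for x, continuous f}) ->
  (\int[leb]_(x in `[a, b]) (f x)%:E = (F b - F a)%:E)%E.
Proof.
rewrite le_eqVlt => /predU1P[->|ab] dF cf.
  by rewrite set_itv1 integral_set1 subrr.
have cF x : a <= x <= b -> {for x, continuous F}.
  by move=> /dF [dFx _]; apply: differentiable_continuous; exact/derivable1_diffP.
rewrite (@continuous_FTC2 _ f F)//.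
- apply: continuous_in_subspaceT => x; rewrite inE/= in_itv/=; exact: cf.
- split.
  + move=> x; rewrite in_itv/= => /andP[/ltW ax /ltW xb].
    by have [|] := dF x; rewrite ?ax.
  + by apply: cvg_at_right_filter; apply: cF; rewrite lexx ltW.
  + by apply: cvg_at_left_filter; apply: cF; rewrite lexx ltW.
- move=> x; rewrite in_itv/= => /andP[/ltW ax /ltW xb].
  rewrite derive1E; have xab : a <= x <= b by rewrite ax.
  by have [_ ->] := dF x xab.
Qed.

Lemma itv_cy_bigcup (a : R) : `[a, +oo[%classic = \bigcup_n `[a, a + n%:R]%classic :> set R.
Proof.
apply/seteqP; split => x /=.
  rewrite in_itv/= andbT => ax; exists (Num.bound (x - a)) => //=.
  by rewrite in_itv/= ax -lerBlDl ltW// archi_boundP// subr_ge0.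
by move=> [n _]; rewrite /= !in_itv/= andbT => /andP[].
Qed.

Lemma integral_cy_cvg (g : R -> R) (a : R) : measurable_fun setT g ->
  (forall x, a <= x -> 0 <= g x) ->
  (\int[leb]_(x in `[a, (a + n%:R)%R]) (g x)%:E @[n --> \oo] -->
   \int[leb]_(x in `[a, +oo[) (g x)%:E)%E.
Proof.
move=> mg g0; rewrite itv_cy_bigcup; apply: ge0_nondecreasing_set_cvg_integral.
- move=> m n mn; apply/subsetPset => x /=; rewrite !in_itv/= => /andP[-> /le_trans]; apply.
  by rewrite lerD2l ler_nat.
- by [].
- by move=> n; apply/measurable_EFinP; exact: measurable_funTS.
- by move=> n x /=; rewrite in_itv/= lee_fin => /andP[/g0].
Qed.

Lemma integral_cy_le (g : R -> R) (a : R) (M : \bar R) : measurable_fun setT g ->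
  (forall x, a <= x -> 0 <= g x) ->
  (forall n, (\int[leb]_(x in `[a, (a + n%:R)%R]) (g x)%:E <= M)%E) ->
  (\int[leb]_(x in `[a, +oo[) (g x)%:E <= M)%E.
Proof.
move=> mg g0 gM; have h := integral_cy_cvg mg g0.
by have /cvg_lim <- // := h; apply: lime_le; [exact: cvgP h|exact: nearW].
Qed.

(** The convergence test used for all integrals over widths. The rate a^(-3/2) is the one that the
    L^2 bounds [kpL2] have for d = 1, and its primitive - 2 / sqrt a is explicit. *)
Lemma integral_ps_lty (f : R -> R) (C : R) : measurable_fun setT f ->
  (forall a, 0 < a -> 0 <= f a) ->
  (forall a, 0 < a <= 1 -> f a <= C) ->
  (forall a, 1 <= a -> f a <= C / (a * Num.sqrt a)) ->
  (\int[leb]_a (ps a * f a)%:E < +oo)%E.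
Proof.
move=> mf f0 f1 f2.
have C0 : 0 <= C by rewrite (le_trans (f0 1 _) (f1 1 _))// ltr01 lexx.
pose g (x : R) : R := (x * Num.sqrt x)^-1.
have g0 x : 1 <= x -> 0 <= g x.
  by move=> x1; rewrite invr_ge0 mulr_ge0 ?sqrtr_ge0// (le_trans ler01).
have msq : measurable_fun setT (@Num.sqrt R).
  by apply: continuous_measurable_fun; exact: sqrt_continuous.
have mg : measurable_fun setT g.
  by apply: (measurableT_comp measurable_inv); exact: measurable_funM.
have gfin : (\int[leb]_(x in `[1%R, +oo[) (g x)%:E <= 2%:E)%E.
  apply: integral_cy_le => // n.
  have pos x : 1 <= x <= 1 + n%:R -> 0 < x by move=> /andP[/(lt_le_trans ltr01)].
  have -> : (\int[leb]_(x in `[1%R, (1 + n%:R)%R]) (g x)%:E =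
      (- 2 * (Num.sqrt (1 + n%:R))^-1 - - 2 * (Num.sqrt 1)^-1)%:E)%E.
    apply: (@integral_ftc (fun x => - 2 * (Num.sqrt x)^-1) g); first by rewrite lerDl.
    - move=> x /pos x0; have sx0 : Num.sqrt x != 0 by rewrite gt_eqF// sqrtr_gt0.
      have h := is_deriveV sx0 (is_derive1_sqrt x0).
      have h2 : is_derive x 1 (fun x => - 2 * (Num.sqrt x)^-1) _ := is_deriveZ (- 2) h.
      apply: (is_derive_eq h2).
      rewrite /g /GRing.scale/= -[in RHS](sqr_sqrtr (ltW x0)) sqrtr_sqr ger0_norm ?sqrtr_ge0//.
      by field.
    - move=> x /pos x0; apply: cvgV; first by rewrite mulf_neq0// gt_eqF// sqrtr_gt0.
      by apply: cvgM; [exact: cvg_id|exact: sqrt_continuous].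
  rewrite lee_fin sqrtr1 invr1 mulr1 mulNr opprK gerDr oppr_le0.
  by rewrite mulr_ge0// invr_ge0 sqrtr_ge0.
apply: (@le_lt_trans _ _ (\int[leb]_(x in `]0%R, 1%R]) C%:E + \int[leb]_(x in `[1%R, +oo[) (C * g x)%:E)%E).
  rewrite [X in (X + _)%E]integral_mkcond [X in (_ + X)%E]integral_mkcond -ge0_integralD//; last 4 first.
  - by move=> x _; apply: erestrict_ge0 => y _; rewrite lee_fin.
  - by apply/(measurable_restrictT _ _).1 => //.
  - move=> x _; apply: erestrict_ge0 => y /=; rewrite in_itv/= andbT => y1.
    by rewrite lee_fin mulr_ge0// g0.
  - apply/(measurable_restrictT _ _).1 => //; apply: measurable_funTS.
    by apply/measurable_EFinP; exact: measurable_funM.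
  apply: ge0_le_integral => //.
  - move=> x _; rewrite lee_fin; have [x0|x0] := leP x 0; first by rewrite ps_le0// mul0r.
    by rewrite mulr_ge0 ?ps_ge0// f0.
  - by apply/measurable_EFinP; apply: measurable_funM => //; exact: measurable_ps.
  - apply: emeasurable_funD; apply/(measurable_restrictT _ _).1 => //; apply: measurable_funTS => //.
    by apply/measurable_EFinP; exact: measurable_funM.
  - move=> x _; rewrite !patchE !mem_setE !in_itv/= andbT.
    have [x0|x0] := leP x 0.
      rewrite ps_le0// mul0r; case: (leP 1 x) => x1; last by rewrite ?adde0 ?addr0 ?lexx.
      by move: (le_trans x1 x0); rewrite ler10.
    rewrite ps_gt0// mul1r; case: (leP x 1) => x1; case: (leP 1 x) => x1'; rewrite ?adde0 ?add0e.
    + by rewrite -EFinD lee_fin (le_trans (f1 x _)) ?x0// lerDl mulr_ge0// g0.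
    + by rewrite lee_fin f1 ?x0.
    + by rewrite lee_fin f2.
    + by move: (lt_trans x1 x1'); rewrite ltxx.
rewrite integral_cst//= lebesgue_measure_itv/= lte_fin ltr01 oppr0 addr0 mule1.
under eq_integral do rewrite EFinM.
rewrite ge0_integralZl_EFin//; last 2 first.
- by move=> x /=; rewrite in_itv/= andbT lee_fin => /g0.
- by apply/measurable_EFinP; exact: measurable_funTS.
rewrite lte_add_pinfty ?ltry// lte_mul_pinfty//; exact: le_lt_trans gfin (ltry _).
Qed.

End ftc_tools.

Section cauchy_weights.
Context {R : realType}.
Local Notation leb := (@lebesgue_measure R).

Lemma itv_0y_bigcup :
  `]0, +oo[%classic = \bigcup_n `[n.+1%:R^-1, n.+1%:R]%classic :> set R.
Proof.
apply/seteqP; split => x /=.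
  rewrite in_itv/= andbT => x0.
  exists (maxn (Num.bound x) (Num.bound x^-1)) => //=.
  have h (y : R) m : (Num.bound y <= m)%N -> 0 < y -> y <= m.+1%:R.
    move=> bm y0; rewrite (le_trans (ltW (archi_boundP (ltW y0))))// ler_nat.
    exact: leq_trans bm (leqnSn _).
  rewrite in_itv/= h ?leq_maxl// andbT -[leRHS]invrK lef_pV2 ?posrE ?invr_gt0//.
  by rewrite h ?leq_maxr ?invr_gt0.
move=> [n _]; rewrite /= !in_itv/= andbT => /andP[+ _]; apply: lt_le_trans.
by rewrite invr_gt0.
Qed.

Lemma integral_0y_cvg (g : R -> R) : measurable_fun setT g ->
  (forall x, 0 < x -> 0 <= g x) ->
  (\int[leb]_(x in `[(n.+1%:R^-1)%R, n.+1%:R%R]) (g x)%:E @[n --> \oo] -->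
   \int[leb]_(x in `]0%R, +oo[) (g x)%:E)%E.
Proof.
move=> mg g0; rewrite itv_0y_bigcup; apply: ge0_nondecreasing_set_cvg_integral.
- move=> m n mn; apply/subsetPset => x /=; rewrite !in_itv/= => /andP[h1 h2].
  rewrite (le_trans _ h1) ?(le_trans h2) ?ler_nat// lef_pV2 ?posrE// ler_nat.
  by [].
- by [].
- by move=> n; apply/measurable_EFinP; exact: measurable_funTS.
- move=> n x /=; rewrite in_itv/= lee_fin => /andP[h _]; apply: g0.
  by apply: lt_le_trans h; rewrite invr_gt0.
Qed.

Let E (x : R) : R := (\int[leb]_(t in `[0%R, x]) gauss_fun t)%R.

Let dE (x : R) : 0 < x -> is_derive x 1 E (gauss_fun x).
Proof.
move=> x0.
have := @continuous_FTC1_closed R gauss_fun 0 x (x + 1).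
rewrite ltrDl ltr01 => /(_ isT).
have h : leb.-integrable `[0, (x + 1)]%classic (EFin \o gauss_fun).
  by apply: integrableS (@integrableT_gauss R).
move=> /(_ h) /(_ x0) /(_ (@continuous_gauss_fun R x)) [d1 d2].
split; first exact: d1.
by rewrite -derive1E; exact: d2.
Qed.

(** The inversion b -> 1 / b turns the weight into a Gaussian. It is carried out on primitives: if
    E' is the Gaussian then b -> - E(1 / b) is a primitive of the weight. The exhausting intervals
    [1 / (n + 1), n + 1] are invariant under inversion. *)
Lemma integral_cauchy_weight1 : (\int[leb]_b (cauchy_weight 1 b)%:E = (hgauss (R := R))%:E)%E.
Proof.
pose g b : R := 1 / b ^+ 2 * expR (- (1 ^+ 2 / b ^+ 2)).
have mg : measurable_fun setT g.
  apply: measurable_funM; last exact: measurable_expVX.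
  by apply: measurable_funM => //; apply: (measurableT_comp measurable_inv); exact: measurable_funX.
have g0 b : 0 <= g b by rewrite mulr_ge0 ?expR_ge0// mul1r invr_ge0 sqr_ge0.
rewrite -integral_ps_gauss (integral_ps mg g0) integral_ps; last 2 first.
- exact: measurable_gauss_fun.
- by move=> x; exact: expR_ge0.
have h1 := integral_0y_cvg mg (fun b _ => g0 b).
have h2 := integral_0y_cvg (@measurable_gauss_fun R) (fun b _ => gauss_fun_ge0 b).
have /cvg_lim <- // := h1; have /cvg_lim <- // := h2; congr (limn _).
apply/funext => n; set a := n.+1%:R^-1; set b := n.+1%:R.
have b0 : 0 < b by [].
have a0 : 0 < a by rewrite invr_gt0.
have ab : a <= b by rewrite (@le_trans _ _ 1)// ?invf_le1// ler1n.
have pos x : a <= x <= b -> 0 < x by move=> /andP[/(lt_le_trans a0)].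
have -> : (\int[leb]_(x in `[a, b]) (gauss_fun x)%:E = (E b - E a)%:E)%E.
  apply: integral_ftc => // x /pos x0; [exact: dE|exact: continuous_gauss_fun].
have -> : (\int[leb]_(x in `[a, b]) (g x)%:E = ((- E b^-1) - (- E a^-1))%:E)%E.
  apply: (@integral_ftc R (fun x => - E x^-1) g) => // x /pos x0.
    have xi0 : 0 < x^-1 by rewrite invr_gt0.
    have xn0 : x != 0 by rewrite gt_eqF.
    have hi : is_derive x 1 (fun x : R => x^-1) _ := @is_deriveV _ id _ _ _ xn0 (is_derive_id x 1).
    have h := is_deriveN (is_derive1_comp (dE xi0) hi).
    have h' : is_derive x 1 (fun x => - E x^-1) _ := h.
    apply: (is_derive_eq h'); rewrite /g /gauss_fun /GRing.scale/=.
    by rewrite mulr1 mulrN opprK mulrC expr1n !mul1r exprVn.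
  have xn0 : x ^+ 2 != 0 by rewrite expf_neq0// gt_eqF.
  have c1 : {for x, continuous (fun x : R => (x ^+ 2)^-1)}.
    by apply: cvgV => //; exact: exprn_continuous.
  apply: cvgM; first by apply: cvgM; [exact: cvg_cst|exact: c1].
  apply: (@continuous_comp _ _ _ (fun b : R => - (1 ^+ 2 / b ^+ 2)) expR); last exact: continuous_expR.
  apply: cvgN.
  by apply: cvgM; [exact: cvg_cst|exact: c1].
by rewrite /a /b invrK; congr (_%:E); ring.
Qed.

Lemma integral_cauchy_weight (y : R) : 0 < y ->
  (\int[leb]_b (cauchy_weight y b)%:E = (hgauss (R := R))%:E)%E.
Proof.
move=> y0; rewrite -integral_cauchy_weight1.
have mw : measurable_fun setT (fun b => (cauchy_weight y b)%:E).
  by apply/measurable_EFinP; exact: measurable_cauchy_weight.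
have w0 b : (0 <= (cauchy_weight y b)%:E)%E by rewrite lee_fin cauchy_weight_ge0// ltW.
transitivity ((y / y)%:E * \int[leb]_b (cauchy_weight y b)%:E)%E.
  by rewrite divff ?gt_eqF// mul1e.
rewrite EFinM -muleA -(ge0_integral_scale y0 mw w0).
have ms : measurable_fun setT (fun b : R => y * b) by exact: measurable_funM.
rewrite -ge0_integralZl_EFin ?(ltW y0)//; last exact: measurableT_comp mw ms.
apply: eq_integral => b _; rewrite -EFinM; congr (_%:E).
rewrite /cauchy_weight ps_scale//.
have [b0|b0] := leP b 0; first by rewrite (ps_le0 b0) !mul0r mulr0.
rewrite exprMn; have -> : y ^+ 2 / (y ^+ 2 * b ^+ 2) = 1 ^+ 2 / b ^+ 2.
  by rewrite expr1n; field; rewrite !gt_eqF.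
by field; rewrite !gt_eqF.
Qed.

End cauchy_weights.

(** * Superpositions of kernels and the regularised Riesz kernels *)

Section mixtures.
Context {R : realType} {d : nat}.
Local Notation E := 'rV[R]_d.
Local Notation mu := (@lebesgue_rV R d).
Local Notation leb := (@lebesgue_measure R).

Lemma mix_cv (K : R * E -> R) (f : E -> R) (x : E) :
  measurable_fun setT K -> measurable_fun setT f ->
  (\int[leb]_a \int[mu]_y (`|K (a, x - y) * f y|)%:E < +oo)%E ->
  cv (fun z => \int[leb]_a K (a, z)) f x = (\int[leb]_a cv (fun z => K (a, z)) f x)%R.
Proof.
move=> mK mf Klt.
pose H (z : R * E) := K (z.1, x - z.2) * f z.2.
have mH : measurable_fun setT H.
  apply: measurable_funM; last exact: measurableT_comp mf measurable_snd.
  apply: (measurableT_comp mK); apply/measurable_fun_pair => //=.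
  exact: measurableT_comp (measurable_rV_subl x) measurable_snd.
rewrite [RHS](@Rintegral_fubini _ _ _ _ _ leb mu H mH Klt) /cv; apply: eq_Rintegral => y _.
rewrite /H/= mulrC -Rintegral_measurableZl; last exact: measurable_fun_pair1 mK.
by apply: eq_Rintegral => a _; rewrite mulrC.
Qed.

(** Minkowski's integral inequality, proved by Cauchy-Schwarz in a for K = B^(1/2) (K / B^(1/2))
    followed by Tonelli. Where [B] vanishes so does [K], and the quotient 0 / 0 = 0 is harmless. *)
Lemma mix_L2 (K : R * E -> R) (B : R -> R) (M : R) :
  measurable_fun setT K -> measurable_fun setT B -> (forall a, 0 <= B a) ->
  (forall a x, B a = 0 -> K (a, x) = 0) ->
  (forall a, (sqn mu (fun x => K (a, x)) <= (B a ^+ 2)%:E)%E) ->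
  (\int[leb]_a (B a)%:E <= M%:E)%E ->
  (sqn mu (fun x => \int[leb]_a K (a, x))%R <= (M ^+ 2)%:E)%E.
Proof.
move=> mK mB B0 BK KB BM.
have M0 : 0 <= M.
  by rewrite -lee_fin (le_trans _ BM)// integral_ge0// => a _; rewrite lee_fin.
have msqrt : measurable_fun setT (@Num.sqrt R).
  by apply: continuous_measurable_fun; exact: sqrt_continuous.
have mKx x : measurable_fun setT (fun a => K (a, x)) by exact: measurable_fun_pair1 mK.
pose G (z : R * E) := (K z ^+ 2 / B z.1)%:E.
have mG : measurable_fun setT G.
  apply/measurable_EFinP; apply: measurable_funM; first exact: measurable_funX.
  by apply: (measurableT_comp measurable_inv); exact: measurableT_comp mB measurable_fst.
have G0 z : (0 <= G z)%E by rewrite lee_fin divr_ge0// sqr_ge0.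
have mGF := measurable_fun_fubini_tonelli_G (m1 := leb) G mG G0.
have pt x : (((\int[leb]_a K (a, x))%R ^+ 2)%:E <= M%:E * \int[leb]_a G (a, x))%E.
  apply: le_trans (sqr_Rintegral_le leb (mKx x)) _.
  have -> : (\int[leb]_a (`|K (a, x)|)%:E = \int[leb]_a
     (`|Num.sqrt (B a) * (K (a, x) / Num.sqrt (B a))|)%:E)%E.
    apply: eq_integral => a _; have [Ba|Ba] := eqVneq (B a) 0.
      by rewrite BK// mul0r mulr0.
    rewrite mulrCA mulfV ?mulr1// sqrtr_eq0 -ltNge lt_def Ba.
    exact: B0.
  apply: le_trans (cauchy_schwarz leb _ _) _.
  - exact: measurableT_comp msqrt mB.
  - apply: measurable_funM; [exact: mKx|]; apply: (measurableT_comp measurable_inv).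
    exact: measurableT_comp msqrt mB.
  have -> : sqn leb (fun a => Num.sqrt (B a)) = (\int[leb]_a (B a)%:E)%E.
    by apply: eq_integral => a _; rewrite sqr_sqrtr.
  have -> : sqn leb (fun a => K (a, x) / Num.sqrt (B a)) = (\int[leb]_a G (a, x))%E.
    by apply: eq_integral => a _; rewrite /G/= exprMn exprVn sqr_sqrtr.
  by apply: lee_wpmul2r => //; exact: integral_ge0.
have mI : measurable_fun setT (fun x => (\int[leb]_a K (a, x))%R).
  have mK2 : measurable_fun setT (fun z : E * R => K (z.2, z.1)).
    by apply: (measurableT_comp mK); apply/measurable_fun_pair.
  exact: (measurable_Rintegral_fst leb mK2).
apply: le_trans (ge0_le_integral _ _ _ _ _ (fun x _ => pt x)) _ => //.
- by move=> x _; rewrite lee_fin sqr_ge0.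
- exact: measurable_sqr.
- exact: measurable_funeM.
rewrite ge0_integralZl_EFin//; last by move=> x _; exact: integral_ge0.
rewrite -(@fubini_tonelli _ _ _ _ _ leb mu G mG G0) expr2 EFinM.
apply: lee_wpmul2l; first by rewrite lee_fin.
apply: le_trans BM; apply: ge0_le_integral => //.
- by move=> a _; exact: integral_ge0.
- exact: (measurable_fun_fubini_tonelli_F (m2 := mu) G mG G0).
- exact/measurable_EFinP.
- move=> a _; rewrite /G/=.
  have [Ba|Ba] := eqVneq (B a) 0.
    by under eq_integral do rewrite BK// expr0n/= mul0r; rewrite integral0 lee_fin.
  have Bp : 0 < B a by rewrite lt_def Ba B0.
  under eq_integral do rewrite mulrC EFinM.
  have mKa : measurable_fun setT (fun x => K (a, x)) by exact: measurable_fun_pair2 mK.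
  rewrite ge0_integralZl_EFin//; last 3 first.
  - by move=> x _; rewrite lee_fin sqr_ge0.
  - exact: measurable_sqr.
  - by rewrite invr_ge0 ltW.
  apply: le_trans (lee_wpmul2l _ (KB a)) _; first by rewrite lee_fin invr_ge0 ltW.
  by rewrite -EFinM lee_fin expr2 mulrA mulVf ?mul1r// gt_eqF.
Qed.

End mixtures.

Section heat_riesz_kernel.
Context {R : realType} {d : nat}.
Local Notation E := 'rV[R]_d.
Local Notation mu := (@lebesgue_rV R d).
Local Notation leb := (@lebesgue_measure R).

(** The width of [gs a] * [gs c]. For c > 0 it is at least c, which removes the singularity of the
    kernels at a = 0. *)
Definition gam (c a : R) : R := Num.sqrt (a ^+ 2 + c ^+ 2).

Lemma measurable_sqrt : measurable_fun setT (@Num.sqrt R).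
Proof. by apply: continuous_measurable_fun; exact: sqrt_continuous. Qed.

Lemma measurable_gam c : measurable_fun setT (gam c).
Proof.
by apply: (measurableT_comp measurable_sqrt); apply: measurable_funD => //; exact: measurable_funX.
Qed.

Lemma sqr_gam c a : gam c a ^+ 2 = a ^+ 2 + c ^+ 2.
Proof. by rewrite sqr_sqrtr// addr_ge0// sqr_ge0. Qed.

Lemma gam_gt0 c a : 0 < c -> 0 < gam c a.
Proof. by move=> c0; rewrite sqrtr_gt0 ltr_wpDl ?sqr_ge0// exprn_gt0. Qed.

Lemma gam_gel c a : 0 <= a -> a <= gam c a.
Proof.
move=> a0; rewrite -[leLHS]ger0_norm// -sqrtr_sqr ler_wsqrtr// lerDl.
exact: sqr_ge0.
Qed.

Lemma gam_ger c a : 0 <= c -> c <= gam c a.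
Proof.
move=> c0; rewrite -[leLHS]ger0_norm// -sqrtr_sqr ler_wsqrtr// lerDr.
exact: sqr_ge0.
Qed.

Section joint.
Context d' (T : measurableType d') (s : T -> R) (f : T -> E).
Hypothesis ms : measurable_fun setT s.
Hypothesis mf : measurable_fun setT f.

Lemma measurable_gs_joint : measurable_fun setT (fun t => gs (s t) (f t)).
Proof.
have mi (u : T -> R) : measurable_fun setT u -> measurable_fun setT (fun t => (u t)^-1).
  by move=> mu'; exact: measurableT_comp measurable_inv mu'.
apply: measurable_funM.
  by apply: mi; apply: measurable_funX; exact: measurable_funM.
apply: measurableT_comp => //; apply: measurable_funN; apply: measurable_funM.
  exact: measurableT_comp measurable_nsq mf.
by apply: mi; exact: measurable_funX.
Qed.

Lemma measurable_kp_joint j : measurable_fun setT (fun t => kp j (s t) (f t)).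
Proof.
apply: measurable_funM; last exact: measurable_gs_joint.
apply: measurable_funM.
  by apply: measurable_funM => //; exact: measurableT_comp (measurable_coord j) mf.
by apply: (measurableT_comp measurable_inv); exact: measurable_funX.
Qed.

End joint.

Definition kpsup (a : R) : R := 2 ^+ d.+1 / a * (a * Num.sqrt pi) ^- d.

Definition kpL2 (a : R) : R := 2 ^+ d.+1 / a * Num.sqrt ((a * Num.sqrt pi) ^- d).

Lemma kpsup_ge0 a : 0 < a -> 0 <= kpsup a.
Proof.
move=> a0; rewrite mulr_ge0 ?divr_ge0 ?exprn_ge0 ?(ltW a0)// invr_ge0 exprn_ge0//.
by rewrite mulr_ge0 ?sqrtr_ge0 ?(ltW a0).
Qed.

Lemma kpL2_gt0 a : 0 < a -> 0 < kpL2 a.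
Proof.
by move=> a0; rewrite mulr_gt0 ?divr_gt0 ?exprn_gt0// sqrtr_gt0 gs_norm_gt0.
Qed.

Lemma gs_norm_le (a b : R) : 0 < a -> a <= b ->
  (b * Num.sqrt pi) ^- d <= (a * Num.sqrt pi) ^- d.
Proof.
move=> a0 ab; have p0 := @sqrtpi_gt0 R; have b0 := lt_le_trans a0 ab.
rewrite lef_pV2 ?posrE ?exprn_gt0 ?mulr_gt0// lerXn2r ?nnegrE ?mulr_ge0 ?(ltW p0) ?(ltW a0) ?(ltW b0)//.
by rewrite ler_pM2r.
Qed.

Lemma kp_le_kpsup (j : 'I_d) a (x : E) : 0 < a -> `|kp j a x| <= kpsup a.
Proof.
move=> a0; apply: le_trans (kp_le j x a0) _; rewrite ler_wpM2l ?divr_ge0 ?exprn_ge0 ?(ltW a0)//.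
have a20 : 0 < 2 * a by rewrite mulr_gt0.
apply: le_trans (gs_le x a20) (gs_norm_le a0 _).
by rewrite ler_peMl ?ler1n// ltW.
Qed.

Lemma sqn_kp_le (j : 'I_d) a : 0 < a -> (sqn mu (kp j a) <= (kpL2 a ^+ 2)%:E)%E.
Proof.
move=> a0; rewrite /kpL2 [in leRHS]exprMn sqr_sqrtr ?(ltW (gs_norm_gt0 _ a0))//.
  exact: sqn_kp.
by rewrite invr_ge0 exprn_ge0// mulr_ge0 ?sqrtr_ge0// ltW.
Qed.

Lemma kpsup_le a b : 0 < a -> a <= b -> kpsup b <= kpsup a.
Proof.
move=> a0 ab; have b0 := lt_le_trans a0 ab; apply: ler_pM.
- by rewrite divr_ge0 ?exprn_ge0// ltW.
- by rewrite invr_ge0 exprn_ge0// mulr_ge0 ?sqrtr_ge0// ltW.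
- by rewrite ler_pM2l ?exprn_gt0// lef_pV2.
- exact: gs_norm_le.
Qed.

Lemma kpL2_le a b : 0 < a -> a <= b -> kpL2 b <= kpL2 a.
Proof.
move=> a0 ab; have b0 := lt_le_trans a0 ab; apply: ler_pM; rewrite ?sqrtr_ge0//.
- by rewrite divr_ge0 ?exprn_ge0// ltW.
- by rewrite ler_pM2l ?exprn_gt0// lef_pV2.
- by rewrite ler_wsqrtr// gs_norm_le.
Qed.

Lemma measurable_kpsup : measurable_fun setT kpsup.
Proof.
apply: measurable_funM; first by apply: measurable_funM => //; exact: measurable_inv.
by apply: (measurableT_comp measurable_inv); apply: measurable_funX; exact: measurable_funM.
Qed.

Lemma measurable_kpL2 : measurable_fun setT kpL2.
Proof.
apply: measurable_funM; first by apply: measurable_funM => //; exact: measurable_inv.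
apply: (measurableT_comp measurable_sqrt); apply: (measurableT_comp measurable_inv).
by apply: measurable_funX; exact: measurable_funM.
Qed.

Lemma measurable_ps_gam c (f : R -> R) : measurable_fun setT f ->
  measurable_fun setT (fun a => ps a * f (gam c a)).
Proof.
move=> mf; apply: measurable_funM; first exact: measurable_ps.
by apply: measurableT_comp mf _; exact: measurable_gam.
Qed.

Lemma integral_kpsup_lty c : (0 < d)%N -> 0 < c ->
  (\int[leb]_a (ps a * kpsup (gam c a))%:E < +oo)%E.
Proof.
move=> d0 c0; have p0 := @sqrtpi_gt0 R.
apply: (@integral_ps_lty _ _ (kpsup c + kpsup 1)).
- by apply: measurableT_comp measurable_kpsup _; exact: measurable_gam.
- by move=> a _; rewrite kpsup_ge0// gam_gt0.
- move=> a /andP[a0 _]; apply: (@le_trans _ _ (kpsup c)).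
    by rewrite kpsup_le// gam_ger// ltW.
  by rewrite lerDl kpsup_ge0.
- move=> a a1; have a0 := lt_le_trans ltr01 a1.
  apply: (@le_trans _ _ (kpsup a)); first by rewrite kpsup_le// gam_gel// ltW.
  apply: (@le_trans _ _ (kpsup 1 / (a * Num.sqrt a))); last first.
    by rewrite ler_wpM2r ?invr_ge0 ?mulr_ge0 ?sqrtr_ge0 ?(ltW a0)// lerDr kpsup_ge0.
  rewrite /kpsup invr1 mulr1 mul1r invfM mulrACA exprMn [leRHS]mulrA -!mulrA ler_pM2l ?exprn_gt0//.
  rewrite ler_pM2l ?invr_gt0//.
  rewrite invfM mulrC ler_pM2l ?invr_gt0 ?exprn_gt0//.
  rewrite lef_pV2 ?posrE ?sqrtr_gt0 ?exprn_gt0//.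
  apply: (@le_trans _ _ a); last by case: d d0 => // n _; rewrite exprS ler_peMr ?(ltW a0)// exprn_ege1.
  rewrite -{2}(sqr_sqrtr (ltW a0)) expr2 ler_peMl ?sqrtr_ge0//.
  by rewrite -sqrtr1 ler_wsqrtr.
Qed.

Lemma integral_kpL2_lty c : (0 < d)%N -> 0 < c ->
  (\int[leb]_a (ps a * kpL2 (gam c a))%:E < +oo)%E.
Proof.
move=> d0 c0; have p0 := @sqrtpi_gt0 R.
apply: (@integral_ps_lty _ _ (kpL2 c + kpL2 1)).
- by apply: measurableT_comp measurable_kpL2 _; exact: measurable_gam.
- by move=> a _; rewrite ltW// kpL2_gt0// gam_gt0.
- move=> a /andP[a0 _]; apply: (@le_trans _ _ (kpL2 c)).
    by rewrite kpL2_le// gam_ger// ltW.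
  by rewrite lerDl ltW// kpL2_gt0.
- move=> a a1; have a0 := lt_le_trans ltr01 a1.
  apply: (@le_trans _ _ (kpL2 a)); first by rewrite kpL2_le// gam_gel// ltW.
  apply: (@le_trans _ _ (kpL2 1 / (a * Num.sqrt a))); last first.
    by rewrite ler_wpM2r ?invr_ge0 ?mulr_ge0 ?sqrtr_ge0 ?(ltW a0)// lerDr ltW// kpL2_gt0.
  rewrite /kpL2 invr1 mulr1 mul1r invfM mulrACA -!mulrA ler_pM2l ?exprn_gt0//.
  rewrite ler_pM2l ?invr_gt0//.
  rewrite exprMn invfM sqrtrM ?invr_ge0 ?exprn_ge0 ?(ltW a0)// mulrC.
  rewrite ler_pM2l ?sqrtr_gt0 ?invr_gt0 ?exprn_gt0//.
  rewrite -sqrtrV ?(ltW a0)// ler_wsqrtr// lef_pV2 ?posrE ?exprn_gt0//.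
  by case: d d0 => // n _; rewrite exprS ler_peMr ?(ltW a0)// exprn_ege1.
Qed.

(** [kp j (gam c a)] is [kp j a] * [gs c]. Superposing these smoothed kernels directly avoids a
    convolution with z_j / |z|^(d+1), which is integrable neither at 0 nor at infinity. *)
Definition kcm (j : 'I_d) c (z : R * E) : R := ps z.1 * kp j (gam c z.1) z.2.

Definition kc (j : 'I_d) c (x : E) : R := (\int[leb]_a kcm j c (a, x))%R.

Lemma measurable_kcm j c : measurable_fun setT (kcm j c).
Proof.
apply: measurable_funM; first exact: measurableT_comp measurable_ps measurable_fst.
apply: measurable_kp_joint; last exact: measurable_snd.
exact: measurableT_comp (measurable_gam c) measurable_fst.
Qed.

Lemma kcm_le j c a x : 0 < c -> `|kcm j c (a, x)| <= ps a * kpsup (gam c a).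
Proof.
move=> c0; rewrite /kcm/= normrM ger0_norm ?ps_ge0// ler_wpM2l ?ps_ge0//.
by rewrite kp_le_kpsup// gam_gt0.
Qed.

Definition kcsup c := fine (\int[leb]_a (ps a * kpsup (gam c a))%:E)%E.

Section bounds.
Variables (j : 'I_d) (c : R).
Hypothesis c0 : 0 < c.

Let d0 : (0 < d)%N := leq_ltn_trans (leq0n j) (ltn_ord j).

Lemma integral_kcsup : (\int[leb]_a (ps a * kpsup (gam c a))%:E = (kcsup c)%:E)%E.
Proof.
rewrite fineK// ge0_fin_numE ?integral_kpsup_lty//.
by apply: integral_ge0 => a _; rewrite lee_fin mulr_ge0 ?ps_ge0 ?kpsup_ge0// gam_gt0.
Qed.

Lemma integral_abs_kcm x : (\int[leb]_a (`|kcm j c (a, x)|)%:E <= (kcsup c)%:E)%E.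
Proof.
rewrite -integral_kcsup; apply: ge0_le_integral => //.
- apply/measurable_EFinP; apply: measurableT_comp => //.
  exact: measurable_fun_pair1 (measurable_kcm j c).
- by apply/measurable_EFinP; exact: measurable_ps_gam measurable_kpsup.
- by move=> a _; rewrite lee_fin kcm_le.
Qed.

Lemma integrable_kcm x : leb.-integrable setT (EFin \o (fun a => kcm j c (a, x))).
Proof.
apply/integrable_ltyP; first exact: measurable_fun_pair1 (measurable_kcm j c).
exact: le_lt_trans (integral_abs_kcm x) (ltry _).
Qed.

Lemma kc_le x : `|kc j c x| <= kcsup c.
Proof.
apply: le_normr_Rintegral_fin (integral_abs_kcm x).
exact: measurable_fun_pair1 (measurable_kcm j c).
Qed.

Lemma measurable_kc : measurable_fun setT (kc j c).
Proof.
have m2 : measurable_fun setT (fun z : E * R => kcm j c (z.2, z.1)).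
  by apply: (measurableT_comp (measurable_kcm j c)); apply/measurable_fun_pair.
exact: (measurable_Rintegral_fst leb m2).
Qed.

Lemma L2r_kc : L2r mu (kc j c).
Proof.
split; first exact: measurable_kc.
pose M := fine (\int[leb]_a (ps a * kpL2 (gam c a))%:E)%E.
apply: le_lt_trans (ltry (M ^+ 2)).
have p0 a : 0 < kpL2 (gam c a) by rewrite kpL2_gt0// gam_gt0.
apply: (@mix_L2 _ _ (kcm j c) (fun a => ps a * kpL2 (gam c a))).
- exact: measurable_kcm.
- exact: measurable_ps_gam measurable_kpL2.
- by move=> a; rewrite mulr_ge0 ?ps_ge0// ltW.
- move=> a x /eqP; rewrite mulf_eq0 (gt_eqF (p0 a)) orbF => /eqP h.
  by rewrite /kcm/= h mul0r.
- move=> a; rewrite /kcm/= sqnZ; last exact: measurable_kp.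
  rewrite [in leRHS]exprMn [leRHS]EFinM; apply: lee_wpmul2l; first by rewrite lee_fin sqr_ge0.
  by apply: sqn_kp_le; exact: gam_gt0.
- rewrite fineK// ge0_fin_numE ?integral_kpL2_lty//.
  by apply: integral_ge0 => a _; rewrite lee_fin mulr_ge0 ?ps_ge0// ltW.
Qed.

Lemma cv_kc_gs b : 0 < b -> cv (kc j c) (gs b) = kc j (gam c b).
Proof.
move=> b0; apply/funext => x.
have mg := measurable_gs b : measurable_fun [set: E] _.
rewrite (mix_cv (measurable_kcm j c) mg).
  apply: eq_Rintegral => a _; rewrite /kcm/= /cv.
  under eq_Rintegral do rewrite -mulrA.
  have mk := measurable_kp j (gam c a) : measurable_fun [set: E] _.
  rewrite Rintegral_measurableZl; last first.
    by apply: measurable_funM => //; exact: measurable_subl.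
  congr (_ * _); rewrite -/(cv _ _ x) cvC// cv_gs_kp ?gam_gt0//.
  by rewrite /gam !sqr_sqrtr ?addr_ge0 ?sqr_ge0// addrCA.
apply: (@le_lt_trans _ _ (\int[leb]_a (ps a * kpsup (gam c a))%:E)%E); last first.
  by rewrite integral_kcsup ltry.
pose H (z : R * E) := kcm j c (z.1, x - z.2) * gs b z.2.
have mH : measurable_fun setT (fun z => (`|H z|)%:E).
  apply/measurable_EFinP; apply: measurableT_comp => //; apply: measurable_funM; last first.
    exact: measurableT_comp mg measurable_snd.
  apply: (measurableT_comp (measurable_kcm j c)); apply/measurable_fun_pair => //=.
  exact: measurableT_comp (measurable_rV_subl x) measurable_snd.
apply: ge0_le_integral => //.
- by move=> a _; exact: integral_ge0.
- exact: (measurable_fun_fubini_tonelli_F (m2 := mu) (fun z => (`|H z|)%:E)).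
- by apply/measurable_EFinP; exact: measurable_ps_gam measurable_kpsup.
- move=> a _; rewrite -[leRHS]mule1 -(@integral_gs R d _ b0) -ge0_integralZl_EFin//; last 3 first.
  + by move=> y _; rewrite lee_fin gs_ge0.
  + exact/measurable_EFinP.
  + by rewrite mulr_ge0 ?ps_ge0 ?kpsup_ge0// gam_gt0.
  apply: ge0_le_integral => //.
  + exact: (measurable_fun_pair2 a mH).
  + by apply: measurable_funeM; exact/measurable_EFinP.
  + move=> y _; rewrite -EFinM lee_fin /H/= normrM [X in _ * X]ger0_norm ?gs_ge0//.
    by rewrite ler_wpM2r ?gs_ge0// kcm_le.
Qed.

End bounds.

End heat_riesz_kernel.

(** * Autocorrelations and the L^2 bound of the regularised operators *)

Section plane_polar.
Context {R : realType}.
Local Notation leb := (@lebesgue_measure R).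

Lemma Rintegral_scale (s : R) (f : R -> R) : 0 < s -> measurable_fun setT f ->
  (\int[leb]_x f (s * x))%R = s^-1 * (\int[leb]_x f x)%R.
Proof.
move=> s0 mf; rewrite /Rintegral [in LHS]integralE [in RHS]integralE.
have mEf : measurable_fun setT (EFin \o f) by exact/measurable_EFinP.
have hp : (\int[leb]_x (EFin \o (fun x => f (s * x)%R))^\+ x =
    (s^-1)%:E * \int[leb]_x (EFin \o f)^\+ x)%E.
  rewrite -(ge0_integral_scale s0 (f := (EFin \o f)^\+%E))//.
  - by apply: eq_integral => x _; rewrite !funeposE.
  - exact: measurable_funepos.
have hn : (\int[leb]_x (EFin \o (fun x => f (s * x)%R))^\- x =
    (s^-1)%:E * \int[leb]_x (EFin \o f)^\- x)%E.
  rewrite -(ge0_integral_scale s0 (f := (EFin \o f)^\-%E))//.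
  - by apply: eq_integral => x _; rewrite !funenegE.
  - exact: measurable_funeneg.
rewrite hp hn; have c0 : 0 < s^-1 by rewrite invr_gt0.
set a := (\int[_]_x _)%E; set a' := (\int[_]_x _)%E.
have p0 : (0 <= a)%E by exact: integral_ge0.
have p'0 : (0 <= a')%E by exact: integral_ge0.
by case: a p0 => [p| |]// _; case: a' p'0 => [p'| |]// _;
  rewrite ?gt0_muley ?lte_fin//= ?mulr0// mulrBr.
Qed.

(** The angle pi / 2 of the quarter plane, with the tangent of the angle as variable. *)
Definition cpolar : R := (\int[leb]_w (ps w * (1 + w ^+ 2)^-1))%R.

Lemma cpolar_finite : (\int[leb]_w (ps w * (1 + w ^+ 2)^-1)%:E < +oo)%E.
Proof.
have m1 : measurable_fun setT (fun w : R => (1 + w ^+ 2)^-1).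
  by apply: (measurableT_comp measurable_inv); apply: measurable_funD.
apply: (@integral_ps_lty _ _ 1) => //.
- by move=> a _; rewrite invr_ge0 addr_ge0// sqr_ge0.
- by move=> a _; rewrite invf_le1 ?ltr_pwDl ?sqr_ge0// lerDl sqr_ge0.
- move=> a a1; have a0 := lt_le_trans ltr01 a1.
  rewrite div1r lef_pV2 ?posrE ?mulr_gt0 ?sqrtr_gt0 ?ltr_pwDl ?sqr_ge0//.
  apply: (@le_trans _ _ (a ^+ 2)); last by rewrite lerDr.
  rewrite expr2 ler_pM2l// -[leRHS](sqr_sqrtr (ltW a0)) expr2 ler_peMl ?sqrtr_ge0//.
  by rewrite -sqrtr1 ler_wsqrtr.
Qed.

Lemma cpolar_ge0 : 0 <= cpolar.
Proof. by apply: Rintegral_ge0 => w _; rewrite mulr_ge0 ?ps_ge0// invr_ge0 addr_ge0// sqr_ge0. Qed.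

Lemma Rpolar_plane (q : R -> R) : measurable_fun setT q ->
  (\int[leb]_r (ps r * (r * `|q r|))%:E < +oo)%E ->
  (\int[leb]_a (ps a * \int[leb]_b (ps b * q (Num.sqrt (a ^+ 2 + b ^+ 2)))))%R =
  cpolar * (\int[leb]_r (ps r * (r * q r)))%R.
Proof.
move=> mq qlt.
have m1 : measurable_fun setT (fun z : R * R => z.1) by exact: measurable_fst.
have m2 : measurable_fun setT (fun z : R * R => z.2) by exact: measurable_snd.
have mps := measurable_ps (R := R).
pose s (w : R) := Num.sqrt (1 + w ^+ 2).
have ms : measurable_fun setT s.
  by apply: (measurableT_comp measurable_sqrt); exact: measurable_funD.
have s2 w : s w ^+ 2 = 1 + w ^+ 2 by rewrite sqr_sqrtr// addr_ge0// sqr_ge0.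
have s0 w : 0 < s w by rewrite sqrtr_gt0 ltr_pwDl// sqr_ge0.
pose Q (q : R -> R) (r : R) := ps r * (r * q r).
have mQ p : measurable_fun setT p -> measurable_fun setT (Q p).
  by move=> mp; apply: measurable_funM => //; exact: measurable_funM.
(* The integrand after b = a w, expressed through r p(r) at r = a sqrt (1 + w^2); integrating in a
   then splits off the factor 1 / (1 + w^2). *)
pose h (p : R -> R) (z : R * R) := ps z.2 * (s z.2)^-1 * Q p (s z.2 * z.1).
have mh p : measurable_fun setT p -> measurable_fun setT (h p).
  move=> mp; apply: measurable_funM.
    apply: measurable_funM; first exact: measurableT_comp mps m2.
    by apply: (measurableT_comp measurable_inv); exact: measurableT_comp ms m2.
  apply: measurableT_comp; first exact: mQ.
  by apply: measurable_funM => //; exact: measurableT_comp ms m2.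
have habs z : `|h q z| = h (fun r => `|q r|) z.
  rewrite /h /Q normrM ger0_norm ?mulr_ge0 ?ps_ge0 ?invr_ge0 ?(ltW (s0 _))//; congr (_ * _).
  have [r0|r0] := leP (s z.2 * z.1) 0; first by rewrite ps_le0// !mul0r normr0.
  by rewrite ps_gt0// !mul1r normrM gtr0_norm.
have hE p a : measurable_fun setT p ->
    ps a * (\int[leb]_b (ps b * p (Num.sqrt (a ^+ 2 + b ^+ 2))))%R =
    (\int[leb]_w h p (a, w))%R.
  move=> mp; have [a0|a0] := leP a 0.
    rewrite ps_le0// mul0r; under eq_Rintegral => w _ do rewrite /h/= /Q (ps_le0 (a := s w * a)) ?pmulr_rle0// mul0r mulr0.
    by rewrite Rintegral_cst ?mul0r.
  pose g b := ps b * p (Num.sqrt (a ^+ 2 + b ^+ 2)).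
  have mg : measurable_fun setT g.
    apply: measurable_funM => //; apply: (measurableT_comp mp).
    by apply: (measurableT_comp measurable_sqrt); apply: measurable_funD => //; exact: measurable_funX.
  rewrite (ps_gt0 a0) mul1r -/g.
  transitivity (a * (\int[leb]_x g (a * x))%R).
    by rewrite Rintegral_scale// mulrA divff ?mul1r// gt_eqF.
  rewrite -Rintegral_measurableZl; last first.
    by apply: (measurableT_comp mg); exact: measurable_funM.
  apply: eq_Rintegral => w _; rewrite /g /h/= /Q ps_scale// (ps_gt0 (mulr_gt0 (s0 w) a0)) mul1r.
  have -> : a ^+ 2 + (a * w) ^+ 2 = (a * s w) ^+ 2 by rewrite [in RHS]exprMn s2; ring.
  rewrite sqrtr_sqr ger0_norm; last by rewrite ltW// mulr_gt0.
  rewrite [a * s w]mulrC !mulrA; congr (_ * p _); rewrite mulrC -!mulrA; congr (_ * _).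
  by rewrite mulrA mulVf ?mul1r// gt_eqF.
have hw p w : measurable_fun setT p ->
    (\int[leb]_a h p (a, w))%R = ps w * (1 + w ^+ 2)^-1 * (\int[leb]_r Q p r)%R.
  move=> mp; rewrite /h/= Rintegral_measurableZl; last first.
    by apply: (measurableT_comp (mQ _ mp)); exact: measurable_funM.
  rewrite Rintegral_scale//; last exact: mQ.
  by rewrite -s2 expr2 invfM; ring.
have hlt : (\int[leb]_a \int[leb]_w (`|h q (a, w)|)%:E < +oo)%E.
  pose q' r := `|q r|.
  have mq' : measurable_fun setT q' by exact: measurableT_comp mq.
  have Q0 r : 0 <= Q q' r.
    rewrite /Q; have [r0|r0] := leP r 0; first by rewrite ps_le0// mul0r.
    by rewrite mulr_ge0 ?ps_ge0// mulr_ge0 ?(ltW r0)// normr_ge0.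
  have h0 z : 0 <= h q' z.
    by rewrite mulr_ge0// mulr_ge0 ?ps_ge0// invr_ge0 ltW.
  have mh' : measurable_fun setT (fun z => (h q' z)%:E) by apply/measurable_EFinP; exact: mh.
  under eq_integral do under eq_integral do rewrite habs.
  rewrite (@fubini_tonelli _ _ _ _ _ leb leb (fun z => (h q' z)%:E))//.
  have -> : (\int[leb]_w \int[leb]_a (h q' (a, w))%:E =
     \int[leb]_w ((ps w * (1 + w ^+ 2)^-1)%:E * \int[leb]_r (Q q' r)%:E))%E.
    apply: eq_integral => w _; rewrite /h/=.
    under eq_integral do rewrite EFinM.
    rewrite ge0_integralZl_EFin//; last 3 first.
    - by move=> x _; rewrite lee_fin.
    - apply/measurable_EFinP; apply: (measurableT_comp (mQ _ mq')).
      exact: measurable_funM.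
    - by rewrite mulr_ge0 ?ps_ge0// invr_ge0 ltW.
    rewrite (ge0_integral_scale (s0 w) (f := fun r => (Q q' r)%:E))//; last first.
      by apply/measurable_EFinP; exact: mQ.
    by rewrite muleA -EFinM -mulrA -invfM -expr2 s2.
  rewrite -(fineK (x := (\int[leb]_r (Q q' r)%:E)%E)); last first.
    by rewrite ge0_fin_numE//; apply: integral_ge0 => r _; rewrite lee_fin.
  rewrite ge0_integralZr//; last 3 first.
  - apply/measurable_EFinP; apply: measurable_funM => //.
    by apply: (measurableT_comp measurable_inv); exact: measurable_funD.
  - by move=> w _; rewrite lee_fin mulr_ge0 ?ps_ge0// invr_ge0 addr_ge0// sqr_ge0.
  - by rewrite lee_fin fine_ge0// integral_ge0// => r _; rewrite lee_fin.
  apply: lte_mul_pinfty.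
  - by apply: integral_ge0 => w _; rewrite lee_fin mulr_ge0 ?ps_ge0// invr_ge0 addr_ge0// sqr_ge0.
  - rewrite ge0_fin_numE ?cpolar_finite//.
    by apply: integral_ge0 => w _; rewrite lee_fin mulr_ge0 ?ps_ge0// invr_ge0 addr_ge0// sqr_ge0.
  - exact: ltry.
transitivity (\int[leb]_a \int[leb]_w h q (a, w))%R.
  by apply: eq_Rintegral => a _; rewrite hE.
rewrite (@Rintegral_fubini _ _ _ _ _ leb leb (h q) (mh q mq) hlt).
have m3 : measurable_fun setT (fun w : R => ps w * (1 + w ^+ 2)^-1).
  apply: measurable_funM => //; apply: (measurableT_comp measurable_inv).
  exact: measurable_funD.
transitivity (\int[leb]_w ((\int[leb]_r Q q r)%R * (ps w * (1 + w ^+ 2)^-1)))%R.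
  by apply: eq_Rintegral => w _; rewrite hw// mulrC.
by rewrite [RHS]mulrC; exact: (Rintegral_measurableZl leb _ m3).
Qed.

End plane_polar.

Section gs_radius.
Context {R : realType} {d : nat}.
Local Notation E := 'rV[R]_d.
Local Notation leb := (@lebesgue_measure R).

(** The derivative is a / 2 times the Laplacian of [gs a] at x: the heat equation in the time a^2 /
    4. *)
Lemma is_derive_gs (a : R) (x : E) : 0 < a ->
  is_derive a 1 (fun a => gs a x) (gs a x * (2 * nsq x / a ^+ 3 - d%:R / a)).
Proof.
move=> a0; have p0 := @sqrtpi_gt0 R.
have h1 : is_derive a 1 (fun a : R => (a * Num.sqrt pi) ^+ d)
   (d%:R * (a * Num.sqrt pi) ^+ d.-1 * Num.sqrt pi).
  have hm : is_derive a 1 (fun a : R => a * Num.sqrt pi) (Num.sqrt pi).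
    have h2 : is_derive a 1 (fun a : R => a * Num.sqrt pi) _ := is_deriveM (is_derive_id a 1) (is_derive_cst (Num.sqrt pi) a 1).
    by apply: (is_derive_eq h2); rewrite scaler0 add0r /GRing.scale/= mulr1.
  have h2 := is_deriveX d hm; rewrite exprfctE in h2.
  by apply: (is_derive_eq h2); rewrite /GRing.scale/=.
have h1' : is_derive a 1 (fun a : R => (a * Num.sqrt pi) ^- d) _ :=
  is_deriveV (f := fun a : R => (a * Num.sqrt pi) ^+ d) (x := a) (lt0r_neq0 (exprn_gt0 d (mulr_gt0 a0 p0))) h1.
have h3 : is_derive a 1 (fun a : R => a ^+ 2) _ := is_deriveX 2 (is_derive_id a 1).
have h4 : is_derive a 1 (fun a : R => (a ^+ 2)^-1) _ := is_deriveV (f := fun a : R => a ^+ 2) (x := a) (lt0r_neq0 (exprn_gt0 2 a0)) h3.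
have h5 : is_derive a 1 (fun a : R => - nsq x * (a ^+ 2)^-1) _ := is_deriveZ (- nsq x) h4.
have h6 : is_derive a 1 (fun a : R => expR (- nsq x * (a ^+ 2)^-1)) _ :=
  is_derive1_comp (is_derive_expR _) h5.
have h7 : is_derive a 1 (fun a : R => (a * Num.sqrt pi) ^- d * expR (- nsq x * (a ^+ 2)^-1)) _ :=
  is_deriveM h1' h6.
have -> : (fun a : R => gs a x) = (fun a : R => (a * Num.sqrt pi) ^- d * expR (- nsq x * (a ^+ 2)^-1)).
  by apply/funext => b; rewrite /gs mulNr.
apply: (is_derive_eq h7); rewrite /GRing.scale/= /gs mulNr.
move: (nsq x) => N; set e := expR _; have a1 := lt0r_neq0 a0; have p1 := lt0r_neq0 p0.
case: (d) => [|n]; first by rewrite expr0 invr1; field.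
rewrite !exprS/=; set w := (a * Num.sqrt pi) ^+ n.
have w0 : w != 0 by rewrite expf_neq0// mulf_neq0.
by rewrite -natr1; field; rewrite ?a1 ?p1 ?w0.
Qed.
End gs_radius.

Section radial_moment.
Context {R : realType} {d : nat}.
Local Notation E := 'rV[R]_d.
Local Notation leb := (@lebesgue_measure R).
Variables (e : R) (x : E).
Hypotheses (e0 : 0 < e) (d0 : (0 < d)%N).

Let G r := gs (gam e r) x.

(** The Laplacian of the Gaussian of width [gam e r] at x. *)
Definition lapl_radial (r : R) : R :=
  (4 * nsq x / gam e r ^+ 4 - 2 * d%:R / gam e r ^+ 2) * gs (gam e r) x.

Let q := lapl_radial.

Let s0 r : 0 < gam e r := gam_gt0 r e0.

Let dgam (r : R) : is_derive r 1 (gam e) (r / gam e r).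
Proof.
have u0 : 0 < r ^+ 2 + e ^+ 2 by rewrite ltr_wpDl ?sqr_ge0// exprn_gt0.
have h1 : is_derive r 1 (fun r : R => r ^+ 2 + e ^+ 2) _ :=
  is_deriveD (is_deriveX 2 (is_derive_id r 1)) (is_derive_cst (e ^+ 2) r 1).
have h2 : is_derive r 1 (gam e) _ :=
  is_derive1_comp (g := fun r => r ^+ 2 + e ^+ 2) (x := r) (is_derive1_sqrt u0) h1.
apply: (is_derive_eq h2); rewrite -/(gam e r) /GRing.scale/=.
by have s1 := lt0r_neq0 (s0 r); field.
Qed.

Let dG (r : R) : is_derive r 1 G (2^-1 * (r * q r)).
Proof.
have h2 := dgam r.
have h3 : is_derive r 1 G _ := is_derive1_comp (g := gam e) (x := r) (is_derive_gs x (s0 r)) h2.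
apply: (is_derive_eq h3); rewrite /q /lapl_radial -/(gam e r).
have s1 := lt0r_neq0 (s0 r); rewrite /GRing.scale/=.
by field.
Qed.

Let cG (r : R) : {for r, continuous G}.
Proof. by apply: differentiable_continuous; apply/derivable1_diffP; exact: ex_derive. Qed.

Let cq (r : R) : {for r, continuous (fun u : R => u * q u)}.
Proof.
have cg : {for r, continuous (gam e)}.
  apply: differentiable_continuous; apply/derivable1_diffP.
  have h2 := dgam r.
  exact: ex_derive.
have cX n : {for r, continuous (fun u : R => gam e u ^+ n)}.
  by apply: (@continuous_comp _ _ _ (gam e) (fun u : R => u ^+ n)) => //; exact: exprn_continuous.
apply: cvgM; first exact: cvg_id.
apply: cvgM; last exact: cG.
by apply: cvgB; apply: cvgM; first [exact: cvg_cst|apply: cvgV; [rewrite expf_neq0// gt_eqF|exact: cX]].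
Qed.

Lemma measurable_lapl_radial : measurable_fun setT lapl_radial.
Proof.
apply: measurable_funM; last exact: measurable_gs_joint (measurable_gam e) (measurable_cst x).
apply: measurable_funB; apply: measurable_funM => //; apply: (measurableT_comp measurable_inv);
  apply: measurable_funX; exact: measurable_gam.
Qed.

Let mq := measurable_lapl_radial.

Let q_le r : `|q r| <= (4 * nsq x / gam e r ^+ 4 + 2 * d%:R / gam e r ^+ 2) * (gam e r * Num.sqrt pi) ^- d.
Proof.
rewrite normrM; apply: ler_pM => //; last by rewrite ger0_norm ?gs_ge0// gs_le.
apply: le_trans (ler_normB _ _) _.
by rewrite !ger0_norm ?mulr_ge0 ?nsq_ge0 ?invr_ge0 ?exprn_ge0 ?(ltW (s0 r)).
Qed.

Lemma lapl_radial_lty : (\int[leb]_r (ps r * (r * `|lapl_radial r|))%:E < +oo)%E.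
Proof.
have p0 := @sqrtpi_gt0 R; have N0 := nsq_ge0 x.
pose A := (4 * nsq x / e ^+ 4 + 2 * d%:R / e ^+ 2) * (e * Num.sqrt pi) ^- d.
pose B := (4 * nsq x + 2 * d%:R) * (1 * Num.sqrt pi) ^- d.
have A0 : 0 <= A.
  by rewrite mulr_ge0 ?addr_ge0 ?mulr_ge0 ?invr_ge0 ?exprn_ge0 ?mulr_ge0 ?(ltW p0) ?(ltW e0).
have B0 : 0 <= B by rewrite mulr_ge0 ?addr_ge0 ?mulr_ge0 ?invr_ge0 ?exprn_ge0 ?mulr_ge0 ?(ltW p0).
apply: (@integral_ps_lty _ _ (A + B)).
- by apply: measurable_funM => //; exact: measurableT_comp mq.
- by move=> a a0; rewrite mulr_ge0// ltW.
- move=> a /andP[a0 a1]; apply: (@le_trans _ _ A); last by rewrite lerDl.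
  apply: le_trans (_ : 1 * `|q a| <= _); first by rewrite ler_wpM2r.
  rewrite mul1r; apply: le_trans (q_le a) _; have es : e <= gam e a := gam_ger a (ltW e0).
  have i n : (gam e a ^+ n)^-1 <= (e ^+ n)^-1.
    by rewrite lef_pV2 ?posrE ?exprn_gt0// lerXn2r// nnegrE ltW.
  apply: ler_pM.
  + by rewrite addr_ge0// !mulr_ge0// invr_ge0 exprn_ge0// ltW.
  + by rewrite invr_ge0 exprn_ge0// mulr_ge0// ltW.
  + by apply: lerD; apply: ler_wpM2l (i _); rewrite mulr_ge0.
  + exact: gs_norm_le.
- move=> a a1; have a0 := lt_le_trans ltr01 a1.
  apply: (@le_trans _ _ (B / (a * Num.sqrt a))); last first.
    by rewrite ler_wpM2r ?lerDr// invr_ge0 mulr_ge0 ?sqrtr_ge0// ltW.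
  have as_ : a <= gam e a := gam_gel e (ltW a0).
  apply: le_trans (ler_wpM2l (ltW a0) (q_le a)) _.
  have i n : (1 < n)%N -> (gam e a ^+ n)^-1 <= (a ^+ 2)^-1.
    move=> n1; rewrite lef_pV2 ?posrE ?exprn_gt0//.
    apply: (@le_trans _ _ (a ^+ n)); first by rewrite ler_weXn2l.
    by rewrite lerXn2r// nnegrE ltW.
  have h1 : 4 * nsq x / gam e a ^+ 4 + 2 * d%:R / gam e a ^+ 2 <= (4 * nsq x + 2 * d%:R) / a ^+ 2.
    by rewrite [leRHS]mulrDl; apply: lerD; apply: ler_wpM2l (i _ _) => //; rewrite mulr_ge0.
  have h2 : (gam e a * Num.sqrt pi) ^- d <= (1 * Num.sqrt pi) ^- d / a.
    apply: le_trans (gs_norm_le a0 as_) _.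
    rewrite mul1r exprMn invfM mulrC ler_pM2l ?invr_gt0 ?exprn_gt0//.
    rewrite lef_pV2 ?posrE ?exprn_gt0//.
    by case: (d) d0 => // n _; rewrite exprS ler_peMr ?(ltW a0)// exprn_ege1.
  apply: (@le_trans _ _ (a * ((4 * nsq x + 2 * d%:R) / a ^+ 2 * ((1 * Num.sqrt pi) ^- d / a)))).
    rewrite ler_pM2l//; apply: ler_pM h1 h2.
      by rewrite addr_ge0// !mulr_ge0// invr_ge0 exprn_ge0// ltW.
    by rewrite invr_ge0 exprn_ge0// mulr_ge0// ltW.
  have -> : a * ((4 * nsq x + 2 * d%:R) / a ^+ 2 * ((1 * Num.sqrt pi) ^- d / a)) = B * (a * a)^-1.
    by rewrite /B; field; rewrite ?gt_eqF// exprn_gt0// mul1r.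
  rewrite ler_wpM2l// lef_pV2 ?posrE ?mulr_gt0 ?sqrtr_gt0// ler_pM2l//.
  rewrite -[leRHS](sqr_sqrtr (ltW a0)) expr2 ler_peMl ?sqrtr_ge0//.
  by rewrite -sqrtr1 ler_wsqrtr.
Qed.

(** By the heat equation the integrand is the derivative of 2 [gs (gam e r) x] in r. That function
    tends to 0 at infinity, and at r = 0 the width is e. *)
Lemma lapl_radial_moment :
  (\int[leb]_r (ps r * (r * lapl_radial r)))%R = - (2 * gs e x).
Proof.
have p0 := @sqrtpi_gt0 R.
pose f r := ps r * (r * q r).
have mf : measurable_fun setT f.
  by apply: measurable_funM; [exact: measurable_ps|exact: measurable_funM].
pose fn n r : R := \1_(`[0, n%:R]%classic : set R) r * f r.
have mfn n : measurable_fun setT (fn n).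
  by apply: measurable_funM => //; exact: measurable_indic.
have fE r : `|f r| = ps r * (r * `|q r|).
  rewrite normrM ger0_norm ?ps_ge0//; have [r0|r0] := leP r 0; first by rewrite ps_le0// !mul0r.
  by rewrite normrM [`|r|]gtr0_norm.
have intf : leb.-integrable setT (EFin \o (fun r => `|f r|)).
  apply/integrable_ltyP; first exact: measurableT_comp.
  by under eq_integral do rewrite normr_id fE; exact: lapl_radial_lty.
have c1 : (\int[leb]_r fn n r)%R @[n --> \oo] --> (\int[leb]_r f r)%R.
  apply: (@cvg_Rintegral _ _ _ leb fn f (fun r => `|f r|) mfn mf _ intf).
  - apply: aeW => r; apply/cvgrPdist_lt => ep ep0; near=> n.
    rewrite /fn; have [r0|r0] := leP r 0.
      by rewrite /f ps_le0// mul0r mulr0 subrr normr0.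
    rewrite indicE mem_set ?mul1r ?subrr ?normr0//= in_itv/= (ltW r0)/=.
    by near: n; exact: nbhs_infty_ger.
  - apply: aeW => r n; rewrite /fn normrM indicE.
    by case: (_ \in _); rewrite ?normr1 ?normr0 ?mul1r ?mul0r.
have c2 n : (\int[leb]_r fn n r)%R = 2 * G n%:R - 2 * gs e x.
  have -> : (\int[leb]_r fn n r)%R = fine (\int[leb]_(r in `[0%R, (n%:R)%R]) (r * q r)%:E)%E.
    rewrite /Rintegral [in RHS]integral_mkcond; congr fine; apply: eq_integral => r _.
    rewrite patchE /fn indicE; case: ifPn => [|_]; last by rewrite mul0r.
    rewrite inE/= in_itv/= mul1r /f => /andP[r0 _].
    have [r1|r1] := leP r 0; last by rewrite ps_gt0// mul1r.
    by have -> : r = 0 by [apply/eqP; rewrite eq_le r0 r1]; rewrite !mul0r mulr0.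
  have -> : (\int[leb]_(r in `[0%R, (n%:R)%R]) (r * q r)%:E = (2 * G n%:R - 2 * G 0)%R%:E)%E.
    apply: (@integral_ftc _ (fun r => 2 * G r)) => //.
    move=> r _; have h : is_derive r 1 (fun r => 2 * G r) _ := is_deriveZ 2 (dG r).
    by apply: (is_derive_eq h); rewrite /GRing.scale/= mulrA divff// mul1r.
  rewrite /= /G; congr (_ - 2 * gs _ _).
  by rewrite /gam expr0n add0r sqrtr_sqr ger0_norm// ltW.
have c3 : G n%:R @[n --> \oo] --> 0.
  apply: (@squeeze_cvgr _ _ _ _ (fun=> 0) (fun n : nat => (Num.sqrt pi) ^- d * n%:R^-1)).
  - near=> n; rewrite gs_ge0//=.
    have n0 : (0 < n)%N by near: n; exact: nbhs_infty_gt.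
    have n0' : 0 < n%:R :> R by rewrite ltr0n.
    apply: le_trans (gs_le _ (s0 _)) _.
    apply: le_trans (gs_norm_le n0' (gam_gel e (ltW n0'))) _.
    rewrite exprMn invfM mulrC ler_pM2l ?invr_gt0 ?exprn_gt0// lef_pV2 ?posrE ?exprn_gt0//.
    case: (d) d0 => // m _; rewrite exprS ler_peMr// exprn_ege1//.
    by rewrite ler1n.
  - exact: cvg_cst.
  - rewrite -[X in _ --> X](mulr0 ((Num.sqrt pi) ^- d)); apply: cvgMr.
    by rewrite -(cvg_shiftS (fun n : nat => n%:R^-1 : R)); exact: cvg_harmonic.
have c4 : (\int[leb]_r fn n r)%R @[n --> \oo] --> 2 * 0 - 2 * gs e x.
  under eq_fun do rewrite c2.
  by apply: cvgB; [exact: cvgMr|exact: cvg_cst].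
by have := cvg_unique _ c1 c4; rewrite mulr0 sub0r; apply.
Unshelve. all: by end_near.
Qed.

End radial_moment.

Lemma le_EFin_sqr (R : realType) (X : \bar R) (y : R) : 0 <= y -> (0 <= X)%E ->
  (X ^+ 2 <= (y ^+ 2)%:E)%E -> (X <= y%:E)%E.
Proof.
move=> y0; case: X => [r||]; last by rewrite leeNy_eq.
  by rewrite !lee_fin => r0; rewrite -/(r ^+ 2) ler_sqr.
by rewrite expe2 mulyy leye_eq.
Qed.

Lemma integrable_bounded d (T : measurableType d) (R : realType)
    (m : {measure set T -> \bar R}) (f g : T -> R) (M : R) :
  m.-integrable setT (EFin \o f) -> measurable_fun setT g -> (forall x, `|g x| <= M) ->
  m.-integrable setT (EFin \o (fun x => f x * g x)).
Proof.
move=> intf mg gM; have mf : measurable_fun setT f.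
  by apply/measurable_EFinP; exact: measurable_int intf.
apply: (@integrable_le _ _ _ _ _ (fun x => M * `|f x|)).
- exact: measurable_funM.
- apply: integrable_realZl; apply/integrable_ltyP; first exact: measurableT_comp.
  by under eq_integral do rewrite normr_id; exact/integrable_ltyP.
- by move=> x; rewrite normrM mulrC ler_wpM2r.
Qed.

Section convolution_bounds.
Context {R : realType} {d : nat}.
Local Notation E := 'rV[R]_d.
Local Notation mu := (@lebesgue_rV R d).
Implicit Types f g h : E -> R.

Lemma cv_holder f g (A B : R) : 0 <= A -> 0 <= B ->
  measurable_fun setT f -> measurable_fun setT g ->
  (sqn mu f <= (A ^+ 2)%:E)%E -> (sqn mu g <= (B ^+ 2)%:E)%E ->
  forall x, (\int[mu]_y (`|f (x - y) * g y|)%:E <= (A * B)%:E)%E.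
Proof.
move=> A0 B0 mf mg fA gB x; apply: le_EFin_sqr; first exact: mulr_ge0.
  exact: integral_ge0.
apply: le_trans (cauchy_schwarz mu (measurable_subl x mf) mg) _.
rewrite sqn_subl// exprMn EFinM; apply: lee_pmul => //; exact: sqn_ge0.
Qed.

Lemma L2r_bound f : L2r mu f -> exists2 A, 0 <= A & (sqn mu f <= (A ^+ 2)%:E)%E.
Proof.
move=> hf; exists (Num.sqrt (fine (sqn mu f))); first exact: sqrtr_ge0.
by rewrite sqr_sqrtr ?fine_ge0 ?sqn_ge0// fineK// L2r_fin_num.
Qed.

Lemma cv_le f g (A B : R) : 0 <= A -> 0 <= B ->
  measurable_fun setT f -> measurable_fun setT g ->
  (sqn mu f <= (A ^+ 2)%:E)%E -> (sqn mu g <= (B ^+ 2)%:E)%E ->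
  forall x, `|cv f g x| <= A * B.
Proof.
move=> A0 B0 mf mg fA gB x; apply: le_normr_Rintegral_fin; last exact: cv_holder.
by apply: measurable_funM => //; exact: measurable_subl.
Qed.

Lemma fine_sqn f : fine (sqn mu f) = (\int[mu]_x (f x * f x))%R.
Proof. by rewrite /sqn /Rintegral; congr fine; apply: eq_integral => x _; rewrite expr2. Qed.

Lemma integrable_subl f x : mu.-integrable setT (EFin \o f) ->
  mu.-integrable setT (EFin \o (fun y => f (x - y))).
Proof.
move=> intf; have mf : measurable_fun setT f.
  by apply/measurable_EFinP; exact: measurable_int intf.
apply/integrable_ltyP; first exact: measurable_subl.
rewrite (ge0_integral_rV_subl x (f := fun y => (`|f y|)%:E))//.
  exact/integrable_ltyP.
by apply/measurable_EFinP; exact: measurableT_comp.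
Qed.

(** The reflection of the odd kernel produces the sign. Fubini applies because |k| * |h| is bounded
    and [g] is integrable. *)
Lemma cv_adjoint_odd k g h : L2r mu k -> L2r mu h -> (forall x, k (- x) = - k x) ->
  mu.-integrable setT (EFin \o g) ->
  (\int[mu]_x (cv k g x * h x))%R = - (\int[mu]_y (g y * cv k h y))%R.
Proof.
move=> hk hh kN intg; have [mk _] := hk; have [mh _] := hh.
have mg : measurable_fun setT g by apply/measurable_EFinP; exact: measurable_int intg.
have [A A0 kA] := L2r_bound hk; have [B B0 hB] := L2r_bound hh.
pose H (z : E * E) := g z.1 * (k (z.2 - z.1) * h z.2).
have mH : measurable_fun setT H.
  apply: measurable_funM; first exact: measurableT_comp mg measurable_fst.
  apply: measurable_funM; last exact: measurableT_comp mh measurable_snd.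
  have ms : measurable_fun setT (fun z : E * E => (z.2, z.1)).
    by apply/measurable_fun_pair.
  exact: measurableT_comp mk (measurableT_comp measurable_rV_sub ms).
have kE y : (\int[mu]_x H (y, x))%R = - (g y * cv k h y).
  rewrite /H/= Rintegral_measurableZl; last first.
    by apply: measurable_funM => //; exact: (measurableT_comp mk (measurable_rV_subr y)).
  transitivity (g y * (\int[mu]_x (-1 * (k (y - x) * h x)))%R).
    congr (_ * _); apply: eq_Rintegral => x _; rewrite -(opprB x y) kN; ring.
  have m1 : measurable_fun setT (fun x : E => k (y - x) * h x).
    by apply: measurable_funM => //; exact: measurable_subl.
  by have /= -> := Rintegral_measurableZl mu (-1) m1; rewrite mulN1r mulrN.
have Hlt : (\int[mu]_y \int[mu]_x (`|H (y, x)|)%:E < +oo)%E.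
  apply: (@le_lt_trans _ _ (\int[mu]_y ((A * B)%:E * (`|g y|)%:E))%E).
    have mH' : measurable_fun setT (fun z => (`|H z|)%:E).
      by apply/measurable_EFinP; exact: measurableT_comp.
    apply: ge0_le_integral => //.
    - by move=> y _; exact: integral_ge0.
    - exact: (measurable_fun_fubini_tonelli_F (m2 := mu) (fun z => (`|H z|)%:E)).
    - by apply: measurable_funeM; apply/measurable_EFinP; exact: measurableT_comp.
    - move=> y _; rewrite /H/=; under eq_integral do rewrite normrM EFinM.
      have mkh : measurable_fun setT (fun x : E => k (x - y) * h x).
        by apply: measurable_funM => //; exact: (measurableT_comp mk (measurable_rV_subr y)).
      rewrite ge0_integralZl_EFin//; last first.
        by apply/measurable_EFinP; exact: measurableT_comp.
      rewrite muleC; apply: lee_wpmul2r; first by rewrite lee_fin.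
      apply: le_trans (cv_holder A0 B0 mk mh kA hB y).
      rewrite le_eqVlt; apply/orP; left; apply/eqP; apply: eq_integral => x _.
      by rewrite -(opprB x y) kN mulNr normrN.
  rewrite ge0_integralZl_EFin ?mulr_ge0//; last first.
    by apply/measurable_EFinP; exact: measurableT_comp.
  apply: lte_mul_pinfty; rewrite ?lee_fin ?mulr_ge0//.
  exact/integrable_ltyP.
transitivity (\int[mu]_x \int[mu]_y H (y, x))%R.
  apply: eq_Rintegral => x _; rewrite mulrC /cv -Rintegral_measurableZl; last first.
    by apply: measurable_funM => //; exact: measurable_subl.
  by apply: eq_Rintegral => y _; rewrite /H/=; ring.
rewrite -(Rintegral_fubini mH Hlt); under eq_Rintegral do rewrite kE -mulN1r.
rewrite Rintegral_measurableZl ?mulN1r//.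
by apply: measurable_funM => //; exact: measurable_cv.
Qed.

End convolution_bounds.

Section heat_riesz_bound.
Context {R : realType} {d : nat}.
Local Notation E := 'rV[R]_d.
Local Notation mu := (@lebesgue_rV R d).
Local Notation leb := (@lebesgue_measure R).
Implicit Types f g : E -> R.

Lemma kcN (j : 'I_d) c x : kc j c (- x) = - kc j c x :> R.
Proof.
rewrite /kc -mulN1r -Rintegral_measurableZl; last exact: measurable_fun_pair1 (measurable_kcm j c).
by apply: eq_Rintegral => a _; rewrite /kcm/= kpN mulN1r mulrN.
Qed.

Section mix.
Variables (j : 'I_d) (c : R) (f : E -> R).
Hypotheses (c0 : 0 < c) (hf : L2r mu f).

Let d0 : (0 < d)%N := leq_ltn_trans (leq0n j) (ltn_ord j).

Lemma kcm_cv_lty x :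
  (\int[leb]_a \int[mu]_y (`|kcm j c (a, x - y) * f y|)%:E < +oo)%E.
Proof.
have [mf _] := hf; have [B B0 fB] := L2r_bound hf.
pose H (z : R * E) := kcm j c (z.1, x - z.2) * f z.2.
have mH : measurable_fun setT (fun z => (`|H z|)%:E).
  apply/measurable_EFinP; apply: measurableT_comp => //; apply: measurable_funM; last first.
    exact: measurableT_comp mf measurable_snd.
  apply: (measurableT_comp (measurable_kcm j c)); apply/measurable_fun_pair => //=.
  exact: measurableT_comp (measurable_rV_subl x) measurable_snd.
have p0 a : 0 < kpL2 (d := d) (gam c a) by rewrite kpL2_gt0// gam_gt0.
have mp := measurable_ps_gam c (measurable_kpL2 (R := R) (d := d)).
apply: (@le_lt_trans _ _ (\int[leb]_a (B%:E * (ps a * kpL2 (d := d) (gam c a))%:E))%E).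
  apply: ge0_le_integral => //.
  - by move=> a _; exact: integral_ge0.
  - exact: (measurable_fun_fubini_tonelli_F (m2 := mu) (fun z => (`|H z|)%:E)).
  - by apply: measurable_funeM; exact/measurable_EFinP.
  - move=> a _; rewrite -EFinM mulrC; apply: (@cv_holder _ _ (fun z => kcm j c (a, z))) => //.
    + by rewrite mulr_ge0 ?ps_ge0// ltW.
    + exact: measurable_fun_pair2 (measurable_kcm j c).
    + rewrite /kcm/= sqnZ; last exact: measurable_kp.
      rewrite [in leRHS]exprMn [leRHS]EFinM; apply: lee_wpmul2l; first by rewrite lee_fin sqr_ge0.
      by apply: sqn_kp_le; exact: gam_gt0.
rewrite ge0_integralZl_EFin//; last 2 first.
- by move=> a _; rewrite lee_fin mulr_ge0 ?ps_ge0// ltW.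
- exact/measurable_EFinP.
apply: lte_mul_pinfty; rewrite ?lee_fin//.
exact: integral_kpL2_lty.
Qed.

Lemma cv_kcE x : cv (kc j c) f x = (\int[leb]_a (ps a * cv (kp j (gam c a)) f x))%R.
Proof.
have [mf _] := hf; rewrite (mix_cv (measurable_kcm j c) mf); last exact: kcm_cv_lty.
apply: eq_Rintegral => a _; rewrite /kcm/= /cv.
under eq_Rintegral do rewrite -mulrA.
rewrite Rintegral_measurableZl//.
by apply: measurable_funM => //; apply: measurable_subl; exact: measurable_kp.
Qed.

Lemma integrable_cv_kcm x :
  leb.-integrable setT (fun a => (ps a * cv (kp j (gam c a)) f x)%:E).
Proof.
have [mf _] := hf.
pose H (z : R * E) := kcm j c (z.1, x - z.2) * f z.2.
have mH : measurable_fun setT H.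
  apply: measurable_funM; last exact: measurableT_comp mf measurable_snd.
  apply: (measurableT_comp (measurable_kcm j c)); apply/measurable_fun_pair => //=.
  exact: measurableT_comp (measurable_rV_subl x) measurable_snd.
have := @integrable_Rintegral_fst _ _ _ _ _ leb mu H mH (kcm_cv_lty x).
apply: eq_integrable => // a _; congr EFin.
have m1 : measurable_fun setT (fun y : E => kp j (gam c a) (x - y) * f y).
  by apply: measurable_funM => //; apply: measurable_subl; exact: measurable_kp.
rewrite -(Rintegral_measurableZl mu _ m1).
by apply: eq_Rintegral => y _; rewrite /H /kcm/= mulrA.
Qed.

End mix.

(** The two superpositions range over the quarter plane of (a, b), and by [sum_cv_kp] the summed
    integrand depends on a^2 + b^2 only. Polar coordinates reduce the double integral to
    [lapl_radial_moment] with e^2 = 2 c^2. *)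
Lemma sum_cv_kc (c : R) (x : E) : (0 < d)%N -> 0 < c ->
  \sum_(j < d) cv (kc j c) (kc j c) x = - (2 * cpolar) * gs (gam c c) x.
Proof.
move=> d0 c0; have e0 : 0 < gam c c := gam_gt0 c c0.
have hkp (j : 'I_d) a : L2r mu (kp j (gam c a)) by apply: L2r_kp; exact: gam_gt0.
have inner (j : 'I_d) a : cv (kp j (gam c a)) (kc j c) x =
    (\int[leb]_b (ps b * cv (kp j (gam c b)) (kp j (gam c a)) x))%R.
  rewrite cvC; last 2 first.
  - exact: measurable_kp.
  - exact: measurable_kc.
  exact: cv_kcE.
rewrite (eq_bigr (fun j : 'I_d => (\int[leb]_a (ps a * cv (kp j (gam c a)) (kc j c) x))%R)); last first.
  by move=> j _; exact: (cv_kcE j c0 (L2r_kc j c0)).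
rewrite -Rintegral_sum; last by move=> j; exact: (integrable_cv_kcm j c0 (L2r_kc j c0) x).
transitivity (\int[leb]_a (ps a * \int[leb]_b (ps b *
   lapl_radial (gam c c) x (Num.sqrt (a ^+ 2 + b ^+ 2)))))%R.
  apply: eq_Rintegral => a _; rewrite -mulr_sumr; congr (_ * _).
  under eq_bigr do rewrite inner.
  rewrite -Rintegral_sum; last by move=> j; exact: (integrable_cv_kcm j c0 (hkp j a) x).
  apply: eq_Rintegral => b _; rewrite -mulr_sumr; congr (_ * _).
  rewrite sum_cv_kp ?gam_gt0// /lapl_radial.
  have -> : Num.sqrt (gam c b ^+ 2 + gam c a ^+ 2) = gam (gam c c) (Num.sqrt (a ^+ 2 + b ^+ 2)).
    by rewrite [RHS]/gam !sqr_gam; congr Num.sqrt; ring.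
  by [].
rewrite Rpolar_plane; last 2 first.
- exact: measurable_lapl_radial.
- exact: lapl_radial_lty.
by rewrite lapl_radial_moment//; ring.
Qed.

(** Oddness moves one kernel across the scalar product, so the sum over i of the squared norms is 2
    [cpolar] times the pairing of g with a Gaussian average of g; a Gaussian of mass one does not
    increase the norm. Each term is at most the sum. *)
Lemma sqn_cv_kc_integrable (j : 'I_d) c g : 0 < c -> L2r mu g ->
  mu.-integrable setT (EFin \o g) ->
  (sqn mu (cv (kc j c) g) <= (2 * cpolar)%:E * sqn mu g)%E.
Proof.
move=> c0 hg intg; have [mg _] := hg.
have d0 : (0 < d)%N := leq_ltn_trans (leq0n j) (ltn_ord j).
have hk (i : 'I_d) : L2r mu (kc i c) by exact: L2r_kc.
have mk (i : 'I_d) : measurable_fun setT (kc i c : E -> R) by exact: measurable_kc.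
have gk (i : 'I_d) : cv (kc i c) g = cv g (kc i c) by exact: cvC.
have hh (i : 'I_d) : L2r mu (cv (kc i c) g) by rewrite gk; exact: L2r_cv.
pose u (i : 'I_d) := cv (kc i c) (kc i c).
have mu_ i : measurable_fun setT (u i) by exact: measurable_cv.
have ub i : exists M, forall x, `|u i x| <= M.
  have [A A0 kA] := L2r_bound (hk i); exists (A * A) => x.
  exact: (cv_le A0 A0 (mk i) (mk i) kA kA).
have assoc (i : 'I_d) : cv (kc i c) (cv (kc i c) g) = cv g (u i).
  have [A A0 kA] := L2r_bound (hk i).
  rewrite cvC//; last by apply: measurable_cv.
  by rewrite gk (@cvA _ _ g _ _ (A * A))//; exact: (cv_holder A0 A0 (mk i) (mk i) kA kA).
have main : \sum_(i < d) fine (sqn mu (cv (kc i c) g)) =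
    2 * cpolar * (\int[mu]_y (g y * cv (gs (gam c c)) g y))%R.
  have e0 : 0 < gam c c := gam_gt0 c c0.
  have mge : measurable_fun setT (gs (gam c c) : E -> R) by exact: measurable_gs.
  rewrite (eq_bigr (fun i : 'I_d => - (\int[mu]_y (g y * cv (kc i c) (cv (kc i c) g) y))%R)); last first.
    by move=> i _; rewrite fine_sqn; exact: (cv_adjoint_odd (hk i) (hh i) (kcN i c)).
  have gu i y : mu.-integrable setT (EFin \o (fun z => g (y - z) * u i z)).
    have [M hM] := ub i; apply: (@integrable_bounded _ _ _ _ _ _ M) => //.
    exact: integrable_subl.
  rewrite sumrN -Rintegral_sum; last first.
    move=> i; have [A A0 kA] := L2r_bound (hk i); have [B B0 hB] := L2r_bound (hh i).
    apply: (@integrable_bounded _ _ _ _ _ _ (A * B)) => //.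
      by apply: measurable_cv => //; exact: (hh i).1.
    exact: (cv_le A0 B0 (mk i) (hh i).1 kA hB).
  have F1E y : \sum_(i < d) g y * cv (kc i c) (cv (kc i c) g) y =
      - (2 * cpolar) * (g y * cv (gs (gam c c)) g y).
    rewrite -mulr_sumr; under eq_bigr do rewrite assoc.
    rewrite [cv (gs _) _]cvC// [RHS]mulrCA; congr (_ * _).
    rewrite /cv -Rintegral_sum; last by move=> i; exact: gu.
    have m1 : measurable_fun setT (fun z : E => g (y - z) * gs (gam c c) z).
      by apply: measurable_funM => //; exact: measurable_subl.
    rewrite -(Rintegral_measurableZl mu _ m1).
    by apply: eq_Rintegral => z _; rewrite -mulr_sumr /u sum_cv_kc//; ring.
  have m2 : measurable_fun setT (fun y : E => g y * cv (gs (gam c c)) g y).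
    by apply: measurable_funM => //; exact: measurable_cv.
  under eq_Rintegral do rewrite F1E.
  by have /= -> := Rintegral_measurableZl mu (- (2 * cpolar)) m2; rewrite mulNr opprK.
have S0 : 0 <= fine (sqn mu g) by rewrite fine_ge0// sqn_ge0.
have bnd : `|(\int[mu]_y (g y * cv (gs (gam c c)) g y))%R| <= fine (sqn mu g).
  have e0 : 0 < gam c c := gam_gt0 c c0.
  have ig := integrable_gs (d := d) e0.
  rewrite -lee_fin; apply: le_EFin_sqr => //.
  apply: le_trans (normr_Rintegral_sqr_le mu mg (L2r_cv ig hg).1) _.
  rewrite expr2 EFinM fineK ?L2r_fin_num//.
  apply: lee_wpmul2l; first exact: sqn_ge0.
  have := @sqn_cv_le R d (gs (gam c c)) g 1 ig _ hg; rewrite expr1n mul1e; apply.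
  rewrite -(@integral_gs R d _ e0) le_eqVlt; apply/orP; left; apply/eqP.
  by apply: eq_integral => y _; rewrite ger0_norm ?gs_ge0.
rewrite -(fineK (L2r_fin_num (hh j))) -(fineK (L2r_fin_num hg)) -EFinM lee_fin.
apply: (@le_trans _ _ (\sum_(i < d) fine (sqn mu (cv (kc i c) g)))).
  by rewrite (bigD1 j)//= lerDl sumr_ge0// => i _; rewrite fine_ge0// sqn_ge0.
rewrite main ler_wpM2l ?mulr_ge0 ?cpolar_ge0//.
exact: le_trans (ler_norm _) bnd.
Qed.

(** Restrictions of [g] to cubes are integrable and converge to [g] in L^2. As the kernel is in L^2
    the convolutions converge at every point, and Fatou's lemma passes the bound on. *)
Lemma sqn_cv_kc (j : 'I_d) c g : 0 < c -> L2r mu g ->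
  (sqn mu (cv (kc j c) g) <= (2 * cpolar)%:E * sqn mu g)%E.
Proof.
move=> c0 hg; have [mg _] := hg.
have hk : L2r mu (kc j c) by exact: L2r_kc.
pose gn n (x : E) := \1_(cube n) x * g x.
have mgn n : measurable_fun setT (gn n).
  by apply: measurable_funM => //; apply: measurable_indic; exact: measurable_obox.
have gn_le n x : `|gn n x| <= `|g x|.
  by rewrite /gn normrM indicE; case: (_ \in _); rewrite ?normr1 ?normr0 ?mul1r ?mul0r.
have hgn n : L2r mu (gn n) by apply: L2r_le hg _ => //; exact: aeW.
have ign n : mu.-integrable setT (EFin \o gn n).
  apply: integrableM_L2r => //; apply: L2r_indic; last exact: obox_lty.
  exact: measurable_obox.
have gng : cvgL2 mu gn g.
  apply: (@cvgL2_dominated _ _ _ mu gn g (fun x => `|g x|)) => //.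
  - apply: aeW => x; apply/cvgrPdist_lt => ep ep0.
    have [N _ hN] : (\bigcup_n cube n) x by rewrite cube_bigcup.
    near=> n; rewrite /gn indicE mem_set ?mul1r ?subrr ?normr0//.
    by apply: cube_nd hN; near: n; exact: nbhs_infty_ge.
  - by split; [exact: measurableT_comp|rewrite sqn_norm hg.2].
  - exact: aeW.
apply: (@sqn_fatou _ _ _ mu (fun n => cv (kc j c) (gn n))).
- by move=> n; apply: measurable_cv => //; exact: hk.1.
- by apply: measurable_cv => //; exact: hk.1.
- apply: aeW => x.
  have e (h : E -> R) : cv (kc j c) h x = (\int[mu]_y (h y * kc j c (x - y)))%R.
    by apply: eq_Rintegral => y _; rewrite mulrC.
  have h := cvg_Rintegral_L2 hgn hg (L2r_subl x hk) gng.
  rewrite -e in h.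
  have e' : (fun n => cv (kc j c) (gn n) x) = (fun n => (\int[mu]_y (gn n y * kc j c (x - y)))%R).
    by apply/funext => n; exact: e.
  by rewrite -e' in h.
- apply: nearW => n; apply: le_trans (sqn_cv_kc_integrable j c0 (hgn n) (ign n)) _.
  apply: lee_wpmul2l; first by rewrite lee_fin mulr_ge0// cpolar_ge0.
  by apply: sqn_le => //; exact: aeW.
Unshelve. all: by end_near.
Qed.

End heat_riesz_bound.

(** * Difference quotients and truncated Gaussians *)

Lemma is_derive_cvg_seq (R : realType) (f : R -> R) (l : R) (u : nat -> R) :
  is_derive (0 : R) 1 f l -> (forall n, u n != 0) -> u n @[n --> \oo] --> 0 ->
  (u n)^-1 * (f (u n) - f 0) @[n --> \oo] --> l.
Proof.
move=> [df <-] u0 uc.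
have h : h^-1 *: (f (h *: (1 : R) + 0) - f 0) @[h --> 0^'] --> 'D_1 f 0 by exact: df.
move/cvgr_dnbhsP : h => /(_ u (conj u0 uc)).
by under eq_fun do rewrite /GRing.scale/= mulr1 addr0.
Qed.

Section coordinate_shift.
Context {R : realType} {d : nat}.
Local Notation E := 'rV[R]_d.
Local Notation mu := (@lebesgue_rV R d).
Variable j : 'I_d.
Local Notation ej := (delta_mx 0 j : 'rV[R]_d).

Lemma nsq_shift (s : R) (z : E) : nsq (z + s *: ej) = nsq z + (2 * z 0 j * s + s ^+ 2).
Proof.
rewrite /nsq (bigD1 j)//= [in RHS](bigD1 j)//= !mxE !eqxx/= mulr1.
rewrite (eq_bigr (fun i => z 0 i ^+ 2)); first by ring.
by move=> i ij; rewrite !mxE (negbTE ij) andbF mulr0 addr0.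
Qed.

Lemma is_derive_gs_shift (a s : R) (z : E) : 0 < a ->
  is_derive s 1 (fun s : R => gs a (z + s *: ej)) (- kp j a (z + s *: ej)).
Proof.
move=> a0; have a1 := lt0r_neq0 a0.
pose P (s : R) := - (a ^+ 2)^-1 * (nsq z + (2 * z 0 j * s + s ^+ 2)).
have h1 : is_derive s 1 (fun s : R => nsq z + (2 * z 0 j * s + s ^+ 2)) _ :=
  is_deriveD (is_derive_cst (nsq z) s 1)
    (is_deriveD (is_deriveZ (2 * z 0 j) (is_derive_id s 1)) (is_deriveX 2 (is_derive_id s 1))).
have h2 : is_derive s 1 P _ := is_deriveZ (- (a ^+ 2)^-1) h1.
have h3 : is_derive s 1 (fun s => expR (P s)) _ :=
  is_derive1_comp (g := P) (x := s) (is_derive_expR _) h2.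
have h4 : is_derive s 1 (fun s => (a * Num.sqrt pi) ^- d * expR (P s)) _ :=
  is_deriveZ ((a * Num.sqrt pi) ^- d) h3.
have -> : (fun s : R => gs a (z + s *: ej)) = (fun s => (a * Num.sqrt pi) ^- d * expR (P s)).
  apply/funext => u; rewrite /gs nsq_shift /P; congr (_ * expR _); ring.
apply: (is_derive_eq h4); rewrite /kp /gs nsq_shift !mxE !eqxx/=.
rewrite (_ : - ((nsq z + (2 * z 0 j * s + s ^+ 2)) / a ^+ 2) = P s); last by rewrite /P; ring.
by rewrite /GRing.scale/=; ring.
Qed.

Lemma gs_shift_le (a s : R) (z : E) : 0 < a -> 0 <= s ->
  `|gs a (z + s *: ej) - gs a z| <= kpsup (d := d) a * s.
Proof.
move=> a0 s0; pose f (u : R) := gs a (z + u *: ej).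
have df (u : R) := is_derive_gs_shift u z a0.
have [|c _] := @MVT_segment R f (fun u => - kp j a (z + u *: ej)) 0 s s0 (fun x _ => df x).
  apply: derivable_within_continuous => u _; have h := df u; exact: ex_derive.
rewrite /f scale0r addr0 subr0 => ->; rewrite normrM normrN (ger0_norm s0) ler_wpM2r//.
exact: kp_le_kpsup.
Qed.

(** Mean value theorem; the bound is uniform in s and z, so it dominates the difference quotients
    under the integral. *)
Lemma gs_quot_le (a s : R) (z : E) : 0 < a -> s != 0 ->
  `|s^-1 * (gs a (z + s *: ej) - gs a z)| <= kpsup (d := d) a.
Proof.
move=> a0 s0; rewrite normrM normfV mulrC ler_pdivrMr ?normr_gt0//.
have [s1|s1] := leP 0 s; first by rewrite [`|s|]ger0_norm// gs_shift_le.
rewrite [`|s|]ltr0_norm// distrC.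
have := @gs_shift_le a (- s) (z + s *: ej) a0; rewrite oppr_ge0 (ltW s1) => /(_ isT).
by rewrite scaleNr -addrA subrr addr0.
Qed.

Lemma gs_quot_cvg (a : R) (z : E) (u : nat -> R) : 0 < a -> (forall n, u n != 0) ->
  u n @[n --> \oo] --> 0 ->
  (u n)^-1 * (gs a (z + u n *: ej) - gs a z) @[n --> \oo] --> - kp j a z.
Proof.
move=> a0 u0 uc; have h := is_derive_cvg_seq (is_derive_gs_shift 0 z a0) u0 uc.
by move: h; rewrite scale0r addr0.
Qed.

End coordinate_shift.

Section sphere.
Context {R : realType}.
Local Notation leb := (@lebesgue_measure R).

Lemma nsq_consrV n (a : R) (v : 'rV[R]_n) : nsq (consrV (a, v)) = a ^+ 2 + nsq v.
Proof.
rewrite /nsq big_ord_recl consrV0; congr (_ + _).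
by apply: eq_bigr => i _; rewrite consrVS.
Qed.

Lemma measurable_sphere d (r : R) : measurable [set x : 'rV[R]_d | nsq x = r].
Proof.
rewrite (_ : [set x | _] = setT `&` (nsq (R := R) (d := d)) @^-1` [set r]); last first.
  by rewrite setTI.
exact: measurable_nsq.
Qed.

(** Tonelli in the first coordinate: once the others are fixed, at most two values remain. *)
Lemma sphere_null d (r : R) : (0 < d)%N ->
  {ae @lebesgue_rV R d, forall x, nsq x != r}.
Proof.
case: d => // n _; exists [set x : 'rV[R]_n.+1 | nsq x = r]; split.
- exact: measurable_sphere.
- pose f (x : 'rV[R]_n.+1) := (\1_[set x | nsq x = r] x : R)%:E.
  have mf : measurable_fun setT f.
    by apply/measurable_EFinP; apply: measurable_indic; exact: measurable_sphere.
  have f0 x : (0 <= f x)%E by rewrite lee_fin.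
  have <- : (\int[lebesgue_rV n.+1]_x f x =
    lebesgue_rV n.+1 [set x : 'rV[R]_n.+1 | nsq x = r])%E.
    by rewrite /f integral_indic ?setIT//; exact: measurable_sphere.
  rewrite ge0_integral_rVS// (@fubini_tonelli _ _ _ _ _ leb (lebesgue_rV n)
     (fun z => f (consrV z)))//; last by apply: measurableT_comp mf _; exact: measurable_consrV.
  rewrite integral0_eq// => v _; rewrite -[RHS](_ : (\int[leb]_a 0 = 0)%E); last exact: integral0.
  apply: ae_eq_integral => //.
  + have m2 := measurableT_comp mf (@measurable_consrV R n).
    exact: (measurable_fun_pair1 v m2).
  + exists [set Num.sqrt (r - nsq v); - Num.sqrt (r - nsq v)]; split.
    * by apply: measurableU; exact: measurable_set1.
    * apply: countable_lebesgue_measure0; apply: finite_set_countable.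
      by rewrite finite_setU; split; exact: finite_set1.
    * move=> a /= /not_implyP[_]; rewrite /f indicE.
      have [|h []//] := boolP (consrV (a, v) \in _).
      rewrite inE/= nsq_consrV => h _.
      have -> : r - nsq v = a ^+ 2 by rewrite -h addrK.
      rewrite sqrtr_sqr; have [a0|a0] := leP 0 a; first by left; rewrite ger0_norm.
      by right; rewrite ltr0_norm// opprK.
- by move=> x /= /negP; rewrite negbK => /eqP.
Qed.

End sphere.

Section truncated_gaussian.
Context {R : realType} {d : nat}.
Local Notation E := 'rV[R]_d.
Local Notation mu := (@lebesgue_rV R d).
Implicit Types (a c t : R) (x z : E).

Definition gsr a t : R := (a * Num.sqrt pi) ^- d * expR (- (t ^+ 2 / a ^+ 2)).

Definition wt t a z : R := Num.max (gs a z - gsr a t) 0.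

Lemma gsr_ge0 a t : 0 < a -> 0 <= gsr a t.
Proof. by move=> a0; rewrite mulr_ge0 ?expR_ge0// ltW// gs_norm_gt0. Qed.

Lemma wt_ge0 t a z : 0 <= wt t a z.
Proof. by rewrite le_max lexx orbT. Qed.

Lemma wt_le t a z : 0 < a -> wt t a z <= gs a z.
Proof. by move=> a0; rewrite ge_max gs_ge0// andbT gerBl gsr_ge0. Qed.

Lemma gs_le_wt t a z : gs a z <= gsr a t + wt t a z.
Proof. by rewrite -lerBlDl le_max lexx. Qed.

Lemma wt_lip t a z z' : `|wt t a z - wt t a z'| <= `|gs a z - gs a z'|.
Proof.
have -> : gs a z - gs a z' = (gs a z - gsr a t) - (gs a z' - gsr a t) by ring.
rewrite /wt; set p := gs a z - _; set q := gs a z' - _.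
have [p0|p0] := leP p 0; have [q0|q0] := leP q 0.
- by rewrite subrr normr0.
- by rewrite sub0r normrN gtr0_norm// distrC ger0_norm ?lerDl ?oppr_ge0// subr_ge0 (le_trans p0)// ltW.
- by rewrite subr0 gtr0_norm// ger0_norm ?lerDl ?oppr_ge0// subr_ge0 (le_trans q0)// ltW.
- by [].
Qed.

Lemma wt_in t a z : 0 < a -> nsq z < t ^+ 2 -> wt t a z = gs a z - gsr a t.
Proof.
move=> a0 zt; rewrite /wt max_l// subr_ge0 /gsr ler_wpM2l//; first by rewrite ltW// gs_norm_gt0.
by rewrite ler_expR lerN2 ler_wpM2r ?(ltW zt)// invr_ge0 sqr_ge0.
Qed.

Lemma wt_out t a z : 0 < a -> t ^+ 2 <= nsq z -> wt t a z = 0.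
Proof.
move=> a0 zt; rewrite /wt max_r// subr_le0 /gsr ler_wpM2l//; first by rewrite ltW// gs_norm_gt0.
by rewrite ler_expR lerN2 ler_wpM2r// invr_ge0 sqr_ge0.
Qed.

Lemma measurable_gsr t : measurable_fun setT (fun a => gsr a t).
Proof.
apply: measurable_funM; last exact: measurable_expVX.
by apply: (measurableT_comp measurable_inv); apply: measurable_funX; exact: measurable_funM.
Qed.

Lemma measurable_wt_joint t : measurable_fun setT (fun p : R * E => wt t p.1 p.2).
Proof.
apply: measurable_maxr => //; apply: measurable_funB.
  by apply: measurable_gs_joint; [exact: measurable_fst|exact: measurable_snd].
exact: measurableT_comp (measurable_gsr t) measurable_fst.
Qed.

Lemma measurable_wt t a : measurable_fun setT (wt t a).
Proof. exact: (measurable_fun_pair2 a (measurable_wt_joint t)). Qed.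

Lemma integrable_wt t a : 0 < a -> mu.-integrable setT (EFin \o wt t a).
Proof.
move=> a0; apply: integrable_le (integrable_gs a0) _; first exact: measurable_wt.
by move=> z; rewrite ger0_norm ?wt_ge0// wt_le.
Qed.

Variable j : 'I_d.
Local Notation ej := (delta_mx 0 j : 'rV[R]_d).

(** Both the inner and the outer part are cut by a strict inequality: [kout] then matches the domain
    |x - y| > t of the truncated transform, and the sphere left out is a null set. *)
Definition kin t a z : R := kp j a z * (nsq z < t ^+ 2)%R%:R.

Definition kout t a z : R := kp j a z * (t ^+ 2 < nsq z)%R%:R.

Lemma measurable_lt_nsq t : measurable_fun setT (fun z : E => (nsq z < t ^+ 2)%R%:R : R).
Proof.
rewrite (_ : (fun z : E => _) = \1_[set z : E | nsq z < t ^+ 2]); last first.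
  by apply/funext => z; rewrite indicE; congr ((nat_of_bool _)%:R); apply/idP/idP; rewrite inE.
apply: measurable_indic.
rewrite (_ : [set z | _] = setT `&` (@nsq R d) @^-1` `]-oo, (t ^+ 2)%R[%classic); last first.
  by rewrite setTI; apply/seteqP; split => z /=; rewrite in_itv.
by apply: measurable_nsq => //; exact: measurable_itv.
Qed.

Lemma measurable_gt_nsq t : measurable_fun setT (fun z : E => (t ^+ 2 < nsq z)%R%:R : R).
Proof.
rewrite (_ : (fun z : E => _) = \1_[set z : E | t ^+ 2 < nsq z]); last first.
  by apply/funext => z; rewrite indicE; congr ((nat_of_bool _)%:R); apply/idP/idP; rewrite inE.
apply: measurable_indic.
rewrite (_ : [set z | _] = setT `&` (@nsq R d) @^-1` `](t ^+ 2)%R, +oo[%classic); last first.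
  by rewrite setTI; apply/seteqP; split => z /=; rewrite in_itv/= andbT.
by apply: measurable_nsq => //; exact: measurable_itv.
Qed.

Lemma measurable_kin t a : measurable_fun setT (kin t a).
Proof. by apply: measurable_funM; [exact: measurable_kp|exact: measurable_lt_nsq]. Qed.

Lemma measurable_kout t a : measurable_fun setT (kout t a).
Proof. by apply: measurable_funM; [exact: measurable_kp|exact: measurable_gt_nsq]. Qed.

(* Both sides are limits of the same difference quotient of [wt t a]; it
   converges off the sphere [nsq z = t ^+ 2]. *)
Lemma cv_kin_gs t a c x : 0 < a -> 0 < c ->
  cv (kin t a) (gs c) x = cv (wt t a) (kp j c) x.
Proof.
move=> a0 c0; have d0 : (0 < d)%N := leq_ltn_trans (leq0n j) (ltn_ord j).
rewrite cvC; [|exact: measurable_kin|exact: measurable_gs].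
rewrite [in RHS]cvC; [|exact: measurable_wt|exact: measurable_kp].
have mg b (y : E) : measurable_fun setT (fun z : E => gs b (y - z)).
  by apply: measurable_subl; exact: measurable_gs.
have mgx : measurable_fun setT (fun z : E => gs c (x - z)) := mg c x.
have mkx : measurable_fun setT (fun z : E => kp j c (x - z)).
  by apply: measurable_subl; exact: measurable_kp.
have mw := measurable_wt t a; have mk := measurable_kin t a.
pose u (n : nat) : R := n.+1%:R^-1.
have u0 n : u n != 0 by rewrite invr_eq0.
have uc : u n @[n --> \oo] --> 0 by exact: cvg_harmonic.
have mws n : measurable_fun setT (fun z => wt t a (z + u n *: ej)).
  apply: (measurableT_comp mw); have := measurable_rV_affine 1 (u n *: ej).
  by apply: eq_measurable_fun => z _; rewrite scale1r.
have mgs_ n : measurable_fun setT (fun z => gs c (x - z + u n *: ej)).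
  rewrite (_ : (fun z => _) = fun z => gs c ((x + u n *: ej) - z)); first exact: mg.
  by apply/funext => z; rewrite addrAC.
pose A n z := wt t a z * ((u n)^-1 * (gs c (x - z + u n *: ej) - gs c (x - z))).
pose B n z := (u n)^-1 * (wt t a (z + u n *: ej) - wt t a z) * gs c (x - z).
have c1 : (\int[mu]_z A n z)%R @[n --> \oo] --> (\int[mu]_z (wt t a z * - kp j c (x - z)))%R.
  apply: (@cvg_Rintegral _ _ _ mu A _ (fun z => wt t a z * kpsup (d := d) c)).
  - by move=> n; apply: measurable_funM => //; apply: measurable_funM => //; exact: measurable_funB.
  - by apply: measurable_funM => //; exact: measurable_funN.
  - by apply: aeW => z; apply: cvgMr; exact: gs_quot_cvg.
  - by apply: integrable_bounded (integrable_wt t a0) _ _ => //= _.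
  - apply: aeW => z n; rewrite /A normrM ger0_norm ?wt_ge0// ler_wpM2l ?wt_ge0//.
    exact: gs_quot_le.
have c2 : (\int[mu]_z B n z)%R @[n --> \oo] --> (\int[mu]_z (- kin t a z * gs c (x - z)))%R.
  apply: (@cvg_Rintegral _ _ _ mu B _ (fun z => kpsup (d := d) a * gs c (x - z))).
  - by move=> n; apply: measurable_funM => //; apply: measurable_funM => //; exact: measurable_funB.
  - by apply: measurable_funM => //; exact: measurable_funN.
  - apply: filterS (sphere_null (t ^+ 2) d0) => z zt; apply: cvgMl.
    have q := @gs_quot_cvg R d j a z u a0 u0 uc.
    have cs : nsq (z + u n *: ej) @[n --> \oo] --> nsq z.
      have -> : (fun n => nsq (z + u n *: ej)) = fun n => nsq z + (2 * z 0 j * u n + u n * u n).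
        by apply/funext => n; rewrite nsq_shift expr2.
      rewrite -[X in _ --> X]addr0 -[X in _ --> _ + X](addr0 0).
      apply: cvgD; first exact: cvg_cst.
      apply: cvgD; first by rewrite -[X in _ --> X](mulr0 (2 * z 0 j)); exact: cvgMr.
      by rewrite -[X in _ --> X](mulr0 0); exact: cvgM.
    have [zi|zo] := ltP (nsq z) (t ^+ 2).
      rewrite /kin zi mulr1; apply: cvg_trans q; apply: near_eq_cvg; near=> n.
      rewrite !wt_in//; last by near: n; exact: (cvgr_lt _ cs).
      by congr (_ * _); ring.
    rewrite /kin ltNge zo mulr0 oppr0.
    have {}zo : t ^+ 2 < nsq z by rewrite lt_neqAle eq_sym zt.
    apply: cvg_near_cst; near=> n.
    rewrite !wt_out ?subrr ?mulr0 ?(ltW zo)// ltW//.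
    by near: n; exact: (cvgr_gt _ cs).
  - by apply: integrable_realZl; apply: integrable_subl; exact: integrable_gs.
  - apply: aeW => z n; rewrite /B normrM [X in _ * X]ger0_norm ?gs_ge0// ler_wpM2r ?gs_ge0//.
    apply: le_trans (gs_quot_le j z a0 (u0 n)).
    by rewrite !normrM ler_wpM2l// wt_lip.
(* Discrete integration by parts: a translation of z by [u n *: ej] moves the difference from the
   Gaussian to [wt t a]. *)
have AB n : (\int[mu]_z A n z)%R = (\int[mu]_z B n z)%R.
  have ig : mu.-integrable setT (EFin \o gs c) := integrable_gs c0.
  have gb (y : E) : `|gs c y| <= (c * Num.sqrt pi) ^- d by rewrite ger0_norm ?gs_ge0// gs_le.
  have wb (y : E) : `|wt t a y| <= (a * Num.sqrt pi) ^- d.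
    by rewrite ger0_norm ?wt_ge0// (le_trans (wt_le t y a0))// gs_le.
  pose p z := wt t a z * gs c (x - z + u n *: ej).
  pose q z := wt t a z * gs c (x - z).
  pose r z := wt t a (z + u n *: ej) * gs c (x - z).
  have mp : measurable_fun setT p by exact: measurable_funM.
  have mq : measurable_fun setT q by exact: measurable_funM.
  have mr : measurable_fun setT r by exact: measurable_funM.
  have ip : mu.-integrable setT (EFin \o p).
    by apply: integrable_bounded (integrable_wt t a0) _ _.
  have iq : mu.-integrable setT (EFin \o q).
    by apply: integrable_bounded (integrable_wt t a0) _ _.
  have ir : mu.-integrable setT (EFin \o r).
    have := integrable_bounded (integrable_subl x ig) (mws n) (fun z => wb _).
    by apply: eq_integrable => // z _; rewrite /= mulrC.
  transitivity ((u n)^-1 * ((\int[mu]_z p z)%R - (\int[mu]_z q z)%R)).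
    rewrite -RintegralB// -(Rintegral_measurableZl mu _ (measurable_funB mp mq)).
    by apply: eq_Rintegral => z _; rewrite /A /p /q/=; ring.
  transitivity ((u n)^-1 * ((\int[mu]_z r z)%R - (\int[mu]_z q z)%R)); last first.
    rewrite -RintegralB// -(Rintegral_measurableZl mu _ (measurable_funB mr mq)).
    by apply: eq_Rintegral => z _; rewrite /B /r /q/=; ring.
  have pr : (\int[mu]_z p z)%R = (\int[mu]_z r z)%R.
    apply: etrans (esym (Rintegral_rV_subr (- (u n *: ej)) mp)) _.
    by apply: eq_Rintegral => z _; rewrite /p /r !opprK opprD addrA subrK.
  exact: (congr1 (fun w => (u n)^-1 * (w - (\int[mu]_z q z)%R)) pr).
have e : (\int[mu]_z (wt t a z * - kp j c (x - z)) = \int[mu]_z (- kin t a z * gs c (x - z)))%R.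
  have AB' : (fun n => (\int[mu]_z A n z)%R) = (fun n => (\int[mu]_z B n z)%R) by exact/funext.
  by rewrite AB' in c1; exact: (cvg_unique _ c1 c2).
have m1 : measurable_fun setT (fun z => gs c (x - z) * kin t a z) by exact: measurable_funM.
have m2 : measurable_fun setT (fun z => kp j c (x - z) * wt t a z) by exact: measurable_funM.
rewrite /cv -[LHS]opprK -[RHS]opprK; congr (- _).
have /= e1 := Rintegral_measurableZl mu (-1) m1; have /= e2 := Rintegral_measurableZl mu (-1) m2.
rewrite -mulN1r -e1 -[RHS]mulN1r -e2.
transitivity (\int[mu]_z (- kin t a z * gs c (x - z)))%R.
  by apply: eq_Rintegral => z _; ring.
by rewrite -e; apply: eq_Rintegral => z _; ring.
Unshelve. all: by end_near.
Qed.

(** The left side is [kp j a] * [gs c]. The part of [kp j a] inside the ball is minus the derivative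
    of [wt t a], without boundary term because [wt t a] vanishes on the sphere, so the derivative
    can be passed to [gs c]. *)
Lemma kp_gam_split t a c x : 0 < a -> 0 < c ->
  kp j (gam c a) x = cv (kout t a) (gs c) x + cv (wt t a) (kp j c) x.
Proof.
move=> a0 c0; have d0 : (0 < d)%N := leq_ltn_trans (leq0n j) (ltn_ord j).
rewrite -cv_kin_gs// cvC; [|exact: measurable_kout|exact: measurable_gs].
rewrite [in X in _ + X]cvC; [|exact: measurable_kin|exact: measurable_gs].
have mgx : measurable_fun setT (fun z : E => gs c (x - z)).
  by apply: measurable_subl; exact: measurable_gs.
have ig : mu.-integrable setT (EFin \o (fun z => gs c (x - z))).
  by apply: integrable_subl; exact: integrable_gs.
have bnd (p : bool) z : `|kp j a z * p%:R| <= kpsup (d := d) a.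
  apply: le_trans (kp_le_kpsup j z a0); rewrite normrM.
  by case: p; rewrite ?normr1 ?normr0 ?mulr1 ?mulr0.
rewrite /cv -RintegralD//; last 2 first.
- by apply: integrable_bounded ig _ (fun z => bnd _ z); exact: measurable_kout.
- by apply: integrable_bounded ig _ (fun z => bnd _ z); exact: measurable_kin.
have -> : kp j (gam c a) x = cv (gs c) (kp j a) x.
  by rewrite cv_gs_kp// /gam addrC.
rewrite /cv /Rintegral; congr fine; apply: ae_eq_integral => //.
- apply/measurable_EFinP; apply: measurable_funM => //; exact: measurable_kp.
- apply/measurable_EFinP; apply: measurable_funD; apply: measurable_funM => //.
    exact: measurable_kout.
  exact: measurable_kin.
apply: filterS (sphere_null (t ^+ 2) d0) => z zt _; rewrite /kout /kin.
by congr EFin; move: zt; case: ltgtP => //= _ _; rewrite ?mulr1 ?mulr0 ?addr0 ?add0r.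
Qed.

End truncated_gaussian.

(** * The Riesz kernel, its truncation and the defect [vt] *)

Section lower_bound.
Context {R : realType}.
Local Notation leb := (@lebesgue_measure R).

Lemma integral_ps_ge (f : R -> R) (m p q : R) : measurable_fun setT f ->
  (forall a, 0 < a -> 0 <= f a) -> 0 < p -> p <= q -> 0 <= m ->
  (forall a, p <= a <= q -> m <= f a) ->
  ((m * (q - p))%:E <= \int[leb]_a (ps a * f a)%:E)%E.
Proof.
move=> mf f0 p0 pq m0 fm.
have pf0 a : 0 <= ps a * f a.
  by have [a0|a0] := leP a 0; [rewrite ps_le0// mul0r|rewrite ps_gt0// mul1r f0].
have mpf : measurable_fun setT (fun a => (ps a * f a)%:E).
  by apply/measurable_EFinP; apply: measurable_funM => //; exact: measurable_ps.
apply: (@le_trans _ _ (\int[leb]_(a in `[p, q]) (ps a * f a)%:E)%E); last first.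
  by apply: ge0_subset_integral => // a _; rewrite lee_fin.
apply: (@le_trans _ _ (\int[leb]_(a in `[p, q]) m%:E)%E).
  rewrite integral_cst//= lebesgue_measure_itv/= lte_fin EFinM.
  have [|] := ltP p q => pq'; first by rewrite EFinB.
  by have -> : q = p by [apply/le_anti; rewrite pq pq']; rewrite subrr mule0.
apply: ge0_le_integral => //.
- by apply: measurable_funTS.
- move=> a /=; rewrite in_itv/= => /[dup] /andP[pa _] ha.
  by rewrite lee_fin ps_gt0 ?mul1r ?fm// (lt_le_trans p0).
Qed.

End lower_bound.

Section riesz_kernel.
Context {R : realType} {d : nat}.
Local Notation E := 'rV[R]_d.
Local Notation mu := (@lebesgue_rV R d).
Local Notation leb := (@lebesgue_measure R).
Implicit Types (a c t : R) (x z : E).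

(** The radial profile: with N = |z|, [kp j (N * s) z] is z_j / N^(d+2) times [kprof s]. *)
Definition kprof (s : R) : R := 2 / s ^+ 2 * ((s * Num.sqrt pi) ^- d * expR (- (1 / s ^+ 2))).

Lemma kprof_ge0 s : 0 < s -> 0 <= kprof s.
Proof.
move=> s0; have p0 := @sqrtpi_gt0 R.
by rewrite !mulr_ge0 ?expR_ge0 ?invr_ge0 ?exprn_ge0 ?mulr_ge0 ?(ltW s0) ?(ltW p0).
Qed.

Lemma measurable_kprof : measurable_fun setT kprof.
Proof.
apply: measurable_funM.
  by apply: measurable_funM => //; apply: (measurableT_comp measurable_inv); exact: measurable_funX.
apply: measurable_funM; last exact: measurable_expVX.
by apply: (measurableT_comp measurable_inv); apply: measurable_funX; exact: measurable_funM.
Qed.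

Lemma kprof_lty : (\int[leb]_s (ps s * kprof s)%:E < +oo)%E.
Proof.
have p0 := @sqrtpi_gt0 R.
pose Q : R := 2 * Num.sqrt pi ^- d.
have Q0 : 0 <= Q by rewrite mulr_ge0// invr_ge0 exprn_ge0// ltW.
have F1 : 0 < (d.+2)`!%:R :> R by rewrite ltr0n fact_gt0.
have kE s : 0 < s -> kprof s = Q * ((s ^+ d.+2)^-1 * expR (- (1 / s ^+ 2))).
  move=> s0; rewrite /kprof /Q exprMn !exprS; field.
  by rewrite !expf_neq0 ?gt_eqF.
(* Near 0 the negative powers are absorbed by exp (1 / s^2) >= exp (1 / s) >= s^-(d+2) / (d+2)!; at
   infinity there remains at least the decay s^-2. *)
apply: (@integral_ps_lty _ _ (Q * (d.+2)`!%:R)).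
- exact: measurable_kprof.
- exact: kprof_ge0.
- move=> s /andP[s0 s1]; rewrite kE// ler_wpM2l// mulrC ler_pdivrMr ?exprn_gt0//.
  have sd0 : 0 < s ^+ d.+2 by exact: exprn_gt0.
  rewrite expRN -[leRHS]invrK lef_pV2 ?posrE ?expR_gt0 ?invr_gt0 ?(mulr_gt0 F1 sd0)//.
  have e1 : s^-1 <= 1 / s ^+ 2.
    rewrite div1r lef_pV2 ?posrE ?exprn_gt0// expr2 ler_piMl//; exact: ltW.
  apply: le_trans (_ : expR (s^-1) <= _); last by rewrite ler_expR.
  rewrite invfM mulrC -exprVn.
  apply: le_trans (expR_ge1Dxn d.+1 _); last by rewrite invr_ge0 ltW.
  by rewrite ler_wpDl.
- move=> s s1; have s0 := lt_le_trans ltr01 s1.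
  rewrite kE// -mulrA ler_wpM2l//.
  apply: le_trans (_ : (s ^+ 2)^-1 <= _).
    apply: (@le_trans _ _ ((s ^+ d.+2)^-1 * 1)).
      by rewrite ler_wpM2l ?invr_ge0 ?exprn_ge0 ?(ltW s0)// -expR0 ler_expR oppr_le0 divr_ge0// exprn_ge0// ltW.
    by rewrite mulr1 lef_pV2 ?posrE ?exprn_gt0// ler_weXn2l.
  apply: (@le_trans _ _ (1 / (s * Num.sqrt s))); last first.
    by rewrite ler_wpM2r ?invr_ge0 ?mulr_ge0 ?sqrtr_ge0 ?(ltW s0)// ler1n fact_gt0.
  rewrite div1r lef_pV2 ?posrE ?exprn_gt0 ?mulr_gt0 ?sqrtr_gt0// expr2 ler_pM2l//.
  rewrite -[leRHS](sqr_sqrtr (ltW s0)) expr2 ler_peMl ?sqrtr_ge0//.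
  by rewrite -sqrtr1 ler_wsqrtr.
Qed.

(** The constant in front of z_j / |z|^(d+1) in [kk]. The substitution u = 1 / s evaluates it to
    Gamma ((d + 1) / 2) / pi^(d/2), but the proof keeps it as an integral. *)
Definition ckk : R := fine (\int[leb]_s (ps s * kprof s)%:E)%E.

Lemma ckkE : (\int[leb]_s (ps s * kprof s)%:E = ckk%:E)%E.
Proof.
rewrite fineK// ge0_fin_numE ?kprof_lty//; apply: integral_ge0 => s _.
by rewrite lee_fin; have [s0|s0] := leP s 0; [rewrite ps_le0// mul0r|rewrite ps_gt0// mul1r kprof_ge0].
Qed.

Lemma ckk_gt0 : 0 < ckk.
Proof.
have p0 := @sqrtpi_gt0 R.
pose m : R := 2 / 2 ^+ 2 * ((2 * Num.sqrt pi) ^- d * expR (- 1)).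
have m0 : 0 < m by rewrite !mulr_gt0 ?expR_gt0 ?invr_gt0 ?exprn_gt0 ?mulr_gt0.
apply: (lt_le_trans m0); rewrite -lee_fin -ckkE.
have := @integral_ps_ge R kprof m 1 2 measurable_kprof kprof_ge0 ltr01 (ler1n _ 2) (ltW m0).
rewrite (_ : m * (2 - 1) = m); last by ring.
apply=> a /andP[a1 a2]; have a0 := lt_le_trans ltr01 a1.
apply: ler_pM.
- by rewrite mulr_ge0// invr_ge0 exprn_ge0.
- by rewrite mulr_ge0 ?expR_ge0// invr_ge0 exprn_ge0// mulr_ge0// ltW.
- by rewrite ler_wpM2l// lef_pV2 ?posrE ?exprn_gt0// lerXn2r// nnegrE ltW.
apply: ler_pM; [by rewrite invr_ge0 exprn_ge0// mulr_ge0// ltW|exact: expR_ge0|exact: gs_norm_le|].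
  by rewrite ler_expR lerN2 div1r invf_le1 ?exprn_gt0// exprn_ege1.
Qed.

Variable j : 'I_d.

(** The sign of [kp j a z] is that of z_j for every a > 0, so signed integrals over widths reduce to
    nonnegative ones. *)
Lemma kp_sg a z : 0 < a -> kp j a z = Num.sg (z 0 j) * `|kp j a z|.
Proof.
move=> a0; rewrite {1}[kp j a z]numEsg; congr (_ * _).
have -> : kp j a z = z 0 j * (2 / a ^+ 2 * gs a z) by rewrite /kp; ring.
by rewrite sgrM [X in _ * X]gtr0_sg ?mulr1// mulr_gt0 ?gs_gt0// divr_gt0// exprn_gt0.
Qed.

Lemma integral_abs_kp_radius z : 0 < nsq z ->
  (\int[leb]_a (ps a * `|kp j a z|)%:E =
   (ckk * (`|z 0 j| / Num.sqrt (nsq z) ^+ d.+1))%:E)%E.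
Proof.
move=> z0; set N := Num.sqrt (nsq z); have N0 : 0 < N by rewrite sqrtr_gt0.
have p0 := @sqrtpi_gt0 R.
have mF : measurable_fun setT (fun a => (ps a * `|kp j a z|)%:E).
  apply/measurable_EFinP; apply: measurable_funM; first exact: measurable_ps.
  apply: measurableT_comp => //.
  exact: (@measurable_kp_joint R d _ _ id (fun=> z)).
have F0 a : (0 <= (ps a * `|kp j a z|)%:E)%E by rewrite lee_fin mulr_ge0 ?ps_ge0.
have h := ge0_integral_scale N0 mF F0.
transitivity ((N / N)%:E * \int[leb]_a (ps a * `|kp j a z|)%:E)%E.
  by rewrite divff ?gt_eqF// mul1e.
rewrite EFinM -muleA -h mulrC EFinM -ckkE.
rewrite -ge0_integralZl_EFin ?(ltW N0)//; last first.
  have ms : measurable_fun setT (fun w : R => N * w) by exact: measurable_funM.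
  exact: measurableT_comp mF ms.
rewrite -ge0_integralZl_EFin//; last 3 first.
- move=> s _; rewrite lee_fin.
  by have [s0|s0] := leP s 0; [rewrite ps_le0// mul0r|rewrite ps_gt0// mul1r kprof_ge0].
- by apply/measurable_EFinP; apply: measurable_funM; [exact: measurable_ps|exact: measurable_kprof].
- by rewrite divr_ge0// exprn_ge0// ltW.
apply: eq_integral => s _; rewrite ps_scale// -!EFinM; congr EFin.
have [s0|s0] := leP s 0; first by rewrite ps_le0// !mul0r !mulr0.
rewrite ps_gt0// !mul1r /kp normrM [X in _ * (_ * X)]ger0_norm ?gs_ge0 ?mulr_gt0//.
rewrite normrM normfV [`|(N * s) ^+ 2|]ger0_norm ?sqr_ge0// normrM (ger0_norm (ler0n _ 2)).
rewrite /gs /kprof (_ : nsq z / (N * s) ^+ 2 = 1 / s ^+ 2); last first.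
  rewrite exprMn (sqr_sqrtr (ltW z0)); field.
  by rewrite ?gt_eqF.
have -> : (N * s * Num.sqrt pi) ^+ d = N ^+ d * (s * Num.sqrt pi) ^+ d by rewrite -mulrA exprMn.
rewrite [N ^+ d.+1]exprS; have A0 : N ^+ d != 0 by rewrite gt_eqF// exprn_gt0.
have B0 : (s * Num.sqrt pi) ^+ d != 0 by rewrite gt_eqF// exprn_gt0// mulr_gt0.
move: (N ^+ d) ((s * Num.sqrt pi) ^+ d) A0 B0 (expR _) => A B A0 B0 ex; field.
by rewrite A0 B0 ?gt_eqF.
Qed.

Definition kk z : R := (\int[leb]_a (ps a * kp j a z))%R.

Lemma measurable_ps_kp z : measurable_fun setT (fun a => ps a * `|kp j a z|).
Proof.
apply: measurable_funM; first exact: measurable_ps.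
by apply: measurableT_comp => //; exact: (@measurable_kp_joint R d _ _ id (fun=> z)).
Qed.

Lemma kkE z : 0 < nsq z -> kk z = ckk * (z 0 j / Num.sqrt (nsq z) ^+ d.+1).
Proof.
move=> z0.
transitivity (\int[leb]_a (Num.sg (z 0 j) * (ps a * `|kp j a z|)))%R.
  apply: eq_Rintegral => a _.
  have [a0|a0] := leP a 0; first by rewrite ps_le0// !mul0r mulr0.
  by rewrite [RHS]mulrCA -kp_sg.
rewrite (Rintegral_measurableZl leb _ (measurable_ps_kp z)).
rewrite /Rintegral integral_abs_kp_radius//= mulrCA; congr (_ * _).
by rewrite mulrA -numEsg.
Qed.

Definition kt t z : R := kk z * (t ^+ 2 < nsq z)%R%:R.

Lemma measurable_kk : measurable_fun setT kk.
Proof.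
have m2 : measurable_fun setT (fun z : E * R => ps z.2 * kp j z.2 z.1).
  apply: measurable_funM; first exact: measurableT_comp measurable_ps measurable_snd.
  exact: (@measurable_kp_joint R d _ _ snd fst).
exact: (measurable_Rintegral_fst leb m2).
Qed.

Lemma measurable_kt t : measurable_fun setT (kt t).
Proof. by apply: measurable_funM; [exact: measurable_kk|exact: measurable_gt_nsq]. Qed.

(** Only the widths N <= a <= 2 N with N = |z| are kept; for these N <= [gam c a] <= 3 N. The bound
    dominates the truncated kernel by a multiple of [kc], which puts it in L^2. *)
Lemma kc_ge c z : 0 < c -> c ^+ 2 < nsq z ->
  2 / 9 * (3 * Num.sqrt pi) ^- d * expR (- 1) * (`|z 0 j| / Num.sqrt (nsq z) ^+ d.+1) <= `|kc j c z|.
Proof.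
move=> c0 cz; have z0 : 0 < nsq z by apply: lt_trans cz; rewrite exprn_gt0.
set N := Num.sqrt (nsq z); have N0 : 0 < N by rewrite sqrtr_gt0.
have N2 : N ^+ 2 = nsq z by rewrite sqr_sqrtr// ltW.
have p0 := @sqrtpi_gt0 R.
pose f a := `|kp j (gam c a) z|.
have mf : measurable_fun setT f.
  by apply: measurableT_comp => //; exact: (@measurable_kp_joint R d _ _ (gam c) (fun=> z) (measurable_gam c)).
have mpf : measurable_fun setT (fun a => ps a * f a).
  by apply: measurable_funM => //; exact: measurable_ps.
have kcE : kc j c z = Num.sg (z 0 j) * (\int[leb]_a (ps a * f a))%R.
  rewrite -(Rintegral_measurableZl leb _ mpf); apply: eq_Rintegral => a _.
  by rewrite [RHS]mulrCA -kp_sg ?gam_gt0.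
have If : ((\int[leb]_a (ps a * f a))%R%:E = \int[leb]_a (ps a * f a)%:E)%E.
  apply: EFin_Rintegral; apply/integrable_ltyP => //.
  apply: le_lt_trans (ltry (kcsup (d := d) c)); have := integral_abs_kcm j c0 z.
  apply: le_trans; rewrite le_eqVlt; apply/orP; left; apply/eqP.
  by apply: eq_integral => a _; rewrite /kcm/= /f; congr EFin; rewrite [LHS]normrM [RHS]normrM normr_id.
have I0 : 0 <= (\int[leb]_a (ps a * f a))%R.
  by apply: Rintegral_ge0 => a _; rewrite mulr_ge0 ?ps_ge0// normr_ge0.
have [zj|zj] := eqVneq (z 0 j) 0; first by rewrite zj normr0 mul0r mulr0.
rewrite kcE normrM normr_sg zj mul1r (ger0_norm I0) -lee_fin If.
pose m := 2 * `|z 0 j| / (9 * nsq z) * ((3 * N * Num.sqrt pi) ^- d * expR (- 1)).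
have m0 : 0 <= m.
  by rewrite !mulr_ge0 ?expR_ge0 ?invr_ge0 ?exprn_ge0 ?mulr_ge0 ?(ltW N0) ?(ltW p0) ?(ltW z0).
have -> : 2 / 9 * (3 * Num.sqrt pi) ^- d * expR (- 1) * (`|z 0 j| / N ^+ d.+1) = m * (2 * N - N).
  rewrite /m -N2 !exprMn exprS; field.
  by rewrite ?expf_neq0 ?mulf_neq0 ?gt_eqF.
apply: (integral_ps_ge mf (fun a _ => normr_ge0 _) N0 _ m0); first by rewrite ler_peMl ?ler1n// ltW.
move=> a /andP[Na aN]; have a0 := lt_le_trans N0 Na.
have g0 : 0 < gam c a := gam_gt0 a c0.
have g2 : nsq z <= gam c a ^+ 2 <= 9 * nsq z.
  rewrite sqr_gam -N2; apply/andP; split.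
    by rewrite ler_wpDr ?sqr_ge0// lerXn2r// nnegrE ltW.
  apply: (@le_trans _ _ ((2 * N) ^+ 2 + N ^+ 2)).
    apply: lerD; last by rewrite N2 ltW.
    by rewrite lerXn2r ?nnegrE ?mulr_ge0 ?(ltW a0) ?(ltW N0).
  have N20 : 0 <= N ^+ 2 := sqr_ge0 N; rewrite exprMn; lra.
have /andP[g2l g2r] := g2.
have -> : f a = 2 * `|z 0 j| / gam c a ^+ 2 * gs (gam c a) z.
  rewrite /f /kp normrM [X in _ * X]ger0_norm ?gs_ge0//; congr (_ * _).
  by rewrite normrM normfV [`|_ ^+ 2|]ger0_norm ?sqr_ge0// normrM (ger0_norm (ler0n _ 2)).
apply: ler_pM.
- by rewrite !mulr_ge0 ?invr_ge0 ?mulr_ge0 ?(ltW z0).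
- by rewrite mulr_ge0 ?expR_ge0// invr_ge0 exprn_ge0// !mulr_ge0 ?(ltW N0) ?(ltW p0).
- by rewrite ler_wpM2l ?mulr_ge0// lef_pV2 ?posrE ?mulr_gt0 ?exprn_gt0.
rewrite /gs; apply: ler_pM.
- by rewrite invr_ge0 exprn_ge0// !mulr_ge0 ?(ltW N0) ?(ltW p0).
- exact: expR_ge0.
- apply: gs_norm_le => //.
  rewrite -ler_sqr ?nnegrE ?mulr_ge0 ?(ltW N0) ?(ltW g0)// [leRHS]exprMn N2.
  by have -> : (3 : R) ^+ 2 = 9 by ring.
- by rewrite ler_expR lerN2 ler_pdivrMr ?exprn_gt0// mul1r.
Qed.

Lemma kt_le_kc t z : 0 < t ->
  `|kt t z| <= ckk / (2 / 9 * (3 * Num.sqrt pi) ^- d * expR (- 1)) * `|kc j t z|.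
Proof.
move=> t0; have p0 := @sqrtpi_gt0 R; set m := 2 / 9 * _ * _.
have m0 : 0 < m by rewrite !mulr_gt0 ?invr_gt0 ?expR_gt0 ?exprn_gt0 ?mulr_gt0.
have C0 := ckk_gt0.
rewrite /kt; case: (ltP (t ^+ 2) (nsq z)) => [tz|_]; last by rewrite mulr0 normr0 mulr_ge0 ?normr_ge0 ?divr_ge0 ?(ltW C0) ?(ltW m0).
have z0 : 0 < nsq z by apply: lt_trans tz; rewrite exprn_gt0.
have N0 : 0 <= Num.sqrt (nsq z) ^+ d.+1 by rewrite exprn_ge0 ?sqrtr_ge0.
rewrite mulr1 kkE// normrM (gtr0_norm C0) -[leRHS]mulrA ler_pM2l//.
rewrite [leRHS]mulrC ler_pdivlMr// [leLHS]mulrC normrM normfV (ger0_norm N0).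
exact: kc_ge.
Qed.

Lemma L2r_kt t : 0 < t -> L2r mu (kt t).
Proof.
move=> t0; have h := L2rZ (ckk / (2 / 9 * (3 * Num.sqrt pi) ^- d * expR (- 1))) (L2r_kc j t0).
apply: (L2r_le _ h); first exact: measurable_kt.
apply: aeW => z; apply: le_trans (kt_le_kc z t0) _.
by rewrite [leRHS]normrM ler_wpM2r// ler_norm.
Qed.

End riesz_kernel.

(** * Nonnegative mixtures and the mass of the defect *)

Section mixtures_L1.
Context {R : realType} {d : nat}.
Local Notation E := 'rV[R]_d.
Local Notation mu := (@lebesgue_rV R d).
Local Notation leb := (@lebesgue_measure R).

Lemma cvZl (w f : E -> R) (c : R) x : measurable_fun setT w -> measurable_fun setT f ->
  cv (fun z => c * w z) f x = c * cv w f x.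
Proof.
move=> mw mf; have m1 : measurable_fun setT (fun y : E => w (x - y) * f y).
  by apply: measurable_funM => //; exact: measurable_subl.
by rewrite -(Rintegral_measurableZl mu _ m1); apply: eq_Rintegral => y _; rewrite mulrA.
Qed.

Variable K : R * E -> R.
Hypotheses (mK : measurable_fun setT K) (K0 : forall z, 0 <= K z).
Hypothesis Klt : (\int[leb]_a \int[mu]_z (K (a, z))%:E < +oo)%E.

Definition mix z : R := (\int[leb]_a K (a, z))%R.

Let mKE : measurable_fun setT (fun z => (K z)%:E). Proof. exact/measurable_EFinP. Qed.

Let mK' : measurable_fun setT (fun z : E * R => K (z.2, z.1)).
Proof. by apply: (measurableT_comp mK); apply/measurable_fun_pair. Qed.

Let Klt' : (\int[mu]_z \int[leb]_a (K (a, z))%:E < +oo)%E.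
Proof. by rewrite -(@fubini_tonelli _ _ _ _ _ leb mu (fun z => (K z)%:E)). Qed.

Let Klt_abs : (\int[mu]_z \int[leb]_a (`|K (a, z)|)%:E < +oo)%E.
Proof.
apply: le_lt_trans Klt'; rewrite le_eqVlt; apply/orP; left; apply/eqP.
by apply: eq_integral => z _; apply: eq_integral => a _; rewrite ger0_norm.
Qed.

Lemma mix_ge0 z : 0 <= mix z.
Proof. exact: Rintegral_ge0. Qed.

Lemma measurable_mix : measurable_fun setT mix.
Proof. exact: (measurable_Rintegral_fst leb mK'). Qed.

Lemma mix_ae : {ae mu, forall z, ((mix z)%:E = \int[leb]_a (K (a, z))%:E)%E}.
Proof.
exact: (@EFin_Rintegral_ae _ _ _ _ _ mu leb (fun z => K (z.2, z.1)) mK' Klt_abs).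
Qed.

Lemma integrable_mix : mu.-integrable setT (EFin \o mix).
Proof.
exact: (@integrable_Rintegral_fst _ _ _ _ _ mu leb (fun z => K (z.2, z.1)) mK' Klt_abs).
Qed.

Lemma integral_mix : (\int[mu]_z (mix z)%:E = \int[leb]_a \int[mu]_z (K (a, z))%:E)%E.
Proof.
rewrite (@fubini_tonelli _ _ _ _ _ leb mu (fun z => (K z)%:E))//.
apply: ae_eq_integral => //.
- by apply/measurable_EFinP; exact: measurable_mix.
- exact: (measurable_fun_fubini_tonelli_G (m1 := leb) (fun z => (K z)%:E)).
- by apply: filterS mix_ae => z ->.
Qed.

Lemma mix_cv_lty (f : E -> R) (M : R) x : measurable_fun setT f -> (forall y, `|f y| <= M) ->
  (\int[leb]_a \int[mu]_y (`|K (a, x - y) * f y|)%:E < +oo)%E.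
Proof.
move=> mf fM; have M0 : 0 <= M by exact: le_trans (fM 0).
pose H (z : R * E) := K (z.1, x - z.2) * f z.2.
have mH : measurable_fun setT (fun z : R * E => (`|H z|)%:E).
  apply/measurable_EFinP; apply: measurableT_comp => //; apply: measurable_funM; last first.
    exact: measurableT_comp mf measurable_snd.
  apply: (measurableT_comp mK); apply/measurable_fun_pair => //=.
  exact: measurableT_comp (measurable_rV_subl x) measurable_snd.
have mF := measurable_fun_fubini_tonelli_F (m2 := mu) (fun z => (K z)%:E) mKE (fun z => K0 z).
apply: (@le_lt_trans _ _ (\int[leb]_a (M%:E * \int[mu]_z (K (a, z))%:E))%E).
  apply: ge0_le_integral => //.
  - by move=> a _; exact: integral_ge0.
  - exact: (measurable_fun_fubini_tonelli_F (m2 := mu) (fun z : R * E => (`|H z|)%:E)).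
  - exact: measurable_funeM.
  - move=> a _; have mKa : measurable_fun setT (fun z => (K (a, z))%:E) := measurable_fun_pair2 a mKE.
    rewrite -(ge0_integral_rV_subl x mKa)//; last by move=> z; rewrite lee_fin.
    rewrite -ge0_integralZl_EFin//; last 2 first.
    + by move=> y _; rewrite lee_fin.
    + exact: (measurableT_comp mKa (measurable_rV_subl x)).
    apply: ge0_le_integral => //.
    + exact: (measurable_fun_pair2 a mH).
    + by apply: measurable_funeM; exact: (measurableT_comp mKa (measurable_rV_subl x)).
    + by move=> y _; rewrite -EFinM lee_fin normrM (ger0_norm (K0 _)) mulrC ler_wpM2r ?K0.
rewrite ge0_integralZl_EFin//; last by move=> a _; apply: integral_ge0 => z _; rewrite lee_fin.
by apply: lte_mul_pinfty; rewrite ?lee_fin//; apply: integral_ge0 => a _;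
  apply: integral_ge0 => z _; rewrite lee_fin.
Qed.

Lemma cv_mix (f : E -> R) (M : R) x : measurable_fun setT f -> (forall y, `|f y| <= M) ->
  cv mix f x = (\int[leb]_a cv (fun z => K (a, z)) f x)%R.
Proof. by move=> mf fM; exact: (mix_cv mK mf (mix_cv_lty x mf fM)). Qed.

End mixtures_L1.

Lemma integrable_cv_mix {R : realType} {d : nat} (K : R * 'rV[R]_d -> R) (f : 'rV[R]_d -> R) x :
  measurable_fun setT K -> measurable_fun setT f ->
  (\int[lebesgue_measure]_a \int[lebesgue_rV d]_y (`|K (a, x - y) * f y|)%:E < +oo)%E ->
  lebesgue_measure.-integrable setT (fun a => (cv (fun z => K (a, z)) f x)%:E).
Proof.
move=> mK mf h.
pose H (z : R * 'rV[R]_d) := K (z.1, x - z.2) * f z.2.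
have mH : measurable_fun setT H.
  apply: measurable_funM; last exact: measurableT_comp mf measurable_snd.
  apply: (measurableT_comp mK); apply/measurable_fun_pair => //=.
  exact: measurableT_comp (measurable_rV_subl x) measurable_snd.
exact: (@integrable_Rintegral_fst _ _ _ _ _ lebesgue_measure (lebesgue_rV d) H mH h).
Qed.

Section truncation_defect.
Context {R : realType} {d : nat}.
Local Notation E := 'rV[R]_d.
Local Notation mu := (@lebesgue_rV R d).
Local Notation leb := (@lebesgue_measure R).
Implicit Types (a c t : R) (x z : E).

Definition wtm t (z : R * E) : R := ps z.1 * wt t z.1 z.2.

Lemma measurable_wtm t : measurable_fun setT (wtm t).
Proof.
by apply: measurable_funM; [exact: measurableT_comp measurable_ps measurable_fst|exact: measurable_wt_joint].
Qed.

Lemma wtm_ge0 t (z : R * E) : 0 <= wtm t z.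
Proof. by rewrite mulr_ge0 ?ps_ge0 ?wt_ge0. Qed.

Definition wmass t : \bar R := (\int[leb]_a \int[mu]_z (wtm t (a, z))%:E)%E.

(** Dilating z and a by t multiplies [wt] by t^-d, so the mass is homogeneous of degree one in t.
    This reduces finiteness to t = 1 and later gives the rate t at which truncations converge. *)
Lemma wmass_scale t : 0 < t -> wmass t = (t%:E * wmass 1)%E.
Proof.
move=> t0; have mw := measurable_wtm t.
have mwE : measurable_fun setT (fun z : R * E => (wtm t z)%:E) by exact/measurable_EFinP.
have w0 (z : R * E) : (0 <= (wtm t z)%:E)%E by rewrite lee_fin wtm_ge0.
pose I a := (\int[mu]_z (wtm t (a, z))%:E)%E.
have mI : measurable_fun setT I.
  exact: (measurable_fun_fubini_tonelli_F (m2 := mu) (fun z : R * E => (wtm t z)%:E) mwE w0).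
have I0 a : (0 <= I a)%E by apply: integral_ge0.
have main W1 : (\int[leb]_a I (t * a)%R = W1)%E -> wmass t = (t%:E * W1)%E.
  move=> <-; have h : (\int[leb]_a I (t * a)%R = (t^-1)%:E * wmass t)%E.
    exact: (ge0_integral_scale t0 mI I0).
  by rewrite h muleA -EFinM divff ?mul1e// lt0r_neq0.
apply: main.
rewrite /wmass; apply: eq_integral => a _; rewrite /I.
have mwa : measurable_fun setT (fun z => (wtm t (t * a, z))%:E) := measurable_fun_pair2 (t * a) mwE.
transitivity ((t ^+ d * t ^- d)%:E * \int[mu]_z (wtm t (t * a, z))%:E)%E.
  by rewrite (divff (lt0r_neq0 (exprn_gt0 d t0))) mul1e.
rewrite EFinM -muleA -{2}(ger0_norm (ltW t0)).
rewrite -(ge0_integral_rV_affine 0 (lt0r_neq0 t0) mwa)//.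
rewrite -ge0_integralZl_EFin//; last 2 first.
- exact: (measurableT_comp mwa (measurable_rV_affine t 0)).
- by rewrite exprn_ge0// ltW.
apply: eq_integral => z _; rewrite -EFinM addr0 /wtm/= ps_scale//; congr EFin.
have [a0|a0] := leP a 0; first by rewrite ps_le0// !mul0r mulr0.
rewrite mulrCA; congr (_ * _); rewrite /wt maxr_pMr ?exprn_ge0 ?(ltW t0)// mulr0; congr Num.max.
have e (u : R) : t ^+ 2 * u / (t * a) ^+ 2 = u / a ^+ 2.
  by rewrite exprMn; field; rewrite ?gt_eqF.
have e2 (u : R) : t ^+ d * ((t * a * Num.sqrt pi) ^- d * u) = (a * Num.sqrt pi) ^- d * u.
  rewrite -[t * a * _]mulrA [(t * _) ^+ d]exprMn invfM !mulrA divff ?mul1r// gt_eqF//.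
  exact: exprn_gt0.
rewrite /gs /gsr nsqZ e mulrBr !e2; congr (_ - _ * expR (- _)).
by rewrite -[t ^+ 2 in LHS]mulr1 e expr1n.
Qed.

Lemma wmass1_lty : (0 < d)%N -> (wmass 1 < +oo)%E.
Proof.
move=> d0; have p0 := @sqrtpi_gt0 R.
pose f a := (\int[mu]_z wt 1 a z)%R.
have mf : measurable_fun setT f by exact: (measurable_Rintegral_fst mu (measurable_wt_joint 1)).
have f0 a : 0 <= f a by apply: Rintegral_ge0 => z _; exact: wt_ge0.
have fE a : 0 < a -> ((f a)%:E = \int[mu]_z (wt 1 a z)%:E)%E.
  by move=> a0; apply: EFin_Rintegral; exact: integrable_wt.
have -> : wmass 1 = (\int[leb]_a (ps a * f a)%:E)%E.
  apply: eq_integral => a _; rewrite /wtm/=; have [a0|a0] := leP a 0.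
    rewrite ps_le0// mul0r; under eq_integral do rewrite mul0r.
    by rewrite integral0.
  by rewrite ps_gt0// mul1r fE//; apply: eq_integral => z _; rewrite mul1r.
pose V : R := fine (mu (cube 1)).
have VE : mu (cube 1) = V%:E.
  by rewrite fineK// ge0_fin_numE//; exact: obox_lty.
have V0 : 0 <= V by rewrite fine_ge0.
pose Q : R := Num.sqrt pi ^- d.
have Q0 : 0 <= Q by rewrite invr_ge0 exprn_ge0// ltW.
apply: (@integral_ps_lty _ _ (1 + Q * V)) => //.
- move=> a /andP[a0 _]; apply: (@le_trans _ _ 1); last by rewrite lerDl mulr_ge0.
  rewrite -lee_fin fE// -(@integral_gs R d _ a0); apply: ge0_le_integral => //.
  + by move=> z _; rewrite lee_fin wt_ge0.
  + by apply/measurable_EFinP; exact: measurable_wt.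
  + by apply/measurable_EFinP; exact: measurable_gs.
  + by move=> z _; rewrite lee_fin wt_le.
- move=> a a1; have a0 := lt_le_trans ltr01 a1.
  have mc : measurable (cube 1 : set E) by exact: measurable_obox.
  (* In the unit ball the difference of Gaussians is at most (a sqrt pi)^-d (1 - exp (- 1 / a^2)).
     The value subtracted at radius 1 thus gains a factor a^-2, without which the integral over a
     would diverge for d = 1. *)
  pose m := (a * Num.sqrt pi) ^- d / a ^+ 2.
  have m0 : 0 <= m by rewrite mulr_ge0 ?invr_ge0 ?exprn_ge0 ?mulr_ge0 ?(ltW a0) ?(ltW p0).
  have wm z : wt 1 a z <= m * \1_(cube 1) z.
    have [z1|z1] := leP 1 (nsq z); first by rewrite wt_out ?expr1n// mulr_ge0.
    rewrite indicE mem_set ?mulr1; last first.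
      move=> i; rewrite -ltr_norml -(@ltr_pXn2r _ 2)// ?nnegrE// expr1n real_normK ?num_real//.
      exact: le_lt_trans (coord_sqr_le z i) z1.
    rewrite wt_in ?expr1n// /gs /gsr /m -mulrBr ler_wpM2l//; first by rewrite ltW// gs_norm_gt0.
    apply: (@le_trans _ _ (1 - expR (- (1 ^+ 2 / a ^+ 2)))).
      by rewrite lerB// -expR0 ler_expR oppr_le0 divr_ge0 ?nsq_ge0 ?sqr_ge0.
    rewrite expr1n div1r lerBlDr addrC -lerBlDr.
    by have := expR_ge1Dx (- (a ^+ 2)^-1).
  have fm : f a <= m * V.
    rewrite -lee_fin fE// EFinM -VE.
    apply: (@le_trans _ _ (\int[mu]_z (m%:E * (\1_(cube 1) z : R)%:E))%E).
      apply: ge0_le_integral => //.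
      * by move=> z _; rewrite lee_fin wt_ge0.
      * by apply/measurable_EFinP; exact: measurable_wt.
      * by apply: measurable_funeM; apply/measurable_EFinP; exact: measurable_indic.
      * by move=> z _; rewrite -EFinM lee_fin.
    rewrite ge0_integralZl_EFin//; last by apply/measurable_EFinP; exact: measurable_indic.
    by rewrite integral_indic// setIT.
  apply: le_trans fm _; apply: (@le_trans _ _ (Q * V / (a * Num.sqrt a))); last first.
    by rewrite ler_wpM2r ?lerDr// invr_ge0 mulr_ge0 ?sqrtr_ge0// ltW.
  rewrite [leRHS]mulrAC ler_wpM2r// /m; apply: ler_pM.
  + by rewrite invr_ge0 exprn_ge0// mulr_ge0// ltW.
  + by rewrite invr_ge0 exprn_ge0// ltW.
  + by have := @gs_norm_le R d 1 a ltr01 a1; rewrite mul1r.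
  + rewrite lef_pV2 ?posrE ?exprn_gt0 ?mulr_gt0 ?sqrtr_gt0// expr2 ler_pM2l//.
    rewrite -[leRHS](sqr_sqrtr (ltW a0)) expr2 ler_peMl ?sqrtr_ge0//.
    by rewrite -sqrtr1 ler_wsqrtr.
Qed.

Lemma wmass_lty t : (0 < d)%N -> 0 < t -> (wmass t < +oo)%E.
Proof.
move=> d0 t0; rewrite wmass_scale// lte_mul_pinfty ?lee_fin ?(ltW t0)//.
exact: wmass1_lty.
Qed.

Definition vt t : E -> R := mix (wtm t).

Variable j : 'I_d.

Let d0 : (0 < d)%N := leq_ltn_trans (leq0n j) (ltn_ord j).

(** The integral of [kp_gam_split] over all widths a; the two Fubini exchanges rest on the
    boundedness of the truncated kernel and on the finite mass of [vt t]. *)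
Lemma kc_split t c x : 0 < t -> 0 < c ->
  kc j c x = cv (kt j t) (gs c) x + cv (vt t) (kp j c) x.
Proof.
move=> t0 c0; have p0 := @sqrtpi_gt0 R.
pose K (z : R * E) := ps z.1 * kout j t z.1 z.2.
have mK : measurable_fun setT K.
  apply: measurable_funM; first exact: measurableT_comp measurable_ps measurable_fst.
  apply: measurable_funM; last exact: measurableT_comp (measurable_gt_nsq t) measurable_snd.
  exact: (@measurable_kp_joint R d _ _ fst snd).
have mg : measurable_fun setT (gs c : E -> R) by exact: measurable_gs.
have mk : measurable_fun setT (kp j c : E -> R) by exact: measurable_kp.
(* Outside the ball |z_j| / |z|^(d+1) <= 1 / |z|^d <= 1 / t^d. *)
have Kb z : (\int[leb]_a (`|K (a, z)|)%:E <= (ckk (R := R) (d := d) / t ^+ d)%:E)%E.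
  have C0 := ckk_gt0 (R := R) (d := d).
  rewrite /K /kout/=; case: (ltP (t ^+ 2) (nsq z)) => [tz|_]; last first.
    under eq_integral do rewrite !mulr0 normr0; rewrite integral0 lee_fin.
    by rewrite divr_ge0 ?exprn_ge0// ltW.
  have z0 : 0 < nsq z by apply: lt_trans tz; rewrite exprn_gt0.
  have N0 : 0 < Num.sqrt (nsq z) by rewrite sqrtr_gt0.
  under eq_integral do rewrite mulr1 normrM ger0_norm ?ps_ge0//.
  rewrite integral_abs_kp_radius// lee_fin ler_pM2l// exprS invfM mulrA.
  apply: (@le_trans _ _ (1 / Num.sqrt (nsq z) ^+ d)).
    rewrite ler_wpM2r ?invr_ge0 ?exprn_ge0 ?(ltW N0)// ler_pdivrMr// mul1r.
    by rewrite -sqrtr_sqr ler_wsqrtr// coord_sqr_le.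
  rewrite div1r lef_pV2 ?posrE ?exprn_gt0// lerXn2r ?nnegrE ?(ltW N0) ?(ltW t0)//.
  by rewrite -[leLHS](ger0_norm (ltW t0)) -sqrtr_sqr ler_wsqrtr// ltW.
have Klt : (\int[leb]_a \int[mu]_y (`|K (a, (x - y)%R) * gs c y|)%:E < +oo)%E.
  pose H (z : R * E) := K (z.1, x - z.2) * gs c z.2.
  have mH : measurable_fun setT (fun z : R * E => (`|H z|)%:E).
    apply/measurable_EFinP; apply: measurableT_comp => //; apply: measurable_funM; last first.
      exact: measurableT_comp mg measurable_snd.
    apply: (measurableT_comp mK); apply/measurable_fun_pair => //=.
    exact: measurableT_comp (measurable_rV_subl x) measurable_snd.
  rewrite (@fubini_tonelli _ _ _ _ _ leb mu (fun z : R * E => (`|H z|)%:E))//.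
  apply: (@le_lt_trans _ _ (\int[mu]_y ((ckk (R := R) (d := d) / t ^+ d)%:E * (gs c y)%:E))%E).
    apply: ge0_le_integral => //.
    - by move=> y _; exact: integral_ge0.
    - exact: (measurable_fun_fubini_tonelli_G (m1 := leb) (fun z : R * E => (`|H z|)%:E)).
    - by apply: measurable_funeM; exact/measurable_EFinP.
    - move=> y _; rewrite /H/=.
      under eq_integral do rewrite normrM [X in _ * X]ger0_norm ?gs_ge0// mulrC EFinM.
      rewrite ge0_integralZl_EFin ?gs_ge0//; last first.
        apply/measurable_EFinP; apply: measurableT_comp => //.
        exact: measurable_fun_pair1 mK.
      by rewrite muleC; apply: lee_wpmul2r; rewrite ?lee_fin ?gs_ge0.
  rewrite ge0_integralZl_EFin//; last 3 first.
  - by move=> y _; rewrite lee_fin gs_ge0.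
  - exact/measurable_EFinP.
  - by rewrite divr_ge0 ?exprn_ge0// ltW// ckk_gt0.
  by rewrite integral_gs// mule1 ltry.
have ktE z : kt j t z = (\int[leb]_a K (a, z))%R.
  rewrite /kt mulrC -Rintegral_measurableZl; last first.
    apply: measurable_funM; first exact: measurable_ps.
    exact: (@measurable_kp_joint R d _ _ id (fun=> z)).
  by apply: eq_Rintegral => a _; rewrite /K /kout/=; ring.
have kM y : `|kp j c y| <= kpsup (d := d) c by exact: kp_le_kpsup.
have wlt := wmass_lty d0 t0.
have -> : cv (kt j t) (gs c) x = cv (fun z => (\int[leb]_a K (a, z))%R) (gs c) x.
  by congr (cv _ _ x); apply/funext => z; exact: ktE.
rewrite mix_cv// (cv_mix (measurable_wtm t) (wtm_ge0 t) wlt x mk kM).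
have i1 := integrable_cv_mix mK mg Klt.
have i2 := integrable_cv_mix (measurable_wtm t) mk
  (mix_cv_lty (measurable_wtm t) (wtm_ge0 t) wlt x mk kM).
rewrite -RintegralD//; apply: eq_Rintegral => a _.
rewrite /K /wtm/= !cvZl//; [|exact: measurable_wt|exact: measurable_kout].
rewrite /kcm/= -mulrDr; have [a0|a0] := leP a 0; first by rewrite ps_le0// !mul0r.
by rewrite -kp_gam_split.
Qed.

End truncation_defect.

(** * Convolution of integrable with bounded functions, Gaussian mixtures and the Poisson
    identity *)

Section bounded_convolution.
Context {R : realType} {d : nat}.
Local Notation E := 'rV[R]_d.
Local Notation mu := (@lebesgue_rV R d).
Implicit Types f g h : E -> R.

Definition L1r f := mu.-integrable setT (EFin \o f).

Lemma L1r_measurable f : L1r f -> measurable_fun setT f.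
Proof. by move=> intf; apply/measurable_EFinP; exact: measurable_int intf. Qed.

Definition L1n f : R := fine (\int[mu]_x (`|f x|)%:E)%E.

Lemma L1nE f : L1r f -> (\int[mu]_x (`|f x|)%:E = (L1n f)%:E)%E.
Proof.
move=> intf; rewrite fineK// ge0_fin_numE; last exact: integral_ge0.
by apply/integrable_ltyP => //; exact: L1r_measurable.
Qed.

Lemma L1n_ge0 f : 0 <= L1n f.
Proof. by rewrite fine_ge0// integral_ge0. Qed.

Definition bdd (B : R) h := measurable_fun setT h /\ forall x, `|h x| <= B.

Lemma integrable_cv_bdd f h B x : L1r f -> bdd B h -> L1r (fun y => f (x - y) * h y).
Proof. by move=> intf [mh hB]; exact: (integrable_bounded (integrable_subl x intf) mh hB). Qed.

Lemma cv_bdd_abs f h B x : L1r f -> bdd B h ->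
  (\int[mu]_y (`|f (x - y) * h y|)%:E <= (B * L1n f)%:E)%E.
Proof.
move=> intf [mh hB]; have mf := L1r_measurable intf.
have B0 : 0 <= B := le_trans (normr_ge0 _) (hB 0).
have maf : measurable_fun setT (fun y => (`|f y|)%:E).
  by apply/measurable_EFinP; exact: measurableT_comp.
rewrite EFinM -L1nE// -(ge0_integral_rV_subl x maf)//.
rewrite -ge0_integralZl_EFin//; last exact: (measurableT_comp maf (measurable_rV_subl x)).
apply: ge0_le_integral => //.
- apply/measurable_EFinP; apply: measurableT_comp => //.
  by apply: measurable_funM => //; exact: measurable_subl.
- by apply: measurable_funeM; exact: (measurableT_comp maf (measurable_rV_subl x)).
- by move=> y _; rewrite -EFinM lee_fin normrM mulrC ler_wpM2r.
Qed.

Lemma bdd_cv f h B : L1r f -> bdd B h -> bdd (B * L1n f) (cv f h).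
Proof.
move=> intf hh; have mf := L1r_measurable intf; have [mh _] := hh.
split; first exact: measurable_cv.
move=> x; apply: le_normr_Rintegral_fin; last exact: cv_bdd_abs.
by apply: measurable_funM => //; exact: measurable_subl.
Qed.

Lemma cvA_bdd f g h B : L1r f -> L1r g -> bdd B h ->
  cv (cv f g) h = cv f (cv g h).
Proof.
move=> intf intg hh; apply: (@cvA _ _ _ _ _ (B * L1n g)) => //.
- exact: L1r_measurable.
- exact: hh.1.
- by move=> x; exact: cv_bdd_abs.
Qed.

Lemma cvBr f h1 h2 B1 B2 x : L1r f -> bdd B1 h1 -> bdd B2 h2 ->
  cv f (fun y => h1 y - h2 y) x = cv f h1 x - cv f h2 x.
Proof.
move=> intf b1 b2; rewrite /cv -RintegralB//.
- by apply: eq_Rintegral => y _; rewrite mulrBr.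
- exact: (integrable_cv_bdd x intf b1).
- exact: (integrable_cv_bdd x intf b2).
Qed.

Lemma cvBDl f1 f2 f3 h B x : L1r f1 -> L1r f2 -> L1r f3 -> bdd B h ->
  cv (fun y => f1 y - f2 y + f3 y) h x = cv f1 h x - cv f2 h x + cv f3 h x.
Proof.
move=> i1 i2 i3 b.
have j1 := integrable_cv_bdd x i1 b; have j2 := integrable_cv_bdd x i2 b.
have j3 := integrable_cv_bdd x i3 b.
rewrite /cv -RintegralB// -RintegralD//; last exact: integrable_realB.
by apply: eq_Rintegral => y _; rewrite mulrDl mulrBl.
Qed.

Section L1_convolution.
Variables f g : E -> R.
Hypotheses (intf : L1r f) (intg : L1r g).

Let mf := L1r_measurable intf.
Let mg := L1r_measurable intg.
Let H (z : E * E) := f (z.1 - z.2) * g z.2.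
Let mH : measurable_fun setT H. Proof. exact: measurable_cv_kernel. Qed.

Let inner y : (\int[mu]_x (`|H (x, y)|)%:E = (L1n f)%:E * (`|g y|)%:E)%E.
Proof.
have maf : measurable_fun setT (fun y => (`|f y|)%:E).
  by apply/measurable_EFinP; exact: measurableT_comp.
rewrite -L1nE// -(ge0_integral_rV_subr y maf)// muleC -ge0_integralZl_EFin//; last first.
  exact: (measurableT_comp maf (measurable_rV_subr y)).
by apply: eq_integral => x _; rewrite -EFinM /H/= normrM mulrC.
Qed.

Lemma cv_L1_lty : (\int[mu]_x \int[mu]_y (`|H (x, y)|)%:E < +oo)%E.
Proof.
have mH' : measurable_fun setT (fun z : E * E => (`|H z|)%:E).
  by apply/measurable_EFinP; exact: measurableT_comp.
rewrite (@fubini_tonelli _ _ _ _ _ mu mu (fun z : E * E => (`|H z|)%:E))//.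
under eq_integral do rewrite inner.
rewrite ge0_integralZl_EFin ?L1n_ge0//; last first.
  by apply/measurable_EFinP; exact: measurableT_comp.
by rewrite L1nE// -EFinM ltry.
Qed.

Lemma L1r_cv : L1r (cv f g).
Proof. exact: (@integrable_Rintegral_fst _ _ _ _ _ mu mu H mH cv_L1_lty). Qed.

Lemma cv_L1_ae : {ae mu, forall x, ((cv f g x)%:E = \int[mu]_y (f (x - y) * g y)%:E)%E}.
Proof. exact: (@EFin_Rintegral_ae _ _ _ _ _ mu mu H mH cv_L1_lty). Qed.

Lemma Rintegral_cv : (\int[mu]_x cv f g x)%R = (\int[mu]_x f x)%R * (\int[mu]_x g x)%R.
Proof.
rewrite [LHS](@Rintegral_fubini _ _ _ _ _ mu mu H mH cv_L1_lty).
rewrite -(Rintegral_measurableZl mu _ mg); apply: eq_Rintegral => y _.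
have ms : measurable_fun setT (fun x : E => f (x - y)).
  exact: (measurableT_comp mf (measurable_rV_subr y)).
rewrite -(Rintegral_rV_subr y mf) mulrC -(Rintegral_measurableZl mu _ ms).
by apply: eq_Rintegral => x _; rewrite /H/= mulrC.
Qed.

End L1_convolution.
End bounded_convolution.

Section gaussian_mixtures.
Context {R : realType} {d : nat}.
Local Notation E := 'rV[R]_d.
Local Notation mu := (@lebesgue_rV R d).
Local Notation leb := (@lebesgue_measure R).
Variable w : R -> R.
Hypotheses (mw : measurable_fun setT w) (w0 : forall a, 0 <= w a).
Hypotheses (wneg : forall a, a <= 0 -> w a = 0) (wlt : (\int[leb]_a (w a)%:E < +oo)%E).

(** The weight vanishes for a <= 0, where [gs a] is negative if d is odd. *)
Definition gK (z : R * E) : R := w z.1 * gs z.1 z.2.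

Lemma measurable_gK : measurable_fun setT gK.
Proof.
apply: measurable_funM; first exact: measurableT_comp mw measurable_fst.
by apply: measurable_gs_joint; [exact: measurable_fst|exact: measurable_snd].
Qed.

Lemma gK_ge0 z : 0 <= gK z.
Proof.
rewrite /gK; have [a0|a0] := leP z.1 0; first by rewrite wneg// mul0r.
by rewrite mulr_ge0 ?gs_ge0.
Qed.

Lemma gK_mass : (\int[leb]_a \int[mu]_z (gK (a, z))%:E = \int[leb]_a (w a)%:E)%E.
Proof.
apply: eq_integral => a _; rewrite /gK/=; have [a0|a0] := leP a 0.
  by rewrite wneg//; under eq_integral do rewrite mul0r; rewrite integral0.
under eq_integral do rewrite EFinM.
rewrite ge0_integralZl_EFin//; first by rewrite integral_gs// mule1.
- by move=> z _; rewrite lee_fin gs_ge0.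
- by apply/measurable_EFinP; exact: measurable_gs.
Qed.

Lemma gK_lty : (\int[leb]_a \int[mu]_z (gK (a, z))%:E < +oo)%E.
Proof. by rewrite gK_mass. Qed.

Definition gmix : E -> R := mix gK.

Lemma L1r_gmix : L1r gmix.
Proof. exact: (integrable_mix measurable_gK gK_ge0 gK_lty). Qed.

Lemma gmix_ge0 z : 0 <= gmix z.
Proof. exact: (mix_ge0 gK_ge0). Qed.

Lemma integral_gmix : (\int[mu]_z (gmix z)%:E = \int[leb]_a (w a)%:E)%E.
Proof. by rewrite (integral_mix measurable_gK gK_ge0 gK_lty) gK_mass. Qed.

Lemma cv_gmix f B x : bdd B f ->
  cv gmix f x = (\int[leb]_a (w a * cv (gs a) f x))%R /\
  leb.-integrable setT (fun a => (w a * cv (gs a) f x)%:E).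
Proof.
move=> [mf fB].
have e a : cv (fun z => gK (a, z)) f x = w a * cv (gs a) f x.
  by rewrite /gK/= cvZl//; exact: measurable_gs.
split.
  rewrite (cv_mix measurable_gK gK_ge0 gK_lty x mf fB).
  by apply: eq_Rintegral => a _; rewrite e.
have := integrable_cv_mix measurable_gK mf (mix_cv_lty measurable_gK gK_ge0 gK_lty x mf fB).
by apply: eq_integrable => // a _; rewrite e.
Qed.

End gaussian_mixtures.

Section poisson.
Context {R : realType} {d : nat}.
Local Notation E := 'rV[R]_d.
Local Notation mu := (@lebesgue_rV R d).
Local Notation leb := (@lebesgue_measure R).
Implicit Types (a b c t y : R) (x z : E).

Definition ew y a : R := expR (- (y ^+ 2 / a ^+ 2)).

Lemma measurable_ew y : measurable_fun setT (ew y).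
Proof. exact: measurable_expVX. Qed.

Lemma ew_le1 y a : ew y a <= 1.
Proof. by rewrite -expR0 ler_expR oppr_le0 divr_ge0 ?sqr_ge0. Qed.

Definition w1 y a : R := ps a * (1 - ew y a).

Definition w2 y b : R := hgauss^-1 * cauchy_weight y b.

Lemma measurable_w1 y : measurable_fun setT (w1 y).
Proof.
by apply: measurable_funM; [exact: measurable_ps|apply: measurable_funB => //; exact: measurable_ew].
Qed.

Lemma w1_ge0 y a : 0 <= w1 y a.
Proof. by rewrite mulr_ge0 ?ps_ge0// subr_ge0 ew_le1. Qed.

Lemma w1_neg y a : a <= 0 -> w1 y a = 0.
Proof. by move=> a0; rewrite /w1 ps_le0// mul0r. Qed.

Lemma w1_lty1 : (\int[leb]_a (w1 1 a)%:E < +oo)%E.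
Proof.
apply: (@integral_ps_lty _ _ 1).
- by apply: measurable_funB => //; exact: measurable_ew.
- by move=> a _; rewrite subr_ge0 ew_le1.
- by move=> a _; rewrite gerBl expR_ge0.
- move=> a a1; have a0 := lt_le_trans ltr01 a1.
  apply: (@le_trans _ _ (a ^+ 2)^-1).
    rewrite /ew expr1n div1r lerBlDr addrC -lerBlDr.
    by have := expR_ge1Dx (- (a ^+ 2)^-1).
  rewrite div1r lef_pV2 ?posrE ?exprn_gt0 ?mulr_gt0 ?sqrtr_gt0// expr2 ler_pM2l//.
  rewrite -[leRHS](sqr_sqrtr (ltW a0)) expr2 ler_peMl ?sqrtr_ge0//.
  by rewrite -sqrtr1 ler_wsqrtr.
Qed.

Lemma w1_scale y : 0 < y ->
  (\int[leb]_a (w1 y a)%:E = y%:E * \int[leb]_a (w1 1 a)%:E)%E.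
Proof.
move=> y0; have mw : measurable_fun setT (fun a => (w1 y a)%:E).
  by apply/measurable_EFinP; exact: measurable_w1.
have h := ge0_integral_scale y0 mw (fun a => w1_ge0 y a).
have e : (\int[leb]_a (w1 y (y * a))%:E = \int[leb]_a (w1 1 a)%:E)%E.
  apply: eq_integral => a _; rewrite /w1 ps_scale// /ew.
  have [a0|a0] := leP a 0; first by rewrite ps_le0// !mul0r.
  congr ((_ * (1 - expR (- _)))%:E); rewrite exprMn expr1n; field.
  by rewrite ?gt_eqF.
by rewrite -e h muleA -EFinM divff ?mul1e// gt_eqF.
Qed.

Lemma w1_lty y : 0 < y -> (\int[leb]_a (w1 y a)%:E < +oo)%E.
Proof.
by move=> y0; rewrite w1_scale// lte_mul_pinfty ?lee_fin ?(ltW y0)//; exact: w1_lty1.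
Qed.

Lemma measurable_w2 y : measurable_fun setT (w2 y).
Proof. by apply: measurable_funM => //; exact: measurable_cauchy_weight. Qed.

Lemma w2_ge0 y b : 0 < y -> 0 <= w2 y b.
Proof. by move=> y0; rewrite mulr_ge0 ?cauchy_weight_ge0 ?(ltW y0)// invr_ge0 ltW// hgauss_gt0. Qed.

Lemma w2_neg y b : b <= 0 -> w2 y b = 0.
Proof. by move=> b0; rewrite /w2 /cauchy_weight ps_le0// mul0r mulr0. Qed.

Lemma w2_mass y : 0 < y -> (\int[leb]_b (w2 y b)%:E = 1)%E.
Proof.
move=> y0; have h0 := hgauss_gt0 (R := R); rewrite /w2.
under eq_integral do rewrite EFinM.
rewrite ge0_integralZl_EFin//; first by rewrite integral_cauchy_weight// -EFinM mulVf// gt_eqF.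
- by move=> b _; rewrite lee_fin cauchy_weight_ge0// ltW.
- by apply/measurable_EFinP; exact: measurable_cauchy_weight.
- by rewrite invr_ge0 ltW.
Qed.

Lemma w2_lty y : 0 < y -> (\int[leb]_b (w2 y b)%:E < +oo)%E.
Proof. by move=> y0; rewrite w2_mass// ltry. Qed.

(** [polar] divided by [hgauss]: averaging over b with the probability density [w2 y] multiplies the
    radial integrand by [ew y]. *)
Lemma polar_w2 (F : R -> R) y : 0 < y -> measurable_fun setT F -> (forall r, 0 <= F r) ->
  (\int[leb]_b \int[leb]_a (w2 y b * (ps a * F (Num.sqrt (a ^+ 2 + b ^+ 2))))%:E =
   \int[leb]_r (ps r * (ew y r * F r))%:E)%E.
Proof.
move=> y0 mF F0; have h0 := hgauss_gt0 (R := R).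
have mF' : measurable_fun setT (EFin \o F) by exact/measurable_EFinP.
have mps := measurable_ps (R := R); have mc := measurable_cauchy_weight y.
have h := polar y0 mF' (fun r => F0 r).
pose H (z : R * R) := ps z.2 * cauchy_weight y z.1 * F (Num.sqrt (z.2 ^+ 2 + z.1 ^+ 2)).
have mH : measurable_fun setT H.
  apply: measurable_funM.
    by apply: measurable_funM; [exact: measurableT_comp mps measurable_snd|exact: measurableT_comp mc measurable_fst].
  apply: (measurableT_comp mF); apply: (measurableT_comp measurable_sqrt).
  by apply: measurable_funD; apply: measurable_funX; [exact: measurable_snd|exact: measurable_fst].
have H0 (z : R * R) : 0 <= H z by rewrite mulr_ge0// mulr_ge0 ?ps_ge0 ?cauchy_weight_ge0 ?(ltW y0).
have mHE : measurable_fun setT (fun z : R * R => (H z)%:E) by exact/measurable_EFinP.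
have mI := measurable_fun_fubini_tonelli_F (m2 := leb) (fun z : R * R => (H z)%:E) mHE (fun z : R * R => H0 z).
transitivity ((hgauss^-1)%:E * \int[leb]_b \int[leb]_a (H (b, a))%:E)%E.
  rewrite -ge0_integralZl_EFin//; last 2 first.
  - by move=> b _; apply: integral_ge0 => a _; rewrite lee_fin.
  - by rewrite invr_ge0 ltW.
  apply: eq_integral => b _; rewrite -ge0_integralZl_EFin//; last 3 first.
  - by move=> a _; rewrite lee_fin.
  - exact: (measurable_fun_pair2 b mHE).
  - by rewrite invr_ge0 ltW.
  by apply: eq_integral => a _; rewrite -EFinM; congr EFin; rewrite /w2 /H/=; ring.
transitivity ((hgauss^-1)%:E * (hgauss%:E * \int[leb]_r (ps r * (ew y r * F r))%:E))%E; last first.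
  by rewrite muleA -EFinM mulVf ?mul1e// gt_eqF.
congr (_ * _)%E; rewrite /H/=; under eq_integral do under eq_integral do rewrite EFinM.
rewrite h; congr (_ * _)%E; apply: eq_integral => r _.
by rewrite /= -EFinM; congr EFin; rewrite /ew mulrA.
Qed.

Variable j : 'I_d.

Let d0 : (0 < d)%N := leq_ltn_trans (leq0n j) (ltn_ord j).

Definition psi y : E -> R := gmix (w1 y).

Definition py y : E -> R := gmix (w2 y).

Lemma bdd_kp c : 0 < c -> bdd (kpsup (d := d) c) (kp j c).
Proof. by move=> c0; split; [exact: measurable_kp|move=> x; exact: kp_le_kpsup]. Qed.

Lemma bdd_kc c : 0 < c -> bdd (kcsup (d := d) c) (kc j c).
Proof. by move=> c0; split; [exact: measurable_kc|move=> x; exact: kc_le]. Qed.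

(** Convolving with [gs b] turns [kc j c] into [kc j (gam c b)], so [py y] * [kc j c] is an integral
    over the (a, b) quarter plane of a function of a^2 + b^2. By [polar_w2] it is the integral
    defining [kc j c] with the extra weight [ew y]; the mixture [psi y] supplies the complementary
    weight 1 - [ew y]. *)
Lemma kc_poisson y c x : 0 < y -> 0 < c ->
  kc j c x = cv (psi y) (kp j c) x + cv (py y) (kc j c) x.
Proof.
move=> y0 c0.
have [-> _] := cv_gmix (measurable_w1 y) (w1_ge0 y) (@w1_neg y) (w1_lty y0) x (bdd_kp c0).
have [-> _] := cv_gmix (measurable_w2 y) (fun b => w2_ge0 b y0) (@w2_neg y) (w2_lty y0) x (bdd_kc c0).
pose F r := `|kp j (gam c r) x|.
have mk : measurable_fun setT (fun r => kp j (gam c r) x).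
  exact: (@measurable_kp_joint R d _ _ (gam c) (fun=> x) (measurable_gam c)).
have mF : measurable_fun setT F by exact: measurableT_comp mk.
have F0 r : 0 <= F r by exact: normr_ge0.
(* Factoring out the common sign makes the polar formula for nonnegative functions applicable. *)
have kF r : kp j (gam c r) x = Num.sg (x 0 j) * F r by apply: kp_sg; exact: gam_gt0.
pose I b := (\int[leb]_a (ps a * F (Num.sqrt (a ^+ 2 + b ^+ 2))))%R.
have gE a b : gam (gam c b) a = gam c (Num.sqrt (a ^+ 2 + b ^+ 2)).
  by rewrite {1}/gam sqr_gam [in RHS]/gam sqr_sqrtr ?addr_ge0 ?sqr_ge0// addrA.
have mFs b : measurable_fun setT (fun a => ps a * F (Num.sqrt (a ^+ 2 + b ^+ 2))).
  apply: measurable_funM; first exact: measurable_ps.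
  apply: (measurableT_comp mF); apply: (measurableT_comp measurable_sqrt).
  by apply: measurable_funD => //; exact: measurable_funX.
have kcI b : kc j (gam c b) x = Num.sg (x 0 j) * I b.
  rewrite /I -(Rintegral_measurableZl leb _ (mFs b)); apply: eq_Rintegral => a _.
  by rewrite /kcm/= gE kF mulrCA.
have IE b : 0 < b -> ((I b)%:E = \int[leb]_a (ps a * F (Num.sqrt (a ^+ 2 + b ^+ 2)))%:E)%E.
  move=> b0; apply: EFin_Rintegral; apply/integrable_ltyP; first exact: mFs.
  have g0 : 0 < gam c b := gam_gt0 b c0.
  apply: le_lt_trans (ltry (kcsup (d := d) (gam c b))); have := integral_abs_kcm j g0 x.
  apply: le_trans; rewrite le_eqVlt; apply/orP; left; apply/eqP.
  by apply: eq_integral => a _; congr EFin; rewrite /kcm/= gE [LHS]normrM [RHS]normrM normr_id.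
have mI : measurable_fun setT I.
  pose H (z : R * R) := ps z.2 * F (Num.sqrt (z.2 ^+ 2 + z.1 ^+ 2)).
  have mH : measurable_fun setT H.
    apply: measurable_funM; first exact: measurableT_comp measurable_ps measurable_snd.
    apply: (measurableT_comp mF); apply: (measurableT_comp measurable_sqrt).
    by apply: measurable_funD; apply: measurable_funX; [exact: measurable_snd|exact: measurable_fst].
  exact: (measurable_Rintegral_fst leb mH).
have mwI : measurable_fun setT (fun b => w2 y b * I b).
  by apply: measurable_funM => //; exact: measurable_w2.
have meF : measurable_fun setT (fun r => ps r * (ew y r * F r)).
  by apply: measurable_funM; [exact: measurable_ps|apply: measurable_funM => //; exact: measurable_ew].
have e2 : (\int[leb]_b (w2 y b * cv (gs b) (kc j c) x))%R = (\int[leb]_r (ew y r * kcm j c (r, x)))%R.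
  transitivity (Num.sg (x 0 j) * (\int[leb]_b (w2 y b * I b))%R).
    rewrite -(Rintegral_measurableZl leb _ mwI); apply: eq_Rintegral => b _.
    have [b0|b0] := leP b 0; first by rewrite w2_neg// !mul0r mulr0.
    rewrite cvC; [|exact: measurable_gs|exact: measurable_kc].
    by rewrite cv_kc_gs// kcI mulrCA.
  transitivity (Num.sg (x 0 j) * (\int[leb]_r (ps r * (ew y r * F r)))%R).
    congr (_ * _); rewrite /Rintegral; congr fine; rewrite -(polar_w2 y0 mF F0).
    apply: eq_integral => b _; have [b0|b0] := leP b 0.
      by rewrite w2_neg// mul0r; under eq_integral do rewrite mul0r; rewrite integral0.
    under [RHS]eq_integral do rewrite EFinM.
    rewrite ge0_integralZl_EFin ?w2_ge0//; first by rewrite EFinM IE.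
    + by move=> a _; rewrite lee_fin mulr_ge0// ps_ge0.
    + by apply/measurable_EFinP; exact: mFs.
  rewrite -(Rintegral_measurableZl leb _ meF); apply: eq_Rintegral => r _.
  rewrite /kcm/= kF; ring.
have e1 : (\int[leb]_a (w1 y a * cv (gs a) (kp j c) x))%R = (\int[leb]_r ((1 - ew y r) * kcm j c (r, x)))%R.
  apply: eq_Rintegral => a _; have [a0|a0] := leP a 0.
    by rewrite w1_neg// /kcm/= ps_le0// !mul0r mulr0.
  by rewrite cv_gs_kp// /w1 /kcm/= -/(gam c a); ring.
have ik := integrable_kcm j c0 x.
have mew := measurable_ew y.
have iew : leb.-integrable setT (EFin \o (fun r => ew y r * kcm j c (r, x))).
  have hb r : `|ew y r| <= 1 by rewrite ger0_norm ?expR_ge0// ew_le1.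
  have := @integrable_bounded _ _ _ leb (fun r => kcm j c (r, x)) (ew y) 1 ik mew hb.
  by apply: eq_integrable => // r _; rewrite /= mulrC.
have iew1 : leb.-integrable setT (EFin \o (fun r => (1 - ew y r) * kcm j c (r, x))).
  have := integrable_realB ik iew; apply: eq_integrable => // r _; rewrite /= mulrBl mul1r.
  by [].
rewrite e1 e2 -RintegralD//; apply: eq_Rintegral => r _; ring.
Qed.

End poisson.

(** * The function [phi]: identity, mass and positivity *)

Section defect_positivity.
Context {R : realType} {d : nat}.
Local Notation E := 'rV[R]_d.
Local Notation mu := (@lebesgue_rV R d).
Local Notation leb := (@lebesgue_measure R).
Implicit Types (a b c t y : R) (x z : E).
Variables (j : 'I_d) (y t : R).
Hypotheses (y0 : 0 < y) (t0 : 0 < t).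

Let d0 : (0 < d)%N := leq_ltn_trans (leq0n j) (ltn_ord j).

Let L1psi : L1r (psi y : E -> R).
Proof. exact: (L1r_gmix (measurable_w1 y) (w1_ge0 y) (@w1_neg _ y) (w1_lty y0)). Qed.

Let L1py : L1r (py y : E -> R).
Proof. exact: (L1r_gmix (measurable_w2 y) (fun b => w2_ge0 b y0) (@w2_neg _ y) (w2_lty y0)). Qed.

Let py0 z : 0 <= py y z.
Proof. exact: (gmix_ge0 (fun b => w2_ge0 b y0) (@w2_neg _ y)). Qed.

Let py1 : (\int[mu]_z py y z)%R = 1.
Proof.
rewrite /Rintegral (integral_gmix (measurable_w2 y) (fun b => w2_ge0 b y0) (@w2_neg _ y) (w2_lty y0)).
by rewrite w2_mass.
Qed.

Let L1vt : L1r (vt t : E -> R).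
Proof. exact: (integrable_mix (measurable_wtm t) (wtm_ge0 t) (wmass_lty d0 t0)). Qed.

Let vt0 z : 0 <= vt t z.
Proof. exact: (mix_ge0 (wtm_ge0 t)). Qed.

Definition phi z : R := psi y z - vt t z + cv (py y) (vt t) z.

Let L1pv : L1r (cv (py y) (vt t) : E -> R).
Proof. exact: L1r_cv. Qed.

Lemma L1r_phi : L1r phi.
Proof. by apply: integrable_realD => //; exact: integrable_realB. Qed.

(** [py y] has mass one, so the contributions of [vt t] and of [py y] * [vt t] cancel. *)
Lemma Rintegral_phi : (\int[mu]_z phi z)%R = (\int[mu]_z psi y z)%R.
Proof.
rewrite /phi RintegralD//; last exact: integrable_realB.
by rewrite RintegralB// Rintegral_cv// py1 mul1r subrK.
Qed.

Lemma cv_psi_kt c : 0 < c ->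
  cv (psi y) (cv (kt j t) (gs c)) = cv phi (kc j c).
Proof.
move=> c0; have bk := bdd_kc j c0; have bp := bdd_kp j c0.
have bvp := bdd_cv L1vt bp; have bpk := bdd_cv L1py bk.
apply/funext => x.
have -> : cv (kt j t) (gs c) = (fun z => kc j c z - cv (vt t) (kp j c) z).
  by apply/funext => z; rewrite (kc_split j z t0 c0) addrK.
rewrite (cvBr x L1psi bk bvp) -(cvA_bdd L1psi L1vt bp).
have -> : cv (psi y) (vt t) = cv (vt t) (psi y) :> (E -> R) by apply: cvC; exact: L1r_measurable.
rewrite (cvA_bdd L1vt L1psi bp).
have -> : cv (psi y) (kp j c) = (fun z => kc j c z - cv (py y) (kc j c) z).
  by apply/funext => z; rewrite {1}(kc_poisson j z y0 c0) addrK.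
rewrite (cvBr x L1vt bk bpk) -(cvA_bdd L1vt L1py bk).
have -> : cv (vt t) (py y) = cv (py y) (vt t) :> (E -> R) by apply: cvC; exact: L1r_measurable.
rewrite (cvBDl x L1psi L1vt L1pv bk); move: (cv _ _ x) (cv _ _ x) (cv _ _ x) => p q r; ring.
Qed.

Section positivity.
Variables (x : E) (A : R).
Hypotheses (xt : nsq x < t ^+ 2) (A0 : 0 <= A).

Let chi a : R := \1_(`[0, A]%classic : set R) a.
Let chi0 a : 0 <= chi a. Proof. by rewrite /chi indicE. Qed.
Let chi1 a : chi a <= 1. Proof. by rewrite /chi indicE lern1 leq_b1. Qed.
Let mchi : measurable_fun setT chi. Proof. exact: measurable_indic. Qed.
Let mps := measurable_ps (R := R).
Let u a := ps a * chi a.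
Let u0 a : 0 <= u a. Proof. by rewrite mulr_ge0 ?ps_ge0. Qed.
Let mu_ : measurable_fun setT u. Proof. exact: measurable_funM. Qed.
Let un a : a <= 0 -> u a = 0. Proof. by move=> a0; rewrite /u ps_le0// mul0r. Qed.

Let bdd_wt a : 0 < a -> bdd ((a * Num.sqrt pi) ^- d) (wt t a : E -> R).
Proof.
move=> a0; split; first exact: measurable_wt.
by move=> z; rewrite ger0_norm ?wt_ge0// (le_trans (wt_le t z a0))// gs_le.
Qed.

Let bdd_gs a : 0 < a -> bdd ((a * Num.sqrt pi) ^- d) (gs a : E -> R).
Proof.
by move=> a0; split; [exact: measurable_gs|move=> z; rewrite ger0_norm ?gs_ge0// gs_le].
Qed.

Let pw a := cv (py y) (wt t a) x.
Let pg a := cv (py y) (gs a) x.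

Let pw0 a : 0 <= pw a.
Proof. by apply: Rintegral_ge0 => z _; rewrite mulr_ge0 ?wt_ge0. Qed.

Let pg_le a : 0 < a -> pg a <= gsr (d := d) a t + pw a.
Proof.
move=> a0; have b1 := bdd_wt a0; have b2 := bdd_gs a0.
have mpx := measurable_subl x (L1r_measurable L1py).
have ipx : L1r (fun z => py y (x - z)) by exact: integrable_subl.
rewrite -[gsr (d := d) a t]mulr1 -py1 -(Rintegral_rV_subl x (L1r_measurable L1py)).
rewrite -(Rintegral_measurableZl mu _ mpx) -RintegralD//; last 2 first.
- exact: integrable_realZl.
- exact: (integrable_cv_bdd x L1py b1).
apply: le_Rintegral => //.
- exact: (integrable_cv_bdd x L1py b2).
- by apply: integrable_realD; [exact: integrable_realZl|exact: (integrable_cv_bdd x L1py b1)].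
- by move=> z _; rewrite [X in _ <= X + _]mulrC -mulrDr ler_wpM2l// gs_le_wt.
Qed.

Let mgx : measurable_fun setT (fun a => gs a x).
Proof. exact: (@measurable_gs_joint R d _ _ id (fun=> x)). Qed.

Let mew := measurable_ew (R := R) y.

(** The cut-off on the left concerns the radius sqrt (a^2 + b^2), and this being at most A forces a
    <= A; so the polar identity becomes an inequality. The inner integral on the right uses [gs b] *
    [gs a] = [gs] of the radius. *)
Let L_le : (\int[leb]_a (ps a * (ew y a * (chi a * gs a x)))%:E <=
  \int[leb]_a (u a * pg a)%:E)%E.
Proof.
(* The maximum is taken because [polar_w2] asks for a function nonnegative on the whole line; for r
   > 0 it changes nothing. *)
pose F r := chi r * Num.max (gs r x) 0.
have mF : measurable_fun setT F.
  by apply: measurable_funM => //; exact: measurable_maxr.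
have F0 r : 0 <= F r by rewrite mulr_ge0// le_max lexx orbT.
have Fp r : 0 < r -> F r = chi r * gs r x by move=> r0; rewrite /F max_l// gs_ge0.
have -> : (\int[leb]_a (ps a * (ew y a * (chi a * gs a x)))%:E =
    \int[leb]_a (ps a * (ew y a * F a))%:E)%E.
  apply: eq_integral => a _; have [a0|a0] := leP a 0; first by rewrite ps_le0// !mul0r.
  by rewrite Fp.
rewrite -(polar_w2 y0 mF F0).
pose s (z : R * R) := Num.sqrt (z.2 ^+ 2 + z.1 ^+ 2).
have ms : measurable_fun setT s.
  apply: (measurableT_comp measurable_sqrt).
  by apply: measurable_funD; apply: measurable_funX; [exact: measurable_snd|exact: measurable_fst].
pose G (z : R * R) := w2 y z.1 * (u z.2 * Num.max (gs (s z) x) 0).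
have mG1 : measurable_fun setT (fun z : R * R => w2 y z.1 * (ps z.2 * F (s z))).
  apply: measurable_funM; first exact: measurableT_comp (measurable_w2 y) measurable_fst.
  by apply: measurable_funM; [exact: measurableT_comp mps measurable_snd|exact: measurableT_comp mF ms].
have mG : measurable_fun setT G.
  apply: measurable_funM; first exact: measurableT_comp (measurable_w2 y) measurable_fst.
  apply: measurable_funM; first exact: measurableT_comp mu_ measurable_snd.
  by apply: measurable_maxr => //; exact: measurableT_comp mgx ms.
have mG1E : measurable_fun setT (fun z : R * R => (w2 y z.1 * (ps z.2 * F (s z)))%:E) by exact/measurable_EFinP.
have mGE : measurable_fun setT (fun z : R * R => (G z)%:E) by exact/measurable_EFinP.
have G10 (z : R * R) : (0 <= (w2 y z.1 * (ps z.2 * F (s z)))%:E)%E.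
  by rewrite lee_fin mulr_ge0 ?w2_ge0// mulr_ge0 ?ps_ge0.
have G0 (z : R * R) : (0 <= (G z)%:E)%E.
  by rewrite lee_fin mulr_ge0 ?w2_ge0// mulr_ge0// le_max lexx orbT.
apply: (@le_trans _ _ (\int[leb]_b \int[leb]_a (G (b, a))%:E)%E).
  apply: ge0_le_integral => //.
  - by move=> b _; apply: integral_ge0 => a _; exact: (G10 (b, a)).
  - exact: (measurable_fun_fubini_tonelli_F (m2 := leb) (fun z : R * R => (w2 y z.1 * (ps z.2 * F (s z)))%:E) mG1E G10).
  - exact: (measurable_fun_fubini_tonelli_F (m2 := leb) (fun z : R * R => (G z)%:E) mGE G0).
  move=> b _; apply: ge0_le_integral => //.
  - by move=> a _; exact: (G10 (b, a)).
  - exact: (measurable_fun_pair2 b mG1E).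
  - exact: (measurable_fun_pair2 b mGE).
  move=> a _; rewrite lee_fin /G/= ler_wpM2l ?w2_ge0// /u -mulrA.
  have [a0|a0] := leP a 0; first by rewrite ps_le0// !mul0r.
  rewrite ps_gt0// !mul1r /F ler_wpM2r//; first by rewrite le_max lexx orbT.
  rewrite /chi !indicE; case: (boolP (_ \in _)) => [|_]; last by rewrite ler0n.
  rewrite !inE/= !in_itv/= => /andP[_ sA]; rewrite mem_set//= in_itv/= (ltW a0)/=.
  apply: le_trans sA; rewrite -[leLHS]ger0_norm ?(ltW a0)// -sqrtr_sqr ler_wsqrtr//.
  by rewrite lerDl sqr_ge0.
rewrite (@fubini_tonelli _ _ _ _ _ leb leb (fun z : R * R => (G z)%:E))//.
rewrite le_eqVlt; apply/orP; left; apply/eqP; apply: eq_integral => a _.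
have [a0|a0] := leP a 0.
  by rewrite un// mul0r /G/= un//; under eq_integral do rewrite mul0r mulr0; rewrite integral0.
have [e ie] := cv_gmix (measurable_w2 y) (fun b => w2_ge0 b y0) (@w2_neg _ y) (w2_lty y0) x (bdd_gs a0).
rewrite /pg {1}/py e EFinM (EFin_Rintegral ie) -ge0_integralZl_EFin//; last 2 first.
- move=> b _; rewrite lee_fin; have [b0|b0] := leP b 0; first by rewrite w2_neg// mul0r.
  by rewrite mulr_ge0 ?w2_ge0// cv_gs// gs_ge0// gs_sqrt_gt0.
- exact: measurable_int ie.
apply: eq_integral => b _; rewrite -EFinM /G/=; congr EFin.
have [b0|b0] := leP b 0; first by rewrite w2_neg// !mul0r mulr0.
rewrite cv_gs// mulrCA; congr (_ * (_ * _)).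
by rewrite /s/= addrC max_l// gs_ge0// gs_sqrt_gt0.
Qed.

Let gsr_lty : (\int[leb]_a (u a * gsr (d := d) a t)%:E < +oo)%E.
Proof.
have p0 := @sqrtpi_gt0 R.
(* With s = a / t, [gsr a t] is t^-d (s^2 / 2) [kprof s], and the cut-off bounds s by A / t. *)
pose B := t ^- d * ((A / t) ^+ 2 / 2).
have B0 : 0 <= B by rewrite mulr_ge0 ?divr_ge0 ?sqr_ge0// invr_ge0 exprn_ge0// ltW.
pose k (s : R) := ps s * kprof (d := d) s.
have mk : measurable_fun setT k by apply: measurable_funM => //; exact: measurable_kprof.
have k0 s : 0 <= k s.
  by rewrite /k; have [s0|s0] := leP s 0; [rewrite ps_le0// mul0r|rewrite ps_gt0// mul1r kprof_ge0].
have mkE : measurable_fun setT (EFin \o k) by exact/measurable_EFinP.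
have it0 : 0 < t^-1 by rewrite invr_gt0.
have h := ge0_integral_scale it0 mkE (fun s => k0 s).
have mks : measurable_fun setT (fun a => k (t^-1 * a)).
  by apply: (measurableT_comp mk); exact: measurable_funM.
apply: (@le_lt_trans _ _ (\int[leb]_a (B%:E * (k (t^-1 * a))%:E))%E).
  apply: ge0_le_integral => //.
  - move=> a _; rewrite lee_fin; have [a0|a0] := leP a 0; first by rewrite un// mul0r.
    by rewrite mulr_ge0// gsr_ge0.
  - by apply/measurable_EFinP; apply: measurable_funM => //; exact: measurable_gsr.
  - by apply: measurable_funeM; exact/measurable_EFinP.
  move=> a _; rewrite -EFinM lee_fin /k ps_scale// /u.
  have [a0|a0] := leP a 0; first by rewrite ps_le0// !mul0r mulr0.
  rewrite ps_gt0// !mul1r /chi indicE; case: (boolP (_ \in _)) => [|_]; last first.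
    by rewrite mul0r mulr_ge0// kprof_ge0// mulr_gt0.
  rewrite inE/= in_itv/= mul1r => /andP[_ aA].
  have s0 : 0 < t^-1 * a by rewrite mulr_gt0.
  have -> : gsr (d := d) a t = t ^- d * ((t^-1 * a) ^+ 2 / 2) * kprof (d := d) (t^-1 * a).
    rewrite /gsr /kprof (_ : t ^+ 2 / a ^+ 2 = 1 / (t^-1 * a) ^+ 2); last first.
      by rewrite exprMn; field; rewrite ?gt_eqF.
    have {1}-> : a = t * (t^-1 * a) by rewrite mulrA divff ?mul1r// gt_eqF.
    move: s0; move: (t^-1 * a) => s s0; rewrite -[t * s * _]mulrA [(t * _) ^+ d]exprMn.
    have A1 : t ^+ d != 0 by rewrite gt_eqF// exprn_gt0.
    have B1 : (s * Num.sqrt pi) ^+ d != 0 by rewrite gt_eqF// exprn_gt0// mulr_gt0.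
    move: (t ^+ d) ((s * Num.sqrt pi) ^+ d) A1 B1 (expR _) => P Q A1 B1 ex; field.
    by rewrite A1 B1 ?gt_eqF.
  rewrite ler_wpM2r ?kprof_ge0// /B ler_wpM2l ?invr_ge0 ?exprn_ge0 ?(ltW t0)//.
  rewrite ler_wpM2r// lerXn2r ?nnegrE ?(ltW s0) ?divr_ge0 ?(ltW t0)// mulrC.
  by rewrite ler_wpM2r// ltW.
rewrite ge0_integralZl_EFin//; last 2 first.
- by move=> a _; rewrite lee_fin.
- exact/measurable_EFinP.
rewrite h (ckkE (d := d)) -!EFinM; exact: ltry.
Qed.

Let PL : (\int[leb]_a (ps a * pw a)%:E = \int[mu]_z (py y (x - z) * vt t z)%:E)%E.
Proof.
pose H (z : R * E) := py y (x - z.2) * wtm t z.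
have mpx := measurable_subl x (L1r_measurable L1py).
have mH : measurable_fun setT (fun z : R * E => (H z)%:E).
  apply/measurable_EFinP; apply: measurable_funM; last exact: measurable_wtm.
  exact: measurableT_comp mpx measurable_snd.
have H0 (z : R * E) : (0 <= (H z)%:E)%E by rewrite lee_fin mulr_ge0 ?wtm_ge0.
transitivity (\int[leb]_a \int[mu]_z (H (a, z))%:E)%E.
  apply: eq_integral => a _; rewrite /H /wtm/=; have [a0|a0] := leP a 0.
    by rewrite ps_le0// mul0r; under eq_integral do rewrite mul0r mulr0; rewrite integral0.
  rewrite ps_gt0// mul1r; under eq_integral do rewrite mul1r.
  by rewrite EFin_Rintegral//; exact: (integrable_cv_bdd x L1py (bdd_wt a0)).
rewrite (@fubini_tonelli _ _ _ _ _ leb mu (fun z : R * E => (H z)%:E))//.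
apply: ae_eq_integral => //.
- exact: (measurable_fun_fubini_tonelli_G (m1 := leb) (fun z : R * E => (H z)%:E) mH H0).
- by apply/measurable_EFinP; apply: measurable_funM => //; exact: L1r_measurable.
apply: filterS (mix_ae (measurable_wtm t) (wtm_ge0 t) (wmass_lty d0 t0)) => z ez _.
rewrite EFinM /vt ez -ge0_integralZl_EFin//.
- by move=> a _; rewrite lee_fin wtm_ge0.
- by apply/measurable_EFinP; exact: (measurable_fun_pair1 z (measurable_wtm t)).
Qed.

(** Inside the ball [wt t a x] is [gs a x] - [gsr a t]. The share [ew y a] of the Gaussian is
    bounded through [L_le] by [py y] * [gs a], and [pg_le] bounds the latter by [gsr a t] + [py y] *
    [wt t a]. The integrals of [gsr] on the two sides cancel, being finite thanks to the cut-off,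
    which is essential for d = 1. *)
Lemma wtm_cut_le :
  (\int[leb]_(a in `[0%R, A]) (wtm t (a, x))%:E <=
   \int[leb]_a (gK (w1 y) (a, x))%:E + \int[mu]_z (py y (x - z) * vt t z)%:E)%E.
Proof.
have mwx : measurable_fun setT (fun a => wt t a x) := measurable_fun_pair1 x (measurable_wt_joint t).
have mgsr := measurable_gsr t (R := R) (d := d).
have S1 : (\int[leb]_(a in `[0%R, A]) (wtm t (a, x))%:E = \int[leb]_a (u a * wt t a x)%:E)%E.
  rewrite integral_mkcond; apply: eq_integral => a _; rewrite patchE /u /chi indicE.
  by case: ifPn => _; rewrite /wtm/= ?mulr1// mulr0 mul0r.
pose G := (\int[leb]_a (u a * gsr (d := d) a t)%:E)%E.
have G0 : (0 <= G)%E.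
  apply: integral_ge0 => a _; rewrite lee_fin; have [a0|a0] := leP a 0; first by rewrite un// mul0r.
  by rewrite mulr_ge0// gsr_ge0.
have Gfin : G \is a fin_num by rewrite ge0_fin_numE.
have ugsr0 a : 0 <= u a * gsr (d := d) a t.
  by have [a0|a0] := leP a 0; [rewrite un// mul0r|rewrite mulr_ge0// gsr_ge0].
have uwt0 a : 0 <= u a * wt t a x by rewrite mulr_ge0// wt_ge0.
have upw0 a : 0 <= u a * pw a by rewrite mulr_ge0.
have mpw : measurable_fun setT pw.
  have mq : measurable_fun setT (fun z : R * E => py y (x - z.2) * wt t z.1 z.2).
    apply: measurable_funM; last exact: measurable_wt_joint.
    exact: measurableT_comp (measurable_subl x (L1r_measurable L1py)) measurable_snd.
  exact: (measurable_Rintegral_fst mu mq).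
have mpg : measurable_fun setT pg.
  have mq : measurable_fun setT (fun z : R * E => py y (x - z.2) * gs z.1 z.2).
    apply: measurable_funM; last by apply: measurable_gs_joint; [exact: measurable_fst|exact: measurable_snd].
    exact: measurableT_comp (measurable_subl x (L1r_measurable L1py)) measurable_snd.
  exact: (measurable_Rintegral_fst mu mq).
have upg0 a : 0 <= u a * pg a.
  have [a0|a0] := leP a 0; first by rewrite un// mul0r.
  by rewrite mulr_ge0//; apply: Rintegral_ge0 => z _; rewrite mulr_ge0// gs_ge0.
have gK0 a : 0 <= gK (w1 y) (a, x) by apply: gK_ge0; [exact: w1_ge0|exact: w1_neg].
have mgK : measurable_fun setT (fun a => gK (w1 y) (a, x)).
  exact: (measurable_fun_pair1 x (measurable_gK (measurable_w1 y))).
have ueg0 a : 0 <= ps a * (ew y a * (chi a * gs a x)).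
  have [a0|a0] := leP a 0; first by rewrite ps_le0// mul0r.
  by rewrite mulr_ge0 ?ps_ge0// mulr_ge0 ?expR_ge0// mulr_ge0 ?gs_ge0.
have mueg : measurable_fun setT (fun a => ps a * (ew y a * (chi a * gs a x))).
  by apply: measurable_funM => //; apply: measurable_funM => //; exact: measurable_funM.
have main : (\int[leb]_a (u a * wt t a x)%:E + G <=
   (\int[leb]_a (gK (w1 y) (a, x))%:E + \int[mu]_z (py y (x - z) * vt t z)%:E) + G)%E.
  apply: (@le_trans _ _ (\int[leb]_a (gK (w1 y) (a, x) + ps a * (ew y a * (chi a * gs a x)))%R%:E)%E).
    rewrite -ge0_integralD//; last 4 first.
    - by move=> a _; rewrite lee_fin.
    - by apply/measurable_EFinP; exact: measurable_funM.
    - by move=> a _; rewrite lee_fin.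
    - by apply/measurable_EFinP; exact: measurable_funM.
    apply: ge0_le_integral => //.
    - by move=> a _; rewrite adde_ge0// lee_fin.
    - by apply: emeasurable_funD; apply/measurable_EFinP; exact: measurable_funM.
    - by apply/measurable_EFinP; exact: measurable_funD.
    move=> a _; rewrite -EFinD lee_fin /gK /w1 /u/=.
    have [a0|a0] := leP a 0; first by rewrite ps_le0// !mul0r !addr0.
    rewrite ps_gt0// !mul1r wt_in// -mulrDr subrK.
    have -> : (1 - ew y a) * gs a x + ew y a * (chi a * gs a x) = gs a x * ((1 - ew y a) + ew y a * chi a) by ring.
    rewrite mulrC ler_wpM2l ?gs_ge0//.
    have e0 : 0 <= ew y a by exact: expR_ge0.
    have e1 := ew_le1 y a; have c0 := chi0 a; have c1 := chi1 a.
    by rewrite -subr_ge0 (_ : _ - _ = (1 - ew y a) * (1 - chi a)); [rewrite mulr_ge0// subr_ge0|ring].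
  under eq_integral do rewrite EFinD.
  rewrite ge0_integralD//; last 4 first.
  - by move=> a _; rewrite lee_fin.
  - exact/measurable_EFinP.
  - by move=> a _; rewrite lee_fin.
  - exact/measurable_EFinP.
  rewrite -addeA; apply: leeD2l; apply: le_trans L_le _; rewrite -PL.
  rewrite -ge0_integralD//; last 4 first.
  - by move=> a _; rewrite lee_fin mulr_ge0// ps_ge0.
  - by apply/measurable_EFinP; exact: measurable_funM.
  - by move=> a _; rewrite lee_fin.
  - by apply/measurable_EFinP; exact: measurable_funM.
  apply: ge0_le_integral => //.
  - by move=> a _; rewrite lee_fin.
  - by apply/measurable_EFinP; exact: measurable_funM.
  - by apply: emeasurable_funD; apply/measurable_EFinP; exact: measurable_funM.
  move=> a _; rewrite -EFinD lee_fin; have [a0|a0] := leP a 0.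
    by rewrite un// ps_le0// !mul0r addr0.
  apply: (@le_trans _ _ (u a * (gsr (d := d) a t + pw a))); first by rewrite ler_wpM2l// pg_le.
  by rewrite mulrDr addrC lerD2r ler_wpM2r// /u ler_piMr// ps_ge0.
by rewrite S1; move: main; rewrite leeD2rE.
Qed.

End positivity.

(** Outside the ball [vt t] vanishes and the other two terms are nonnegative. Inside, [wtm_cut_le]
    is used with A = n and monotone convergence. Real values agree with the extended integrals only
    almost everywhere, whence the form of the conclusion. *)
Lemma phi_ge0 : {ae mu, forall z, 0 <= phi z}.
Proof.
have mg := measurable_gK (d := d) (measurable_w1 y).
have g0 (z : R * E) : 0 <= gK (w1 y) z by apply: gK_ge0; [exact: w1_ge0|exact: w1_neg].
have glt : (\int[leb]_a \int[mu]_z (gK (w1 y) (a, z))%:E < +oo)%E.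
  by apply: gK_lty; do ?[exact: w1_ge0|exact: w1_neg|exact: w1_lty].
apply: filterS3 (mix_ae (measurable_wtm t) (wtm_ge0 t) (wmass_lty d0 t0)) (mix_ae mg g0 glt)
  (cv_L1_ae L1py L1vt) => x e1 e2 e3.
have pv0 : 0 <= cv (py y) (vt t) x by apply: Rintegral_ge0 => z _; rewrite mulr_ge0.
have psi0 : 0 <= psi y x by exact: (mix_ge0 g0).
rewrite /phi; have [xt|xt] := ltP (nsq x) (t ^+ 2); last first.
  suff -> : vt t x = 0 by rewrite subr0 addr_ge0.
  rewrite /vt /mix (_ : (fun a => wtm t (a, x)) = fun=> 0); first by rewrite Rintegral_cst ?mul0r.
  apply/funext => a; rewrite /wtm/=; have [a0|a0] := leP a 0; first by rewrite ps_le0// mul0r.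
  by rewrite wt_out// mulr0.
rewrite addrAC subr_ge0 -lee_fin EFinD.
rewrite [X in (X <= _)%E](e1 : (vt t x)%:E = _) [X in (_ <= X + _)%E](e2 : (psi y x)%:E = _) e3.
have mw : measurable_fun setT (fun a => wtm t (a, x)) := measurable_fun_pair1 x (measurable_wtm t).
have -> : (\int[leb]_a (wtm t (a, x))%:E = \int[leb]_(a in `[0%R, +oo[) (wtm t (a, x))%:E)%E.
  rewrite [in RHS]integral_mkcond; apply: eq_integral => a _; rewrite patchE.
  case: ifPn => //; rewrite notin_setE/= in_itv/= andbT => /negP; rewrite -ltNge => a0.
  by rewrite /wtm/= ps_le0 ?(ltW a0)// mul0r.
apply: integral_cy_le => //; first by move=> a _; exact: wtm_ge0.
by move=> n; apply: wtm_cut_le => //; rewrite add0r.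
Qed.

Lemma L1n_phi : L1n phi = (\int[mu]_z psi y z)%R.
Proof.
rewrite -Rintegral_phi /L1n /Rintegral; congr fine; apply: ae_eq_integral => //.
- by apply/measurable_EFinP; apply: measurableT_comp => //; exact: L1r_measurable L1r_phi.
- by apply/measurable_EFinP; exact: L1r_measurable L1r_phi.
- by apply: filterS phi_ge0 => z z0 _; rewrite ger0_norm.
Qed.

End defect_positivity.

(** * Uniqueness of L^2 limits and Gaussian approximate identities *)

Section L2_limits.
Context d (T : measurableType d) (R : realType) (m : {measure set T -> \bar R}).
Implicit Types f g : T -> R.

Lemma cvgL2_unique (f_ : nat -> T -> R) f g : (forall n, measurable_fun setT (f_ n)) ->
  measurable_fun setT f -> measurable_fun setT g -> cvgL2 m f_ f -> cvgL2 m f_ g ->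
  {ae m, forall x, f x = g x}.
Proof.
move=> mf_ mf mg cf cg.
have s0 : sqn m (fun x => f x - g x) = 0%E.
  apply/eqP; rewrite eq_le sqn_ge0 andbT; apply/lee_addgt0Pr => e e0; rewrite add0e.
  have e4 : 0 < e / 4 by rewrite divr_gt0.
  near \oo => n.
  have h1 : (sqn m (fun x => f_ n x - f x)%R <= (e / 4)%:E)%E by near: n; exact: cf.
  have h2 : (sqn m (fun x => f_ n x - g x)%R <= (e / 4)%:E)%E by near: n; exact: cg.
  have -> : (fun x => f x - g x) = fun x => (f_ n x - g x) - (f_ n x - f x).
    by apply/funext => x; ring.
  apply: le_trans (sqnB_le _ _ _) _; try exact: measurable_funB.
  apply: le_trans (lee_wpmul2l _ (leeD h2 h1)) _; first by rewrite lee_fin.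
  by rewrite -EFinD -EFinM lee_fin; lra.
have mh : measurable_fun setT (fun x => ((f x - g x) ^+ 2)%:E).
  by apply: measurable_sqr; exact: measurable_funB.
have : ae_eq m setT (fun x => ((f x - g x) ^+ 2)%:E) (cst 0%E).
  apply/(ae_eq_integral_abs m measurableT mh); rewrite -s0.
  by apply: eq_integral => x _; rewrite gee0_abs// lee_fin sqr_ge0.
apply: filterS => x /(_ I) /= [/eqP]; rewrite sqrf_eq0 subr_eq0 => /eqP.
by [].
Unshelve. all: by end_near.
Qed.

End L2_limits.

Section approximate_identity.
Context {R : realType} {d : nat}.
Local Notation E := 'rV[R]_d.
Local Notation mu := (@lebesgue_rV R d).
Implicit Types f g h : E -> R.

Lemma cv_linr g f h (a : R) x : L2r mu g -> L2r mu f -> L2r mu h ->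
  cv g (fun y => a * f y + h y) x = a * cv g f x + cv g h x.
Proof.
move=> hg hf hh; have i1 := integrableM_L2r (L2r_subl x hg) hf.
have i2 := integrableM_L2r (L2r_subl x hg) hh.
have m1 : measurable_fun setT (fun y : E => g (x - y) * f y).
  by apply: measurable_funM; [exact: measurable_subl hg.1|exact: hf.1].
rewrite /cv -(Rintegral_measurableZl mu _ m1) -RintegralD//; last exact: integrable_realZl.
by apply: eq_Rintegral => y _; rewrite mulrDr mulrCA.
Qed.

Lemma cvBr_L2 g f h x : L2r mu g -> L2r mu f -> L2r mu h ->
  cv g (fun y => f y - h y) x = cv g f x - cv g h x.
Proof.
move=> hg hf hh; have i1 := integrableM_L2r (L2r_subl x hg) hf.
have i2 := integrableM_L2r (L2r_subl x hg) hh.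
by rewrite /cv -RintegralB//; apply: eq_Rintegral => y _; rewrite mulrBr.
Qed.

Lemma L1n_gs (b : R) : 0 < b -> (\int[mu]_z (`|gs b z|)%:E = 1)%E.
Proof.
move=> b0; rewrite -(@integral_gs R d _ b0); apply: eq_integral => z _.
by rewrite ger0_norm ?gs_ge0.
Qed.

Lemma sqn_cv_gs_le (b : R) f : 0 < b -> L2r mu f -> (sqn mu (cv (gs b) f) <= sqn mu f)%E.
Proof.
move=> b0 hf; have := @sqn_cv_le R d (gs b) f 1 (integrable_gs b0) _ hf.
by rewrite expr1n mul1e; apply; rewrite L1n_gs.
Qed.

Lemma L2r_cv_gs (b : R) f : 0 < b -> L2r mu f -> L2r mu (cv (gs b) f).
Proof. by move=> b0 hf; exact: (L2r_cv (integrable_gs b0) hf). Qed.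

Section box.
Variables l u : 'I_d -> R.
Let B := obox l u.
Let f : E -> R := \1_B.
Let mB : measurable B. Proof. exact: measurable_obox. Qed.
Let mf : measurable_fun setT f. Proof. exact: measurable_indic. Qed.
Let L2f : L2r mu f. Proof. by apply: L2r_indic => //; exact: obox_lty. Qed.

Let f_le1 x : `|f x| <= 1.
Proof. by rewrite /f indicE; case: (_ \in _); rewrite ?normr1 ?normr0. Qed.

Let cvE b x : 0 < b -> cv (gs b) f x = (\int[mu]_z (gs 1 z * f (x - b *: z)))%R.
Proof.
move=> b0; have mg : measurable_fun setT (gs b : E -> R) by exact: measurable_gs.
rewrite cvC//.
have mh : measurable_fun setT (fun y : E => f (x - y) * gs b y).
  by apply: measurable_funM => //; exact: measurable_subl.
have h := Rintegral_rV_affine 0 (lt0r_neq0 b0) mh.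
have bd : b ^+ d != 0 by rewrite gt_eqF// exprn_gt0.
transitivity (b ^+ d * (\int[mu]_z (f (x - (b *: z + 0)) * gs b (b *: z + 0)))%R).
  by rewrite h (gtr0_norm b0) mulrA divff// mul1r.
rewrite -Rintegral_measurableZl; last first.
  exact: (measurableT_comp mh (measurable_rV_affine b 0)).
apply: eq_Rintegral => z _; rewrite addr0 (gs_scale _ b0) scalerA mulVf ?gt_eqF// scale1r.
by move: (b ^+ d) bd => P P0; field.
Qed.

Let cv_box x (v : nat -> R) : B x -> (forall n, 0 < v n) -> v n @[n --> \oo] --> 0 ->
  cv (gs (v n)) f x @[n --> \oo] --> (1 : R).
Proof.
move=> Bx v0 vc.
have -> : (fun n => cv (gs (v n)) f x) = (fun n => (\int[mu]_z (gs 1 z * f (x - v n *: z)))%R).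
  by apply/funext => n; rewrite cvE.
have mg : measurable_fun setT (gs 1 : E -> R) by exact: measurable_gs.
rewrite -[X in _ --> X](@Rintegral_gs R d 1)//.
apply: (@cvg_Rintegral _ _ _ mu (fun n z => gs 1 z * f (x - v n *: z)) (gs 1) (gs 1)).
- move=> n /=; apply: (measurable_funM mg).
  rewrite (_ : (fun z => f (x - v n *: z)) = f \o (fun z => - v n *: z + x)).
    exact: (measurableT_comp mf (measurable_rV_affine (- v n) x)).
  by apply/funext => z; rewrite /comp scaleNr [- _ + x]addrC.
- exact: mg.
- apply: aeW => z; apply: cvg_near_cst; near=> n.
  suff h : B (x - v n *: z) by rewrite /f indicE mem_set ?mulr1.
  near: n; apply: filter_forall => i.
  have ci : (x - v n *: z) 0 i @[n --> \oo] --> x 0 i.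
    rewrite (_ : (fun n => _) = fun n => x 0 i - v n * z 0 i); last by apply/funext => n; rewrite !mxE.
    rewrite -[X in _ --> X]subr0; apply: cvgB; first exact: cvg_cst.
    by rewrite -[X in _ --> X](mul0r (z 0 i)); exact: cvgMl.
  have /andP[li ui] := Bx i; near=> n.
  by apply/andP; split; near: n; [exact: (cvgr_gt _ ci)|exact: (cvgr_lt _ ci)].
- exact: integrable_gs.
- by apply: aeW => z n; rewrite normrM (ger0_norm (gs_ge0 z ltr01)) ler_piMr ?gs_ge0 ?f_le1.
Unshelve. all: by end_near.
Qed.

(** Expanding the square and using that [gs b] is a contraction bounds the squared distance by 2
    |f|^2 - 2 <gs b * f, f>. The pairing tends to |f|^2 by dominated convergence: f vanishes off the
    box, and the box is open, so the averages tend to 1 at each of its points. *)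
Lemma approx_id_box (e : R) : 0 < e ->
  \forall b \near 0^'+, (sqn mu (fun x => cv (gs b) f x - f x)%R <= e%:E)%E.
Proof.
move=> e0; pose V := fine (sqn mu f); pose phib b := (\int[mu]_x (cv (gs b) f x * f x))%R.
have cphi : phib b @[b --> 0^'+] --> V.
  apply/cvg_at_rightP => v [v0 vc]; rewrite /V fine_sqn.
  have b1 : bdd 1 f by [].
  apply: (@cvg_Rintegral _ _ _ mu _ _ f).
  - by move=> n; apply: measurable_funM => //; apply: measurable_cv => //; exact: measurable_gs.
  - exact: measurable_funM.
  - apply: aeW => x; have [Bx|Bx] := pselect (B x).
      have -> : f x = 1 by rewrite /f indicE mem_set.
      by apply: cvgMl; exact: cv_box.
    have -> : f x = 0 by rewrite /f indicE memNset.
    by apply: cvg_near_cst; apply: nearW => n; rewrite !mulr0.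
  - apply: integrable_le (integrableM_L2r L2f L2f) _ => // x.
    by rewrite /f indicE; case: (_ \in _); rewrite ?normr1 ?normr0 ?mulr1 ?mulr0.
  - apply: aeW => x n; have [_ h] := bdd_cv (integrable_gs (v0 n)) b1.
    have f0 : 0 <= f x by rewrite /f indicE.
    rewrite normrM (ger0_norm f0) ler_piMl//.
    by have := h x; rewrite /L1n L1n_gs// mul1r.
have e2 : 0 < e / 2 by rewrite divr_gt0.
near=> b; have b0 : 0 < b by near: b; exact: nbhs_right_gt.
have L2g := L2r_cv_gs b0 L2f.
have hs : sqn mu (fun x => cv (gs b) f x - f x) =
    (fine (sqn mu (cv (gs b) f)) + V - 2 * phib b)%:E.
  rewrite -(fineK (L2r_fin_num (L2rB L2g L2f))) /V !fine_sqn; congr EFin.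
  have i1 := integrableM_L2r L2g L2g; have i2 := integrableM_L2r L2f L2f.
  have i3 := integrable_realZl 2 (integrableM_L2r L2g L2f).
  rewrite /phib -(Rintegral_measurableZl mu 2 (measurable_funM L2g.1 L2f.1)).
  rewrite -RintegralD// -RintegralB//; last exact: integrable_realD.
  by apply: eq_Rintegral => x _; rewrite /=; ring.
rewrite hs lee_fin.
have gf : fine (sqn mu (cv (gs b) f)) <= V.
  by apply: fine_le; [exact: L2r_fin_num|exact: L2r_fin_num|exact: sqn_cv_gs_le].
have : V - e / 2 < phib b.
  by near: b; apply: (cvgr_gt _ cphi); rewrite gtrBl.
lra.
Unshelve. all: by end_near.
Qed.

End box.

Lemma approx_id f : L2r mu f -> forall e : R, 0 < e ->
  \forall b \near 0^'+, (sqn mu (fun x => cv (gs b) f x - f x)%R <= e%:E)%E.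
Proof.
move: f; apply: L2_induction.
- move=> e e0; near=> b; rewrite [X in sqn _ X](_ : _ = fun=> 0).
    by rewrite /sqn; under eq_integral do rewrite expr0n/=; rewrite integral0 lee_fin ltW.
  apply/funext => x; rewrite subr0 /cv; under eq_Rintegral do rewrite mulr0.
  by rewrite Rintegral_cst ?mul0r.
- move=> a f h hf hh Pf Ph e e0.
  pose e1 := e / (4 * (a ^+ 2 + 1)).
  have a1 : 0 < a ^+ 2 + 1 by rewrite ltr_wpDl ?sqr_ge0.
  have e10 : 0 < e1 by rewrite divr_gt0// mulr_gt0.
  have e4 : 0 < e / 4 by rewrite divr_gt0.
  near=> b; have b0 : 0 < b by near: b; exact: nbhs_right_gt.
  have gf := L2r_cv_gs b0 hf; have gh := L2r_cv_gs b0 hh.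
  have [A A0 hA] := L2r_bound hf.
  have hgs : L2r mu (gs b : E -> R) by exact: L2r_gs.
  have -> : (fun x => cv (gs b) (fun y => a * f y + h y) x - (a * f x + h x)) =
      fun x => a * (cv (gs b) f x - f x) + (cv (gs b) h x - h x).
    by apply/funext => x; rewrite cv_linr//; ring.
  have m1 : measurable_fun setT (fun x => cv (gs b) f x - f x).
    by apply: measurable_funB; [exact: gf.1|exact: hf.1].
  have m2 : measurable_fun setT (fun x => cv (gs b) h x - h x).
    by apply: measurable_funB; [exact: gh.1|exact: hh.1].
  apply: le_trans (sqnD_le mu (measurable_funM (measurable_cst a) m1) m2) _.
  rewrite sqnZ//.
  have s1 : (sqn mu (fun x => cv (gs b) f x - f x)%R <= e1%:E)%E by near: b; exact: Pf.
  have s2 : (sqn mu (fun x => cv (gs b) h x - h x)%R <= (e / 4)%:E)%E by near: b; exact: Ph.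
  have s1' : ((a ^+ 2)%:E * sqn mu (fun x => cv (gs b) f x - f x)%R <= (a ^+ 2 * e1)%:E)%E.
    by rewrite [leRHS]EFinM; apply: lee_wpmul2l => //; rewrite lee_fin sqr_ge0.
  apply: le_trans (lee_wpmul2l _ (leeD s1' s2)) _; first by rewrite lee_fin.
  rewrite -EFinD -EFinM lee_fin.
  have : a ^+ 2 * e1 <= e / 4.
    rewrite /e1 mulrA ler_pdivrMr ?mulr_gt0//.
    by rewrite (_ : e / 4 * (4 * (a ^+ 2 + 1)) = a ^+ 2 * e + e); [rewrite lerDl ltW|field].
  lra.
- move=> f_ f hf_ Pf hf ff e e0.
  (* Three errors e / 16 combined by two uses of [sqnD_le] give 2 (1 + 2 (1 + 1)) e / 16 <= e. *)
  have e16 : 0 < e / 16 by rewrite divr_gt0.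
  near \oo => n.
  have s3 : (sqn mu (fun x => f_ n x - f x)%R <= (e / 16)%:E)%E by near: n; exact: ff.
  near=> b; have b0 : 0 < b by near: b; exact: nbhs_right_gt.
  have hgs : L2r mu (gs b : E -> R) by exact: L2r_gs.
  have gfn := L2r_cv_gs b0 (hf_ n); have hfn := hf_ n.
  have hD := L2rB hf hfn; have gD := L2r_cv_gs b0 hD.
  have s2 : (sqn mu (fun x => cv (gs b) (f_ n) x - f_ n x)%R <= (e / 16)%:E)%E.
    by near: b; exact: Pf.
  have s1 : (sqn mu (cv (gs b) (fun x => f x - f_ n x)%R) <= (e / 16)%:E)%E.
    by apply: le_trans (sqn_cv_gs_le b0 hD) _; rewrite sqn_subC.
  have -> : (fun x => cv (gs b) f x - f x) = fun x => cv (gs b) (fun x => f x - f_ n x) x +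
      ((cv (gs b) (f_ n) x - f_ n x) + (f_ n x - f x)).
    by apply/funext => x; rewrite cvBr_L2//; ring.
  have m2 : measurable_fun setT (fun x => cv (gs b) (f_ n) x - f_ n x).
    by apply: measurable_funB; [exact: gfn.1|exact: hfn.1].
  have m3 : measurable_fun setT (fun x => f_ n x - f x).
    by apply: measurable_funB; [exact: hfn.1|exact: hf.1].
  apply: le_trans (sqnD_le mu gD.1 (measurable_funD m2 m3)) _.
  have p2 : (0 <= 2%:E :> \bar R)%E by rewrite lee_fin.
  have s23 := le_trans (sqnD_le mu m2 m3) (lee_wpmul2l p2 (leeD s2 s3)).
  apply: le_trans (lee_wpmul2l p2 (leeD s1 s23)) _.
  by rewrite -!(EFinD, EFinM) lee_fin; lra.
- exact: approx_id_box.
Unshelve. all: by end_near.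
Qed.

End approximate_identity.

(** * The strong limit T of the regularised operators *)

Section riesz_limit.
Context {R : realType} {d : nat}.
Local Notation E := 'rV[R]_d.
Local Notation mu := (@lebesgue_rV R d).
Local Notation leb := (@lebesgue_measure R).
Implicit Types f g h : E -> R.

Lemma approx_id_delta f (e : R) : L2r mu f -> 0 < e ->
  exists2 dl : R, 0 < dl & forall b, 0 < b -> b < dl ->
    (sqn mu (fun x => cv (gs b) f x - f x)%R <= e%:E)%E.
Proof.
move=> hf e0; have [dl /= dl0 h] := approx_id hf e0.
exists dl => // b b0 bd; apply: h => //=.
by rewrite sub0r normrN gtr0_norm.
Qed.

Lemma approx_id_seq f (v : nat -> R) : L2r mu f -> (forall n, 0 < v n) ->
  v n @[n --> \oo] --> 0 -> cvgL2 mu (fun n => cv (gs (v n)) f) f.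
Proof.
move=> hf v0 vc e e0; have [dl dl0 h] := approx_id_delta hf e0.
by near=> n; apply: h => //; near: n; exact: (cvgr_lt _ vc).
Unshelve. all: by end_near.
Qed.

Variable j : 'I_d.

Let d0 : (0 < d)%N := leq_ltn_trans (leq0n j) (ltn_ord j).

Definition cseq (n : nat) : R := n.+1%:R^-1.

Lemma cseq_gt0 n : 0 < cseq n.
Proof. by rewrite invr_gt0. Qed.

Lemma cvg_cseq : cseq n @[n --> \oo] --> 0.
Proof. exact: cvg_harmonic. Qed.

(** A relation, since an L^2 limit is determined only up to a null set; the sequence c = 1 / (n + 1)
    represents c -> 0. *)
Definition is_T f Tf := L2r mu Tf /\ cvgL2 mu (fun n => cv (kc j (cseq n)) f) Tf.

Lemma L2r_Tc c f : 0 < c -> L2r mu f -> L2r mu (cv (kc j c) f).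
Proof.
move=> c0 hf; split; first by apply: measurable_cv; [exact: measurable_kc|exact: hf.1].
apply: le_lt_trans (sqn_cv_kc j c0 hf) _.
by rewrite lte_mul_pinfty ?hf.2// lee_fin mulr_ge0// cpolar_ge0.
Qed.

Lemma cv_gs_Tc b c f : 0 < b -> 0 < c -> L2r mu f ->
  cv (gs b) (cv (kc j c) f) = cv (kc j (gam c b)) f.
Proof.
move=> b0 c0 hf; have hk := L2r_kc j c0.
have [A A0 kA] := L2r_bound hk; have [B B0 fB] := L2r_bound hf.
have hb := cv_holder A0 B0 hk.1 hf.1 kA fB.
rewrite -(cvA hk.1 hf.1 (integrable_gs b0) hb); congr (cv _ f).
by rewrite cvC; [exact: cv_kc_gs|exact: measurable_gs|exact: hk.1].
Qed.

Lemma cv_Tc_gs b c f : 0 < b -> 0 < c -> L2r mu f ->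
  cv (kc j c) (cv (gs b) f) = cv (gs b) (cv (kc j c) f).
Proof.
move=> b0 c0 hf; have hk := L2r_kc j c0.
have [A A0 kA] := L2r_bound hk; have [B B0 fB] := L2r_bound hf.
have hb := cv_holder B0 A0 hf.1 hk.1 fB kA.
rewrite cvC; [|exact: hk.1|by apply: measurable_cv; [exact: measurable_gs|exact: hf.1]].
rewrite (cvA hf.1 hk.1 (integrable_gs b0) hb); congr (cv (gs b) _).
by rewrite cvC; [|exact: hf.1|exact: hk.1].
Qed.

(** Enlarging c to [gam c b] amounts to applying [kc j c] to [gs b] * f, so the uniform bound
    reduces the difference to the approximate identity. *)
Lemma sqn_Tc_sub b c f : 0 < b -> 0 < c -> L2r mu f ->
  (sqn mu (fun x => cv (kc j (gam c b)) f x - cv (kc j c) f x)%R <=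
   (2 * cpolar)%:E * sqn mu (fun x => cv (gs b) f x - f x)%R)%E.
Proof.
move=> b0 c0 hf; have hk := L2r_kc j c0; have hg := L2r_cv_gs b0 hf.
have e : cv (kc j (gam c b)) f = cv (kc j c) (cv (gs b) f).
  exact: (etrans (esym (cv_gs_Tc b0 c0 hf)) (esym (cv_Tc_gs b0 c0 hf))).
have -> : (fun x => cv (kc j (gam c b)) f x - cv (kc j c) f x) =
    cv (kc j c) (fun x => cv (gs b) f x - f x).
  by rewrite e; apply/funext => x; exact: (esym (cvBr_L2 x hk hg hf)).
by apply: sqn_cv_kc => //; exact: L2rB.
Qed.

Let Cp : R := 2 * cpolar + 1.
Let Cp0 : 0 < Cp.
Proof. by rewrite ltr_wpDl// mulr_ge0// cpolar_ge0. Qed.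

Lemma T_exists f : L2r mu f -> exists Tf, is_T f Tf.
Proof.
move=> hf.
have [|e e0|Tf hT cT] := @L2_complete _ _ _ mu (fun n => cv (kc j (cseq n)) f); last by exists Tf.
  by move=> n; apply: L2r_Tc => //; exact: cseq_gt0.
have eC : 0 < e / Cp by rewrite divr_gt0.
have [dl dl0 h] := approx_id_delta hf eC.
have [N _ hN] : \forall n \near \oo, cseq n < dl by exact: (cvgr_lt _ cvg_cseq).
have half p q : (N <= p)%N -> (p < q)%N ->
    (sqn mu (fun x => cv (kc j (cseq p)) f x - cv (kc j (cseq q)) f x)%R <= e%:E)%E.
  move=> Np pq; have cp0 := cseq_gt0 p; have cq0 := cseq_gt0 q.
  have cqp : cseq q < cseq p by rewrite /cseq ltf_pV2 ?posrE// ltr_nat.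
  (* Chosen so that [gam (cseq q) b] = [cseq p]; moreover b <= [cseq p], which is small. *)
  pose b := Num.sqrt (cseq p ^+ 2 - cseq q ^+ 2).
  have b20 : 0 < cseq p ^+ 2 - cseq q ^+ 2 by rewrite subr_sqr mulr_gt0 ?subr_gt0 ?addr_gt0.
  have b0 : 0 < b by rewrite sqrtr_gt0.
  have bp : b <= cseq p.
    rewrite -[leRHS]ger0_norm ?(ltW cp0)// -sqrtr_sqr ler_wsqrtr// gerBl sqr_ge0//.
  have -> : cseq p = gam (cseq q) b.
    by rewrite /gam sqr_sqrtr ?(ltW b20)// subrK sqrtr_sqr gtr0_norm.
  apply: le_trans (sqn_Tc_sub b0 cq0 hf) _.
  have hb := h b b0 (le_lt_trans bp (hN p Np)).
  apply: le_trans (lee_wpmul2l _ hb) _; first by rewrite lee_fin mulr_ge0// cpolar_ge0.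
  rewrite -EFinM lee_fin mulrA ler_pdivrMr// mulrC ler_wpM2l ?(ltW e0)//.
  by rewrite /Cp lerDl.
exists N => p q Np Nq; case: (ltngtP p q) => [pq|qp|<-].
- exact: half.
- by rewrite sqn_subC; exact: half.
- rewrite [X in sqn _ X](_ : _ = fun=> 0); last by apply/funext => x; rewrite subrr.
  by rewrite /sqn; under eq_integral do rewrite expr0n/=; rewrite integral0 lee_fin ltW.
Qed.

Lemma T_unique f Tf Tf' : L2r mu f -> is_T f Tf -> is_T f Tf' -> {ae mu, forall x, Tf x = Tf' x}.
Proof.
move=> hf [h1 c1] [h2 c2]; apply: (cvgL2_unique _ h1.1 h2.1 c1 c2) => n.
exact: (L2r_Tc (cseq_gt0 n) hf).1.
Qed.

(** [gs b] * [kc j (cseq n)] * f is [kc j (gam (cseq n) b)] * f. By continuity of [gs b] it tends to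
    [gs b] * Tf, and by [sqn_Tc_sub] to [kc j b] * f. Hence every regularised operator is T followed
    by a contraction. *)
Lemma T_gs f Tf b : L2r mu f -> is_T f Tf -> 0 < b ->
  {ae mu, forall x, cv (gs b) Tf x = cv (kc j b) f x}.
Proof.
move=> hf [hT cT] b0; have hTn n := L2r_Tc (cseq_gt0 n) hf.
have hgs : L2r mu (gs b : E -> R) by exact: L2r_gs.
apply: (@cvgL2_unique _ _ _ mu (fun n => cv (gs b) (cv (kc j (cseq n)) f))).
- by move=> n; exact: (L2r_cv_gs b0 (hTn n)).1.
- exact: (L2r_cv_gs b0 hT).1.
- exact: (L2r_Tc b0 hf).1.
- move=> e e0; near=> n.
  have -> : (fun x => cv (gs b) (cv (kc j (cseq n)) f) x - cv (gs b) Tf x) =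
      cv (gs b) (fun x => cv (kc j (cseq n)) f x - Tf x).
    by apply/funext => x; rewrite cvBr_L2.
  apply: le_trans (sqn_cv_gs_le b0 (L2rB (hTn n) hT)) _.
  by near: n; exact: cT.
- move=> e e0; have eC : 0 < e / Cp by rewrite divr_gt0.
  have ap := approx_id_seq hf cseq_gt0 cvg_cseq eC; near=> n.
  rewrite cv_gs_Tc ?cseq_gt0// (_ : gam (cseq n) b = gam b (cseq n)); last by rewrite /gam addrC.
  apply: le_trans (sqn_Tc_sub (cseq_gt0 n) b0 hf) _.
  have hb : (sqn mu (fun x => cv (gs (cseq n)) f x - f x)%R <= (e / Cp)%:E)%E by near: n; exact: ap.
  apply: le_trans (lee_wpmul2l _ hb) _; first by rewrite lee_fin mulr_ge0// cpolar_ge0.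
  rewrite -EFinM lee_fin mulrA ler_pdivrMr// mulrC ler_wpM2l ?(ltW e0)//.
  by rewrite /Cp lerDl.
Unshelve. all: by end_near.
Qed.

Lemma sqn_Tc_le f Tf c : L2r mu f -> is_T f Tf -> 0 < c ->
  (sqn mu (cv (kc j c) f) <= sqn mu Tf)%E.
Proof.
move=> hf hT c0; apply: le_trans (sqn_cv_gs_le c0 hT.1).
rewrite (sqn_ae_eq _ _ (T_gs hf hT c0))//.
- exact: (L2r_cv_gs c0 hT.1).1.
- exact: (L2r_Tc c0 hf).1.
Qed.

(** Twice the constant of [sqn_cv_kc]; the factor 2 is lost in [sqnD_le]. *)
Lemma T_bound f Tf : L2r mu f -> is_T f Tf ->
  (sqn mu Tf <= (4 * cpolar)%:E * sqn mu f)%E.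
Proof.
move=> hf [hT cT]; apply/lee_addgt0Pr => e e0; have e2 : 0 < e / 2 by rewrite divr_gt0.
near \oo => n; have hTn := L2r_Tc (cseq_gt0 n) hf.
have s1 : (sqn mu (fun x => Tf x - cv (kc j (cseq n)) f x)%R <= (e / 2)%:E)%E.
  by rewrite sqn_subC; near: n; exact: cT.
have -> : sqn mu Tf = sqn mu (fun x => (Tf x - cv (kc j (cseq n)) f x) + cv (kc j (cseq n)) f x).
  by congr sqn; apply/funext => x; rewrite subrK.
apply: le_trans (sqnD_le mu (measurable_funB hT.1 hTn.1) hTn.1) _.
have p2 : (0 <= 2%:E :> \bar R)%E by rewrite lee_fin.
apply: le_trans (lee_wpmul2l p2 (leeD s1 (sqn_cv_kc j (cseq_gt0 n) hf))) _.
rewrite -(fineK (L2r_fin_num hf)) -!(EFinM, EFinD) lee_fin.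
by rewrite le_eqVlt; apply/orP; left; apply/eqP; field.
Unshelve. all: by end_near.
Qed.

Lemma T_linear f g Tf Tg a : L2r mu f -> L2r mu g -> is_T f Tf -> is_T g Tg ->
  is_T (fun x => a * f x + g x) (fun x => a * Tf x + Tg x).
Proof.
move=> hf hg [hTf cf] [hTg cg]; split; first by apply: L2rD => //; exact: L2rZ.
move=> e e0; pose e1 := e / (4 * (a ^+ 2 + 1)).
have a1 : 0 < a ^+ 2 + 1 by rewrite ltr_wpDl ?sqr_ge0.
have e10 : 0 < e1 by rewrite divr_gt0// mulr_gt0.
have e4 : 0 < e / 4 by rewrite divr_gt0.
near=> n; have hk := L2r_kc j (cseq_gt0 n).
have hfn := L2r_Tc (cseq_gt0 n) hf; have hgn := L2r_Tc (cseq_gt0 n) hg.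
have -> : (fun x => cv (kc j (cseq n)) (fun y => a * f y + g y) x - (a * Tf x + Tg x)) =
    fun x => a * (cv (kc j (cseq n)) f x - Tf x) + (cv (kc j (cseq n)) g x - Tg x).
  by apply/funext => x; rewrite cv_linr//; ring.
have m1 := measurable_funB hfn.1 hTf.1; have m2 := measurable_funB hgn.1 hTg.1.
apply: le_trans (sqnD_le mu (measurable_funM (measurable_cst a) m1) m2) _.
rewrite sqnZ//.
have s1 : (sqn mu (fun x => cv (kc j (cseq n)) f x - Tf x)%R <= e1%:E)%E by near: n; exact: cf.
have s2 : (sqn mu (fun x => cv (kc j (cseq n)) g x - Tg x)%R <= (e / 4)%:E)%E by near: n; exact: cg.
have s1' : ((a ^+ 2)%:E * sqn mu (fun x => cv (kc j (cseq n)) f x - Tf x)%R <= (a ^+ 2 * e1)%:E)%E.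
  by rewrite [leRHS]EFinM; apply: lee_wpmul2l => //; rewrite lee_fin sqr_ge0.
apply: le_trans (lee_wpmul2l _ (leeD s1' s2)) _; first by rewrite lee_fin.
rewrite -EFinD -EFinM lee_fin.
have : a ^+ 2 * e1 <= e / 4.
  rewrite /e1 mulrA ler_pdivrMr ?mulr_gt0//.
  by rewrite (_ : e / 4 * (4 * (a ^+ 2 + 1)) = a ^+ 2 * e + e); [rewrite lerDl ltW|field].
lra.
Unshelve. all: by end_near.
Qed.

(** * The inequality for real-valued functions *)

Section main_inequality.
Variables (t : R) (f Tf : E -> R).
Hypotheses (t0 : 0 < t) (hf : L2r mu f) (hT : is_T f Tf).

Let u := cv (kt j t) f.
Let hkt : L2r mu (kt j t) := L2r_kt j t0.
Let mu1 : R := fine (\int[leb]_a (w1 1 a)%:E)%E.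

Let mu1E : (\int[leb]_a (w1 1 a)%:E = mu1%:E :> \bar R)%E.
Proof.
rewrite fineK// ge0_fin_numE ?w1_lty1//.
by apply: integral_ge0 => a _; rewrite lee_fin w1_ge0.
Qed.

Let mu1_gt0 : 0 < mu1.
Proof.
have m0 : 0 < 1 - expR (- (1 / 4)) :> R by rewrite subr_gt0 -expR0 ltr_expR oppr_lt0 divr_gt0.
apply: (lt_le_trans m0); rewrite -lee_fin -mu1E.
have := @integral_ps_ge R (fun a => 1 - ew 1 a) (1 - expR (- (1 / 4))) 1 2 _ _ ltr01 (ler1n _ 2) (ltW m0).
rewrite (_ : (1 - expR (- (1 / 4))) * (2 - 1) = 1 - expR (- (1 / 4)) :> R); last by ring.
apply.
- by apply: measurable_funB => //; exact: measurable_ew.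
- by move=> a _; rewrite subr_ge0 ew_le1.
move=> a /andP[a1 a2]; have a0 := lt_le_trans ltr01 a1.
rewrite lerB// /ew ler_expR lerN2 expr1n ler_wpM2l// lef_pV2 ?posrE ?exprn_gt0//.
have -> : (4 : R) = 2 ^+ 2 by ring.
by rewrite lerXn2r// nnegrE ltW.
Qed.

Let bddu : exists2 B, 0 <= B & bdd B u.
Proof.
have [A A0 kA] := L2r_bound hkt; have [B B0 fB] := L2r_bound hf.
exists (A * B); first exact: mulr_ge0.
split; first by apply: measurable_cv; [exact: hkt.1|exact: hf.1].
exact: (cv_le A0 B0 hkt.1 hf.1 kA fB).
Qed.

Let cv_gs_u y : 0 < y -> cv (gs y) u = cv (cv (kt j t) (gs y)) f.
Proof.
move=> y0; have [A A0 kA] := L2r_bound hkt; have [B B0 fB] := L2r_bound hf.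
have hb := cv_holder A0 B0 hkt.1 hf.1 kA fB.
rewrite /u -(cvA hkt.1 hf.1 (integrable_gs y0) hb); congr (cv _ f).
by rewrite cvC; [|exact: measurable_gs|exact: hkt.1].
Qed.

Let L1psi y : 0 < y -> L1r (psi y : E -> R).
Proof. by move=> y0; exact: (L1r_gmix (measurable_w1 y) (w1_ge0 y) (@w1_neg _ y) (w1_lty y0)). Qed.

(** The parameter y of the mixture is also taken as the regularisation c, so that a single limit y
    -> 0 remains. *)
Let G y := cv (psi y) (cv (gs y) u).

Let G_phi y : 0 < y -> G y = cv (phi y t) (cv (kc j y) f).
Proof.
move=> y0; have hk := L2r_kc j y0.
have [A A0 kA] := L2r_bound hk; have [B B0 fB] := L2r_bound hf.
have hb := cv_holder A0 B0 hk.1 hf.1 kA fB.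
have hW : L2r mu (cv (kt j t) (gs y)).
  rewrite cvC; [|exact: hkt.1|exact: measurable_gs].
  exact: L2r_cv_gs.
have [A' A'0 kA'] := L2r_bound hW; have hb' := cv_holder A'0 B0 hW.1 hf.1 kA' fB.
transitivity (cv (psi y) (cv (cv (kt j t) (gs y)) f)); first by rewrite /G (cv_gs_u y0).
transitivity (cv (cv (psi y) (cv (kt j t) (gs y))) f).
  exact: (esym (cvA hW.1 hf.1 (L1psi y0) hb')).
transitivity (cv (cv (phi y t) (kc j y)) f); first by rewrite (cv_psi_kt j y0 t0 y0).
exact: (cvA hk.1 hf.1 (L1r_phi j y0 t0) hb).
Qed.

Let psi_mass y : 0 < y -> (\int[mu]_z psi y z)%R = y * mu1.
Proof.
move=> y0; rewrite /Rintegral.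
rewrite (integral_gmix (measurable_w1 y) (w1_ge0 y) (@w1_neg _ y) (w1_lty y0)).
by rewrite w1_scale// mu1E.
Qed.

Let sqn_G y : 0 < y -> (sqn mu (G y) <= ((y * mu1) ^+ 2)%:E * sqn mu Tf)%E.
Proof.
move=> y0; rewrite G_phi//; have iphi := L1r_phi j y0 t0.
have h := @sqn_cv_le R d (phi y t) (cv (kc j y) f) (y * mu1) iphi _ (L2r_Tc y0 hf).
apply: le_trans (h _) _; first by rewrite (L1nE iphi) (L1n_phi j y0 t0) psi_mass.
by apply: lee_wpmul2l; [rewrite lee_fin sqr_ge0|exact: sqn_Tc_le].
Qed.

(** The Gaussian is moved onto [f], which it approximates in L^2. Pairing with the square-integrable
    kernel [kt j t] gives convergence at every point x. *)
Lemma cv_gs_kt_cvg x (v : nat -> R) : (forall n, 0 < v n) -> v n @[n --> \oo] --> 0 ->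
  cv (gs (v n)) u x @[n --> \oo] --> u x.
Proof.
move=> v0 vc; have ap := approx_id_seq hf v0 vc.
have h := cvg_Rintegral_L2 (fun n => L2r_cv_gs (v0 n) hf) hf (L2r_subl x hkt) ap.
have e g : cv (kt j t) g x = (\int[mu]_y (g y * kt j t (x - y)))%R.
  by apply: eq_Rintegral => y _; rewrite mulrC.
rewrite -e in h.
have e' : (fun n => cv (gs (v n)) u x) = (fun n => (\int[mu]_y (cv (gs (v n)) f y * kt j t (x - y)))%R).
  apply/funext => n; rewrite -e; have v0n := v0 n.
  have [A A0 kA] := L2r_bound hkt; have [B B0 fB] := L2r_bound hf.
  have hb := cv_holder B0 A0 hf.1 hkt.1 fB kA.
  rewrite [in RHS]cvC; [|exact: hkt.1|exact: (L2r_cv_gs v0n hf).1].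
  rewrite (cvA hf.1 hkt.1 (integrable_gs v0n) hb); congr (cv (gs _) _ x).
  by rewrite /u cvC; [|exact: hkt.1|exact: hf.1].
by rewrite -e' in h.
Qed.

(** The substitution a = y s replaces the weight [w1 y] by the fixed weight [w1 1], and the two
    Gaussians merge into width y [gam 1 s]. In this form dominated convergence in s applies. *)
Let G_scale y x : 0 < y -> y^-1 * G y x =
  (\int[leb]_s (w1 1 s * cv (gs (y * gam 1 s)) u x))%R.
Proof.
move=> y0; have [B B0 bu] := bddu; have igy := integrable_gs (d := d) y0.
have [e _] := cv_gmix (measurable_w1 y) (w1_ge0 y) (@w1_neg _ y) (w1_lty y0) x (bdd_cv igy bu).
rewrite /G {1}/psi e.
have mq : measurable_fun setT (fun a => w1 y a * cv (gs a) (cv (gs y) u) x).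
  apply: measurable_funM; first exact: measurable_w1.
  have mh : measurable_fun setT (fun z : R * E => gs z.1 (x - z.2) * cv (gs y) u z.2).
    apply: measurable_funM.
      apply: measurable_gs_joint; first exact: measurable_fst.
      exact: (measurableT_comp (measurable_rV_subl x) measurable_snd).
    exact: measurableT_comp (bdd_cv igy bu).1 measurable_snd.
  exact: (measurable_Rintegral_fst mu mh).
rewrite -(Rintegral_scale y0 mq); apply: eq_Rintegral => s _.
have [s0|s0] := leP s 0; first by rewrite !w1_neg ?mul0r// pmulr_rle0.
have ys0 : 0 < y * s by rewrite mulr_gt0.
rewrite -(cvA_bdd (integrable_gs ys0) igy bu) cv_gs//; congr (_ * cv (gs _) u x).
  rewrite /w1 ps_scale// /ew; congr (_ * (1 - expR (- _))); rewrite exprMn expr1n; field.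
  by rewrite ?gt_eqF.
have -> : (y * s) ^+ 2 + y ^+ 2 = y ^+ 2 * (s ^+ 2 + 1 ^+ 2) by ring.
by rewrite sqrtrM ?sqr_ge0// sqrtr_sqr gtr0_norm.
Qed.

(** [G y] / y tends to [mu1] times [u] at every point, while its squared norm is at most [mu1]^2
    times that of [Tf] by [sqn_G]. Fatou's lemma preserves the bound and the factor [mu1]^2
    cancels. *)
Lemma sqn_truncated_le : (sqn mu u <= sqn mu Tf)%E.
Proof.
have [B B0 bu] := bddu; have u1 := mu1_gt0.
have mG y : 0 < y -> measurable_fun setT (G y).
  by move=> y0; exact: (bdd_cv (L1psi y0) (bdd_cv (integrable_gs y0) bu)).1.
have hfat : (sqn mu (fun x => mu1 * u x)%R <= (mu1 ^+ 2)%:E * sqn mu Tf)%E.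
  apply: (@sqn_fatou _ _ _ mu (fun n x => (cseq n)^-1 * G (cseq n) x)).
  - by move=> n; apply: measurable_funM => //; apply: mG; exact: cseq_gt0.
  - by apply: measurable_funM => //; exact: bu.1.
  - apply: aeW => x.
    have -> : (fun n => (cseq n)^-1 * G (cseq n) x) =
        (fun n => (\int[leb]_s (w1 1 s * cv (gs (cseq n * gam 1 s)) u x))%R).
      by apply/funext => n; rewrite G_scale// cseq_gt0.
    have -> : mu1 * u x = (\int[leb]_s (w1 1 s * u x))%R.
      rewrite mulrC; transitivity (\int[leb]_s (u x * w1 1 s))%R.
        exact: (esym (Rintegral_measurableZl leb (u x) (measurable_w1 1))).
      by apply: eq_Rintegral => s _; rewrite mulrC.
    apply: (@cvg_Rintegral _ _ _ leb _ _ (fun s => B * w1 1 s)).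
    + move=> n; apply: measurable_funM; first exact: measurable_w1.
      have mh : measurable_fun setT (fun z : R * E => gs (cseq n * gam 1 z.1) (x - z.2) * u z.2).
        apply: measurable_funM; last exact: measurableT_comp bu.1 measurable_snd.
        apply: measurable_gs_joint.
          by apply: measurable_funM => //; exact: measurableT_comp (measurable_gam 1) measurable_fst.
        exact: (measurableT_comp (measurable_rV_subl x) measurable_snd).
      exact: (measurable_Rintegral_fst mu mh).
    + by apply: measurable_funM => //; exact: measurable_w1.
    + apply: aeW => s; apply: cvgMr; apply: cv_gs_kt_cvg.
        by move=> n; rewrite mulr_gt0 ?cseq_gt0// gam_gt0.
      by rewrite -[X in _ --> X](mul0r (gam 1 s)); apply: cvgMl; exact: cvg_cseq.
    + apply: integrable_realZl; apply/integrable_ltyP; first exact: measurable_w1.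
      under eq_integral do rewrite ger0_norm ?w1_ge0//.
      exact: w1_lty1.
    + apply: aeW => s n; have g0 : 0 < cseq n * gam 1 s by rewrite mulr_gt0 ?cseq_gt0// gam_gt0.
      rewrite normrM ger0_norm ?w1_ge0// mulrC ler_wpM2r ?w1_ge0//.
      have [_ h] := bdd_cv (integrable_gs (d := d) g0) bu; apply: le_trans (h x) _.
      by rewrite /L1n L1n_gs// mulr1.
  - apply: nearW => n; have c0 := cseq_gt0 n; rewrite sqnZ; last exact: mG.
    apply: le_trans (lee_wpmul2l _ (sqn_G c0)) _; first by rewrite lee_fin sqr_ge0.
    rewrite muleA -EFinM le_eqVlt; apply/orP; left; apply/eqP; congr (_%:E * _)%E.
    by field; rewrite gt_eqF.
move: hfat; rewrite sqnZ; last exact: bu.1.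
by rewrite lee_pmul2l// ?fin_numE// lte_fin exprn_gt0.
Qed.

End main_inequality.

End riesz_limit.

(** * Uniform convergence of the truncations on Lipschitz functions *)

Lemma cvg_norm_le (R : realType) (f g : nat -> R) (l m : R) :
  f n @[n --> \oo] --> l -> g n @[n --> \oo] --> m -> (forall n, `|f n| <= g n) -> `|l| <= m.
Proof.
move=> fl gm fg.
have cn : `|f n| @[n --> \oo] --> `|l| by apply: cvg_norm.
rewrite -(cvg_lim _ cn)// -(cvg_lim _ gm)//.
by apply: ler_lim; [exact: cvgP cn|exact: cvgP gm|exact: nearW].
Qed.

Section truncation_limit.
Context {R : realType} {d : nat}.
Local Notation E := 'rV[R]_d.
Local Notation mu := (@lebesgue_rV R d).
Local Notation leb := (@lebesgue_measure R).
Variables (j : 'I_d) (u : E -> R) (D M : R).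
Local Notation ej := (delta_mx 0 j : 'rV[R]_d).
Hypotheses (L1u : L1r u) (L2u : L2r mu u) (bu : bdd M u) (D0 : 0 <= D).
Hypothesis lipu : forall x s, 0 < s -> `|u (x + s *: ej) - u x| <= D * s.

Let mu' : measurable_fun setT u := L1r_measurable L1u.
Let d0 : (0 < d)%N := leq_ltn_trans (leq0n j) (ltn_ord j).

(** Convolution with [kp j c] is minus the j-th derivative of a Gaussian average of [u]. On
    difference quotients the shift is moved onto [u], whose quotients are at most D, and the
    Gaussian has mass one. *)
Lemma cv_kp_lip c x : 0 < c -> `|cv (kp j c) u x| <= D.
Proof.
move=> c0; have ig := integrable_gs (d := d) c0.
have mg (y : E) : measurable_fun setT (fun z : E => gs c (y - z)).
  by apply: measurable_subl; exact: measurable_gs.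
have mgx : measurable_fun setT (fun z : E => gs c (x - z)) := mg x.
have igx : L1r (fun z : E => gs c (x - z)) by exact: integrable_subl.
have mkx : measurable_fun setT (fun z : E => kp j c (x - z)).
  by apply: measurable_subl; exact: measurable_kp.
pose v (n : nat) : R := n.+1%:R^-1.
have v0 n : 0 < v n by rewrite invr_gt0.
have v1 n : v n != 0 by rewrite gt_eqF.
have vc : v n @[n --> \oo] --> 0 by exact: cvg_harmonic.
have mus n : measurable_fun setT (fun z : E => u (z + v n *: ej)).
  rewrite (_ : (fun z => _) = u \o (fun z : E => 1 *: z + v n *: ej)).
    exact: (measurableT_comp mu' (measurable_rV_affine 1 (v n *: ej))).
  by apply/funext => z; rewrite /comp scale1r.
have gE n : (fun z : E => gs c (x - z + v n *: ej)) = fun z : E => gs c ((x + v n *: ej) - z).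
  by apply/funext => z; rewrite addrAC.
have mgs_ n : measurable_fun setT (fun z : E => gs c (x - z + v n *: ej)) by rewrite gE; exact: mg.
pose A n (z : E) := (v n)^-1 * (gs c (x - z + v n *: ej) - gs c (x - z)) * u z.
pose B n (z : E) := gs c (x - z) * ((v n)^-1 * (u (z + v n *: ej) - u z)).
have c1 : (\int[mu]_z A n z)%R @[n --> \oo] --> (\int[mu]_z (- kp j c (x - z) * u z))%R.
  apply: (@cvg_Rintegral _ _ _ mu A (fun z : E => - kp j c (x - z) * u z)
    (fun z : E => kpsup (d := d) c * `|u z|)).
  - move=> n; apply: measurable_funM => //.
    by apply: measurable_funM; [exact: measurable_cst|exact: measurable_funB].
  - by apply: measurable_funM => //; exact: measurable_funN.
  - by apply: aeW => z; apply: cvgMl; exact: gs_quot_cvg.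
  - apply: integrable_realZl; apply/integrable_ltyP; first exact: measurableT_comp.
    by under eq_integral do rewrite normr_id; exact/integrable_ltyP.
  - by apply: aeW => z n; rewrite /A normrM ler_wpM2r//; exact: gs_quot_le.
have AB n : (\int[mu]_z A n z)%R = (\int[mu]_z B n z)%R.
  have gb (y : E) : `|gs c y| <= (c * Num.sqrt pi) ^- d by rewrite ger0_norm ?gs_ge0// gs_le.
  pose p (z : E) := gs c (x - z + v n *: ej) * u z.
  pose q (z : E) := gs c (x - z) * u z.
  pose r (z : E) := gs c (x - z) * u (z + v n *: ej).
  have mp : measurable_fun setT p by exact: measurable_funM.
  have mq : measurable_fun setT q by exact: measurable_funM.
  have mr : measurable_fun setT r by exact: measurable_funM.
  have iq : L1r q by exact: (integrable_bounded igx mu' bu.2).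
  have ir : L1r r by exact: (integrable_bounded igx (mus n) (fun z => bu.2 _)).
  have ip : L1r p.
    have igx' : L1r (fun z : E => gs c (x - z + v n *: ej)) by rewrite gE; exact: integrable_subl.
    exact: (integrable_bounded igx' mu' bu.2).
  transitivity ((v n)^-1 * ((\int[mu]_z p z)%R - (\int[mu]_z q z)%R)).
    rewrite -RintegralB// -(Rintegral_measurableZl mu _ (measurable_funB mp mq)).
    by apply: eq_Rintegral => z _; rewrite /A /p /q/=; ring.
  transitivity ((v n)^-1 * ((\int[mu]_z r z)%R - (\int[mu]_z q z)%R)); last first.
    rewrite -RintegralB// -(Rintegral_measurableZl mu _ (measurable_funB mr mq)).
    by apply: eq_Rintegral => z _; rewrite /B /r /q/=; ring.
  have pr : (\int[mu]_z p z)%R = (\int[mu]_z r z)%R.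
    apply: etrans (esym (Rintegral_rV_subr (- (v n *: ej)) mp)) _.
    by apply: eq_Rintegral => z _; rewrite /p /r !opprK opprD addrA subrK.
  exact: (congr1 (fun w => (v n)^-1 * (w - (\int[mu]_z q z)%R)) pr).
have Bb n : `|(\int[mu]_z B n z)%R| <= D.
  have mB : measurable_fun setT (B n).
    apply: measurable_funM => //; apply: measurable_funM; first exact: measurable_cst.
    exact: measurable_funB.
  apply: le_normr_Rintegral_fin => //.
  apply: (@le_trans _ _ (\int[mu]_z (D%:E * (gs c (x - z))%:E))%E).
    apply: ge0_le_integral => //.
    - by apply/measurable_EFinP; exact: measurableT_comp.
    - by apply: measurable_funeM; exact/measurable_EFinP.
    - move=> z _; rewrite -EFinM lee_fin /B normrM ger0_norm ?gs_ge0// mulrC ler_wpM2r ?gs_ge0//.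
      rewrite normrM ger0_norm ?invr_ge0 ?(ltW (v0 n))// mulrC ler_pdivrMr ?v0//.
      exact: lipu.
  rewrite ge0_integralZl_EFin//; last 2 first.
  - by move=> z _; rewrite lee_fin gs_ge0.
  - exact/measurable_EFinP.
  have mgE : measurable_fun setT (fun z : E => (gs c z)%:E).
    by apply/measurable_EFinP; exact: measurable_gs.
  rewrite (ge0_integral_rV_subl x mgE); last by move=> z; rewrite lee_fin gs_ge0.
  by rewrite integral_gs// mule1.
have e : (\int[mu]_z (- kp j c (x - z) * u z))%R = - cv (kp j c) u x.
  have mkk : measurable_fun setT (fun z : E => kp j c (x - z) * u z) by exact: measurable_funM.
  rewrite -mulN1r -(Rintegral_measurableZl mu (-1) mkk); apply: eq_Rintegral => z _; ring.
rewrite -normrN -e; apply: (cvg_norm_le c1 (cvg_cst D)) => n.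
by rewrite AB.
Qed.

Let a (t : R) (x : E) := cv (kt j t) u x.
Let W : R := fine (@wmass R d 1).

Let vt_mass t : 0 < t -> L1n (vt t : E -> R) = t * W.
Proof.
move=> t0; rewrite /L1n; have lt1 := wmass_lty (R := R) d0 t0.
transitivity (fine (@wmass R d t)); last first.
  rewrite wmass_scale// -(fineK (x := @wmass R d 1)) ?fine_EFin -?EFinM//.
  rewrite ge0_fin_numE ?wmass1_lty//; apply: integral_ge0 => b _.
  by apply: integral_ge0 => z _; rewrite lee_fin wtm_ge0.
rewrite /wmass -(integral_mix (measurable_wtm t) (wtm_ge0 t) lt1).
congr fine; apply: eq_integral => z _; rewrite ger0_norm//.
exact: (mix_ge0 (wtm_ge0 t)).
Qed.

Let W0 : 0 <= W.
Proof.
by rewrite fine_ge0//; apply: integral_ge0 => b _; apply: integral_ge0 => z _; rewrite lee_fin wtm_ge0.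
Qed.

(** By [kc_split] the difference is [vt t] * ([kp j c] * u): the first factor has mass t W and the
    second is at most D. The bound does not depend on c. *)
Let heat_close t c x : 0 < t -> 0 < c ->
  `|cv (kc j c) u x - cv (gs c) (a t) x| <= D * (t * W).
Proof.
move=> t0 c0; have hkt := L2r_kt j t0; have hgs : L2r mu (gs c : E -> R) by exact: L2r_gs.
have [A A0 kA] := L2r_bound hkt; have [B B0 gB] := L2r_bound hgs; have [C C0 uC] := L2r_bound L2u.
have L1v : L1r (vt t : E -> R) by exact: (integrable_mix (measurable_wtm t) (wtm_ge0 t) (wmass_lty d0 t0)).
have bk := bdd_kp j c0; have bvk := bdd_cv L1v bk.
have b1 : bdd (A * B) (cv (kt j t) (gs c)).
  by split; [apply: measurable_cv; [exact: hkt.1|exact: hgs.1]|exact: (cv_le A0 B0 hkt.1 hgs.1 kA gB)].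
have bkp : bdd D (cv (kp j c) u).
  by split; [apply: measurable_cv => //; exact: measurable_kp|move=> y; exact: cv_kp_lip].
have e1 : cv (gs c) (a t) = cv (cv (kt j t) (gs c)) u.
  have hb := cv_holder A0 C0 hkt.1 L2u.1 kA uC.
  rewrite /a -(cvA hkt.1 L2u.1 (integrable_gs c0) hb); congr (cv _ u).
  by rewrite cvC; [|exact: hgs.1|exact: hkt.1].
have e2 : cv (cv (vt t) (kp j c)) u = cv (vt t) (cv (kp j c) u).
  exact: (cvA_bdd L1v (integrable_kp j c0) bu).
have mE (h : E -> R) B' y : bdd B' h -> L1r (fun z => h (y - z) * u z).
  move=> [mh hB']; have := integrable_bounded L1u (measurable_subl y mh) (fun z => hB' _).
  by apply: eq_integrable => // z _; rewrite /= mulrC.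
have e3 : cv (kc j c) u x = cv (cv (kt j t) (gs c)) u x + cv (cv (vt t) (kp j c)) u x.
  rewrite /cv -RintegralD//; [|exact: (mE _ _ x b1)|exact: (mE _ _ x bvk)].
  by apply: eq_Rintegral => z _; rewrite -mulrDl (kc_split j (x - z) t0 c0).
rewrite e3 -e1 addrAC subrr add0r e2 -(vt_mass t0).
by have [_ h] := bdd_cv L1v bkp; exact: h.
Qed.

Let a_close t s x : 0 < t -> 0 < s -> `|a t x - a s x| <= D * W * (t + s).
Proof.
move=> t0 s0; have c1 : cv (gs (cseq n)) (a t) x @[n --> \oo] --> a t x.
  by apply: cv_gs_kt_cvg => //; [exact: cseq_gt0|exact: cvg_cseq].
have c2 : cv (gs (cseq n)) (a s) x @[n --> \oo] --> a s x.
  by apply: cv_gs_kt_cvg => //; [exact: cseq_gt0|exact: cvg_cseq].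
have cn : cv (gs (cseq n)) (a t) x - cv (gs (cseq n)) (a s) x @[n --> \oo] --> a t x - a s x.
  by apply: cvgB; [exact: c1|exact: c2].
apply: (cvg_norm_le cn (cvg_cst _)) => n; have h1 := heat_close x t0 (cseq_gt0 n); have h2 := heat_close x s0 (cseq_gt0 n).
apply: (@le_trans _ _ (`|cv (gs (cseq n)) (a t) x - cv (kc j (cseq n)) u x| +
   `|cv (kc j (cseq n)) u x - cv (gs (cseq n)) (a s) x|)).
  by apply: le_trans (ler_normD _ _); rewrite addrA subrK.
rewrite distrC; apply: le_trans (lerD h1 h2) _.
by rewrite le_eqVlt; apply/orP; left; apply/eqP; ring.
Qed.

(** Comparing two truncations through the same regularised operator gives |a t - a s| <= Q (t + s)
    uniformly in x, whence a uniform limit L. It lies in L^2 by Fatou's lemma and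
    [sqn_truncated_le]. *)
Theorem truncation_limit : exists L : E -> R, is_T j u L /\
  forall x, cv (kt j t) u x @[t --> 0^'+] --> L x.
Proof.
pose Q := D * W; have Q0 : 0 <= Q by rewrite mulr_ge0.
have Q1 : 0 < Q + 1 by rewrite ltr_wpDl.
have ca x : cvgn (fun n => a (cseq n) x).
  apply/cauchy_cvgP; apply: cauchy_exP => e e0.
  have e2 : 0 < e / (2 * (Q + 1)) by rewrite divr_gt0// mulr_gt0.
  have [N _ hN] : \forall n \near \oo, cseq n < e / (2 * (Q + 1)) :> R.
    exact: (cvgr_lt _ (@cvg_cseq R)).
  exists (a (cseq N) x); exists N => // n /= Nn; rewrite /ball/=.
  apply: le_lt_trans (a_close x (cseq_gt0 N) (cseq_gt0 n)) _.
  apply: (@le_lt_trans _ _ ((Q + 1) * (cseq N + cseq n))).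
    by rewrite ler_wpM2r ?addr_ge0 ?(ltW (cseq_gt0 _))// lerDl.
  have h := ltrD (hN N (leqnn N)) (hN n Nn).
  rewrite -ltr_pdivlMl//; apply: lt_le_trans h _.
  by rewrite le_eqVlt; apply/orP; left; apply/eqP; field; rewrite gt_eqF.
pose L x := limn (fun n => a (cseq n) x).
have cL x : a (cseq n) x @[n --> \oo] --> L x by exact: ca.
have La t x : 0 < t -> `|a t x - L x| <= Q * t.
  move=> t0; have cn : a t x - a (cseq n) x @[n --> \oo] --> a t x - L x.
    by apply: cvgB; [exact: cvg_cst|exact: cL].
  have c2 : Q * (t + cseq n) @[n --> \oo] --> Q * t.
    rewrite -[X in _ --> Q * X]addr0; apply: cvgMr; apply: cvgD; [exact: cvg_cst|exact: cvg_cseq].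
  by apply: (cvg_norm_le cn c2) => n; exact: (a_close x t0 (cseq_gt0 n)).
have ma t : 0 < t -> measurable_fun setT (a t).
  by move=> t0; apply: measurable_cv => //; exact: measurable_kt.
have mL : measurable_fun setT L.
  apply/measurable_EFinP; apply: (emeasurable_fun_cvg (fun n x => (a (cseq n) x)%:E)).
    by move=> n; apply/measurable_EFinP; apply: ma; exact: cseq_gt0.
  by move=> x _; apply: cvg_comp (cL x) _; exact: cvg_id.
have [Tu hT] := T_exists j L2u.
have sa t : 0 < t -> (sqn mu (a t) <= sqn mu Tu)%E.
  by move=> t0; exact: (sqn_truncated_le t0 L2u hT).
have L2a t : 0 < t -> L2r mu (a t).
  by move=> t0; split; [exact: ma|apply: le_lt_trans (sa t t0) hT.1.2].
have L2L : L2r mu L.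
  split => //; apply: le_lt_trans hT.1.2.
  apply: (@sqn_fatou _ _ _ mu (fun n => a (cseq n))) => //.
  - by move=> n; apply: ma; exact: cseq_gt0.
  - by apply: aeW => x; exact: cL.
  - by apply: nearW => n; apply: sa; exact: cseq_gt0.
(* Both sides are within Q t of [gs c] * [a t] for every t > 0. It identifies the regularisations of
   u with Gaussian averages of L, so their L^2 limit is L. *)
have gL c x : 0 < c -> cv (gs c) L x = cv (kc j c) u x.
  move=> c0; have hgs : L2r mu (gs c : E -> R) by exact: L2r_gs.
  apply/eqP; rewrite -subr_eq0 -normr_le0; apply/ler_addgt0Pr => e e0; rewrite add0r.
  pose t := e / (2 * (Q + 1)); have t0 : 0 < t by rewrite divr_gt0// mulr_gt0.
  have h1 := heat_close x t0 c0.
  have bL : bdd (Q * t) (fun y => L y - a t y).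
    by split; [exact: measurable_funB mL (ma t t0)|move=> y; rewrite distrC; exact: La].
  have [_ h2] := bdd_cv (integrable_gs c0) bL.
  have := h2 x; rewrite /L1n L1n_gs// mulr1 (cvBr_L2 x hgs L2L (L2a t t0)) => {}h2.
  apply: (@le_trans _ _ (`|cv (gs c) L x - cv (gs c) (a t) x| + `|cv (gs c) (a t) x - cv (kc j c) u x|)).
    by apply: le_trans (ler_normD _ _); rewrite addrA subrK.
  rewrite [X in _ + X]distrC; apply: le_trans (lerD h2 h1) _.
  have -> : Q * t + D * (t * W) = 2 * Q * t by rewrite /Q; ring.
  rewrite /t mulrA ler_pdivrMr ?mulr_gt0// mulrC ler_wpM2l ?(ltW e0)//.
  by rewrite ler_pM2l// lerDl.
exists L; split.
  split => //; rewrite (_ : (fun n => _) = fun n => cv (gs (cseq n)) L); last first.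
    by apply/funext => n; apply/funext => x; rewrite gL// cseq_gt0.
  by apply: approx_id_seq => //; [exact: cseq_gt0|exact: cvg_cseq].
move=> x; apply/cvgrPdist_le => e e0; have eQ : 0 < e / (Q + 1) by rewrite divr_gt0.
near=> t; have t0 : 0 < t by near: t; exact: nbhs_right_gt.
rewrite distrC; apply: le_trans (La t x t0) _.
apply: (@le_trans _ _ ((Q + 1) * t)); first by rewrite ler_wpM2r ?(ltW t0)// lerDl.
rewrite -ler_pdivlMl// mulrC; apply/ltW; near: t; exact: nbhs_right_lt.
Unshelve. all: by end_near.
Qed.

End truncation_limit.

(** * Schwartz functions: measurability, decay and truncation limits *)

Section continuous_functions.
Context {R : realType} {d : nat}.
Local Notation E := 'rV[R]_d.

(* An open set is a countable union of half-open cubes of a dyadic-type grid. *)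
Lemma measurable_nbhs (A : set E) : (forall x, A x -> nbhs x A) -> measurable A.
Proof.
move=> Ao.
pose F (p : 'rV[int]_d * nat) : set E :=
  [set x | forall i, `[(p.1 0 i)%:~R / p.2.+1%:R, (p.1 0 i + 1)%:~R / p.2.+1%:R[%classic
    (x 0 i : measurableTypeR R)].
pose G (k : nat) : set E := if unpickle k is Some p then
  (if `[< F p `<=` A >] then F p else set0) else set0.
have -> : A = \bigcup_k G k.
  apply/seteqP; split => [x Ax|x [k _]]; last first.
    rewrite /G; case: (unpickle k) => // p; case: ifPn => // /asboolP h Fx.
    exact: h.
  have /nbhs_ballP[e /= e0 he] := Ao x Ax.
  near \oo => n; have ne : n.+1%:R^-1 < e :> R.
    by near: n; exact: (cvgr_lt _ (@cvg_harmonic R)).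
  have n0 : 0 < n.+1%:R :> R by [].
  pose p : 'rV[int]_d * nat := (\row_i Num.floor (x 0 i * n.+1%:R), n).
  have Fx : F p x.
    move=> i; rewrite /p/= mxE in_itv/=; have := floor_itv (x 0 i * n.+1%:R).
    by rewrite ler_pdivrMr// ltr_pdivlMr.
  exists (pickle p) => //; rewrite /G pickleK ifT//; apply/asboolP => y Fy.
  apply: he; split => // i0 i; rewrite (ord1 i0) /ball/=; apply: lt_trans ne.
  have := Fx i; have := Fy i; rewrite /p/= !in_itv/= intrD mulrDl mulr1z mul1r.
  set K := _%:~R / _; set N := n.+1%:R^-1.
  by move=> /andP[y1 y2] /andP[x1 x2]; rewrite ltr_norml; apply/andP; split; lra.
apply: bigcupT_measurable => k; rewrite /G; case: (unpickle k) => [p|//].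
case: ifP => // _.
apply: (@measurable_coord_forall R d (fun i => `[(p.1 0 i)%:~R / p.2.+1%:R, (p.1 0 i + 1)%:~R / p.2.+1%:R[%classic)) => i.
exact: measurable_itv.
Unshelve. all: by end_near.
Qed.

Lemma continuous_measurable_rV (u : E -> R) : continuous u -> measurable_fun setT u.
Proof.
move=> cu; apply: (measurability _ (RGenOInfty.measurableE R)) => _ [_ [r ->] <-].
rewrite setTI; apply: measurable_nbhs => x /=; rewrite in_itv/= andbT => rx.
have : \forall y \near x, r < u y by exact: (cvgr_gt _ (cu x)).
by apply: filterS => y ry; rewrite /= in_itv/= ry.
Qed.

Lemma is_derive_line (u : E -> R) (v x : E) (s : R) : derivable u (x + s *: v) v ->
  is_derive s 1 (fun s : R => u (x + s *: v)) ('D_v u (x + s *: v)).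
Proof.
move=> du; pose f (s : R) := u (x + s *: v).
have e : (fun h : R => h^-1 *: ((f \o shift s) (h *: (1 : R)) - f s)) =
    (fun h : R => h^-1 *: ((u \o shift (x + s *: v)) (h *: v) - u (x + s *: v))).
  apply/funext => h; rewrite /f /=; congr (_ *: (u _ - _)).
  by rewrite -[h *: 1]/(h * 1) mulr1 scalerDl addrCA.
split; first by rewrite /derivable e.
by rewrite /derive e.
Qed.

Lemma lipschitz_line (u : E -> R) (v : E) (D : R) : (forall x, derivable u x v) ->
  (forall x, `|'D_v u x| <= D) ->
  forall x s, 0 < s -> `|u (x + s *: v) - u x| <= D * s.
Proof.
move=> du hD x s s0; pose f (s : R) := u (x + s *: v).
have df (r : R) := is_derive_line (du (x + r *: v)).
have [|c _] := @MVT_segment R f (fun r => 'D_v u (x + r *: v)) 0 s (ltW s0) (fun r _ => df r).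
  apply: derivable_within_continuous => r _; have h := df r; exact: ex_derive.
rewrite /f scale0r addr0 subr0 => ->; rewrite normrM (gtr0_norm s0) ler_wpM2r ?(ltW s0)//.
Qed.

End continuous_functions.

Section rapid_decay.
Context {R : realType} {d : nat}.
Local Notation E := 'rV[R]_d.
Local Notation mu := (@lebesgue_rV R d).
Local Notation leb := (@lebesgue_measure R).

Lemma integral_cauchy_line_lty : (\int[leb]_x ((1 + x ^+ 2)^-1)%:E < +oo)%E.
Proof.
pose g (x : R) := ps x * (1 + x ^+ 2)^-1.
have mg : measurable_fun setT (fun x => (g x)%:E).
  apply/measurable_EFinP; apply: measurable_funM; first exact: measurable_ps.
  by apply: (measurableT_comp measurable_inv); exact: measurable_funD.
have p0 (x : R) : 0 < 1 + x ^+ 2 by rewrite ltr_pwDl// sqr_ge0.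
have g0 x : (0 <= (g x)%:E)%E by rewrite lee_fin mulr_ge0 ?ps_ge0// invr_ge0 ltW.
have gfin : (\int[leb]_x (g x)%:E)%E \is a fin_num.
  by rewrite ge0_fin_numE ?cpolar_finite//; exact: integral_ge0.
have n1 : (-1 : R) != 0 by rewrite oppr_eq0 oner_neq0.
have m1 : measurable_fun setT (fun x : R => (g (1 * x + 1))%:E).
  exact: (measurableT_comp mg (measurable_affine 1 1)).
have m2 : measurable_fun setT (fun x : R => (g (-1 * x + 1))%:E).
  exact: (measurableT_comp mg (measurable_affine (-1) 1)).
have h1 := ge0_integral_affine 1 (oner_neq0 R) mg g0.
have h2 := ge0_integral_affine 1 n1 mg g0.
(* 1 + (1 + |x|)^2 <= 3 (1 + x^2) bounds the line integral by two shifted half-line integrals; the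
   shift by 1 keeps the argument positive at x = 0, where [ps] vanishes. *)
apply: (@le_lt_trans _ _ (\int[leb]_x (3%:E * ((g (1 * x + 1))%:E + (g (-1 * x + 1))%:E)))%E).
  apply: ge0_le_integral => //.
  - by move=> x _; rewrite lee_fin invr_ge0 ltW.
  - apply/measurable_EFinP; apply: (measurableT_comp measurable_inv); exact: measurable_funD.
  - by apply: measurable_funeM; exact: emeasurable_funD.
  move=> x _; rewrite -EFinD -EFinM lee_fin.
  have key (y : R) : (y = 1 * x + 1 \/ y = -1 * x + 1) -> 0 < y -> (1 + x ^+ 2)^-1 <= 3 * g y.
    move=> hy y0; rewrite /g ps_gt0// mul1r ler_pdivlMr// mulrC ler_pdivrMr//.
    by case: hy => ->; nra.
  have gr0 y : 0 <= g y by have := g0 y; rewrite lee_fin.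
  have [x0|x0] := leP 0 x.
    apply: le_trans (key (1 * x + 1) (or_introl erefl) _) _; first by rewrite mul1r ltr_wpDl.
    by rewrite ler_pM2l// lerDl.
  apply: le_trans (key (-1 * x + 1) (or_intror erefl) _) _; first by rewrite mulN1r ltr_wpDl// oppr_ge0 ltW.
  by rewrite ler_pM2l// lerDr.
rewrite ge0_integralZl_EFin//; last 2 first.
- by move=> x _; rewrite adde_ge0.
- exact: emeasurable_funD.
rewrite ge0_integralD// h1 h2 normrN1 normr1 invr1 !mul1e -(fineK gfin) -EFinD -EFinM.
exact: ltry.
Qed.

Definition cauchy_weight_rV (x : E) : R := \prod_i (1 + x 0 i ^+ 2)^-1.

Lemma cauchy_weight_rV_ge0 x : 0 <= cauchy_weight_rV x.
Proof. by apply: prodr_ge0 => i _; rewrite invr_ge0 addr_ge0// sqr_ge0. Qed.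

Lemma L1r_cauchy_weight_rV : L1r cauchy_weight_rV.
Proof.
have mh : measurable_fun setT (fun x : R => ((1 + x ^+ 2)^-1)%:E).
  apply/measurable_EFinP; apply: (measurableT_comp measurable_inv); exact: measurable_funD.
have h0 (x : R) : (0 <= ((1 + x ^+ 2)^-1)%:E)%E by rewrite lee_fin invr_ge0 addr_ge0// sqr_ge0.
have mc : measurable_fun setT cauchy_weight_rV.
  apply: measurable_prod => i _; apply: (measurableT_comp measurable_inv).
  by apply: measurable_funD => //; apply: measurable_funX; exact: measurable_coord.
apply/integrable_ltyP => //.
have -> : (\int[mu]_x (`|cauchy_weight_rV x|)%:E =
    \int[mu]_x \prod_(i < d) ((1 + x 0%R i ^+ 2)^-1)%:E)%E.
  by apply: eq_integral => x _; rewrite ger0_norm ?cauchy_weight_rV_ge0// prodEFin.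
rewrite (@ge0_integral_prod R d (fun=> fun x : R => ((1 + x ^+ 2)^-1)%:E))//.
have fin : (\int[leb]_x ((1 + x ^+ 2)^-1)%:E)%E \is a fin_num.
  by rewrite ge0_fin_numE ?integral_cauchy_line_lty//; exact: integral_ge0.
by rewrite -(fineK fin) prodEFin ltry.
Qed.

Section decay.
Variable u : E -> R.
Hypothesis mu_ : measurable_fun setT u.
Hypothesis hu : forall a : 'I_d -> nat, exists M : R, forall x : E,
  `|(\prod_i x 0 i ^+ a i) * u x| <= M.

(** Each factor 1 + x_i^2 is at most 2 x_i^2 if x_i^2 > 1 and at most 2 otherwise. So the product is
    at most 2^d times the monomial over the set S of large coordinates, and summing over the
    finitely many S makes the constant independent of x. *)
Lemma decay_le : exists2 C, 0 <= C & forall x, `|u x| <= C * cauchy_weight_rV x.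
Proof.
have [Mf hM] := choice (fun S : {set 'I_d} => hu (fun i => (2 * (i \in S))%N)).
pose C := 2 ^+ d * \sum_(S : {set 'I_d}) `|Mf S|.
exists C; first by rewrite mulr_ge0 ?exprn_ge0// sumr_ge0.
move=> x; pose S : {set 'I_d} := finset (fun i => 1 < x 0 i ^+ 2).
pose P := \prod_i (1 + x 0 i ^+ 2).
have P0 : 0 < P by apply: prodr_gt0 => i _; rewrite ltr_pwDl// sqr_ge0.
rewrite /cauchy_weight_rV prodfV -/P ler_pdivlMr//.
have PS : P <= 2 ^+ d * \prod_i x 0 i ^+ (2 * (i \in S)).
  have -> : (2 : R) ^+ d = \prod_(i < d) 2 by rewrite prodr_const card_ord.
  rewrite -big_split; apply: ler_prod => i _; have x0 := sqr_ge0 (x 0 i).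
  have -> : (i \in S) = (1 < x 0 i ^+ 2) by rewrite inE.
  rewrite addr_ge0//=; case: (ltP 1 (x 0 i ^+ 2)) => h; rewrite ?muln1 ?muln0 ?expr0; lra.
apply: (@le_trans _ _ (`|u x| * (2 ^+ d * \prod_i x 0 i ^+ (2 * (i \in S))))).
  by rewrite ler_wpM2l.
rewrite mulrCA /C ler_wpM2l ?exprn_ge0//.
apply: (@le_trans _ _ `|Mf S|); last by rewrite (bigD1 S)//= lerDl sumr_ge0.
apply: le_trans (ler_norm _); apply: le_trans (hM S x).
rewrite normrM mulrC ler_wpM2r// ler_norm//.
Qed.

Lemma decay_bdd : exists2 M, 0 <= M & bdd M u.
Proof.
have [C C0 hC] := decay_le; exists C => //; split => // x; apply: le_trans (hC x) _.
rewrite ler_piMr// /cauchy_weight_rV; apply: prodr_ile1 => i _.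
by rewrite invr_ge0 addr_ge0 ?sqr_ge0//= invf_le1 ?ltr_pwDl ?sqr_ge0// lerDl sqr_ge0.
Qed.

Lemma decay_L1r : L1r u.
Proof.
have [C C0 hC] := decay_le.
apply: (@integrable_le _ _ _ _ _ (fun x => C * cauchy_weight_rV x)) => //.
by apply: integrable_realZl; exact: L1r_cauchy_weight_rV.
Qed.

Lemma decay_L2r : L2r mu u.
Proof.
have [M M0 [_ hM]] := decay_bdd; split => //.
have h := integrable_bounded decay_L1r mu_ hM.
have /integrable_ltyP h2 := h.
have m2 : measurable_fun setT (fun x => u x * u x) by exact: measurable_funM.
apply: le_lt_trans (h2 m2); rewrite le_eqVlt; apply/orP; left; apply/eqP.
by apply: eq_integral => x _; rewrite -expr2 ger0_norm ?sqr_ge0.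
Qed.

End decay.

End rapid_decay.

Section schwartz_functions.
Context {R : realType} {d : nat}.
Local Notation E := 'rV[R]_d.
Local Notation mu := (@lebesgue_rV R d).
Variables (u : E -> R) (j : 'I_d).
Hypothesis su : schwartzR u.

Lemma schwartz_measurable : measurable_fun setT u.
Proof.
apply: continuous_measurable_rV => x; apply: differentiable_continuous.
exact: (su.1 [::] x).
Qed.

Lemma schwartz_decay (a : 'I_d -> nat) : exists M : R, forall x : E,
  `|(\prod_i x 0 i ^+ a i) * u x| <= M.
Proof. exact: (su.2 a [::]). Qed.

Lemma L2r_schwartz : L2r mu u.
Proof. exact: (decay_L2r schwartz_measurable schwartz_decay). Qed.

Lemma schwartz_limit : exists L : E -> R, is_T j u L /\
  forall x, cv (kt j t) u x @[t --> 0^'+] --> L x.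
Proof.
have [M M0 bu] := decay_bdd schwartz_measurable schwartz_decay.
(* The seminorm with trivial monomial and the single derivative d_j is the Lipschitz constant along
   the j-th axis. *)
have [D hD] := su.2 (fun=> 0%N) [:: j].
have hD' x : `|'D_(delta_mx 0 j) u x| <= D.
  by have := hD x; rewrite big1 ?mul1r// => i _; rewrite expr0.
have D0 : 0 <= D := le_trans (normr_ge0 _) (hD' 0).
apply: (truncation_limit (decay_L1r schwartz_measurable schwartz_decay) L2r_schwartz bu D0).
apply: lipschitz_line => // x; apply: diff_derivable; exact: (su.1 [::] x).
Qed.

End schwartz_functions.

(** * Density of Schwartz functions in L^2 *)

Section polynomial_functions.
Context {R : realType} {d : nat}.
Local Notation E := 'rV[R]_d.
Local Notation mu := (@lebesgue_rV R d).

(** Polynomial functions as a class closed under sums, products and derivatives: every iterated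
    derivative of q exp (- P) is again of this form with a new polynomial q. *)
Inductive polyfun : (E -> R) -> Prop :=
| polyfun_cst c : polyfun (fun=> c)
| polyfun_coord i : polyfun (fun x => x 0 i)
| polyfunD f g : polyfun f -> polyfun g -> polyfun (fun x => f x + g x)
| polyfunM f g : polyfun f -> polyfun g -> polyfun (fun x => f x * g x).

Lemma is_derive_coord (x v : E) i : is_derive x v (fun y : E => y 0 i) (v 0 i).
Proof.
have h : (fun h : R => h^-1 *: (((fun y : E => y 0 i) \o shift x) (h *: v) - x 0 i)) @ 0^' --> v 0 i.
  apply: cvg_near_cst; near=> h.
  have h0 : h != 0 by near: h; exact: nbhs_dnbhs_neq.
  by rewrite /= !mxE addrK /GRing.scale/= mulrA mulVf// mul1r.
by split; [exact: cvgP h|exact: cvg_lim h].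
Unshelve. all: by end_near.
Qed.

Lemma polyfun_differentiable f x : polyfun f -> differentiable f x.
Proof.
elim=> {f} [c|i|f g _ df _ dg|f g _ df _ dg].
- exact: differentiable_cst.
- exact: differentiable_coord.
- exact: differentiableD df dg.
- exact: differentiableM df dg.
Qed.

Lemma polyfun_is_derive f (v : E) : polyfun f ->
  exists2 g, polyfun g & forall x, is_derive x v f (g x).
Proof.
elim=> {f} [c|i|f g pf [f' pf' df] pg [g' pg' dg]|f g pf [f' pf' df] pg [g' pg' dg]].
- by exists (fun=> 0) => [|x]; [exact: polyfun_cst|exact: is_derive_cst].
- by exists (fun=> v 0 i) => [|x]; [exact: polyfun_cst|exact: is_derive_coord].
- by exists (fun x => f' x + g' x) => [|x]; [exact: polyfunD|exact: is_deriveD].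
- exists (fun x => f x * g' x + g x * f' x) => [|x].
    by apply: polyfunD; exact: polyfunM.
  exact: is_deriveM.
Qed.

Lemma polyfun_sum (I : Type) (s : seq I) (F : I -> E -> R) : (forall i, polyfun (F i)) ->
  polyfun (fun x => \sum_(i <- s) F i x).
Proof.
move=> hF; elim: s => [|i s ih].
  rewrite (_ : (fun x => _) = fun=> 0); first exact: polyfun_cst.
  by apply/funext => x; rewrite big_nil.
rewrite (_ : (fun x => _) = fun x => F i x + \sum_(i <- s) F i x); first exact: polyfunD.
by apply/funext => x; rewrite big_cons.
Qed.

Lemma polyfun_prod (I : Type) (s : seq I) (F : I -> E -> R) : (forall i, polyfun (F i)) ->
  polyfun (fun x => \prod_(i <- s) F i x).
Proof.
move=> hF; elim: s => [|i s ih].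
  rewrite (_ : (fun x => _) = fun=> 1); first exact: polyfun_cst.
  by apply/funext => x; rewrite big_nil.
rewrite (_ : (fun x => _) = fun x => F i x * \prod_(i <- s) F i x); first exact: polyfunM.
by apply/funext => x; rewrite big_cons.
Qed.

Lemma polyfunX f n : polyfun f -> polyfun (fun x => f x ^+ n).
Proof.
move=> pf; elim: n => [|n ih].
  by rewrite (_ : (fun x => _) = fun=> 1); [exact: polyfun_cst|apply/funext => x; rewrite expr0].
rewrite (_ : (fun x => _) = fun x => f x * f x ^+ n); first exact: polyfunM.
by apply/funext => x; rewrite exprS.
Qed.

Section exponential_weight.
Variable P : E -> R.
Hypotheses (pP : polyfun P) (P0 : forall x, 0 <= P x).
Hypothesis hP : forall i, exists2 C, 0 <= C & forall x : E, `|x 0 i| <= C * (1 + P x).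

(** Stated for every e > 0 so that the induction can spend e / 2 on each factor of a product; the
    coordinates are controlled by 1 + P, hence by the exponential. *)
Lemma polyfun_growth f : polyfun f -> forall e : R, 0 < e ->
  exists2 C, 0 <= C & forall x, `|f x| <= C * expR (e * P x).
Proof.
have E1 (e : R) x : 0 < e -> 1 <= expR (e * P x).
  by move=> e0; rewrite -expR0 ler_expR mulr_ge0// ltW.
elim=> {f} [c|i|f g _ hf _ hg|f g _ hf _ hg] e e0.
- by exists `|c| => // x; rewrite ler_peMr// E1.
- have [C C0 hC] := hP i; exists (C * (1 + e^-1)); first by rewrite mulr_ge0// addr_ge0// invr_ge0 ltW.
  move=> x; apply: le_trans (hC x) _; rewrite -mulrA ler_wpM2l// mulrDl mul1r.
  apply: lerD; first exact: E1.
  rewrite mulrC ler_pdivlMr// mulrC; apply: le_trans (expR_ge1Dx _).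
  by rewrite lerDr.
- have [C C0 hC] := hf e e0; have [D D0 hD] := hg e e0.
  exists (C + D) => [|x]; first exact: addr_ge0.
  by apply: le_trans (ler_normD _ _) _; rewrite mulrDl lerD.
- have e2 : 0 < e / 2 by rewrite divr_gt0.
  have [C C0 hC] := hf _ e2; have [D D0 hD] := hg _ e2.
  exists (C * D) => [|x]; first exact: mulr_ge0.
  rewrite normrM; apply: le_trans (ler_pM _ _ (hC x) (hD x)) _ => //.
  rewrite mulrACA -expRD -mulrDl.
  by have -> : e / 2 + e / 2 = e by field.
Qed.

Definition expweight (q : E -> R) (x : E) : R := q x * expR (- P x).

Lemma is_derive_expR_comp (g : E -> R) (dg : R) (x v : E) : differentiable g x ->
  is_derive x v g dg -> is_derive x v (fun y => expR (g y)) (dg * expR (g x)).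
Proof.
move=> diffg [_ gv]; have de : differentiable (@expR R) (g x).
  by apply/derivable1_diffP; have h := is_derive_expR (g x); exact: ex_derive.
have dc : differentiable (expR \o g) x by exact: differentiable_comp.
split; first exact: diff_derivable.
have gv' : 'd g x v = dg by rewrite -deriveE.
have h := is_derive_expR (g x).
rewrite (_ : (fun y => expR (g y)) = expR \o g)// deriveE// diff_comp//= gv' diff1E//.
by rewrite /GRing.scale/= derive1E (derive_val (is_derive := h)).
Qed.

Lemma expweight_differentiable q x : polyfun q -> differentiable (expweight q) x.
Proof.
move=> pq; apply: differentiableM; first exact: polyfun_differentiable.
have dP : differentiable (fun y => - P y) x.
  by apply: differentiableN; exact: polyfun_differentiable.
apply: (@differentiable_comp _ _ _ _ (fun y => - P y) (@expR R)) => //.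
by apply/derivable1_diffP; have h := is_derive_expR (- P x); exact: ex_derive.
Qed.

Lemma expweight_derive q (v : E) : polyfun q -> exists2 q', polyfun q' &
  forall x, 'D_v (expweight q) x = expweight q' x.
Proof.
move=> pq; have [q' pq' dq] := polyfun_is_derive v pq; have [P' pP' dP] := polyfun_is_derive v pP.
exists (fun x => q' x + (-1) * (q x * P' x)).
  apply: polyfunD => //; apply: polyfunM; first exact: polyfun_cst.
  exact: polyfunM.
move=> x; have dN : differentiable (fun y => - P y) x.
  by apply: differentiableN; exact: polyfun_differentiable.
have h1 : is_derive x v (fun y => - P y) (- P' x) := is_deriveN (dP x).
have h2 := is_derive_expR_comp dN h1.
have h3 : is_derive x v (expweight q) _ := is_deriveM (dq x) h2.
rewrite (derive_val (is_derive := h3)) /expweight /GRing.scale/=; ring.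
Qed.

Lemma iter_partial_expweight s q : polyfun q ->
  exists2 q', polyfun q' & iter_partial s (expweight q) = expweight q'.
Proof.
move=> pq; elim: s => [|i s [q' pq' /= ->]]; first by exists q.
have [q'' pq'' h] := expweight_derive 'e_i pq'.
by exists q'' => //; apply/funext => x; exact: h.
Qed.

Lemma schwartzR_expweight q : polyfun q -> schwartzR (expweight q).
Proof.
move=> pq; split => [s x|a s].
  by have [q' pq' ->] := iter_partial_expweight s pq; exact: expweight_differentiable.
have [q' pq' ->] := iter_partial_expweight s pq.
have pa : polyfun (fun x => (\prod_i x 0 i ^+ a i) * q' x).
  apply: polyfunM => //; apply: polyfun_prod => i; apply: polyfunX; exact: polyfun_coord.
have [C C0 hC] := polyfun_growth pa ltr01; exists C => x.
rewrite /expweight mulrA normrM [X in _ * X]ger0_norm ?expR_ge0//.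
by rewrite expRN ler_pdivrMr ?expR_gt0//; have := hC x; rewrite mul1r.
Qed.

End exponential_weight.

End polynomial_functions.

Section schwartz_density.
Context {R : realType} {d : nat}.
Local Notation E := 'rV[R]_d.
Local Notation mu := (@lebesgue_rV R d).

Lemma hyperplane_null i (c : R) : {ae mu, forall x : E, x 0 i != c}.
Proof.
pose A (k : 'I_d) : set (measurableTypeR R) := if k == i then [set c] else setT.
have mA k : measurable (A k) by rewrite /A; case: eqP => _ //; exact: measurable_set1.
exists [set x : E | forall k, A k (x 0 k)]; split.
- exact: measurable_coord_forall.
- rewrite (lebesgue_rV_box mA) (bigD1 i)//= /A eqxx.
  by rewrite lebesgue_measure_set1 mul0e.
- move=> x /= /negP; rewrite negbK => /eqP xc k; rewrite /A.
  by case: eqP => [->|].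
Qed.

Section box.
Variables m r : 'I_d -> R.
Hypothesis r0 : forall i, 0 < r i.

Let y (x : E) i := (x 0 i - m i) / r i.

(** A polynomial potential with even powers: as n grows, exp (- [boxpot n]) tends to 1 where all
    rescaled coordinates have modulus below 1 and to 0 where one exceeds 1. This approximates the
    box by Schwartz functions without bump functions. *)
Definition boxpot n (x : E) : R := \sum_i ((x 0 i - m i) / r i) ^+ n.+1.*2.

Lemma boxpot_sqr n x : boxpot n x = \sum_i (y x i ^+ 2) ^+ n.+1.
Proof. by apply: eq_bigr => i _; rewrite -exprM mul2n. Qed.

Lemma boxpot_ge0 n x : 0 <= boxpot n x.
Proof. by rewrite boxpot_sqr; apply: sumr_ge0 => i _; rewrite exprn_ge0// sqr_ge0. Qed.

Lemma polyfun_boxpot n : polyfun (boxpot n).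
Proof.
apply: polyfun_sum => i; apply: polyfunX; apply: polyfunM; last exact: polyfun_cst.
by apply: polyfunD; [exact: polyfun_coord|exact: polyfun_cst].
Qed.

Lemma boxpot_coord n i : exists2 C, 0 <= C & forall x : E, `|x 0 i| <= C * (1 + boxpot n x).
Proof.
exists (`|m i| + r i) => [|x]; first by rewrite addr_ge0// ltW.
have yP : `|y x i| <= 1 + boxpot n x.
  apply: (@le_trans _ _ (1 + (y x i ^+ 2) ^+ n.+1)); last first.
    rewrite lerD2l boxpot_sqr (bigD1 i)//= lerDl; apply: sumr_ge0 => k _.
    by rewrite exprn_ge0// sqr_ge0.
  have z0 := sqr_ge0 (y x i); have [h|h] := leP `|y x i| 1.
    by apply: le_trans h _; rewrite lerDl exprn_ge0.
  apply: (@le_trans _ _ (y x i ^+ 2)).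
    by rewrite -(real_normK (num_real (y x i))) expr2 ler_peMl// ltW.
  have h2 : 1 <= y x i ^+ 2 by rewrite -(real_normK (num_real (y x i))) exprn_ege1// ltW.
  by apply: ler_wpDl => //; rewrite [leRHS]exprS ler_peMr// exprn_ege1.
have -> : x 0 i = m i + r i * y x i by rewrite /y; field; rewrite gt_eqF.
apply: le_trans (ler_normD _ _) _; rewrite mulrDl; apply: lerD.
  by rewrite ler_peMr// lerDl boxpot_ge0.
by rewrite normrM (gtr0_norm (r0 i)) ler_pM2l.
Qed.

Definition boxapprox n : E -> R := expweight (boxpot n) (fun=> 1).

Lemma schwartzR_boxapprox n : schwartzR (boxapprox n).
Proof.
apply: schwartzR_expweight; [exact: polyfun_boxpot|exact: boxpot_ge0|exact: boxpot_coord|exact: polyfun_cst].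
Qed.

Lemma cvgL2_boxapprox :
  cvgL2 mu boxapprox (\1_(obox (fun i => m i - r i) (fun i => m i + r i)) : E -> R).
Proof.
set B := obox _ _.
have L2s n := L2r_schwartz (schwartzR_boxapprox n).
have inB x : B x <-> forall i, y x i ^+ 2 < 1.
  have e i : (m i - r i < x 0 i < m i + r i) = (y x i ^+ 2 < 1).
    rewrite -real_normK ?num_real// expr_lt1// ltr_norml /y ltr_pdivlMr// ltr_pdivrMr//.
    by apply/idP/idP => /andP[h1 h2]; apply/andP; split; lra.
  by split => h i; have := h i; rewrite e.
(* Since s - 1 <= s^(n+1) for s = y_i^2 >= 0, the potential of index n is at least that of index 0
   minus d; this gives the dominating multiple of a Gaussian. *)
apply: (@cvgL2_dominated _ _ _ mu _ _ (fun x => expR d%:R * boxapprox 0 x)).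
- by move=> n; exact: (L2s n).1.
- by apply: measurable_indic; exact: measurable_obox.
(* On the hyperplanes carrying the faces a power stays equal to 1 and the limit may be neither 0 nor
   1; they are null sets. *)
- have aeb : {ae mu, forall x : E, forall i, y x i ^+ 2 != 1}.
    apply: filter_forall => i.
    apply: filterS2 (hyperplane_null i (m i + r i)) (hyperplane_null i (m i - r i)) => x h1 h2.
    apply/negP => /eqP hy; have ry : x 0 i = m i + r i * y x i by rewrite /y; field; rewrite gt_eqF.
    have : (y x i - 1) * (y x i + 1) == 0 by rewrite -subr_sqr hy expr1n subrr.
    rewrite mulf_eq0 subr_eq0 addr_eq0 => /orP[/eqP e|/eqP e]; move: ry; rewrite e => ry.
      by move: h1; rewrite ry mulr1 eqxx.
    by move: h2; rewrite ry mulrN1 eqxx.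
  apply: filterS aeb => x hx; rewrite indicE.
  have [Bx|Bx] := pselect (B x).
    rewrite mem_set//= -expR0 -oppr0; have yx := (inB x).1 Bx.
    have cP : boxpot n x @[n --> \oo] --> (0 : R).
      rewrite (_ : (fun n => _) = fun n => \sum_i (y x i ^+ 2) ^+ n.+1); last first.
        by apply/funext => n; exact: boxpot_sqr.
      rewrite -[X in _ --> X](_ : \sum_(i < d) (0 : R) = 0); last by rewrite big1.
      apply: (cvg_big add_continuous) => i _; rewrite (cvg_shiftS (fun n => (y x i ^+ 2) ^+ n)).
      by apply: cvg_expr; rewrite ger0_norm ?sqr_ge0.
    rewrite (_ : (fun n => _) = fun n => expR (- boxpot n x)); last first.
      by apply/funext => n; rewrite /boxapprox /expweight mul1r.
    by apply: continuous_cvg; [exact: continuous_expR|exact: cvgN].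
  rewrite memNset//; have [i yi] : exists i, 1 < y x i ^+ 2.
    apply: contrapT => /forallNP h; apply: Bx; apply/inB => i.
    by have /negP := h i; rewrite -leNgt lt_neqAle hx.
  pose z := y x i ^+ 2; have z0 : 0 < z := lt_trans ltr01 yi.
  rewrite mulr0n.
  apply: (@squeeze_cvgr _ _ _ _ (fun=> 0) (fun n : nat => (z^-1) ^+ n.+1)); last 2 first.
  + exact: cvg_cst.
  + rewrite (cvg_shiftS (fun n => z^-1 ^+ n)); apply: cvg_expr.
    by rewrite ger0_norm ?invr_ge0 ?(ltW z0)// invf_lt1.
  + apply: nearW => n; rewrite /boxapprox /expweight mul1r expR_ge0/=.
    have zn : 0 < z ^+ n.+1 by exact: exprn_gt0.
    rewrite expRN exprVn lef_pV2 ?posrE ?expR_gt0 ?zn//.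
    apply: le_trans (expR_ge1Dx _); apply: ler_wpDl => //; rewrite boxpot_sqr (bigD1 i)//= lerDl.
    by apply: sumr_ge0 => k _; rewrite exprn_ge0// sqr_ge0.
- exact: (L2rZ _ (L2s 0%N)).
- apply: aeW => x n; rewrite /boxapprox /expweight !mul1r -expRD ger0_norm ?expR_ge0// ler_expR.
  rewrite !boxpot_sqr lerNl opprB -[d in d%:R]card_ord -sumr_const -sumrB; apply: ler_sum => i _.
  rewrite expr1; have z0 := sqr_ge0 (y x i); have [h|h] := leP 1 (y x i ^+ 2).
    by apply: (@le_trans _ _ (y x i ^+ 2)); [rewrite gerBl|rewrite [leRHS]exprS ler_peMr// exprn_ege1].
  by apply: (@le_trans _ _ 0); [rewrite subr_le0 ltW|rewrite exprn_ge0].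
Qed.

End box.

Theorem schwartz_induction (Q : (E -> R) -> Prop) :
  (forall a f g, L2r mu f -> L2r mu g -> Q f -> Q g -> Q (fun x => a * f x + g x)) ->
  (forall (f_ : nat -> E -> R) f, (forall n, L2r mu (f_ n)) -> (forall n, Q (f_ n)) ->
    L2r mu f -> cvgL2 mu f_ f -> Q f) ->
  (forall u, schwartzR u -> Q u) ->
  forall f, L2r mu f -> Q f.
Proof.
move=> QZD Qlim QS.
have Q0 : Q (fun=> 0).
  have e (x : E) : (0 : R) = -1 * boxapprox (fun=> 0) (fun=> 1) 0 x + boxapprox (fun=> 0) (fun=> 1) 0 x.
    by rewrite mulN1r addNr.
  have s := @schwartzR_boxapprox (fun=> 0) (fun=> 1) (fun=> ltr01) 0.
  rewrite (_ : (fun=> 0) = fun x => -1 * boxapprox (fun=> 0) (fun=> 1) 0 x + boxapprox (fun=> 0) (fun=> 1) 0 x).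
    by apply: QZD; [exact: L2r_schwartz|exact: L2r_schwartz|exact: QS|exact: QS].
  by apply/funext => x; exact: e.
apply: L2_induction => // l u.
have [lu|/existsNP[i /negP]] := pselect (forall i, l i < u i); last first.
  rewrite -leNgt => ul; rewrite (_ : obox l u = set0); first by rewrite indic0.
  apply/seteqP; split => // x /(_ i) /andP[h1 h2].
  by have := lt_trans h1 h2; rewrite ltNge ul.
pose m i := (l i + u i) / 2; pose r i := (u i - l i) / 2.
have r0 i : 0 < r i by rewrite divr_gt0// subr_gt0.
have -> : obox l u = obox (fun i => m i - r i) (fun i => m i + r i).
  by congr obox; apply/funext => i; rewrite /m /r; field.
apply: (Qlim (boxapprox m r)).
- by move=> n; apply: L2r_schwartz; exact: schwartzR_boxapprox.
- by move=> n; apply: QS; exact: schwartzR_boxapprox.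
- by apply: L2r_indic; [exact: measurable_obox|exact: obox_lty].
- exact: cvgL2_boxapprox.
Qed.

End schwartz_density.

(** * Complex-valued functions and the Riesz operator *)

Section complex_L2.
Context {R : realType} {d : nat}.
Local Notation E := 'rV[R]_d.
Local Notation mu := (@lebesgue_rV R d).
Implicit Types (f : E -> R[i]) (u v : E -> R).

Definition refun f : E -> R := fun x => complex.Re (f x).
Definition imfun f : E -> R := fun x => complex.Im (f x).
Definition cfun u : E -> R[i] := fun x => Complex (u x) 0.

Lemma L2norm_ge0 f : (0 <= L2norm f)%E.
Proof. exact: Lnorm_ge0. Qed.

Lemma L2norm_sqr f : measurable_fun setT (refun f) -> measurable_fun setT (imfun f) ->
  (L2norm f ^+ 2 = sqn mu (refun f) + sqn mu (imfun f))%E.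
Proof.
move=> mr mi; rewrite /L2norm LnormX2 /sqn -ge0_integralD//; last 4 first.
- by move=> x _; rewrite lee_fin sqr_ge0.
- exact: measurable_sqr.
- by move=> x _; rewrite lee_fin sqr_ge0.
- exact: measurable_sqr.
apply: eq_integral => x _; rewrite /refun /imfun; case: (f x) => a b.
rewrite (_ : ComplexField.Normc.normc (Complex a b) = Num.sqrt (a ^+ 2 + b ^+ 2))//.
by rewrite gee0_abs ?lee_fin ?sqrtr_ge0// -EFin_expe sqr_sqrtr ?addr_ge0 ?sqr_ge0.
Qed.

Lemma sqre_lty (x : \bar R) : (0 <= x)%E -> (x ^+ 2 < +oo)%E = (x < +oo)%E.
Proof. by case: x => [r| |]// _; rewrite expe2 ?mulyy// -EFinM !ltry. Qed.

Lemma lee_sqrE (x y : \bar R) : (0 <= x)%E -> (0 <= y)%E -> (x ^+ 2 <= y ^+ 2)%E = (x <= y)%E.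
Proof.
case: x y => [r| |] [s| |]//; rewrite !expe2 ?mulyy ?leey// => r0 s0.
by rewrite -!EFinM !lee_fin -!expr2 ler_sqr.
Qed.

Lemma L2P f : L2 f <-> L2r mu (refun f) /\ L2r mu (imfun f).
Proof.
split => [[mr mi]|[[mr r2] [mi i2]]].
  rewrite -sqre_lty ?L2norm_ge0// L2norm_sqr// => h.
  split; split => //; apply: le_lt_trans h.
    by rewrite leeDl// sqn_ge0.
  by rewrite leeDr// sqn_ge0.
split => //; rewrite -sqre_lty ?L2norm_ge0// L2norm_sqr//.
exact: lte_add_pinfty.
Qed.

Lemma L2_cfun u : L2r mu u -> L2 (cfun u).
Proof. by move=> hu; apply/L2P; split; [exact: hu|exact: L2r0]. Qed.

Lemma L2norm_cfun u : measurable_fun setT u -> (L2norm (cfun u) ^+ 2 = sqn mu u)%E.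
Proof.
move=> hu; rewrite L2norm_sqr//; last exact: measurable_cst.
have -> : sqn mu (imfun (cfun u)) = 0%E; last by rewrite adde0.
by rewrite /sqn /imfun /cfun /=; under eq_integral do rewrite expr0n/=; rewrite integral0.
Qed.

Lemma measurable_cstM (c : R) u : measurable_fun setT u -> measurable_fun setT (fun x => c * u x).
Proof. by move=> hu; exact: measurable_funM. Qed.

End complex_L2.

Section riesz_operator.
Context {R : realType} {d : nat}.
Local Notation E := 'rV[R]_d.
Local Notation mu := (@lebesgue_rV R d).
Variable j : 'I_d.
Implicit Types (f : E -> R[i]) (u v : E -> R) (t : R).

(** The ratio between the normalisation of the Riesz transform and that of [kk]; its value is
    pi^(-1/2). It multiplies the truncated operator and T alike, so it factors out of the
    inequality. *)
Definition riesz_const : R := Gamma (d.+1%:R / 2) / pi `^ (d.+1%:R / 2) / ckk (R := R) (d := d).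
Local Notation kap := riesz_const.

Lemma Rintegral_riesz_kernel t (x : E) u : 0 < t -> measurable_fun setT u ->
  (\int[mu]_(y in [set y | t < enorm (x - y)])
    ((x - y) 0 j / enorm (x - y) ^+ d.+1 * u y))%R = (ckk (R := R) (d := d))^-1 * cv (kt j t) u x.
Proof.
move=> t0 hu; have c0 := @ckk_gt0 R d.
rewrite Rintegral_mkcond /cv -Rintegral_measurableZl; last first.
  apply: measurable_funM => //; exact: (measurable_subl x (measurable_kt j t)).
apply: eq_Rintegral => y _; rewrite patchE.
have e : (t < enorm (x - y)) = (t ^+ 2 < nsq (x - y)).
  rewrite /enorm -/(nsq (x - y)) -(ltr_sqr (x := t)) ?nnegrE ?sqrtr_ge0 ?(ltW t0)//.
  by rewrite sqr_sqrtr// nsq_ge0.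
rewrite /kt; case: ifPn => [|].
  rewrite inE/= e => h; rewrite h mulr1 kkE; last exact: le_lt_trans (sqr_ge0 t) h.
  by rewrite /enorm -/(nsq (x - y)) !mulrA mulVf ?mul1r// gt_eqF.
by rewrite notin_setE/= e => /negP/negbTE ->; rewrite mulr0 mul0r mulr0.
Qed.

Lemma riesz_truncE t f x : 0 < t -> measurable_fun setT (refun f) -> measurable_fun setT (imfun f) ->
  riesz_trunc j t f x = Complex (kap * cv (kt j t) (refun f) x) (kap * cv (kt j t) (imfun f) x).
Proof.
move=> t0 mr mi; rewrite /riesz_trunc /cintegral.
have hr : (\int[mu]_(y in [set y | (t < enorm (x - y))%R])
    complex.Re (((x - y) 0 j / enorm (x - y) ^+ d.+1)%:C%C * f y))%R =
    (ckk (R := R) (d := d))^-1 * cv (kt j t) (refun f) x.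
  rewrite -Rintegral_riesz_kernel//; apply: eq_Rintegral => y _; rewrite /refun.
  by case: (f y) => a b /=; rewrite mul0r subr0.
have hi : (\int[mu]_(y in [set y | (t < enorm (x - y))%R])
    complex.Im (((x - y) 0 j / enorm (x - y) ^+ d.+1)%:C%C * f y))%R =
    (ckk (R := R) (d := d))^-1 * cv (kt j t) (imfun f) x.
  rewrite -Rintegral_riesz_kernel//; apply: eq_Rintegral => y _; rewrite /imfun.
  by case: (f y) => a b /=; rewrite mul0r addr0.
rewrite hr hi; apply/eqP; rewrite eq_complex /= /riesz_const.
by apply/andP; split; apply/eqP; ring.
Qed.

Definition T_limit u : E -> R := xget (fun=> 0) [set Tu | is_T j u Tu].

Lemma is_T_limit u : L2r mu u -> is_T j u (T_limit u).
Proof. by move=> hu; apply: (@xgetPex _ _ [set Tu | is_T j u Tu]); exact: T_exists. Qed.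

Definition rieszT f : E -> R[i] :=
  fun x => Complex (kap * T_limit (refun f) x) (kap * T_limit (imfun f) x).

(** [T_limit] picks a representative separately for each function, so linearity holds almost
    everywhere, through [T_unique]; a complex scalar mixes real and imaginary parts. *)
Lemma rieszT_linear (a : R[i]) f g : L2 f -> L2 g ->
  {ae mu, forall x, rieszT (fun y => a * f y + g y) x = a * rieszT f x + rieszT g x}.
Proof.
move=> /L2P[fr fi] /L2P[gr gi]; case: a => p q.
have hfr := is_T_limit fr; have hfi := is_T_limit fi.
have hgr := is_T_limit gr; have hgi := is_T_limit gi.
have er : refun (fun y => Complex p q * f y + g y) =
    fun y => p * refun f y + ((- q) * imfun f y + refun g y).
  apply/funext => y; rewrite /refun /imfun; case: (f y) => a b; case: (g y) => a' b' /=; ring.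
have ei : imfun (fun y => Complex p q * f y + g y) =
    fun y => p * imfun f y + (q * refun f y + imfun g y).
  apply/funext => y; rewrite /refun /imfun; case: (f y) => a b; case: (g y) => a' b' /=; ring.
have lr := L2rD (L2rZ (- q) fi) gr; have li := L2rD (L2rZ q fr) gi.
have tr := T_linear p fr lr hfr (T_linear (- q) fi gr hfi hgr).
have ti := T_linear p fi li hfi (T_linear q fr gi hfr hgi).
have Lr := L2rD (L2rZ p fr) lr; have Li := L2rD (L2rZ p fi) li.
have ur : {ae mu, forall x, T_limit (refun (fun y => Complex p q * f y + g y)) x =
    p * T_limit (refun f) x + ((- q) * T_limit (imfun f) x + T_limit (refun g) x)}.
  by rewrite er; exact: T_unique Lr (is_T_limit Lr) tr.
have ui : {ae mu, forall x, T_limit (imfun (fun y => Complex p q * f y + g y)) x =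
    p * T_limit (imfun f) x + (q * T_limit (refun f) x + T_limit (imfun g) x)}.
  by rewrite ei; exact: T_unique Li (is_T_limit Li) ti.
apply: filterS2 ur ui => x h1 h2; rewrite /rieszT h1 h2.
move: (T_limit (refun f) x) (T_limit (imfun f) x) (T_limit (refun g) x) (T_limit (imfun g) x) kap
  => A B A' B' k.
by apply/eqP; rewrite eq_complex /=; apply/andP; split; apply/eqP; ring.
Qed.

Lemma refun_rieszT f : refun (rieszT f) = fun x => kap * T_limit (refun f) x.
Proof. by []. Qed.

Lemma imfun_rieszT f : imfun (rieszT f) = fun x => kap * T_limit (imfun f) x.
Proof. by []. Qed.

Lemma rieszT_sqr f : L2 f -> (L2norm (rieszT f) ^+ 2 =
  (kap ^+ 2)%:E * (sqn mu (T_limit (refun f)) + sqn mu (T_limit (imfun f))))%E.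
Proof.
move=> /L2P[/is_T_limit[[mr _] _] /is_T_limit[[mi _] _]].
have cr := measurable_cstM kap mr; have ci := measurable_cstM kap mi.
have -> : (L2norm (rieszT f) ^+ 2 = sqn mu (fun x => (kap * T_limit (refun f) x)%R) +
    sqn mu (fun x => (kap * T_limit (imfun f) x)%R))%E := L2norm_sqr (f := rieszT f) cr ci.
move: (T_limit (refun f)) (T_limit (imfun f)) mr mi {cr ci} => A B mr mi.
by rewrite (sqnZ mu kap mr) (sqnZ mu kap mi) -ge0_muleDr ?sqn_ge0//.
Qed.

Lemma is_riesz_rieszT : is_riesz j rieszT.
Proof.
split.
- move=> f /L2P[/is_T_limit[hr _] /is_T_limit[hi _]].
  by apply/L2P; rewrite refun_rieszT imfun_rieszT; split; [exact: (L2rZ kap hr)|exact: (L2rZ kap hi)].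
- exact: rieszT_linear.
- exists (`|kap| * Num.sqrt (4 * cpolar (R := R))) => f hf.
  have [[mr _] [mi _]] := (L2P f).1 hf.
  have [/[dup] fr /is_T_limit/(T_bound fr) br /[dup] fi /is_T_limit/(T_bound fi) bi] := (L2P f).1 hf.
  have c0 : 0 <= 4 * cpolar (R := R) by rewrite mulr_ge0// cpolar_ge0.
  rewrite -lee_sqrE ?L2norm_ge0//; last first.
    by rewrite mule_ge0 ?L2norm_ge0// lee_fin mulr_ge0// sqrtr_ge0.
  rewrite rieszT_sqr// [leRHS]expe2 muleACA -!expe2 -EFin_expe [(`|_| * _) ^+ 2]exprMn real_normK ?num_real//.
  rewrite sqr_sqrtr// L2norm_sqr// (EFinM (kap ^+ 2) (4 * cpolar)) -muleA; apply: lee_wpmul2l.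
    by rewrite lee_fin sqr_ge0.
  by rewrite ge0_muleDr ?sqn_ge0//; apply: leeD.
- move=> f [sr si]; have sr' : schwartzR (refun f) := sr; have si' : schwartzR (imfun f) := si.
  have fr := L2r_schwartz sr'; have fi := L2r_schwartz si'.
  have [Lr [tr cr]] := schwartz_limit j sr'; have [Li [ti ci]] := schwartz_limit j si'.
  have ur := T_unique fr tr (is_T_limit fr); have ui := T_unique fi ti (is_T_limit fi).
  have tpos : \forall t \near 0^'+, (0 : R) < t by exact: nbhs_right_gt.
  apply: filterS2 ur ui => x h1 h2; rewrite /rieszT /= -h1 -h2; split.
    have c : kap * cv (kt j t) (refun f) x @[t --> 0^'+] --> kap * Lr x.
      by apply: cvgMr; exact: cr.
    apply: cvg_trans c; apply: near_eq_cvg; apply: filterS tpos => t t0.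
    have e := riesz_truncE x t0 fr.1 fi.1.
    exact: (esym (congr1 (@complex.Re R) e)).
  have c : kap * cv (kt j t) (imfun f) x @[t --> 0^'+] --> kap * Li x.
    by apply: cvgMr; exact: ci.
  apply: cvg_trans c; apply: near_eq_cvg; apply: filterS tpos => t t0.
  have e := riesz_truncE x t0 fr.1 fi.1.
  exact: (esym (congr1 (@complex.Im R) e)).
Qed.

Lemma L2norm_riesz_trunc_le t f : 0 < t -> L2 f ->
  (L2norm (riesz_trunc j t f) ^+ 2 <= L2norm (rieszT f) ^+ 2)%E.
Proof.
move=> t0 hf; have [fr fi] := (L2P f).1 hf.
have mr : measurable_fun setT (cv (kt j t) (refun f)).
  by apply: measurable_cv; [exact: measurable_kt|exact: fr.1].
have mi : measurable_fun setT (cv (kt j t) (imfun f)).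
  by apply: measurable_cv; [exact: measurable_kt|exact: fi.1].
have er : refun (riesz_trunc j t f) = fun x => kap * cv (kt j t) (refun f) x.
  by apply/funext => x; rewrite /refun (riesz_truncE x t0 fr.1 fi.1).
have ei : imfun (riesz_trunc j t f) = fun x => kap * cv (kt j t) (imfun f) x.
  by apply/funext => x; rewrite /imfun (riesz_truncE x t0 fr.1 fi.1).
have cr := measurable_cstM kap mr; have ci := measurable_cstM kap mi.
rewrite rieszT_sqr// L2norm_sqr ?er// ?ei//.
rewrite (sqnZ mu kap mr) (sqnZ mu kap mi) -ge0_muleDr ?sqn_ge0//.
apply: lee_wpmul2l; first by rewrite lee_fin sqr_ge0.
by apply: leeD; apply: sqn_truncated_le => //; exact: is_T_limit.
Qed.

End riesz_operator.

(** * Uniqueness of the Riesz transform *)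

Section riesz_uniqueness.
Context {R : realType} {d : nat}.
Local Notation E := 'rV[R]_d.
Local Notation mu := (@lebesgue_rV R d).
Variable j : 'I_d.
Implicit Types (f : E -> R[i]) (u v : E -> R) (T : (E -> R[i]) -> E -> R[i]).

Lemma is_riesz_sqr_le T : is_riesz j T -> exists2 M : R, 0 <= M &
  forall f, L2 f -> (L2norm (T f) ^+ 2 <= M%:E * L2norm f ^+ 2)%E.
Proof.
case=> _ _ [M hM] _; exists (M ^+ 2) => [|f hf]; first exact: sqr_ge0.
have h : (L2norm (T f) <= `|M|%:E * L2norm f)%E.
  apply: le_trans (hM f hf) _; apply: lee_wpmul2r; first exact: L2norm_ge0.
  by rewrite lee_fin ler_norm.
move: h; rewrite -lee_sqrE ?L2norm_ge0//; last by rewrite mule_ge0 ?L2norm_ge0.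
by rewrite [X in (_ <= X)%E -> _]expe2 muleACA -!expe2 -EFin_expe real_normK ?num_real.
Qed.

Lemma cfunZD (a : R) u v : cfun (fun x => a * u x + v x) = fun x => Complex a 0 * cfun u x + cfun v x.
Proof.
apply/funext => x; rewrite /cfun; apply/eqP; rewrite eq_complex /=.
by apply/andP; split; apply/eqP; ring.
Qed.

(** The operator bound is applied to u - u_n; linearity identifies the image of this difference
    almost everywhere, and real and imaginary parts are each controlled by the complex norm. *)
Lemma is_riesz_cfun_cvg T (u_ : nat -> E -> R) u : is_riesz j T ->
  (forall n, L2r mu (u_ n)) -> L2r mu u -> cvgL2 mu u_ u ->
  cvgL2 mu (fun n => refun (T (cfun (u_ n)))) (refun (T (cfun u))) /\
  cvgL2 mu (fun n => imfun (T (cfun (u_ n)))) (imfun (T (cfun u))).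
Proof.
move=> rT hu_ hu cu; have [M M0 hM] := is_riesz_sqr_le rT; case: rT => TL2 Tlin _ _.
pose w n (x : E) : R := -1 * u_ n x + u x.
have hw n : L2r mu (w n) by apply: L2rD => //; exact: L2rZ.
have L2T v : L2r mu v -> L2r mu (refun (T (cfun v))) /\ L2r mu (imfun (T (cfun v))).
  by move=> hv; apply/L2P/TL2/L2_cfun.
have lin n : {ae mu, forall x, T (cfun (w n)) x = Complex (-1) 0 * T (cfun (u_ n)) x + T (cfun u) x}.
  by rewrite /w cfunZD; apply: Tlin; exact: L2_cfun.
have wle n : (sqn mu (refun (T (cfun (w n)))) + sqn mu (imfun (T (cfun (w n)))) <=
    M%:E * sqn mu (fun x => (u_ n x - u x)%R))%E.
  have [h1 h2] := L2T _ (hw n).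
  rewrite -L2norm_sqr ?h1.1 ?h2.1//; last exact: h2.1; last exact: h1.1.
  apply: le_trans (hM _ (L2_cfun (hw n))) _; rewrite L2norm_cfun; last exact: (hw n).1.
  rewrite sqn_subC (_ : sqn mu (w n) = sqn mu (fun x => (u x - u_ n x)%R))//.
  by congr sqn; apply/funext => x; rewrite /w mulN1r addrC.
have hre n : (sqn mu (fun x => (refun (T (cfun (u_ n))) x - refun (T (cfun u)) x)%R) <=
    M%:E * sqn mu (fun x => (u_ n x - u x)%R))%E.
  apply: le_trans (wle n); rewrite sqn_subC.
  rewrite (sqn_ae_eq (g := refun (T (cfun (w n))))).
  - by rewrite leeDl// sqn_ge0.
  - by apply: (L2rB (L2T _ hu).1 (L2T _ (hu_ n)).1).1.
  - exact: (L2T _ (hw n)).1.1.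
  apply: filterS (lin n) => x e; rewrite /refun e.
  by case: (T _ x) => a b; case: (T _ x) => a' b' /=; ring.
have him n : (sqn mu (fun x => (imfun (T (cfun (u_ n))) x - imfun (T (cfun u)) x)%R) <=
    M%:E * sqn mu (fun x => (u_ n x - u x)%R))%E.
  apply: le_trans (wle n); rewrite sqn_subC.
  rewrite (sqn_ae_eq (g := imfun (T (cfun (w n))))).
  - by rewrite leeDr// sqn_ge0.
  - by apply: (L2rB (L2T _ hu).2 (L2T _ (hu_ n)).2).1.
  - exact: (L2T _ (hw n)).2.1.
  apply: filterS (lin n) => x e; rewrite /imfun e.
  by case: (T _ x) => a b; case: (T _ x) => a' b' /=; ring.
have small (e : R) : 0 < e -> \forall n \near \oo,
    (M%:E * sqn mu (fun x => (u_ n x - u x)%R) <= e%:E)%E.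
  move=> e0; have M1 : 0 < M + 1 by rewrite ltr_wpDl.
  have e1 : 0 < e / (M + 1) by rewrite divr_gt0.
  apply: filterS (cu _ e1) => n h.
  apply: (@le_trans _ _ (M%:E * (e / (M + 1))%:E)%E).
    by apply: lee_wpmul2l => //; rewrite lee_fin.
  rewrite -EFinM lee_fin mulrA ler_pdivrMr// mulrC ler_pM2l// lerDl.
  exact: ler01.
split=> e e0; apply: filterS (small _ e0) => n h.
  exact: le_trans (hre n) h.
exact: le_trans (him n) h.
Qed.

Lemma schwartzR0 : schwartzR (fun _ : E => 0 : R).
Proof.
have e s : iter_partial s (fun _ : E => 0 : R) = fun=> 0.
  elim: s => [//|i s IH]; apply/funext => x /=.
  by rewrite -/(iter_partial s (fun=> 0)) IH derive_cst.
split => [s x|a s]; first by rewrite e.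
by exists 0 => x; rewrite e mulr0 normr0.
Qed.

(** On real Schwartz functions both operators are the same pointwise limit. [schwartz_induction]
    extends the agreement to real functions in L^2, and f = i Im f + Re f with linearity to complex
    ones. *)
Lemma is_riesz_unique T1 T2 : is_riesz j T1 -> is_riesz j T2 ->
  forall f, L2 f -> {ae mu, forall x, T1 f x = T2 f x}.
Proof.
move=> r1 r2.
have cf u : L2r mu u -> {ae mu, forall x, T1 (cfun u) x = T2 (cfun u) x}.
  move: u; apply: schwartz_induction.
  - move=> a u v hu hv Qu Qv; rewrite cfunZD.
    have [_ l1 _ _] := r1; have [_ l2 _ _] := r2.
    have e1 := l1 (Complex a 0) _ _ (L2_cfun hu) (L2_cfun hv).
    have e2 := l2 (Complex a 0) _ _ (L2_cfun hu) (L2_cfun hv).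
    by apply: filterS3 (filterI Qu Qv) e1 e2 => x [-> ->] -> ->.
  - move=> u_ u hu_ Qu_ hu cu.
    have L2T T v : is_riesz j T -> L2r mu v ->
        L2r mu (refun (T (cfun v))) /\ L2r mu (imfun (T (cfun v))).
      by case=> TL2 _ _ _ hv; apply/L2P/TL2/L2_cfun.
    have [c1 c1'] := is_riesz_cfun_cvg r1 hu_ hu cu.
    have [c2 c2'] := is_riesz_cfun_cvg r2 hu_ hu cu.
    have tr : cvgL2 mu (fun n => refun (T1 (cfun (u_ n)))) (refun (T2 (cfun u))).
      move=> e e0; apply: filterS (c2 e e0) => n; apply: le_trans.
      apply: sqn_le.
      + by apply: (L2rB (L2T _ _ r1 (hu_ n)).1 (L2T _ _ r2 hu).1).1.
      + by apply: (L2rB (L2T _ _ r2 (hu_ n)).1 (L2T _ _ r2 hu).1).1.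
      + by apply: filterS (Qu_ n) => x h; rewrite /refun h.
    have ti : cvgL2 mu (fun n => imfun (T1 (cfun (u_ n)))) (imfun (T2 (cfun u))).
      move=> e e0; apply: filterS (c2' e e0) => n; apply: le_trans.
      apply: sqn_le.
      + by apply: (L2rB (L2T _ _ r1 (hu_ n)).2 (L2T _ _ r2 hu).2).1.
      + by apply: (L2rB (L2T _ _ r2 (hu_ n)).2 (L2T _ _ r2 hu).2).1.
      + by apply: filterS (Qu_ n) => x h; rewrite /imfun h.
    have er := cvgL2_unique (fun n => (L2T _ _ r1 (hu_ n)).1.1)
      (L2T _ _ r1 hu).1.1 (L2T _ _ r2 hu).1.1 c1 tr.
    have ei := cvgL2_unique (fun n => (L2T _ _ r1 (hu_ n)).2.1)
      (L2T _ _ r1 hu).2.1 (L2T _ _ r2 hu).2.1 c1' ti.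
    by apply: filterS2 er ei => x; rewrite /refun /imfun; case: (T1 _ x) => a b;
      case: (T2 _ x) => a' b' /= -> ->.
  - move=> u su; have scu : schwartz (cfun u) by split; [exact: su|exact: schwartzR0].
    have [_ _ _ s1] := r1; have [_ _ _ s2] := r2.
    apply: filterS2 (s1 _ scu) (s2 _ scu) => x [a1 b1] [a2 b2].
    have := cvg_lim (@norm_hausdorff _ _) a1; rewrite (cvg_lim (@norm_hausdorff _ _) a2).
    have := cvg_lim (@norm_hausdorff _ _) b1; rewrite (cvg_lim (@norm_hausdorff _ _) b2).
    by case: (T1 _ x) => a b; case: (T2 _ x) => a' b' /= -> ->.
move=> f /L2P[fr fi].
have -> : f = fun y => Complex 0 1 * cfun (imfun f) y + cfun (refun f) y.
  apply/funext => y; rewrite /cfun /imfun /refun; case: (f y) => a b.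
  by apply/eqP; rewrite eq_complex /=; apply/andP; split; apply/eqP; ring.
have [_ l1 _ _] := r1; have [_ l2 _ _] := r2.
have e1 := l1 (Complex 0 1) _ _ (L2_cfun fi) (L2_cfun fr).
have e2 := l2 (Complex 0 1) _ _ (L2_cfun fi) (L2_cfun fr).
by apply: filterS3 (filterI (cf _ fi) (cf _ fr)) e1 e2 => x [-> ->] -> ->.
Qed.

(** [riesz] is a choice from the operators satisfying [is_riesz]; [rieszT] shows that there is one,
    so the choice is not the default value. *)
Lemma is_riesz_riesz : is_riesz j (@riesz R d j).
Proof.
by apply: (@xgetPex _ _ [set T | is_riesz j T]); exists (rieszT j); exact: is_riesz_rieszT.
Qed.

Lemma L2norm_riesz f : L2 f -> (L2norm (riesz j f) ^+ 2 = L2norm (rieszT j f) ^+ 2)%E.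
Proof.
move=> hf; have rr := is_riesz_riesz; have rt := @is_riesz_rieszT R d j.
have e := is_riesz_unique rr rt hf.
have [h1 h2] := (L2P _).1 (let: And4 h _ _ _ := rr in h f hf).
have [h1' h2'] := (L2P _).1 (let: And4 h _ _ _ := rt in h f hf).
rewrite (L2norm_sqr h1.1 h2.1) (L2norm_sqr h1'.1 h2'.1).
have -> : sqn mu (refun (riesz j f)) = sqn mu (refun (rieszT j f)).
  by apply: (sqn_ae_eq h1.1 h1'.1); apply: filterS e => x ex; rewrite /refun ex.
have -> // : sqn mu (imfun (riesz j f)) = sqn mu (imfun (rieszT j f)).
by apply: (sqn_ae_eq h2.1 h2'.1); apply: filterS e => x ex; rewrite /imfun ex.
Qed.

End riesz_uniqueness.

Theorem corollary1 (R : realType) (d : nat) (hd : (1 <= d)%N) (t : R)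
    (ht : 0 < t) (f : 'rV[R]_d -> R[i]) (hf : L2 f) (j : 'I_d) :
  (L2norm (riesz_trunc j t f) ^+ 2 <= L2norm (riesz j f) ^+ 2)%E.
Proof. by rewrite L2norm_riesz//; exact: L2norm_riesz_trunc_le. Qed.
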